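(* Let $\Omega$ be a bounded strongly pseudoconvex domain in $\mathbb{C}^2$ with connected boundary of class $C^\infty$. Let $f_1\in W^{s-1/2}(\partial\Omega)$, where $s\ge3$, and identify $f_1$ with its harmonic extension in $G^s(\Omega)$. Then there exists a function $f_2\in G^{s-2}(\Omega)$ such that $f=f_1+f_2j$ is a $\psi$-regular function on $\Omega$.
   Context: Let $\mathbb{H}$ be the quaternions, with basic units $i,j,k$. Identify $\mathbb{C}^2$ with $\mathbb{H}$ by $(z_1,z_2)=(x_0+ix_1,x_2+ix_3)\mapsto q=z_1+z_2j$; then $aj=j\bar a$ for $a\in\mathbb{C}$. An $\mathbb{H}$-valued function is written $f=f_1+f_2j$ with $f_1,f_2$ complex-valued. A $C^1$ function $f$ is (left-)$\psi$-regular on $\Omega$ if $\left(\frac{\partial}{\partial\bar z_1}+j\frac{\partial}{\partial\bar z_2}\right)f=0$ on $\Omega$; equivalently $\frac{\partial f_1}{\partial\bar z_1}=\frac{\partial\overline{f_2}}{\partial z_2}$ and $\frac{\partial f_1}{\partial\bar z_2}=-\frac{\partial\overline{f_2}}{\partial z_1}$. For $s\ge1$, $W^s(\Omega)$ is the ($L^2$-based) Sobolev space of complex-valued functions of order $s$ on $\Omega$, $W^{s-1/2}(\partial\Omega)$ the corresponding Sobolev space on $\partial\Omega$, and $G^s(\Omega)$ the space of harmonic functions (for the Laplacian of $\mathbb{R}^4$) in $W^s(\Omega)$. Restriction to the boundary gives an isomorphism $G^s(\Omega)\cong W^{s-1/2}(\partial\Omega)$; its inverse is the harmonic extension. *)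

(* Defs.v *)
(* C^2 is identified with R^4 = 'rV[R]_4 by
   (z1, z2) = (x0 + i x1, x2 + i x3). *)
From HB Require Import structures.
From mathcomp Require Import all_boot all_order all_algebra.
From mathcomp Require Import all_classical all_reals all_analysis.
From mathcomp Require Import complex.

Set Implicit Arguments.
Unset Strict Implicit.
Unset Printing Implicit Defensive.

Import Order.TTheory GRing.Theory Num.Theory.
Import numFieldTopology.Exports numFieldNormedType.Exports.

Local Open Scope classical_set_scope.
Local Open Scope ring_scope.
Local Open Scope complex_scope.

(* The sigma-algebra generated by the coordinates, i.e., the Borel one. *)
Definition coord_cylinders (R : realType) (n : nat) : set (set 'rV[R]_n) :=
  [set A | exists i : 'I_n, exists2 B : set (measurableTypeR R),
     measurable B & A = [set x : 'rV[R]_n | B (x 0 i)]].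

Definition rV_display : measure_display. Proof. by constructor. Qed.

Section rV_measurable.
Context (R : realType) (n : nat).

Let rV_measurable0 : <<s @coord_cylinders R n >> set0.
Proof. exact: sigma_algebra0. Qed.

Let rV_measurableC A :
  <<s @coord_cylinders R n >> A -> <<s @coord_cylinders R n >> (~` A).
Proof. exact: sigma_algebraC. Qed.

Let rV_measurable_bigcup (F : (set 'rV[R]_n)^nat) :
  (forall i, <<s @coord_cylinders R n >> (F i)) ->
  <<s @coord_cylinders R n >> (\bigcup_i F i).
Proof. exact: sigma_algebra_bigcup. Qed.

HB.instance Definition _ := @isMeasurable.Build rV_display 'rV[R]_n
  <<s @coord_cylinders R n >>
  rV_measurable0 rV_measurableC rV_measurable_bigcup.
End rV_measurable.

Lemma measurable_rV_coord (R : realType) (n : nat) (i : 'I_n) :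
  measurable_fun [set: 'rV[R]_n] (fun x => x 0 i : measurableTypeR R).
Proof.
move=> _ B mB; rewrite setTI; apply: sub_sigma_algebra.
by exists i; exists B.
Qed.

Lemma measurable_fun_rVP (R : realType) (n : nat) d (T : measurableType d)
    (f : T -> 'rV[R]_n) :
  (forall i, measurable_fun [set: T] (fun x => f x 0 i : measurableTypeR R)) ->
  measurable_fun [set: T] f.
Proof.
move=> mf; apply: (measurability (@coord_cylinders R n)) => //.
by move=> _ [_ [i [B mB ->]] <-]; exact: mf.
Qed.

Definition consrV (R : realType) (n : nat) (p : measurableTypeR R * 'rV[R]_n) :
    'rV[R]_n.+1 :=
  \row_j (if unlift ord0 j is Some k then p.2 0 k else p.1).

Definition unconsrV (R : realType) (n : nat) (x : 'rV[R]_n.+1) :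
    measurableTypeR R * 'rV[R]_n :=
  (x 0 ord0, \row_j x 0 (lift ord0 j)).

Lemma measurable_consrV (R : realType) (n : nat) :
  measurable_fun setT (@consrV R n).
Proof.
apply: measurable_fun_rVP => j; rewrite /consrV.
case: (unliftP ord0 j) => [k ->|->].
  rewrite (_ : (fun x => _) = (fun x : 'rV[R]_n => x 0 k : measurableTypeR R)
    \o snd); last by apply/funext => p; rewrite mxE liftK.
  apply: measurableT_comp => //; exact: measurable_rV_coord.
rewrite (_ : (fun x => _) = fst) //.
by apply/funext => p; rewrite mxE unlift_none.
Qed.

Lemma measurable_unconsrV (R : realType) (n : nat) :
  measurable_fun setT (@unconsrV R n).
Proof.
apply: measurable_fun_pair; first exact: measurable_rV_coord.
apply: measurable_fun_rVP => j.
rewrite (_ : (fun x => _) = fun x : 'rV[R]_n.+1 => x 0 (lift ord0 j)).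
  exact: measurable_rV_coord.
by apply/funext => x; rewrite mxE.
Qed.

Lemma consrVK (R : realType) (n : nat) : cancel (@consrV R n) (@unconsrV R n).
Proof.
move=> [a x]; rewrite /unconsrV /consrV mxE unlift_none; congr (_, _).
by apply/rowP => j; rewrite !mxE liftK.
Qed.

Section consrV_measure.
Context (R : realType) (n : nat).
Variable m : {sigma_finite_measure set 'rV[R]_n -> \bar R}.

Let mu1m : {measure set (measurableTypeR R * 'rV[R]_n)%type -> \bar R} :=
  product_measure1 (@lebesgue_measure R) m.

Definition consrV_measure : set 'rV[R]_n.+1 -> \bar R :=
  pushforward (product_measure1 (@lebesgue_measure R) m) (@consrV R n).

Let measurable_preimage_consrV (A : set 'rV[R]_n.+1) :
  measurable A -> measurable (@consrV R n @^-1` A).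
Proof.
by move=> mA; rewrite -[X in measurable X]setTI; exact: measurable_consrV.
Qed.

Let consrV_measure0 : consrV_measure set0 = 0%E.
Proof. exact: (measure0 mu1m). Qed.

Let consrV_measure_ge0 A : (0 <= consrV_measure A)%E.
Proof. exact: (measure_ge0 mu1m). Qed.

Let consrV_measure_sigma_additive : semi_sigma_additive consrV_measure.
Proof.
move=> F mF tF mUF; rewrite /consrV_measure /pushforward preimage_bigcup.
apply: (@measure_semi_sigma_additive _ _ _ mu1m).
- by move=> k; exact: measurable_preimage_consrV.
- apply/trivIsetP => /= i j _ _ ij; rewrite -preimage_setI.
  by move/trivIsetP : tF => /(_ _ _ _ _ ij) ->//; rewrite preimage_set0.
- by rewrite -preimage_bigcup; exact: measurable_preimage_consrV.
Qed.

HB.instance Definition _ := isMeasure.Build _ _ _ consrV_measure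
  consrV_measure0 consrV_measure_ge0 consrV_measure_sigma_additive.

Let consrV_measure_sigma_finite : sigma_finite setT consrV_measure.
Proof.
have /sigma_finiteP[F [TF ndF Foo]] := sigma_finiteT (@lebesgue_measure R).
have /sigma_finiteP[G [TG ndG Goo]] := sigma_finiteT m.
exists (fun k => @unconsrV R n @^-1` (F k `*` G k)).
  rewrite -preimage_bigcup -[LHS](preimage_setT (@unconsrV R n)).
  congr (_ @^-1` _); rewrite -setXTT TF TG predeqE => -[x y]; split.
    move=> [/= [k _ Fkx] [l _ Gly]]; exists (maxn k l) => //; split.
    - by move: x Fkx; exact/subsetPset/ndF/leq_maxl.
    - by move: y Gly; exact/subsetPset/ndG/leq_maxr.
  by move=> [k _ [/= Fkx Gky]]; split; exists k.
move=> k; have [mF Fk] := Foo k; have [mG Gk] := Goo k; split.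
  rewrite -[X in measurable X]setTI; apply: measurable_unconsrV => //.
  exact: measurableX.
rewrite /consrV_measure /pushforward -comp_preimage.
rewrite (_ : _ \o _ = id); last by apply/funext => p /=; rewrite consrVK.
by rewrite preimage_id product_measure1E// lte_mul_pinfty// ge0_fin_numE.
Qed.

HB.instance Definition _ := Measure_isSigmaFinite.Build _ _ _ consrV_measure
  consrV_measure_sigma_finite.
End consrV_measure.

Fixpoint lebesgue_rV (R : realType) (n : nat) :
    {sigma_finite_measure set 'rV[R]_n -> \bar R} :=
  if n is n'.+1 then consrV_measure (lebesgue_rV R n')
  else dirac (0 : 'rV[R]_0).

Section calculus.
Context (R : realType) (n : nat).
Implicit Types (f : 'rV[R]_n -> R) (U V : set 'rV[R]_n) (l : seq 'I_n).

Definition basis_vec (i : 'I_n) : 'rV[R]_n := delta_mx 0 i.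

(* A multi-index is given by the list of the directions of differentiation;
   its order is the size of the list. *)
Fixpoint partial l f : 'rV[R]_n -> R :=
  if l is i :: l' then fun x => 'D_(basis_vec i) (partial l' f) x else f.

(* The operator 'D_v is total: existence of the derivatives is part of the
   definition. *)
Definition Ck (k : nat) U f : Prop :=
  forall l, (size l <= k)%N -> forall x, U x ->
    {for x, continuous (partial l f)} /\
    ((size l < k)%N -> forall i, derivable (partial l f) x (basis_vec i)).

Definition smooth U f : Prop := forall k, Ck k U f.

Definition test_function U f : Prop :=
  smooth setT f /\
  exists K, [/\ compact K, K `<=` U & forall x, ~ K x -> f x = 0].

Definition harmonic U f : Prop :=
  Ck 2 U f /\ forall x, U x -> \sum_(i < n) partial [:: i; i] f x = 0.

End calculus.

Section sobolev.
Context (R : realType) (n : nat).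
Implicit Types (u v : 'rV[R]_n -> R) (U : set 'rV[R]_n) (l : seq 'I_n).

Local Notation leb := (lebesgue_rV R n).

Definition L2 U u : Prop :=
  measurable_fun U u /\ (\int[leb]_(x in U) ((u x) ^+ 2)%:E < +oo)%E.

Definition weak_partial U l u v : Prop :=
  forall phi, test_function U phi ->
    \int[leb]_(x in U) (u x * partial l phi x) =
    (-1) ^+ size l * \int[leb]_(x in U) (v x * phi x).

Definition eucl_dist (x y : 'rV[R]_n) : R :=
  Num.sqrt (\sum_(i < n) (x 0 i - y 0 i) ^+ 2).

(* The square of the Gagliardo-Slobodeckij seminorm of order sigma. *)
Definition gagliardo (sigma : R) U v : \bar R :=
  \int[leb]_(x in U) \int[leb]_(y in U)
    ((v x - v y) ^+ 2 / eucl_dist x y `^ (n%:R + 2 * sigma))%:E.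

(* W^s(U) for real s >= 0: the weak derivatives of order at most s are in L^2
   and, when s is not an integer, those of order floor(s) have a finite
   seminorm of order s - floor(s); note that 0 < s - size l < 1 holds only for
   size l = floor(s) and s not an integer. *)
Definition sobolev (s : R) U u : Prop :=
  L2 U u /\
  forall l, (size l)%:R <= s ->
    exists v, [/\ L2 U v, weak_partial U l u v &
      0 < s - (size l)%:R < 1 -> (gagliardo (s - (size l)%:R) U v < +oo)%E].

End sobolev.

Section complex_functions.
Context (R : realType).

Definition on_parts n (P : ('rV[R]_n -> R) -> Prop) (f : 'rV[R]_n -> R[i]) :
    Prop :=
  P (fun x => complex.Re (f x)) /\ P (fun x => complex.Im (f x)).

Definition partialC (i : 'I_4) (f : 'rV[R]_4 -> R[i]) : 'rV[R]_4 -> R[i] :=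
  fun x => partial [:: i] (fun y => complex.Re (f y)) x
        +i* partial [:: i] (fun y => complex.Im (f y)) x.

(* z_(k+1) = x_(2k) + i x_(2k+1) for k = 0, 1. *)
Definition re_coord (k : 'I_2) : 'I_4 := inord (2 * k)%N.
Definition im_coord (k : 'I_2) : 'I_4 := inord (2 * k).+1%N.

Definition d_dz (k : 'I_2) (f : 'rV[R]_4 -> R[i]) : 'rV[R]_4 -> R[i] :=
  fun x => (partialC (re_coord k) f x
            - (0 +i* 1) * partialC (im_coord k) f x) / 2%:R.

Definition d_dzbar (k : 'I_2) (f : 'rV[R]_4 -> R[i]) : 'rV[R]_4 -> R[i] :=
  fun x => (partialC (re_coord k) f x
            + (0 +i* 1) * partialC (im_coord k) f x) / 2%:R.

Definition harmonic_sobolev (s : R) (Omega : set 'rV[R]_4)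
    (f : 'rV[R]_4 -> R[i]) : Prop :=
  on_parts (harmonic Omega) f /\ on_parts (sobolev s Omega) f.

End complex_functions.

Section domains.
Context (R : realType).
Implicit Types (Omega U : set 'rV[R]_4) (rho : 'rV[R]_4 -> R).

Definition boundary Omega : set 'rV[R]_4 := closure Omega `\` interior Omega.

Definition defining_function Omega U rho : Prop :=
  [/\ open U, boundary Omega `<=` U, smooth U rho,
      Omega `&` U = [set x | U x /\ rho x < 0] &
      forall p, boundary Omega p -> exists i, partial [:: i] rho p != 0].

Definition levi_form rho (p : 'rV[R]_4) (w : 'cV[R[i]]_2) : R[i] :=
  \sum_(j < 2) \sum_(k < 2)
    d_dz j (d_dzbar k (fun x => (rho x)%:C)) p * w j 0 * conjc (w k 0).

Definition complex_tangent rho (p : 'rV[R]_4) (w : 'cV[R[i]]_2) : Prop :=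
  \sum_(j < 2) d_dz j (fun x => (rho x)%:C) p * w j 0 = 0.

(* The condition does not depend on the choice of the defining function. *)
Definition smooth_strongly_pseudoconvex Omega : Prop :=
  exists U rho, defining_function Omega U rho /\
    forall p w, boundary Omega p -> w != 0 -> complex_tangent rho p w ->
      0 < levi_form rho p w.

Definition bounded_domain Omega : Prop :=
  [/\ open Omega, connected Omega, Omega !=set0 & bounded_set Omega].

End domains.

Section boundary_functions.
Context (R : realType).
Implicit Types (Omega : set 'rV[R]_4) (V : set 'rV[R]_3)
  (phi : 'rV[R]_3 -> 'rV[R]_4) (g : 'rV[R]_4 -> R[i]).

(* Local parametrizations: injective immersions between manifolds of the same
   dimension 3, hence diffeomorphisms onto open subsets of the boundary. *)
Definition boundary_chart Omega V phi : Prop :=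
  [/\ open V, forall i, smooth V (fun x => phi x 0 i),
      {in V &, injective phi}, phi @` V `<=` boundary Omega &
      forall x, V x ->
        row_free (\matrix_(a < 3, i < 4)
                    partial [:: a] (fun y => phi y 0 i) x)].

(* W^t(boundary Omega), for t >= 0: the localizations in the charts are in
   W^t(R^3).  Only the values of g on the boundary matter. *)
Definition boundary_sobolev (t : R) Omega g : Prop :=
  forall V phi (chi : 'rV[R]_3 -> R),
    boundary_chart Omega V phi -> test_function V chi ->
    on_parts (sobolev t setT) (fun x => (chi x)%:C * g (phi x)).

(* F restricts to g on the boundary; g stands for a class of functions that
   are equal almost everywhere for the surface measure.  A harmonic function of
   class W^s with s >= 3 > 4/2 extends continuously to the closure of Omega, and
   its Sobolev trace is the restriction of this extension. *)
Definition boundary_values Omega (F g : 'rV[R]_4 -> R[i]) : Prop :=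
  forall V phi, boundary_chart Omega V phi ->
    {ae lebesgue_rV R 3, forall x, V x ->
      (fun z => complex.Re (F z)) @ within Omega (nbhs (phi x))
        --> complex.Re (g (phi x)) /\
      (fun z => complex.Im (F z)) @ within Omega (nbhs (phi x))
        --> complex.Im (g (phi x))}.

Definition harmonic_extension (s : R) Omega (g F : 'rV[R]_4 -> R[i]) : Prop :=
  harmonic_sobolev s Omega F /\ boundary_values Omega F g.

End boundary_functions.

Section quaternions.
Context (R : realType).

(* The pair (a, b) is the quaternion a + b j. *)
Definition quat : Type := (R[i] * R[i])%type.

(* From j a = conj(a) j and j ^ 2 = -1. *)
Definition qmul (p q : quat) : quat :=
  (p.1 * q.1 - p.2 * conjc q.2, p.1 * q.2 + p.2 * conjc q.1).

Definition qj : quat := (0, 1).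

(* Left multiplication by a complex number acts on each of the two components,
   hence so do the operators d/dzbar_k. *)
Definition q_dzbar (k : 'I_2) (f : 'rV[R]_4 -> quat) : 'rV[R]_4 -> quat :=
  fun x => (d_dzbar k (fun y => (f y).1) x, d_dzbar k (fun y => (f y).2) x).

Definition psi_regular (Omega : set 'rV[R]_4) (f : 'rV[R]_4 -> quat) : Prop :=
  [/\ on_parts (Ck 1 Omega) (fun x => (f x).1),
      on_parts (Ck 1 Omega) (fun x => (f x).2) &
      forall x, Omega x ->
        q_dzbar 0 f x + qmul qj (q_dzbar 1 f x) = 0 :> R[i] * R[i]].

End quaternions.

(* Main.v *)
(** In real coordinates the equations for [f2] prescribe its image under a first
order operator; the datum [e], built from the derivatives of [f1], is closed and
coclosed. A Morrey-Kohn-Hormander inequality with weight [t - sigma] gives weak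
solutions with uniform L2 bounds on slightly larger strongly pseudoconvex
domains. Taylor expansions of [e] at points shifted inwards extend it there up
to a small error; solutions for the dyadic differences are mollified and summed
in [W^(s-2)]. Weyl's lemma makes the sum smooth. *)

Require Import Defs.
From HB Require Import structures.
From mathcomp Require Import all_boot all_order all_algebra.
From mathcomp Require Import all_classical all_reals all_analysis.
From mathcomp Require Import complex.
From mathcomp Require Import measurable_realfun ring lra.

Set Implicit Arguments.
Unset Strict Implicit.
Unset Printing Implicit Defensive.

Import Order.TTheory GRing.Theory Num.Theory.
Import numFieldTopology.Exports numFieldNormedType.Exports.

Local Open Scope classical_set_scope.
Local Open Scope ring_scope.

Local Notation mfun := measurable_fun.
Local Notation tfun := test_function.
Local Notation open_nb := open_nbhs_nbhs.
Local Notation isd_eq := is_derive_eq.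
Local Notation lt_leT := lt_le_trans.
Local Notation le_ltT := le_lt_trans.
Local Notation mfun_comp := measurableT_comp.
Local Notation mfunTS := measurable_funTS.
Local Notation mfunB := measurable_funB.
Local Notation mfunX := measurable_funX.
Local Notation mfunM := measurable_funM.
Local Notation EFin_meas := measurable_EFinP.

(** * Calculus of functions of class [C^k] on open sets *)

Section calculus.
Context {R : realType} {n : nat}.
Local Notation V := 'rV[R]_n.
Implicit Types (f g : V -> R) (U : set V) (i j : 'I_n) (x : V).

(** The first order system is the [dbar] equation for [f2], and its datum is [dbar]-closed because
    [f1] is harmonic. The obstacle is regularity up to the boundary: an L2 solution on [Omega]
    itself gives no derivatives there. It is replaced by a trade of size against room. On the domain
    enlarged by about [h] the dyadic difference of the data has size [h ^ (m + 1)], with [m] the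
    integer part of [s - 2]. Its solution is harmonic, since the datum is also coclosed, so every
    derivative on [Omega] costs only a factor [1 / h]. Derivatives up to order [m] are therefore
    summable, those of order [m + 1] stay bounded, and interpolation gives every fractional order
    below [m + 1]. The weight vanishes at the boundary, so the a priori estimate only involves forms
    with compact support. It still contains the [dbar] part of the test form; that part is made
    small by adding a form orthogonal to the datum, which rests on the density of the Laplacians of
    test functions in a weighted L2 space. This density in turn is a uniqueness statement for
    harmonic functions that are square integrable against the inverse weight. *)

Definition pd i f : V -> R := fun x => 'D_(basis_vec R i) f x.
Definition pder f x := forall i, derivable f x (basis_vec R i).

Lemma partial_rcons l i f : partial (rcons l i) f = partial l (pd i f).
Proof. by elim: l => //= j l ->. Qed.

Lemma Ck0 U f : Ck 0 U f <-> forall x, U x -> {for x, continuous f}.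
Proof.
split=> [H x Ux|H]; first by have [] := H [::] isT x Ux.
by case=> // _ x Ux; split => //; exact: H.
Qed.

(** Peels off the innermost derivative instead of the outermost one, so that sums, products and
    compositions are handled by induction on the order with the function generalized. *)
Lemma CkS k U f : Ck k.+1 U f <->
 (forall x, U x -> {for x, continuous f} /\ pder f x) /\
 (forall i, Ck k U (pd i f)).
Proof.
split=> [H|[H1 H2]].
 split=> [x Ux|i l sl x Ux].
  by have [? ?] := H [::] isT x Ux; split=> // i; exact: (H [::] isT x Ux).2.
 by rewrite -partial_rcons; have := H (rcons l i) _ x Ux; rewrite size_rcons; exact.
elim/last_ind=> [|l i _] sl x Ux.
 by have [? ?] := H1 x Ux; split.
by move: sl; rewrite size_rcons partial_rcons !ltnS => sl; exact: H2.
Qed.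

Lemma Ck_le k l U f : (k <= l)%N -> Ck l U f -> Ck k U f.
Proof.
move=> kl H m mk x Ux; have [c d] := H m (leq_trans mk kl) x Ux.
by split=> // mk'; apply: d; exact: leq_trans mk' kl.
Qed.

Lemma Ck_sub k U U' f : U `<=` U' -> Ck k U' f -> Ck k U f.
Proof. by move=> UU' H l sl x Ux; apply: H => //; exact: UU'. Qed.

Lemma Ck_pd k U f i : Ck k.+1 U f -> Ck k U (pd i f).
Proof. by move=> /CkS[]. Qed.

Lemma smooth_pd U f i : smooth U f -> smooth U (pd i f).
Proof. by move=> H k; apply: Ck_pd; exact: H. Qed.

Lemma smooth_part U f l : smooth U f -> smooth U (partial l f).
Proof. by move=> H; elim: l => [|i l IH]; [exact: H|exact: smooth_pd]. Qed.

Lemma Ck_cont k U f : Ck k U f -> forall x, U x -> {for x, continuous f}.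
Proof. by move=> H x Ux; have [] := H [::] isT x Ux. Qed.

Lemma Ck_pder k U f : Ck k.+1 U f -> forall x, U x -> pder f x.
Proof. by move=> /CkS[H _] x /H[]. Qed.

Lemma basis_vec_neq0 i : basis_vec R i != 0.
Proof.
by apply/eqP => /rowP/(_ i); rewrite !mxE !eqxx => /eqP; rewrite oner_eq0.
Qed.

Lemma pd_near f g x i : (\forall y \near x, f y = g y) -> pd i f x = pd i g x.
Proof. by move=> fg; apply: near_eq_derive => //; exact: basis_vec_neq0. Qed.

Lemma partial_near f g x l : (\forall y \near x, f y = g y) ->
 \forall y \near x, partial l f y = partial l g y.
Proof.
move=> fg; elim: l => //= i l /nbhs_interior IH; near=> y; apply: pd_near.
by near: y.
Unshelve. all: end_near. Qed.

Lemma pder_near f g x : (\forall y \near x, f y = g y) ->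
 pder f x -> pder g x.
Proof.
by move=> fg H i; apply: near_eq_derivable (H i) => //; exact: basis_vec_neq0.
Qed.

Lemma cont_near f g x : (\forall y \near x, f y = g y) ->
 {for x, continuous f} -> {for x, continuous g}.
Proof.
move=> fg; rewrite /prop_for /continuous_at -(nbhs_singleton fg) => cf.
by apply: cvg_trans cf; apply: (@near_eq_cvg _ _ (nbhs x) (nbhs_filter x)); exact: fg.
Qed.

Lemma Ck_near k U f g : (forall x, U x -> \forall y \near x, f y = g y) ->
 Ck k U f -> Ck k U g.
Proof.
move=> fg H l sl x Ux; have [c d] := H l sl x Ux.
have pfg := partial_near l (fg x Ux).
split=> [|lk]; first exact: cont_near c.
by apply: pder_near pfg _ => ?; exact: d.
Qed.

Lemma Ck_eq k U f g : open U -> (forall x, U x -> f x = g x) -> Ck k U f -> Ck k U g.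
Proof.
move=> oU fg; apply: Ck_near => x Ux; near=> y; apply: fg; near: y.
exact: open_nb.
Unshelve. all: end_near. Qed.

Lemma pd_cst c i : pd i (fun=> c) = fun=> 0.
Proof. by apply/funext => x; exact: derive_cst. Qed.

Lemma pdD f g i x : pder f x -> pder g x ->
 pd i (fun y => f y + g y) x = pd i f x + pd i g x.
Proof. by move=> df dg; rewrite /pd deriveD. Qed.

Lemma pdM f g i x : pder f x -> pder g x ->
 pd i (fun y => f y * g y) x = pd i f x * g x + f x * pd i g x.
Proof.
by move=> df dg; rewrite /pd deriveM// addrC /GRing.scale/= (mulrC (g x)).
Qed.

Lemma pdZ f c i x : pder f x -> pd i (fun y => c * f y) x = c * pd i f x.
Proof. by move=> df; rewrite /pd deriveZ. Qed.

Lemma pdN f i x : pder f x -> pd i (fun y => - f y) x = - pd i f x.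
Proof. by move=> df; rewrite /pd deriveN. Qed.

Lemma pdB f g i x : pder f x -> pder g x ->
 pd i (fun y => f y - g y) x = pd i f x - pd i g x.
Proof. by move=> df dg; rewrite /pd deriveB. Qed.

Lemma Ck_cst k U c : Ck k U (fun=> c : R).
Proof.
elim: k c => [|k IH] c; first by apply/Ck0 => x _; exact: cst_continuous.
apply/CkS; split=> [x _|i]; last by rewrite pd_cst.
by split; [exact: cst_continuous|move=> i; exact: derivable_cst].
Qed.

Lemma CkD k U f g : open U -> Ck k U f -> Ck k U g -> Ck k U (fun x => f x + g x).
Proof.
move=> oU; elim: k f g => [|k IH] f g.
 by move=> /Ck0 cf /Ck0 cg; apply/Ck0 => x Ux; apply: continuousD; [exact: cf|exact: cg].
move=> /CkS[cf df] /CkS[cg dg]; apply/CkS; split=> [x Ux|i].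
 split; first by apply: continuousD; [exact: (cf x Ux).1|exact: (cg x Ux).1].
 by move=> i; apply: derivableD; [exact: (cf x Ux).2|exact: (cg x Ux).2].
apply: Ck_eq (IH _ _ (df i) (dg i)) => // x Ux.
by rewrite pdD//; [exact: (cf x Ux).2|exact: (cg x Ux).2].
Qed.

Lemma CkM k U f g : open U -> Ck k U f -> Ck k U g -> Ck k U (fun x => f x * g x).
Proof.
move=> oU; elim: k f g => [|k IH] f g.
 by move=> /Ck0 cf /Ck0 cg; apply/Ck0 => x Ux; apply: continuousM; [exact: cf|exact: cg].
move=> Hf Hg; move: (Hf) (Hg) => /CkS[cf df] /CkS[cg dg]; apply/CkS; split=> [x Ux|i].
 split; first by apply: continuousM; [exact: (cf x Ux).1|exact: (cg x Ux).1].
 by move=> i; apply: derivableM; [exact: (cf x Ux).2|exact: (cg x Ux).2].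
have Hf' := Ck_le (leqnSn k) Hf; have Hg' := Ck_le (leqnSn k) Hg.
apply: Ck_eq (CkD oU (IH _ _ (df i) Hg') (IH _ _ Hf' (dg i))) => // x Ux.
by rewrite pdM//; [exact: (cf x Ux).2|exact: (cg x Ux).2].
Qed.

Lemma CkZ k U c f : open U -> Ck k U f -> Ck k U (fun x => c * f x).
Proof. by move=> oU; apply: CkM => //; exact: Ck_cst. Qed.

Lemma CkN k U f : open U -> Ck k U f -> Ck k U (fun x => - f x).
Proof.
by move=> oU /(CkZ (-1) oU); under eq_fun do rewrite mulN1r.
Qed.

Lemma CkB k U f g : open U -> Ck k U f -> Ck k U g -> Ck k U (fun x => f x - g x).
Proof. by move=> oU Hf Hg; apply: (CkD oU Hf); exact: CkN. Qed.

Lemma Ck_sum k U (I : Type) (s : seq I) (P : pred I) (F : I -> V -> R) : open U ->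
 (forall a, P a -> Ck k U (F a)) -> Ck k U (fun x => \sum_(a <- s | P a) F a x).
Proof.
move=> oU H; elim: s => [|a s IH].
 by under eq_fun do rewrite big_nil; exact: Ck_cst.
under eq_fun do rewrite big_cons.
case Pa: (P a); last exact: IH.
by apply: (CkD oU); [exact: H|exact: IH].
Qed.

Lemma pd_coord i j x : pd i (fun y => y 0 j) x = (i == j)%:R.
Proof.
rewrite /pd /derive (_ : (fun _ => _) = fun h : R => h^-1 *: (h * (i == j)%:R)).
 apply: lim_near_cst => //.
 near=> h; rewrite /GRing.scale/= mulrA mulVf ?mul1r//.
 near: h; exact: nbhs_dnbhs_neq.
apply/funext => h; rewrite /= !mxE eqxx /= addrK; congr (_ *: (_ * _)).
by rewrite eq_sym.
Unshelve. all: end_near. Qed.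

Lemma pder_coord j x : pder (fun y => y 0 j) x.
Proof.
move=> i; rewrite /derivable (_ : (fun _ => _) = fun h : R => h^-1 *: (h * (i == j)%:R)).
 apply/cvg_ex; exists ((i == j)%:R : R); apply: cvg_near_cst.
 near=> h; rewrite /GRing.scale/= mulrA mulVf ?mul1r//.
 near: h; exact: nbhs_dnbhs_neq.
apply/funext => h; rewrite /= !mxE eqxx /= addrK; congr (_ *: (_ * _)).
by rewrite eq_sym.
Unshelve. all: end_near. Qed.

Lemma Ck_coord k U j : Ck k U (fun y => y 0 j).
Proof.
case: k => [|k]; first by apply/Ck0 => x _; exact: coord_continuous.
apply/CkS; split=> [x _|i].
 by split; [exact: coord_continuous|exact: pder_coord].
by rewrite (_ : pd i _ = fun=> (i == j)%:R); [exact: Ck_cst|apply/funext => x; rewrite pd_coord].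
Qed.

End calculus.

Lemma eqW d (T : porderType d) (x y : T) : x = y -> (x <= y)%O.
Proof. by move=> ->. Qed.

Lemma cvg_sum_ord {R : realType} {T : Type} (F : set_system T) {FF : Filter F} m
  (f : 'I_m -> T -> R) (l : 'I_m -> R) :
 (forall i, f i x @[x --> F] --> l i) ->
 (\sum_(i < m) f i x) @[x --> F] --> \sum_(i < m) l i.
Proof.
elim: m f l => [|m IH] f l H.
 by under eq_fun do rewrite big_ord0; rewrite big_ord0; exact: cvg_cst.
under eq_fun do rewrite big_ord_recr/=.
rewrite big_ord_recr/=; apply: cvgD => //.
by apply: IH => i; exact: H.
Qed.

(** * Mean value theorem on lines and the chain rule *)

Section chain_rule.
Context {R : realType} {n : nat}.
Local Notation V := 'rV[R]_n.
Local Notation e_ i := (basis_vec R i).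
Implicit Types (f g : V -> R) (U : set V) (i j : 'I_n) (x : V).

Lemma nbhs_rVP x (P : set V) : (\forall y \near x, P y) <->
 exists2 d : R, 0 < d & forall y, `|y - x| < d -> P y.
Proof.
rewrite -[X in X <-> _]/(nbhs x P) (@nbhs_ballP R V x P); split=> -[d /= d0 H]; exists d => //= y.
 by move=> yx; apply: H; rewrite mx_norm_ball /ball_/= distrC.
by rewrite mx_norm_ball /ball_/= distrC; exact: H.
Qed.

Lemma cont_rVP f x : {for x, continuous f} <->
 forall e : R, 0 < e -> exists2 d : R, 0 < d & forall y, `|y - x| < d -> `|f y - f x| < e.
Proof.
split=> [cf e e0|H].
 have : nbhs x (f @^-1` ball (f x) e) by apply: cf; exact: nbhsx_ballx.
 by move=> /nbhs_rVP[d d0 H]; exists d => // y /H; rewrite /= /ball/= distrC.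
move=> A /nbhs_ballP[e /= e0 HA]; have [d d0 Hd] := H e e0.
apply/nbhs_rVP; exists d => // y /Hd yx; apply: HA.
by rewrite /ball/= distrC.
Qed.

Lemma isd_line f x i (s : R) : derivable f (x + s *: e_ i) (e_ i) ->
 is_derive s (1 : R) (fun t : R => f (x + t *: e_ i)) (pd i f (x + s *: e_ i)).
Proof.
have E : (fun h : R => h^-1 *: ((fun t : R => f (x + t *: e_ i)) (h *: (1 : R) + s) - f (x + s *: e_ i)))
  = (fun h : R => h^-1 *: (f (h *: e_ i + (x + s *: e_ i)) - f (x + s *: e_ i))).
 apply/funext => h; congr (_ *: (f _ - _)).
 by rewrite [h *: _]mulr1 scalerDl addrCA.
by move=> df; split; rewrite /derivable /derive /= E.
Qed.

Lemma MVT_line f x i (t : R) :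
 (forall s, `|s| <= `|t| -> derivable f (x + s *: e_ i) (e_ i)) ->
 exists s, `|s| <= `|t| /\ f (x + t *: e_ i) - f x = t * pd i f (x + s *: e_ i).
Proof.
move=> df; pose g (s : R) := f (x + s *: e_ i).
have dg (s : R) : `|s| <= `|t| -> is_derive s (1 : R) g (pd i f (x + s *: e_ i)) by move=> st; apply: isd_line; exact: df.
have g0 : g 0 = f x by rewrite /g scale0r addr0.
have [t0|t0] := leP 0 t.
 have H s : s \in `[0, t] -> `|s| <= `|t| by rewrite in_itv/= => /andP[s0 st]; rewrite !ger0_norm.
 have [] := @MVT_segment R g (fun s => pd i f (x + s *: e_ i)) 0 t t0.
 - by move=> s /subset_itv_oo_cc s0t; apply: dg; exact: H.
 - apply: derivable_within_continuous => s s0t.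
  by have [] := dg s (H s s0t).
 by move=> c ct; rewrite g0 subr0 mulrC => E; exists c; split => //; exact: H.
have H s : s \in `[t, 0] -> `|s| <= `|t| by rewrite in_itv/= => /andP[s0 st]; rewrite !ler0_norm ?lerN2// ltW.
have [] := @MVT_segment R g (fun s => pd i f (x + s *: e_ i)) t 0 (ltW t0).
- by move=> s /subset_itv_oo_cc s0t; apply: dg; exact: H.
- apply: derivable_within_continuous => s s0t.
 by have [] := dg s (H s s0t).
move=> c ct; rewrite g0 sub0r mulrN => E; exists c; split; first exact: H.
by rewrite -[LHS]opprB E opprK mulrC.
Qed.

Lemma le_normrV x i : `|x 0 i| <= `|x|.
Proof.
by rewrite [leRHS]mx_normrE; apply: (le_bigmax _ (fun ij => `|x ij.1 ij.2|) (0, i)).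
Qed.

Lemma normrV_le x (c : R) : 0 <= c -> (forall i, `|x 0 i| <= c) -> `|x| <= c.
Proof.
move=> c0 H; rewrite [leLHS]mx_normrE; apply: bigmax_le => // -[a b] _ /=.
by rewrite ord1; exact: H.
Qed.

(** The corners of the staircase from [0] to [k] that moves along the coordinate axes in turn. *)
Definition trunc_rV (k : V) (m : nat) : V := \row_j (if (j < m)%N then k 0 j else 0).

Lemma trunc_rV_le (k : V) m : `|trunc_rV k m| <= `|k|.
Proof.
apply: normrV_le => // i; rewrite mxE; case: ifP => _; first exact: le_normrV.
by rewrite normr0.
Qed.

Lemma trunc_rVS (k : V) i : trunc_rV k i.+1 = trunc_rV k i + k 0 i *: e_ i.
Proof.
apply/rowP => j; rewrite !mxE eqxx /= ltnS (leq_eqVlt j i) -(inj_eq val_inj).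
by case: eqP => [E|_] /=; [rewrite E ltnn add0r mulr1; congr (k _ _); exact: val_inj|rewrite mulr0 addr0].
Qed.

(** Slope of [f] along the [i]-th edge of the staircase from [x] to [x + k]. On an edge of length 0
    the default is the partial derivative at [x], which is the limit of the slopes as [k] tends to
    0. *)
Definition slopeC f x i (k : V) : R :=
 if k 0 i == 0 then pd i f x
 else (f (x + trunc_rV k i.+1) - f (x + trunc_rV k i)) / k 0 i.

Lemma slopeCE f x (k : V) : f (x + k) - f x = \sum_i k 0 i * slopeC f x i k.
Proof.
have -> : f (x + k) - f x =
  \sum_(i < n) (f (x + trunc_rV k i.+1) - f (x + trunc_rV k i)).
 rewrite -(big_mkord xpredT (fun m => f (x + trunc_rV k m.+1) - f (x + trunc_rV k m))).
 rewrite telescope_sumr//; congr (f (x + _) - f _).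
  by apply/rowP => j; rewrite mxE ltn_ord.
 rewrite -[LHS]addr0; congr (_ + _); apply/rowP => j; rewrite !mxE.
 by rewrite ?if_same.
apply: eq_bigr => i _; rewrite /slopeC; case: eqP => [k0|/eqP k0].
 by rewrite k0 mul0r trunc_rVS k0 scale0r addr0 subrr.
by rewrite mulrC divfK.
Qed.

Lemma norm_basis_vec i : `|e_ i| = 1.
Proof.
apply/eqP; rewrite eq_le normrV_le//=; last first.
 by move=> j; rewrite mxE; case: eqP; rewrite ?andbF ?andbT//; case: eqP; rewrite ?normr1 ?normr0.
by have := le_normrV (e_ i) i; rewrite mxE !eqxx normr1.
Qed.

Lemma slopeC_cvg f x i :
 (\forall y \near x, derivable f y (e_ i)) -> {for x, continuous (pd i f)} ->
 slopeC f x i k @[k --> (0 : V)] --> pd i f x.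
Proof.
move=> /nbhs_rVP[d1 d10 df] /cont_rVP cf A /nbhs_ballP[e /= e0 HA].
have [d2 d20 Hf] := cf e e0.
pose d := Num.min d1 d2; have d0 : 0 < d by rewrite lt_min d10.
have H y : `|y - x| < d -> derivable f y (e_ i) /\ `|pd i f y - pd i f x| < e.
 by rewrite lt_min => /andP[y1 y2]; split; [exact: df|exact: Hf].
apply/nbhs_rVP; exists (d / 2) => [|k]; first by rewrite divr_gt0.
rewrite subr0 => kd; apply: HA; rewrite /ball/= /slopeC.
case: eqP => [_|/eqP k0]; first by rewrite subrr normr0.
have Hs s : `|s| <= `|k 0 i| -> `|x + trunc_rV k i + s *: e_ i - x| < d.
 move=> sk; rewrite -[x + _ + _]addrA [x + _]addrC addrK.
 rewrite (le_ltT (ler_normD _ _))// (splitr d) ltr_leD//.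
  exact: le_ltT (trunc_rV_le _ _) kd.
 by rewrite normrZ norm_basis_vec mulr1 (le_trans sk)// (le_trans (le_normrV _ _))// ltW.
have [s [sk E]] := @MVT_line f (x + trunc_rV k i) i (k 0 i) (fun s sk => (H _ (Hs s sk)).1).
rewrite trunc_rVS addrA E mulrC mulKf// distrC.
exact: (H _ (Hs s sk)).2.
Qed.

Definition C1at f x :=
 (\forall y \near x, pder f y) /\ forall i, {for x, continuous (pd i f)}.

Lemma Ck_C1at k U f x : open U -> Ck k.+1 U f -> U x -> C1at f x.
Proof.
move=> oU Hf Ux; split.
 by near=> y; apply: (Ck_pder Hf); near: y; exact: open_nb.
by move=> i; apply: (Ck_cont (Ck_pd i Hf)).
Unshelve. all: end_near. Qed.

Lemma isd_comp (W : normedModType R) (G : W -> V) (dG : 'I_n -> R) f (w v : W) :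
 C1at f (G w) -> (forall i, is_derive w v (fun y => G y 0 i) (dG i)) ->
 is_derive w v (fun y => f (G y)) (\sum_i pd i f (G w) * dG i).
Proof.
move=> [df cf] HG.
pose k (h : R) := G (h *: v + w) - G w.
have cG i : h^-1 *: (G (h *: v + w) 0 i - G w 0 i) @[h --> 0^'] --> dG i.
 by have [/cvg_ex[l /= Hl] <-] := HG i; rewrite /derive /=; apply: cvgP Hl.
have k0 : k h @[h --> 0^'] --> (0 : V).
 apply/cvgrPdist_le => e e0; near=> h; rewrite sub0r normrN.
 apply: normrV_le => [|i]; first exact: ltW.
 move: i; near: h; apply: filter_forall => i.
 have : h * (h^-1 *: (G (h *: v + w) 0 i - G w 0 i)) @[h --> 0^'] --> 0 * dG i by apply: cvgM; [exact: nbhs_dnbhs|exact: cG].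
 rewrite mul0r => /cvgrPdist_le/(_ e e0) H.
 near=> h; have hn0 : h != 0 by near: h; exact: nbhs_dnbhs_neq.
 rewrite (_ : k h 0 i = h * (h^-1 *: (G (h *: v + w) 0 i - G w 0 i))); last first.
  by rewrite /GRing.scale/= mulVKf// /k !mxE.
 by rewrite -normrN -sub0r; near: h.
suff H : h^-1 *: (f (G (h *: v + w)) - f (G w)) @[h --> 0^'] -->
  \sum_i pd i f (G w) * dG i.
 split; first by apply/cvg_ex; eexists; exact: H.
 exact: cvg_lim.
have E : (fun h : R => h^-1 *: (f (G (h *: v + w)) - f (G w))) =
  (fun h => \sum_i slopeC f (G w) i (k h) * (h^-1 *: (G (h *: v + w) 0 i - G w 0 i))).
 apply/funext => h.
 have -> : f (G (h *: v + w)) - f (G w) = f (G w + k h) - f (G w) by rewrite /k (addrC (G w)) subrK.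
 rewrite slopeCE scaler_sumr; apply: eq_bigr => i _.
 by rewrite /k !mxE /GRing.scale/=; ring.
rewrite E; apply: cvg_sum_ord => i; apply: cvgM; last exact: cG.
apply: (cvg_comp _ _ k0); apply: slopeC_cvg => //.
by apply: filterS df => y; exact.
Unshelve. all: end_near. Qed.

Lemma pd_comp (m : nat) (G : 'rV[R]_m -> V) f (j : 'I_m) (w : 'rV[R]_m) :
 C1at f (G w) -> (forall i, pder (fun y => G y 0 i) w) ->
 derivable (fun y => f (G y)) w (basis_vec R j) /\
 pd j (fun y => f (G y)) w = \sum_i pd i f (G w) * pd j (fun y => G y 0 i) w.
Proof.
move=> Cf HG.
have [] := @isd_comp _ G (fun i => pd j (fun y => G y 0 i) w) f w (basis_vec R j) Cf.
 by move=> i; apply: derivableP; exact: HG.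
by split.
Qed.

Lemma is_derive_comp1 (W : normedModType R) (q : W -> R) (g dg : R -> R) (x v : W) :
 is_derive (q x) (1 : R) g (dg (q x)) -> derivable q x v ->
 is_derive x v (fun y => g (q y)) (dg (q x) * 'D_v q x).
Proof.
move=> Hg dq.
(* The slope of [g] is extended by the derivative at 0, because [q] may take the value [q x] again
   arbitrarily close to [x]. *)
pose S (k : R) := if k == 0 then dg (q x) else k^-1 * (g (k + q x) - g (q x)).
have cS : S k @[k --> 0] --> dg (q x).
 have [/cvg_ex[l /= Hl] E] := Hg.
 have {E}El : l = dg (q x) by rewrite -E; apply/esym/cvg_lim.
 rewrite {l}El in Hl.
 apply/cvgrPdist_le => e e0.
 move/cvgrPdist_le : Hl => /(_ e e0); rewrite near_withinE => Hl.
 near=> k; rewrite /S; case: eqP => [_|/eqP k0]; first by rewrite subrr normr0 ltW.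
 have : k != 0 -> `|dg (q x) - k^-1 *: (g (k *: 1 + q x) - g (q x))| <= e by near: k.
 by move=> /(_ k0); rewrite [k *: 1]mulr1.
pose k (h : R) := q (h *: v + x) - q x.
have cq : h^-1 *: k h @[h --> 0^'] --> 'D_v q x by [].
have k0 : k h @[h --> 0^'] --> (0 : R).
 have : h * (h^-1 *: k h) @[h --> 0^'] --> 0 * 'D_v q x by apply: cvgM; [exact: nbhs_dnbhs|exact: cq].
 rewrite mul0r; apply: cvg_trans; apply: near_eq_cvg.
 near=> h; rewrite /GRing.scale/= mulVKf//; near: h; exact: nbhs_dnbhs_neq.
suff H : h^-1 *: (g (q (h *: v + x)) - g (q x)) @[h --> 0^'] --> dg (q x) * 'D_v q x.
 split; first by apply/cvg_ex; eexists; exact: H.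
 exact: cvg_lim.
have E : (fun h : R => h^-1 *: (g (q (h *: v + x)) - g (q x))) =
  (fun h => S (k h) * (h^-1 *: k h)).
 apply/funext => h; rewrite /S /k; case: eqP => [|/eqP] k1.
  by rewrite k1 scaler0 mulr0 (subr0_eq k1) subrr scaler0.
 by rewrite subrK /GRing.scale/= [RHS]mulrC -mulrA (mulVKf k1).
by rewrite E; apply: cvgM => //; apply: (cvg_comp _ _ k0).
Unshelve. all: end_near. Qed.

Lemma pd_comp1 (q : V -> R) (g dg : R -> R) x :
 is_derive (q x) (1 : R) g (dg (q x)) -> pder q x ->
 pder (fun y => g (q y)) x /\
 forall i, pd i (fun y => g (q y)) x = dg (q x) * pd i q x.
Proof.
by move=> Hg dq; split=> i; have [] := is_derive_comp1 Hg (dq i).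
Qed.

(** The outer function is given together with its successive derivatives [g 0], [g 1], ..., and the
    induction shifts this sequence. *)
Lemma Ck_comp1 k U (q : V -> R) (g : nat -> R -> R) : open U ->
 (forall (j : nat) (s : R), (j < k)%N -> is_derive s (1 : R) (g j) (g j.+1 s)) ->
 continuous (g k) ->
 Ck k U q -> Ck k U (fun x => g 0%N (q x)).
Proof.
move=> oU; elim: k g => [|k IH] g Hg cg Hq.
 apply/Ck0 => x Ux; apply: continuous_comp; last exact: cg.
 exact: (Ck_cont Hq).
apply/CkS; split=> [x Ux|i].
 split.
  apply: continuous_comp; first exact: (Ck_cont Hq).
  by apply/differentiable_continuous/derivable1_diffP; have [] := Hg 0%N (q x) isT.
 by have [] := pd_comp1 (Hg 0%N (q x) isT) (Ck_pder Hq Ux).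
apply: (@Ck_eq _ _ k U (fun x => g 1%N (q x) * pd i q x)) => //.
 move=> x Ux.
 by have [_ ->] := pd_comp1 (Hg 0%N (q x) isT) (Ck_pder Hq Ux).
apply: CkM => //; last exact: Ck_pd.
refine (IH (fun a : nat => g a.+1) _ cg (Ck_le (leqnSn k) Hq)).
by move=> a s jk; exact: Hg.
Qed.

End chain_rule.

Lemma exists_half_lt3 {R : realFieldType} (a b c : R) : 0 < a -> 0 < b -> 0 < c ->
 exists2 h : R, 0 < h & [/\ h * 2 < a, h * 2 < b & h * 2 < c].
Proof.
move=> a0 b0 c0; exists (Num.min a (Num.min b c) / 3).
 by rewrite divr_gt0// !lt_min a0 b0.
have aux (m x : R) : 0 < x -> m <= x -> m / 3 * 2 < x by lra.
by split; apply: aux => //; rewrite !ge_min lexx ?orbT.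
Qed.

Lemma dist_half_lt {R : realFieldType} (a b c : R) :
 `|c - a| < `|a - b| / 2 -> `|c - b| < `|a - b| / 2 -> False.
Proof.
move=> ca cb; have : `|a - b| < `|a - b| / 2 + `|a - b| / 2.
 by rewrite (le_ltT (ler_distD c _ _))// distrC ltrD.
by rewrite -splitr ltxx.
Qed.

(** * Symmetry of second derivatives *)

Section clairaut.
Context {R : realType} {n : nat}.
Local Notation V := 'rV[R]_n.
Local Notation e_ i := (basis_vec R i).
Implicit Types (f : V -> R) (U : set V) (i j : 'I_n) (x : V).

Lemma derivable_shift f (a x v : V) :
 derivable f (x + a) v -> derivable (fun y => f (y + a)) x v.
Proof.
have E : (fun h : R => h^-1 *: (f (h *: v + (x + a)) - f (x + a))) =
     (fun h : R => h^-1 *: (f (h *: v + x + a) - f (x + a))).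
 by apply/funext => h; rewrite addrA.
by rewrite /derivable /= E.
Qed.

Lemma pd_shift f (a x : V) i : pd i (fun y => f (y + a)) x = pd i f (x + a).
Proof.
have E : (fun h : R => h^-1 *: (f (h *: e_ i + (x + a)) - f (x + a))) =
     (fun h : R => h^-1 *: (f (h *: e_ i + x + a) - f (x + a))).
 by apply/funext => h; rewrite addrA.
by rewrite /pd /derive /= E.
Qed.

Lemma open_ballP U x : open U -> U x ->
 exists2 d : R, 0 < d & forall y, `|y - x| < d -> U y.
Proof. by move=> oU Ux; apply/nbhs_rVP; exact: open_nb. Qed.

(** Two mean value steps: in direction [i] for the increment of [f] in direction [j], then in
    direction [j]. The left side is symmetric in [i] and [j], which forces the two mixed derivatives
    to agree in the limit. *)
Lemma second_difference U f x i j (d h : R) : Ck 2 U f ->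
 (forall y, `|y - x| < d -> U y) -> `|h| < d / 2 ->
 exists y, `|y - x| <= `|h| * 2 /\
  f (x + h *: e_ i + h *: e_ j) - f (x + h *: e_ i) - (f (x + h *: e_ j) - f x)
  = h * h * pd j (pd i f) y.
Proof.
move=> C2 HU hd.
have hle (s t : R) : `|s| <= `|h| -> `|t| <= `|h| ->
  `|x + s *: e_ i + t *: e_ j - x| <= `|h| * 2.
 move=> sh th; rewrite -[x + _ + _]addrA [x + _]addrC addrK.
 rewrite (le_trans (ler_normD _ _))// !normrZ !norm_basis_vec !mulr1 mulr2n mulrDr mulr1.
 exact: lerD.
have hU (s t : R) : `|s| <= `|h| -> `|t| <= `|h| -> U (x + s *: e_ i + t *: e_ j).
 move=> sh th; apply: HU; rewrite (le_ltT (hle _ _ sh th))//.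
 by rewrite -ltr_pdivlMr.
have h0 : `|0 : R| <= `|h| by rewrite normr0.
have df s t : `|s| <= `|h| -> `|t| <= `|h| -> pder f (x + s *: e_ i + t *: e_ j) by move=> sh th; apply: (Ck_pder C2); exact: hU.
pose F y := f (y + h *: e_ j) - f y.
have dF (s : R) : `|s| <= `|h| -> pder F (x + s *: e_ i).
 move=> sh k; apply: derivableB; last first.
  by have := df s 0 sh h0 k; rewrite scale0r addr0.
 by apply: derivable_shift; exact: df.
have [s [sh E]] := @MVT_line _ _ F x i h (fun s sh => dF s sh i).
have dp (t : R) : `|t| <= `|h| -> derivable (pd i f) (x + s *: e_ i + t *: e_ j) (e_ j).
 by move=> th; apply: (Ck_pder (Ck_pd i C2)); exact: hU.
have [t [th E2]] := @MVT_line _ _ (pd i f) (x + s *: e_ i) j h dp.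
exists (x + s *: e_ i + t *: e_ j); split; first exact: hle.
rewrite -mulrA -E2 /F in E *; rewrite E; congr (_ * _).
rewrite pdB ?pd_shift//; first by move=> k; apply: derivable_shift; exact: df.
by move=> k; have := df s 0 sh h0 k; rewrite scale0r addr0.
Qed.

Lemma pdC U f x i j : open U -> Ck 2 U f -> U x -> pd i (pd j f) x = pd j (pd i f) x.
Proof.
move=> oU C2 Ux; have [d d0 HU] := open_ballP oU Ux.
apply/eqP/negPn/negP => neq.
(* Half of the supposed gap: a common value of the two mixed derivatives at nearby points would lie
   within [e] of both. *)
pose e := `|pd i (pd j f) x - pd j (pd i f) x| / 2.
have e0 : 0 < e by rewrite divr_gt0// normr_gt0 subr_eq0.
have cij := (cont_rVP _ _).1 (Ck_cont (Ck_pd i (Ck_pd j C2)) Ux) e e0.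
have cji := (cont_rVP _ _).1 (Ck_cont (Ck_pd j (Ck_pd i C2)) Ux) e e0.
have [d1 d10 H1] := cij; have [d2 d20 H2] := cji.
have [h h0 [hd1 hm1 hm2]] := exists_half_lt3 d0 d10 d20.
have hd : `|h| < d / 2 by rewrite (gtr0_norm h0) ltr_pdivlMr.
have [y [yx Ey]] := second_difference i j C2 HU hd.
have [z [zx Ez]] := second_difference j i C2 HU hd.
have E : pd j (pd i f) y = pd i (pd j f) z.
 apply: (mulfI (x := h * h)); first by rewrite mulf_neq0// gt_eqF.
 have Exy : x + h *: e_ i + h *: e_ j = x + h *: e_ j + h *: e_ i by rewrite addrAC.
 refine (etrans (esym Ey) (etrans _ Ez)); rewrite Exy.
 move: (f (x + h *: e_ j + h *: e_ i)) (f (x + h *: e_ i)) (f (x + h *: e_ j)) (f x) => a b c w.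
 ring.
rewrite (gtr0_norm h0) in yx zx.
have {}yx : `|y - x| < d2 := le_ltT yx hm2.
have {}zx : `|z - x| < d1 := le_ltT zx hm1.
have {}H1 := H1 _ zx; have {}H2 := H2 _ yx; rewrite E in H2.
exact: dist_half_lt H1 H2.
Qed.

End clairaut.

(** * The smooth function [exp (- 1 / s)] and its derivatives *)

Section bump.
Context {R : realType}.
Implicit Types (p : {poly R}) (s : R).

(** A polynomial in [1 / s] times [exp (- 1 / s)], extended by 0. This class is stable under
    differentiation, so one linear bound near 0, valid for all [p], settles every order at once. *)
Definition bump_p p s : R := if 0 < s then p.[s^-1] * expR (- s^-1) else 0.

Lemma expR_ge_exp (y : R) k : 0 <= y -> (y / k.+1%:R) ^+ k.+1 <= expR y.
Proof.
move=> y0; rewrite (_ : expR y = expR (y / k.+1%:R) ^+ k.+1); last first.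
 by rewrite -expRM_natl mulrC divfK.
apply: lerXn2r; rewrite ?nnegrE ?expR_ge0 ?divr_ge0//.
by apply: le_trans (expR_ge1Dx _); rewrite lerDr.
Qed.

Lemma bump_p_bound p : exists2 C : R, 0 <= C &
 forall s, 0 < s -> s <= 1 -> `|bump_p p s| <= C * s.
Proof.
pose d := size p; pose A := \sum_(i < d) `|p`_i|.
have A0 : 0 <= A by apply: sumr_ge0.
exists (A * (d.+1%:R) ^+ d.+1) => [|s s0 s1].
 by rewrite mulr_ge0// exprn_ge0.
rewrite /bump_p s0; set y := s^-1.
have y1 : 1 <= y by rewrite invf_ge1.
have y0 : 0 < y by rewrite invr_gt0.
have py : `|p.[y]| <= A * y ^+ d.
 rewrite horner_coef (le_trans (ler_norm_sum _ _ _))// mulr_suml ler_sum// => i _.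
 rewrite normrM ler_wpM2l// normrX gtr0_norm// ler_weXn2l//.
 exact: ltnW.
(* The exponential is bounded below with one power more than the bound [y ^ d] of the polynomial;
   the spare power is the factor [s]. *)
have := @expR_ge_exp y d (ltW y0); rewrite expr_div_n => ey.
have D0 : 0 < d.+1%:R ^+ d.+1 :> R by rewrite exprn_gt0.
have yd0 : 0 < y ^+ d.+1 by rewrite exprn_gt0.
rewrite normrM (gtr0_norm (expR_gt0 _)) expRN.
have : (expR y)^-1 <= d.+1%:R ^+ d.+1 / y ^+ d.+1.
 rewrite -[leRHS]invrK invf_div lef_pV2// ?posrE ?expR_gt0// divr_gt0//.
move=> ey'.
rewrite (le_trans (ler_pM _ _ py ey'))// ?invr_ge0 ?expR_ge0//.
rewrite (_ : s = y^-1); last by rewrite /y invrK.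
apply: eqW.
move: D0; set D := _ ^+ d.+1; rewrite [y ^+ d.+1]exprS => D0.
by field; rewrite !gt_eqF// exprn_gt0.
Qed.

Lemma isd_bump_poly p s :
 is_derive s (1 : R) (bump_p p) (bump_p ('X^2 * (p - p^`())) s).
Proof.
have [s0|s0|s0] := ltgtP s 0.
- rewrite [X in is_derive _ _ _ X]/bump_p ltNge (ltW s0)/=.
 apply: (near_eq_is_derive _ (is_derive_cst (0 : R) s (1 : R))).
 near=> t; rewrite /bump_p ltNge ifF//; apply/negbF/ltW.
 by near: t; exact: lt_nbhsl.
- have dE : is_derive s (1 : R) (fun t : R => p.[t^-1] * expR (- t^-1))
   (bump_p ('X^2 * (p - p^`())) s).
  have sn0 : s != 0 by rewrite gt_eqF.
  have dV : is_derive s (1 : R) (fun t : R => t^-1) (- s ^- 2).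
   apply: isd_eq; first exact: is_deriveV.
   by rewrite /GRing.scale/= mulr1.
  have dp := @is_derive1_comp R (horner p) (fun t : R => t^-1) s _ _ (is_derive_poly p s^-1) dV.
  have dN : is_derive s (1 : R) (fun t : R => - t^-1) (s ^- 2) by apply: isd_eq; rewrite opprK.
  have de := @is_derive1_comp R expR (fun t : R => - t^-1) s _ _ (is_derive_expR (- s^-1)) dN.
  apply: isd_eq; rewrite /bump_p s0 hornerM hornerXn hornerD hornerN.
  by rewrite /GRing.scale/= exprVn; ring.
 apply: (near_eq_is_derive _ dE).
 near=> t; rewrite /bump_p ifT//.
 by near: t; exact: lt_nbhsr.
(* At 0 the difference quotient is [bump_p ('X * p)], which the linear bound sends to 0; the claimed
   derivative also has the value 0 there. *)
- have [C C0 HC] := bump_p_bound ('X * p).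
 rewrite s0 [X in is_derive _ _ _ X]/bump_p ltxx.
 suff H : h^-1 *: (bump_p p (h *: (1 : R) + 0) - bump_p p 0) @[h --> 0^'] --> (0 : R).
  by split; [apply/cvg_ex; eexists; exact: H|exact: cvg_lim].
 apply/cvgrPdist_le => e e0.
 near=> h; rewrite sub0r normrN [h *: 1]mulr1 addr0 /bump_p ltxx subr0.
 case: ifPn => [h0|_]; last by rewrite scaler0 normr0 ltW.
 have h1 : h <= 1.
  rewrite (le_trans (ler_norm _))// ltW//; near: h; exact: dnbhs0_lt.
 have : `|bump_p ('X * p) h| <= C * h by exact: HC.
 rewrite {1}/bump_p h0 hornerM hornerX -mulrA => /le_trans; apply.
 have hC : `|h| < e / (C + 1) by near: h; apply: dnbhs0_lt; rewrite divr_gt0// ltr_wpDl.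
 move: hC; rewrite gtr0_norm// ltr_pdivlMr ?ltr_wpDl// => hC; apply/ltW; apply: le_ltT hC.
 by rewrite mulrC ler_pM2l// lerDl.
Unshelve. all: end_near. Qed.

End bump.

(** * Measurability of open sets and of continuous functions *)

Section measurability.
Context {R : realType} {n : nat}.
Local Notation V := 'rV[R]_n.
Implicit Types (f : V -> R) (U : set V) (i : 'I_n) (x : V).

Lemma openT_rV : open [set: V].
Proof. by rewrite openE => x _; exact: filterT. Qed.

Lemma normrV_lt x (c : R) : 0 < c -> (forall i, `|x 0 i| < c) -> `|x| < c.
Proof.
move=> c0 H; rewrite [ltLHS]mx_normrE; apply: bigmax_lt => // -[a b] _ /=.
by rewrite ord1; exact: H.
Qed.

Lemma ball_meas_rV x (d : R) : 0 < d -> measurable [set y : V | `|y - x| < d].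
Proof.
move=> d0; rewrite (_ : [set y | _] = \bigcap_(i in [set: 'I_n])
  (setT `&` (fun y : V => y 0 i : measurableTypeR R) @^-1` `]x 0 i - d, x 0 i + d[%classic)).
 apply: fin_bigcap_measurable => // i _.
 by apply: measurable_rV_coord => //; exact: measurable_itv.
apply/seteqP; split => y /=.
 move=> yd i _; split => //=; rewrite in_itv/= -ltr_distl.
 by have := le_normrV (y - x) i; rewrite !mxE => /le_ltT; exact.
move=> H; apply: normrV_lt => // i; have [_ /=] := H i I.
by rewrite in_itv/= -ltr_distl !mxE.
Qed.

Definition cube x (d : R) : set V := [set y | forall i, `|y 0 i - x 0 i| <= d].

(** Enumeration of the cubes with rational centre and radius. The inclusion is stated for the
    doubled radius, to leave room for a cube of radius [r k] around each point of the [k]-th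
    ball. *)
Lemma open_cube_cover U : open U -> exists (c : nat -> V) (r : nat -> R),
 (forall k, 0 < r k -> cube (c k) (2 * r k) `<=` U) /\
 (forall x, U x -> exists k, `|x - c k| < r k).
Proof.
move=> oU.
pose q k : 'rV[rat]_n * rat := odflt (0, 0) (unpickle k).
pose good k := `[< cube (map_mx ratr (q k).1 : V) (2 * ratr (q k).2 : R) `<=` U >].
(* Codes of cubes that leave [U] get radius 0; this is the reason for the guard [0 < r k]. *)
exists (fun k => map_mx ratr (q k).1), (fun k => if good k then ratr (q k).2 else 0).
split=> [k|x Ux]; first by case: ifPn => [/asboolP //|_]; rewrite ltxx.
have [d d0 Hd] := open_ballP oU Ux.
have d20 : 0 < d / 3 by rewrite divr_gt0.
have [k] : exists k : rat, (ratr k : R) \in `]0, d / 3[.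
 by have [k] := rat_in_itvoo d20; exists k.
rewrite in_itv/= => /andP[k0 kd].
have H i : exists q : rat, (ratr q : R) \in `]x 0 i - ratr k, x 0 i + ratr k[.
 have [|p] := @rat_in_itvoo R (x 0 i - ratr k) (x 0 i + ratr k); last by exists p.
 by rewrite ltrD2l gtrN.
have [p Hp] := choice H.
have xq : `|x - map_mx ratr (\row_i p i)| < ratr k.
 apply: normrV_lt => // i; rewrite !mxE; have := Hp i.
 by rewrite in_itv/= -ltr_distl distrC.
exists (pickle (\row_i p i, k)); rewrite /good /q pickleK /=.
case: ifPn => // /asboolP; apply: contra_notT => _ y yq.
apply: Hd; rewrite (_ : d = 2 * (d / 3) + d / 3); last by field.
rewrite (_ : y - x = (y - map_mx ratr (\row_i p i)) - (x - map_mx ratr (\row_i p i))).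
 apply: le_ltT (ler_normB _ _) _; apply: ler_ltD; last exact: lt_trans xq kd.
 apply: (@le_trans _ _ (2 * ratr k)); last by rewrite ler_wpM2l// ltW.
 apply: normrV_le => [|i]; first by rewrite mulr_ge0// ltW.
 by have := yq i; rewrite !mxE.
by rewrite opprB addrA subrK.
Qed.

Lemma open_meas U : open U -> measurable U.
Proof.
move=> oU; have [c [r [cU cover]]] := open_cube_cover oU.
rewrite (_ : U = \bigcup_k [set y : V | `|y - c k| < r k]).
 apply: bigcup_measurable => k _; have [r0|r0] := ltP 0 (r k); first exact: ball_meas_rV.
 rewrite (_ : [set y : V | _] = set0); first exact: measurable0.
 by apply/seteqP; split=> // y /= /lt_leT /(_ r0); rewrite normr_lt0.
apply/seteqP; split => [x /cover[k]|x [k _ /= xk]]; first by exists k.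
have r0 : 0 < r k := le_ltT (normr_ge0 _) xk.
apply: (cU k r0) => i; have := le_normrV (x - c k) i; rewrite !mxE => /le_trans; apply.
by apply: ltW; apply: lt_leT xk _; rewrite ler_pMl// ler1n.
Qed.

Lemma open_cont_meas U f : open U ->
 (forall x, U x -> {for x, continuous f}) -> mfun U f.
Proof.
move=> oU cf; apply: (measurability _ (RGenOpens.measurableE R)).
move=> _ [_ [a [b ->] <-]]; apply: open_meas.
rewrite openE => x [Ux /= fx]; rewrite /interior.
have : nbhs x (f @^-1` `]a, b[%classic) by apply: cf => //; exact: (open_nb (conj (interval_open _ _) fx)).
move=> H; apply: filterI => //; exact: open_nb.
Qed.

Lemma cont_meas f : continuous f -> mfun setT f.
Proof.
move=> cf; apply: (@open_cont_meas setT f) => [|x _]; last exact: cf.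
exact: openT_rV.
Qed.

Lemma Ck_meas k U f : open U -> Ck k U f -> mfun U f.
Proof. by move=> oU /Ck_cont; exact: open_cont_meas. Qed.

Lemma test_meas U U' f : open U -> tfun U' f -> mfun U f.
Proof. by move=> oU [sf _]; apply: (Ck_meas (k := 0) oU); exact: (@Ck_sub _ _ 0 U setT _ (fun _ _ => I) (sf 0%N)). Qed.

Lemma addrV_meas (a : V) : mfun [set: V] (fun x => x + a).
Proof.
apply: measurable_fun_rVP => i.
rewrite (_ : (fun x : V => _) = (fun x : V => (x 0 i : measurableTypeR R) + a 0 i)); last first.
 by apply/funext => x; rewrite mxE.
by apply: measurable_funD => //; exact: measurable_rV_coord.
Qed.

Lemma subrV2_meas : mfun [set: V * V] (fun xy : V * V => xy.1 - xy.2).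
Proof.
apply: measurable_fun_rVP => i.
rewrite (_ : (fun xy => _) = (fun xy : V * V => (xy.1 0 i : measurableTypeR R) - xy.2 0 i)); last first.
 by apply/funext => x; rewrite !mxE.
by apply: mfunB; apply: (mfun_comp (measurable_rV_coord i)).
Qed.

End measurability.

(** * Translation invariance of Lebesgue measure and volumes of cubes *)

Section lebesgue_rV.
Context {R : realType}.

Local Open Scope ereal_scope.

Lemma lebesgue_measureD (a : R) (A : set (measurableTypeR R)) : measurable A ->
 pushforward (@lebesgue_measure R) (fun x : measurableTypeR R => (x + a)%R : measurableTypeR R) A = lebesgue_measure A.
Proof.
move=> mA; apply/esym.
have mD : mfun setT (fun x : measurableTypeR R => (x + a)%R : measurableTypeR R).
 exact: measurable_funD.
apply: lebesgue_measure_unique => //= _ [[b c]] _ <-.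
rewrite /pushforward/=.
rewrite (_ : _ @^-1` _ = `]b - a, c - a]%classic)%R.
 by rewrite !lebesgue_measure_itv/= !lte_fin ltrD2r; case: ifP => // _; rewrite -!EFinB; congr (_%:E); ring.
by apply/seteqP; split => x /=; rewrite !in_itv/= ltrBlDr lerBrDr.
Qed.

Lemma ge0_shift1 (a : R) (f : measurableTypeR R -> \bar R) :
 mfun [set: measurableTypeR R] f -> (forall x, 0 <= f x) ->
 \int[@lebesgue_measure R]_x f (x + a)%R = \int[@lebesgue_measure R]_x f x.
Proof.
move=> mf f0; have mD : mfun setT (fun x : measurableTypeR R => (x + a)%R : measurableTypeR R).
 by apply: measurable_funD.
have -> : \int[@lebesgue_measure R]_x f (x + a)%R =
  \int[pushforward (@lebesgue_measure R) (fun x : measurableTypeR R => (x + a)%R : measurableTypeR R)]_x f x.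
 by rewrite ge0_integral_pushforward.
by apply: eq_measure_integral => A mA _; exact: lebesgue_measureD.
Qed.

Lemma ge0_int_consrV n (f : 'rV[R]_n.+1 -> \bar R) :
 mfun [set: 'rV[R]_n.+1] f -> (forall x, 0 <= f x) ->
 \int[lebesgue_rV R n.+1]_x f x =
 \int[@lebesgue_measure R]_s \int[lebesgue_rV R n]_y f (consrV (s, y)).
Proof.
move=> mf f0.
have := @ge0_integral_pushforward _ _ _ _ _ _ (@measurable_consrV R n) (product_measure1 (@lebesgue_measure R) (lebesgue_rV R n)) setT f measurableT mf (fun x _ => f0 x).
rewrite preimage_setT => E.
transitivity (\int[product_measure1 (@lebesgue_measure R) (lebesgue_rV R n)]_x (f \o @consrV R n) x).
 exact: E.
rewrite fubini_tonelli1//; first exact: (mfun_comp mf (@measurable_consrV R n)).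
by move=> x; exact: f0.
Qed.

(** Induction on the dimension: Tonelli splits off the first coordinate, whose translation is the
    one-dimensional case. *)
Lemma ge0_shift n (a : 'rV[R]_n) (f : 'rV[R]_n -> \bar R) :
 mfun [set: 'rV[R]_n] f -> (forall x, 0 <= f x) ->
 \int[lebesgue_rV R n]_x f (x + a)%R = \int[lebesgue_rV R n]_x f x.
Proof.
elim: n a f => [|n IH] a f mf f0.
 by apply: eq_integral => x _; congr f; apply/rowP => -[].
rewrite ge0_int_consrV//; last by apply: mfun_comp => //; exact: addrV_meas.
rewrite ge0_int_consrV//.
pose a' : 'rV[R]_n := \row_j a 0%R (lift ord0 j).
pose F s := \int[lebesgue_rV R n]_y f (consrV (s, y)).
have E s y : (consrV (s, y) + a)%R = consrV ((s + a 0 ord0)%R, (y + a')%R).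
 apply/rowP => j; rewrite !mxE; case: unliftP => [k ->|->] //.
 by rewrite !mxE.
have mfc s : mfun setT (fun y => f (consrV (s, y))).
 apply: (mfun_comp mf); apply: (mfun_comp (@measurable_consrV R n)).
 exact: pair1_measurable.
transitivity (\int[@lebesgue_measure R]_s F (s + a 0 ord0)%R).
 apply: eq_integral => s _; rewrite /F.
 under eq_integral do rewrite E.
 exact: (IH a' (fun y => f (consrV ((s + a 0 ord0)%R, y)))).
rewrite (@ge0_shift1 _ F)//; last by move=> s; exact: integral_ge0.
have mfc2 : mfun setT (f \o @consrV R n) := mfun_comp mf (@measurable_consrV R n).
exact: (@measurable_fun_fubini_tonelli_F _ _ _ _ _ (lebesgue_rV R n) (f \o @consrV R n) mfc2 (fun x => f0 _)).
Qed.

Lemma cube_meas n (x : 'rV[R]_n) d : measurable (cube x d).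
Proof.
rewrite (_ : cube x d = \bigcap_(i in [set: 'I_n])
  (setT `&` (fun y : 'rV[R]_n => y 0 i : measurableTypeR R) @^-1` `[x 0 i - d, x 0 i + d]%classic)%R).
 apply: fin_bigcap_measurable => // i _.
 by apply: measurable_rV_coord => //; exact: measurable_itv.
apply/seteqP; split => y /=.
 by move=> yd i _; split => //=; rewrite in_itv/= -ler_distl; exact: yd.
by move=> H i; have [_ /=] := H i I; rewrite in_itv/= -ler_distl.
Qed.

Lemma leb_cube n (x : 'rV[R]_n) d : (0 <= d)%R -> lebesgue_rV R n (cube x d) = ((d *+ 2) ^+ n)%:E.
Proof.
move=> d0; elim: n x => [|n IH] x.
 by rewrite /= diracE mem_set// => -[].
rewrite /= /consrV_measure /pushforward.
pose x' : 'rV[R]_n := \row_j x 0%R (lift ord0 j).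
rewrite (_ : _ @^-1` _ = `[x 0%R ord0 - d, x 0%R ord0 + d]%classic%R `*` cube x' d).
 rewrite product_measure1E//; last exact: cube_meas.
 have E : lebesgue_measure `[x 0%R ord0 - d, x 0%R ord0 + d]%classic%R = (d *+ 2)%:E.
  rewrite lebesgue_measure_itv/= lte_fin; case: ltP => h.
   by rewrite -EFinB; congr (_%:E); ring.
  have -> : d = 0%R by apply/eqP; rewrite eq_le d0 andbT; move: h; rewrite lerBrDr -addrA gerDl -mulr2n pmulrn_lle0.
  by rewrite mul0rn.
 rewrite IH exprS EFinM; congr (_ * _)%E; exact: E.
apply/seteqP; split => -[s y] /=.
 move=> H; split.
  by have := H ord0; rewrite mxE unlift_none/= in_itv/= -ler_distl.
 by move=> i; have := H (lift ord0 i); rewrite !mxE liftK.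
move=> [s1 s2] j; rewrite mxE; case: unliftP => [k ->|->] /=.
 by have := s2 k; rewrite mxE.
by move: s1; rewrite in_itv/= -ler_distl.
Qed.

Lemma bounded_leb n (A : set 'rV[R]_n) (c : R) : measurable A ->
 (forall x, A x -> `|x| <= c)%R -> lebesgue_rV R n A < +oo.
Proof.
move=> mA H; apply: (@le_ltT _ _ (lebesgue_rV R n (cube 0 `|c|%R))); last first.
 by rewrite leb_cube// ltry.
apply: le_measure; rewrite ?inE//; first exact: cube_meas.
move=> y Ay i; rewrite mxE subr0 (le_trans (le_normrV _ _))//.
by rewrite (le_trans (H _ Ay))// ler_norm.
Qed.

End lebesgue_rV.

Lemma norm_mul_le_sqr {R : realFieldType} (a b : R) : `|a * b| <= a ^+ 2 + b ^+ 2.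
Proof.
rewrite ler_norml; have := sqr_ge0 (a + b); have := sqr_ge0 (a - b).
have := sqr_ge0 a; have := sqr_ge0 b.
have -> : (a - b) ^+ 2 = a ^+ 2 + b ^+ 2 - 2 * (a * b) by ring.
have -> : (a + b) ^+ 2 = a ^+ 2 + b ^+ 2 + 2 * (a * b) by ring.
by move: (a ^+ 2) (b ^+ 2) (a * b) => x y z *; apply/andP; split; lra.
Qed.

Lemma sqrD_le {R : realFieldType} (a b : R) : (a + b) ^+ 2 <= 2 * a ^+ 2 + 2 * b ^+ 2.
Proof.
have := sqr_ge0 (a - b).
have -> : (a - b) ^+ 2 = a ^+ 2 + b ^+ 2 - 2 * (a * b) by ring.
have -> : (a + b) ^+ 2 = a ^+ 2 + b ^+ 2 + 2 * (a * b) by ring.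
by move: (a ^+ 2) (b ^+ 2) (a * b) => x y z; lra.
Qed.

(** * Fatou's lemma under almost everywhere convergence *)

Section fatou.
Context d (T : measurableType d) (R : realType) (mu : {measure set T -> \bar R}).

Lemma limn_einf_ub (u : (\bar R)^nat) (e : \bar R) (N : nat) :
 (forall k, (N <= k)%N -> (u k <= e)%E) -> (limn_einf u <= e)%E.
Proof.
move=> H; rewrite limn_einf_lim; apply: lime_le; first exact: is_cvg_einfs.
near=> k; apply: (@le_trans _ _ (u (maxn k N))); last by apply: H; exact: leq_maxr.
by apply: ereal_inf_lbound; exists (maxn k N) => //=; exact: leq_maxl.
Unshelve. all: end_near. Qed.

Lemma fatou_le (D : set T) (f_ : nat -> T -> \bar R) (f : T -> \bar R) (e : \bar R) N :
 measurable D -> (forall k, mfun D (f_ k)) ->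
 (forall k x, D x -> (0 <= f_ k x)%E) ->
 mfun D f -> (forall x, D x -> (0 <= f x)%E) ->
 {ae mu, forall x, D x -> f_ ^~ x @ \oo --> f x} ->
 (forall k, (N <= k)%N -> (\int[mu]_(x in D) f_ k x <= e)%E) ->
 (\int[mu]_(x in D) f x <= e)%E.
Proof.
move=> mD mf_ f_0 mf f0 cf He.
have mli : mfun D (fun x => limn_einf (f_ ^~ x)).
 rewrite (_ : (fun x => _) = fun x => - limn_esup (fun k => - f_ k x)%E)%E.
  by apply: mfun_comp => //; apply: measurable_fun_limn_esup => k; exact: mfun_comp.
 by apply/funext => x; rewrite limn_esupN oppeK.
rewrite (_ : (\int[mu]_(x in D) f x = \int[mu]_(x in D) limn_einf (f_ ^~ x))%E).
 by apply: (le_trans (fatou mu mD mf_ f_0)); exact: limn_einf_ub He.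
apply: ge0_ae_eq_integral => //.
 move=> x Dx; rewrite limn_einf_lim; apply: lime_ge; first exact: is_cvg_einfs.
 by near=> k; apply: le_ereal_inf_tmp => _ [j /= _ <-]; exact: f_0.
move: cf; apply: filterS => x H Dx; have {}H := H Dx.
rewrite is_cvg_limn_einfE; last by apply/cvg_ex; exists (f x).
exact/esym/cvg_lim.
Unshelve. all: end_near. Qed.

End fatou.

(** The increments are at most [sqrt S / 2 ^ k], hence summable. In this way a finite sum of
    weighted squares at a point yields convergence at that point. *)
Lemma cvgn_of_sqr_sum {R : realType} (w : nat -> R) (S : R) :
 (forall k, 4 ^+ k * (w k.+1 - w k) ^+ 2 <= S) -> cvgn w.
Proof.
move=> H.
have S0 : 0 <= S by apply: le_trans (H 0%N); rewrite expr0 mul1r sqr_ge0.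
pose d k := w k.+1 - w k.
have dle k : `|d k| <= geometric (Num.sqrt S) (1 / 2) k.
 rewrite /geometric/= -(ler_pXn2r (n := 2)) ?nnegrE ?mulr_ge0 ?sqrtr_ge0 ?exprn_ge0//.
 rewrite real_normK ?num_real// exprMn sqr_sqrtr// -exprM mulnC exprM.
 rewrite (_ : (1 / 2) ^+ 2 = 4^-1 :> R); last by field.
 by rewrite exprVn ler_pdivlMr ?exprn_gt0// mulrC; exact: H.
have cd : cvgn (series d).
 apply: normed_cvg; apply: (@series_le_cvg _ _ (geometric (Num.sqrt S) (1 / 2))) => //.
 - by move=> k; exact: normr_ge0.
 - by move=> k; rewrite /geometric/= mulr_ge0 ?sqrtr_ge0 ?exprn_ge0.
 - by apply: is_cvg_geometric_series; rewrite ger0_norm// ltr_pdivrMr//; lra.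
have E : w = (fun k => w 0%N + series d k).
 apply/funext => k.
 have -> : series d k = w k - w 0%N.
  rewrite /series/= /d -(@telescope_sumr _ 0 k w)//.
 by rewrite addrC subrK.
by rewrite E; apply: is_cvgD => //; exact: is_cvg_cst.
Qed.

(** * L2 spaces of real functions: Cauchy-Schwarz and completeness *)

Section L2_theory.
Context {R : realType} {n : nat}.
Local Notation V := 'rV[R]_n.
Local Notation mu := (lebesgue_rV R n).
Implicit Types (f g u v w : V -> R) (U : set V) (x : V).

Definition integ U f := mu.-integrable U (EFin \o f).
Definition L2n U u : R := \int[mu]_(x in U) (u x ^+ 2).
Definition ip U u v : R := \int[mu]_(x in U) (u x * v x).

Lemma L2n_ge0 U u : 0 <= L2n U u.
Proof. by apply: Rintegral_ge0 => x _; exact: sqr_ge0. Qed.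

Lemma integD U f g : measurable U -> integ U f -> integ U g ->
 integ U (fun x => f x + g x).
Proof.
move=> mU If Ig; rewrite /integ (_ : _ \o _ = (EFin \o f) \+ (EFin \o g))%E.
 exact: integrableD.
by apply/funext => x; rewrite /= EFinD.
Qed.

Lemma integZ U c f : measurable U -> integ U f -> integ U (fun x => c * f x).
Proof.
move=> mU If; rewrite /integ (_ : _ \o _ = (fun x => c%:E * (EFin \o f) x))%E.
 exact: integrableZl.
by apply/funext => x; rewrite /= EFinM.
Qed.

Lemma integN U f : measurable U -> integ U f -> integ U (fun x => - f x).
Proof.
by move=> mU /(integZ (-1) mU); under eq_fun do rewrite mulN1r.
Qed.

Lemma integB U f g : measurable U -> integ U f -> integ U g ->
 integ U (fun x => f x - g x).
Proof. by move=> mU If Ig; apply: integD => //; exact: integN. Qed.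

Lemma integ0 U : integ U (fun=> 0).
Proof. exact: integrable0. Qed.

Lemma integ_sum U (I : Type) (s : seq I) (P : pred I) (F : I -> V -> R) : measurable U ->
 (forall i, P i -> integ U (F i)) -> integ U (fun x => \sum_(i <- s | P i) F i x).
Proof.
move=> mU H; elim: s => [|a s IH].
 by under eq_fun do rewrite big_nil; exact: integ0.
under eq_fun do rewrite big_cons.
case Pa: (P a); last exact: IH.
by apply: (integD mU); [exact: H|exact: IH].
Qed.

Lemma Rint_sum U (I : Type) (s : seq I) (P : pred I) (F : I -> V -> R) : measurable U ->
 (forall i, P i -> integ U (F i)) ->
 \int[mu]_(x in U) (\sum_(i <- s | P i) F i x) = \sum_(i <- s | P i) \int[mu]_(x in U) F i x.
Proof.
move=> mU H; elim: s => [|a s IH].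
 by under eq_fun do rewrite big_nil; rewrite big_nil Rintegral_cst// mul0r.
under eq_fun do rewrite big_cons.
rewrite big_cons; case Pa: (P a) => //.
by rewrite RintegralD ?IH//; [exact: H|exact: integ_sum].
Qed.

Lemma integ_le U f g : measurable U -> mfun U f ->
 (forall x, U x -> `|f x| <= g x) -> integ U g -> integ U f.
Proof.
move=> mU mf fg; apply: le_integrable => //; first exact/EFin_meas.
move=> x Ux /=; rewrite lee_fin (le_trans (fg x Ux))// ler_norm//.
Qed.

Lemma L2_integ U u : measurable U -> L2 U u -> integ U (fun x => u x ^+ 2).
Proof.
move=> mU [mu2 lt]; apply/integrableP; split.
 by apply/EFin_meas/mfunX.
apply: le_ltT lt; apply: eqW.
by apply: eq_integral => x _; rewrite /= ger0_norm// sqr_ge0.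
Qed.

Lemma integ_L2 U u : measurable U -> mfun U u ->
 integ U (fun x => u x ^+ 2) -> L2 U u.
Proof.
move=> mU mu2 /integrableP[_]; split => //.
apply: le_ltT b; apply: eqW.
by apply: eq_integral => x _; rewrite /= ger0_norm// sqr_ge0.
Qed.

Lemma L2nE U u : measurable U -> L2 U u ->
 (\int[mu]_(x in U) ((u x) ^+ 2)%:E = (L2n U u)%:E)%E.
Proof.
move=> mU Lu; rewrite /L2n /Rintegral fineK//.
by apply: integrable_fin_num => //; exact: L2_integ.
Qed.

Lemma L2_mul U u v : measurable U -> L2 U u -> L2 U v -> integ U (fun x => u x * v x).
Proof.
move=> mU Lu Lv.
apply: (@integ_le U _ (fun x => u x ^+ 2 + v x ^+ 2)) => //.
- by apply: mfunM; [exact: Lu.1|exact: Lv.1].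
- by move=> x _; exact: norm_mul_le_sqr.
- by apply: integD => //; exact: L2_integ.
Qed.

Lemma L2D U u v : measurable U -> L2 U u -> L2 U v -> L2 U (fun x => u x + v x).
Proof.
move=> mU Lu Lv; apply: integ_L2 => //.
 by apply: measurable_funD; [exact: Lu.1|exact: Lv.1].
under eq_fun do rewrite sqrrD.
by apply: integD; [|apply: integD|]; rewrite ?mulr2n//; try exact: L2_integ; apply: integD => //; exact: L2_mul.
Qed.

Lemma L2Z U c u : measurable U -> L2 U u -> L2 U (fun x => c * u x).
Proof.
move=> mU Lu; apply: integ_L2 => //.
 by apply: mfunM => //; exact: Lu.1.
under eq_fun do rewrite exprMn.
by apply: integZ => //; exact: L2_integ.
Qed.

Lemma L2N U u : measurable U -> L2 U u -> L2 U (fun x => - u x).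
Proof. by move=> mU /(L2Z (-1) mU); under eq_fun do rewrite mulN1r. Qed.

Lemma L2B U u v : measurable U -> L2 U u -> L2 U v -> L2 U (fun x => u x - v x).
Proof. by move=> mU Lu Lv; apply: L2D => //; exact: L2N. Qed.

Lemma L2_0 U : L2 U (fun=> 0 : R).
Proof.
split; first exact: measurable_cst.
by under eq_integral do rewrite expr0n; rewrite integral0.
Qed.

Lemma L2_sum U (I : Type) (s : seq I) (P : pred I) (F : I -> V -> R) : measurable U ->
 (forall i, P i -> L2 U (F i)) -> L2 U (fun x => \sum_(i <- s | P i) F i x).
Proof.
move=> mU H; elim: s => [|a s IH].
 by under eq_fun do rewrite big_nil; exact: L2_0.
under eq_fun do rewrite big_cons.
case Pa: (P a); last exact: IH.
by apply: (L2D mU); [exact: H|exact: IH].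
Qed.

Lemma L2_sub U U' u : measurable U -> measurable U' -> U `<=` U' -> L2 U' u -> L2 U u.
Proof.
move=> mU mU' UU' Lu; apply: integ_L2 => //.
 exact: measurable_funS Lu.1.
by apply: integrableS (L2_integ mU' Lu).
Qed.

Lemma L2n_sub U U' u : measurable U -> measurable U' -> U `<=` U' -> L2 U' u ->
 L2n U u <= L2n U' u.
Proof.
move=> mU mU' UU' Lu; rewrite -lee_fin -!L2nE//; last exact: L2_sub Lu.
apply: ge0_subset_integral => //.
 by apply/EFin_meas/mfunX; exact: Lu.1.
by move=> x _; rewrite lee_fin sqr_ge0.
Qed.

Lemma eq_L2 U u v : (forall x, U x -> u x = v x) -> L2 U u -> L2 U v.
Proof.
move=> uv [mu2 lt]; split.
 by apply: eq_measurable_fun mu2 => x; rewrite inE => /uv.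
apply: le_ltT lt; apply: eqW.
by apply: eq_integral => x; rewrite inE => /uv ->.
Qed.

Lemma eq_integ U u v : measurable U -> (forall x, U x -> u x = v x) -> integ U u -> integ U v.
Proof.
by move=> mU uv; apply: eq_integrable => // x; rewrite inE => /uv /= ->.
Qed.

Lemma eq_Rint U u v : (forall x, U x -> u x = v x) ->
 \int[mu]_(x in U) u x = \int[mu]_(x in U) v x.
Proof. by move=> uv; apply: eq_Rintegral => x; rewrite inE => /uv. Qed.

Lemma ipC U u v : ip U u v = ip U v u.
Proof. by apply: eq_Rint => x _; rewrite mulrC. Qed.

Lemma ipDl U u v w : measurable U -> L2 U u -> L2 U v -> L2 U w ->
 ip U (fun x => u x + v x) w = ip U u w + ip U v w.
Proof.
move=> mU Lu Lv Lw; rewrite /ip -RintegralD//; try exact: L2_mul.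
by apply: eq_Rint => x _; rewrite mulrDl.
Qed.

Lemma ipZl U c u w : measurable U -> L2 U u -> L2 U w ->
 ip U (fun x => c * u x) w = c * ip U u w.
Proof.
move=> mU Lu Lw; rewrite /ip -RintegralZl//; try exact: L2_mul.
by apply: eq_Rint => x _; rewrite mulrA.
Qed.

Lemma L2nD_expand U u v (t : R) : measurable U -> L2 U u -> L2 U v ->
 L2n U (fun x => u x + t * v x) = L2n U u + 2 * t * ip U u v + t ^+ 2 * L2n U v.
Proof.
move=> mU Lu Lv.
have Iu := L2_integ mU Lu; have Iv := L2_integ mU Lv; have Iuv := L2_mul mU Lu Lv.
rewrite /L2n /ip -!RintegralZl// -!RintegralD//; try exact: integZ; last first.
 by apply: integD => //; exact: integZ.
by apply: eq_Rint => x _; ring.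
Qed.

Lemma quad_discr (a b c : R) : 0 <= c ->
 (forall t, 0 <= a + 2 * t * b + t ^+ 2 * c) -> b ^+ 2 <= a * c.
Proof.
move=> c0 H; have [c00|cn0] := eqVneq c 0.
 rewrite c00 mulr0; rewrite c00 in H.
 have [->|b0] := eqVneq b 0; first by rewrite expr0n.
 have := H (- (a + 1) / (2 * b)); rewrite mulr0 addr0.
 rewrite (_ : 2 * _ * b = - (a + 1)); last by field.
 by lra.
have cp : 0 < c by rewrite lt_def cn0.
have := H (- b / c); rewrite (_ : _ + _ = (a * c - b ^+ 2) / c); last by field.
by rewrite pmulr_lge0 ?invr_gt0// subr_ge0.
Qed.

Lemma L2_CS U u v : measurable U -> L2 U u -> L2 U v ->
 ip U u v ^+ 2 <= L2n U u * L2n U v.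
Proof.
move=> mU Lu Lv; apply: quad_discr; first exact: L2n_ge0.
by move=> t; rewrite -L2nD_expand//; exact: L2n_ge0.
Qed.

Lemma L2nD_le U u v : measurable U -> L2 U u -> L2 U v ->
 L2n U (fun x => u x + v x) <= 2 * L2n U u + 2 * L2n U v.
Proof.
move=> mU Lu Lv.
have Iu := L2_integ mU Lu; have Iv := L2_integ mU Lv.
rewrite /L2n -!RintegralZl// -RintegralD//; try exact: integZ.
apply: le_Rintegral => //; first exact: L2_integ (L2D mU Lu Lv).
 by apply: integD => //; exact: integZ.
by move=> x _; exact: sqrD_le.
Qed.

Lemma L2n_eq0 U u : measurable U -> L2 U u -> L2n U u = 0 ->
 {ae mu, forall x, U x -> u x = 0}.
Proof.
move=> mU Lu H.
have H2 : (\int[mu]_(x in U) `|(u x ^+ 2)%:E| = 0)%E by under eq_integral do rewrite gee0_abs ?lee_fin ?sqr_ge0//; rewrite L2nE// H.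
have mu2 : mfun U (fun x => (u x ^+ 2)%:E) by apply/EFin_meas/mfunX; exact: Lu.1.
have := (ae_eq_integral_abs mu mU mu2).1 H2.
apply: filterS => x Hx Ux; have := Hx Ux => /= -[/eqP].
by rewrite sqrf_eq0 => /eqP.
Qed.

Lemma L2_ae U u v : measurable U -> L2 U u -> mfun U v ->
 {ae mu, forall x, U x -> u x = v x} -> L2 U v /\ L2n U u = L2n U v.
Proof.
move=> mU Lu mv uv.
have E : (\int[mu]_(x in U) (u x ^+ 2)%:E = \int[mu]_(x in U) (v x ^+ 2)%:E)%E.
 apply: ge0_ae_eq_integral => //.
 - by apply/EFin_meas/mfunX; exact: Lu.1.
 - by apply/EFin_meas/mfunX.
 - by move=> x _; rewrite lee_fin sqr_ge0.
 - by move=> x _; rewrite lee_fin sqr_ge0.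
 - by move: uv; apply: filterS => x H Ux; rewrite H.
by rewrite /L2n /Rintegral E; split => //; split => //; rewrite -E; exact: Lu.2.
Qed.

Lemma Rint_ae U u v : measurable U -> mfun U u -> mfun U v ->
 {ae mu, forall x, U x -> u x = v x} ->
 \int[mu]_(x in U) u x = \int[mu]_(x in U) v x.
Proof.
move=> mU mu2 mv uv; congr fine; apply: ae_eq_integral => //.
- exact/EFin_meas.
- exact/EFin_meas.
- by move: uv; apply: filterS => x H Ux; rewrite H.
Qed.

Lemma L2_complete U (u : nat -> V -> R) : measurable U -> (forall k, L2 U (u k)) ->
 (forall e : R, 0 < e -> exists N, forall j k, (N <= j)%N -> (N <= k)%N ->
   L2n U (fun x => u j x - u k x) <= e) ->
 exists v, L2 U v /\ forall e : R, 0 < e -> exists N, forall k, (N <= k)%N ->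
   L2n U (fun x => u k x - v x) <= e.
Proof.
move=> mU Lu Cu.
(* Ratio [1 / 16]: after multiplication by the weight [4 ^ i] of [cvgn_of_sqr_sum] the integrals
   still form a convergent geometric series. *)
have [N0 HN0] := choice (fun i : nat => Cu ((1 / 16) ^+ i : R) (exprn_gt0 i (ltac:(lra) : 0 < 1 / 16 :> R))).
(* Partial sums make the extraction monotone, and adding [i] makes it unbounded. *)
pose N i := (\sum_(j < i.+1) N0 j + i)%N.
have N0N i : (N0 i <= N i)%N by rewrite /N big_ord_recr/= -addnA addnCA leq_addr.
have iN i : (i <= N i)%N by rewrite /N leq_addl.
have NS i : (N i <= N i.+1)%N by rewrite /N [in leqRHS]big_ord_recr/= leq_add// leq_addr.
have Nmono i j : (i <= j)%N -> (N i <= N j)%N by move=> /subnK <-; elim: (j - i)%N => // k IH; rewrite addSn; exact: leq_trans IH (NS _).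
pose w i := u (N i).
have Lw i : L2 U (w i) := Lu _.
have dw i : L2n U (fun x => w i.+1 x - w i x) <= (1 / 16) ^+ i by apply: HN0; [exact: leq_trans (N0N i) (NS i)|exact: N0N].
have Ld i : L2 U (fun x => w i.+1 x - w i x) by exact: L2B.
pose F i x : \bar R := (4 ^+ i * (w i.+1 x - w i x) ^+ 2)%:E.
have mF i : mfun U (F i) by apply/EFin_meas/mfunM => //; apply: mfunX; exact: (Ld i).1.
have F0 i x : U x -> (0 <= F i x)%E by move=> _; rewrite /F lee_fin mulr_ge0 ?sqr_ge0// exprn_ge0// ler0n.
have iF i : (\int[mu]_(x in U) F i x <= ((1 / 4) ^+ i)%:E)%E.
 rewrite /F; under eq_integral do rewrite EFinM.
 rewrite ge0_integralZl_EFin//.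
 - rewrite L2nE// -EFinM lee_fin (_ : (1 / 4) ^+ i = 4 ^+ i * (1 / 16) ^+ i).
   by rewrite ler_wpM2l ?exprn_ge0.
  by rewrite -exprMn; congr (_ ^+ i); field.
 - by move=> x _; rewrite lee_fin sqr_ge0.
 - by apply/EFin_meas/mfunX; exact: (Ld i).1.
have Ssum : (\int[mu]_(x in U) \sum_(0 <= i <oo) F i x < +oo)%E.
 rewrite integral_nneseries//.
 apply: (@le_ltT _ _ (\sum_(0 <= i <oo) ((1 / 4) ^+ i)%:E)%E).
  by apply: lee_nneseries => // i _ _; apply: integral_ge0 => x; exact: F0.
 have cg : cvgn (series (geometric (1 : R) (1 / 4))).
  by apply: is_cvg_geometric_series; rewrite ger0_norm ?ltr_pdivrMr ?divr_ge0 ?ltr0n ?ler01 ?mul1r ?ltr1n.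
 have -> : (\sum_(0 <= i <oo) ((1 / 4) ^+ i)%:E)%E = (limn (series (geometric (1 : R) (1 / 4))))%:E.
  rewrite -EFin_lim//; congr (limn _); apply/funext => k.
  rewrite /= sumEFin; congr (_%:E); rewrite /series /geometric /=.
  by apply: eq_bigr => i _; rewrite [RHS]mul1r.
 by rewrite ltry.
have mS : mfun U (fun x => \sum_(0 <= i <oo) F i x)%E by apply: ge0_emeasurable_sum => // i x Ux _; exact: F0.
have aeS : {ae mu, forall x, U x -> (\sum_(0 <= i <oo) F i x)%E \is a fin_num}.
 apply: (@integrable_ae _ _ _ mu) => //; apply/integrableP; split => //.
 rewrite (eq_integral (fun x => \sum_(0 <= i <oo) F i x)%E)// => x; rewrite inE => Ux.
 by rewrite gee0_abs//; apply: nneseries_ge0 => i _ _; exact: F0.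
(* The upper limit is measurable on all of [U]; it is the limit wherever the sum of the [F i x] is
   finite. *)
pose v x := fine (limn_esup (fun i => (w i x)%:E)).
have mv : mfun U v.
 apply: (mfun_comp (fine_measurable measurableT)).
 by apply: measurable_fun_limn_esup => i; apply/EFin_meas; exact: (Lw i).1.
have cv : {ae mu, forall x, U x -> w ^~ x @ \oo --> v x}.
 move: aeS; apply: filterS => x H Ux; have {}H := H Ux.
 have cw : cvgn (w ^~ x).
  apply: (@cvgn_of_sqr_sum _ _ (fine (\sum_(0 <= i <oo) F i x)%E)) => k.
  rewrite -lee_fin fineK//.
  apply: le_trans (@nneseries_lim_ge R (fun i => F i x) xpredT 0 k.+1 _); last by move=> i _ _; exact: F0.
  rewrite big_nat_recr//= leeDr// sume_ge0// => i _; exact: F0.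
 have cw' : (EFin \o w ^~ x) @ \oo --> (limn (w ^~ x))%:E by apply: cvg_EFin; [exact: nearW|exact: cw].
 rewrite (_ : v x = limn (w ^~ x))//; rewrite /v is_cvg_limn_esupE; last by apply/cvg_ex; eexists; exact: cw'.
 by rewrite (cvg_lim _ cw').
(* Fatou's lemma transfers the bound between the sequence and its subsequence to the limit [v]. *)
have key k (e : R) i0 : (forall i, (i0 <= i)%N -> L2n U (fun x => u k x - w i x) <= e) ->
  mfun U (fun x => u k x - v x) /\
  (\int[mu]_(x in U) ((u k x - v x) ^+ 2)%:E <= e%:E)%E.
 move=> Hi0; have muv : mfun U (fun x => u k x - v x).
  by apply: mfunB => //; exact: (Lu k).1.
 split => //.
 apply: (@fatou_le _ _ _ mu U (fun i x => ((u k x - w i x) ^+ 2)%:E) _ _ i0) => //.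
 - by move=> i; apply/EFin_meas/mfunX; exact: (L2B mU (Lu k) (Lw i)).1.
 - by move=> i x _; rewrite lee_fin sqr_ge0.
 - exact/EFin_meas/mfunX.
 - by move=> x _; rewrite lee_fin sqr_ge0.
 - move: cv; apply: filterS => x H Ux; have {}H := H Ux.
  apply: cvg_EFin; first exact: nearW.
  rewrite /comp/= expr2; under eq_fun do rewrite expr2.
  by apply: cvgM; (apply: cvgB; [exact: cvg_cst|exact: H]).
 - by move=> i /Hi0; rewrite L2nE ?lee_fin//; exact: L2B.
have keyL k (e : R) i0 : (forall i, (i0 <= i)%N -> L2n U (fun x => u k x - w i x) <= e) ->
  L2 U (fun x => u k x - v x) /\ L2n U (fun x => u k x - v x) <= e.
 move=> /key[m2 le]; have L : L2 U (fun x => u k x - v x).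
  by split => //; apply: le_ltT le _; rewrite ltry.
 by split => //; rewrite -lee_fin -L2nE.
have keyC (e : R) : 0 < e -> exists M, forall k, (M <= k)%N ->
  L2 U (fun x => u k x - v x) /\ L2n U (fun x => u k x - v x) <= e.
 move=> e0; have [M HM] := Cu e e0; exists M => k Mk.
 by apply: (@keyL k e M) => i Mi; apply: HM => //; exact: leq_trans Mi (iN i).
exists v; split; last first.
 by move=> e /keyC[M HM]; exists M => k /HM[].
have [M /(_ M (leqnn M))[LM _]] := keyC 1 ltr01.
apply: eq_L2 (L2B mU (Lu M) LM) => x _; ring.
Qed.

End L2_theory.

(** * Vector-valued L2 spaces and the Riesz representation *)

Section riesz.
Context {R : realType} {n N : nat}.
Local Notation V := 'rV[R]_n.
Local Notation mu := (lebesgue_rV R n).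
Implicit Types (U : set V) (x : V) (f g h : 'I_N -> V -> R).

Definition L2v U f := forall i, L2 U (f i).
Definition ipv U f g : R := \sum_i ip U (f i) (g i).
Definition L2vn U f : R := \sum_i L2n U (f i).

Lemma L2vn_ge0 U f : 0 <= L2vn U f.
Proof. by apply: sumr_ge0 => i _; exact: L2n_ge0. Qed.

Lemma ipvC U f g : ipv U f g = ipv U g f.
Proof. by apply: eq_bigr => i _; rewrite ipC. Qed.

Lemma ipvDl U f g h : measurable U -> L2v U f -> L2v U g -> L2v U h ->
 ipv U (fun i x => f i x + g i x) h = ipv U f h + ipv U g h.
Proof. by move=> mU Lf Lg Lh; rewrite /ipv -big_split/=; apply: eq_bigr => i _; rewrite ipDl. Qed.

Lemma ipvZl U c f h : measurable U -> L2v U f -> L2v U h ->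
 ipv U (fun i x => c * f i x) h = c * ipv U f h.
Proof. by move=> mU Lf Lh; rewrite /ipv mulr_sumr; apply: eq_bigr => i _; rewrite ipZl. Qed.

Lemma L2vD U f g : measurable U -> L2v U f -> L2v U g -> L2v U (fun i x => f i x + g i x).
Proof. by move=> mU Lf Lg i; exact: L2D. Qed.

Lemma L2vB U f g : measurable U -> L2v U f -> L2v U g -> L2v U (fun i x => f i x - g i x).
Proof. by move=> mU Lf Lg i; exact: L2B. Qed.

Lemma L2vZ U c f : measurable U -> L2v U f -> L2v U (fun i x => c * f i x).
Proof. by move=> mU Lf i; exact: L2Z. Qed.

Lemma L2vn_expand U f g (t : R) : measurable U -> L2v U f -> L2v U g ->
 L2vn U (fun i x => f i x + t * g i x) = L2vn U f + 2 * t * ipv U f g + t ^+ 2 * L2vn U g.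
Proof.
move=> mU Lf Lg; rewrite /L2vn /ipv !mulr_sumr -!big_split/=.
by apply: eq_bigr => i _; rewrite L2nD_expand.
Qed.

Lemma ipv_CS U f g : measurable U -> L2v U f -> L2v U g ->
 ipv U f g ^+ 2 <= L2vn U f * L2vn U g.
Proof.
move=> mU Lf Lg; apply: quad_discr; first exact: L2vn_ge0.
by move=> t; rewrite -L2vn_expand//; exact: L2vn_ge0.
Qed.

Lemma L2vn_add_le U f g : measurable U -> L2v U f -> L2v U g ->
 L2vn U (fun i x => f i x + g i x) <= 2 * L2vn U f + 2 * L2vn U g.
Proof.
move=> mU Lf Lg; rewrite /L2vn !mulr_sumr -big_split/=.
by apply: ler_sum => i _; exact: L2nD_le.
Qed.

Lemma L2v_complete U (u : nat -> 'I_N -> V -> R) : measurable U -> (forall k, L2v U (u k)) ->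
 (forall e : R, 0 < e -> exists M, forall j k, (M <= j)%N -> (M <= k)%N ->
   L2vn U (fun i x => u j i x - u k i x) <= e) ->
 exists v, L2v U v /\ forall e : R, 0 < e -> exists M, forall k, (M <= k)%N ->
   L2vn U (fun i x => u k i x - v i x) <= e.
Proof.
move=> mU Lu Cu.
have /choice[v Hv] : forall i : 'I_N, exists v, L2 U v /\ forall e : R, 0 < e -> exists M, forall k, (M <= k)%N ->
   L2n U (fun x => u k i x - v x) <= e.
 move=> i; apply: L2_complete => //; first by move=> k; exact: Lu.
 move=> e /Cu[M HM]; exists M => j k Mj Mk; apply: le_trans (HM j k Mj Mk).
 by rewrite /L2vn (bigD1 i)//= lerDl sumr_ge0// => *; exact: L2n_ge0.
exists v; split; first by move=> i; exact: (Hv i).1.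
move=> e e0.
have eN : 0 < e / N.+1%:R by rewrite divr_gt0// ltr0n.
have /choice[M HM] i : exists M, forall k, (M <= k)%N -> L2n U (fun x => u k i x - v i x) <= e / N.+1%:R.
 exact: (Hv i).2.
exists (\max_i M i)%N => k Mk; rewrite /L2vn.
apply: (@le_trans _ _ (\sum_(i < N) e / N.+1%:R)).
 by apply: ler_sum => i _; apply: HM; apply: leq_trans Mk; exact: leq_bigmax.
rewrite sumr_const card_ord -[_ *+ N]mulr_natr -mulrA ler_piMr ?(ltW e0)//.
by rewrite mulrC ler_pdivrMr ?ltr0n// mul1r ler_nat.
Qed.

End riesz.

Lemma ex_invn_lt {R : realType} (e : R) : 0 < e -> exists M : nat, M.+1%:R^-1 < e.
Proof.
move=> e0; exists (Num.bound e^-1); rewrite invf_plt ?posrE ?ltr0n//.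
by rewrite (lt_trans (archi_boundP _)) ?ltr_nat// invr_ge0 ltW.
Qed.

Lemma le0_of_small {R : realFieldType} (a D : R) : 0 <= D ->
 (forall e, 0 < e -> a <= e * D) -> a <= 0.
Proof.
move=> D0 H; rewrite leNgt; apply/negP => a0.
have D1 : 0 < D + 1 by rewrite ltr_wpDl.
have := H (a / (2 * (D + 1))) (ltac:(by rewrite divr_gt0// mulr_gt0)).
rewrite (_ : a / (2 * (D + 1)) * D = a / 2 * (D / (D + 1))); last by field; rewrite gt_eqF.
have : D / (D + 1) <= 1 by rewrite ler_pdivrMr// mul1r lerDl.
move: (D / (D + 1)) => q q1.
have : a / 2 * q <= a / 2 by rewrite ler_piMr// divr_ge0// ltW.
lra.
Qed.

(* The vector of the minimizing sequence of |L x|^2 - 2 ell x is Cauchy by the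
  parallelogram identity. *)
Lemma riesz_subspace {R : realType} {n N : nat} (X : lmodType R) (P : X -> Prop)
  (U : set 'rV[R]_n) (L : X -> 'I_N -> 'rV[R]_n -> R) (ell : X -> R) (C : R) :
 measurable U -> 0 <= C -> P 0 ->
 (forall c x y, P x -> P y -> P (c *: x + y)) ->
 (forall x, P x -> L2v U (L x)) ->
 (forall c x y, P x -> P y -> forall i z, L (c *: x + y) i z = c * L x i z + L y i z) ->
 (forall c x y, P x -> P y -> ell (c *: x + y) = c * ell x + ell y) ->
 (forall x, P x -> ell x ^+ 2 <= C * L2vn U (L x)) ->
 exists v (s : nat -> X), [/\ L2v U v, L2vn U v <= C,
  (forall x, P x -> ell x = ipv U (L x) v),
  (forall k, P (s k)) &
  forall e : R, 0 < e -> exists M, forall k, (M <= k)%N ->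
   L2vn U (fun i z => L (s k) i z - v i z) <= e].
Proof.
move=> mU C0 P0 Plin LP Llin elin ele.
pose J x := L2vn U (L x) - 2 * ell x.
have Jlb x : P x -> - C <= J x.
 move=> Px; have H := ele x Px; have l0 := L2vn_ge0 U (L x).
 rewrite /J; move: (L2vn U (L x)) (ell x) l0 H => l e l0 H.
 have : 2 * e <= C + l.
  rewrite leNgt; apply/negP => le.
  have : (C + l) ^+ 2 < (2 * e) ^+ 2 by rewrite ltr_pXn2r// nnegrE ?addr_ge0// (le_trans _ (ltW le))// addr_ge0.
  have := sqr_ge0 (C - l).
  have -> : (C - l) ^+ 2 = C ^+ 2 + l ^+ 2 - 2 * (C * l) by ring.
  have -> : (C + l) ^+ 2 = C ^+ 2 + l ^+ 2 + 2 * (C * l) by ring.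
  have -> : (2 * e) ^+ 2 = 4 * e ^+ 2 by ring.
  by move: H; move: (C * l) (C ^+ 2) (l ^+ 2) (e ^+ 2) => a b c d; lra.
 by lra.
pose A := [set J x | x in [set x | P x]].
have hA : has_inf A.
 split; first by exists (J 0); exists 0.
 by exists (- C) => _ [x /= Px <-]; exact: Jlb.
pose m := inf A.
have mJ x : P x -> m <= J x by move=> Px; apply: ge_inf; [exact: hA.2|exists x].
have /choice[s Hs] : forall k : nat, exists x, P x /\ J x < m + k.+1%:R^-1.
 move=> k; have k0 : 0 < k.+1%:R^-1 :> R by rewrite invr_gt0 ltr0n.
 have [_ [x /= Px <-] H] := inf_adherent k0 hA.
 by exists x.
have Ps k : P (s k) := (Hs k).1.
have LLin2 c x y : P x -> P y -> forall i, L (c *: x + y) i = (fun z => L y i z + c * L x i z).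
 by move=> Px Py i; apply/funext => z; rewrite Llin// addrC.
have JD c x y : P x -> P y -> J (c *: x + y) = J y + 2 * c * (ipv U (L y) (L x) - ell x) + c ^+ 2 * L2vn U (L x).
 move=> Px Py; rewrite /J elin//.
 rewrite (_ : L (c *: x + y) = fun i z => L y i z + c * L x i z); last by apply/funext => i; exact: LLin2.
 by rewrite L2vn_expand//; try exact: LP; ring.
have par j k : L2vn U (fun i z => L (s j) i z - L (s k) i z) <= 2 * (j.+1%:R^-1 + k.+1%:R^-1).
 pose d := (-1 : R) *: s k + s j.
 have Pd : P d by exact: Plin.
 have Ed : L d = fun i z => L (s j) i z - L (s k) i z by apply/funext => i; apply/funext => z; rewrite Llin//; ring.
 have Ej : (1 : R) *: d + s k = s j by rewrite scale1r /d scaleN1r addrC addNKr.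
 have := JD 1 d (s k) Pd (Ps k); rewrite Ej => E1.
 have := mJ _ (Plin (1 / 2) d (s k) Pd (Ps k)); rewrite JD// => E2.
 have [_ Hj] := Hs j; have [_ Hk] := Hs k.
 rewrite -Ed; move: E1 E2 Hj Hk.
 move: (J (s j)) (J (s k)) (ipv _ _ _ - ell d) (L2vn U (L d)) (j.+1%:R^-1) (k.+1%:R^-1) => a b q D x y.
 by rewrite expr1n !expr2; lra.
have [v [Lv Hv]] : exists v, L2v U v /\ forall e : R, 0 < e -> exists M, forall k, (M <= k)%N ->
  L2vn U (fun i z => L (s k) i z - v i z) <= e.
 apply: L2v_complete => //; first by move=> k; exact: LP.
 move=> e e0.
 have [M HM] : exists M : nat, M.+1%:R^-1 < e / 4 by apply: ex_invn_lt; rewrite divr_gt0.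
 exists M => j k Mj Mk; apply: le_trans (par j k) _.
 have Hle i : (M <= i)%N -> i.+1%:R^-1 <= e / 4.
  move=> Mi; apply: le_trans (ltW HM); rewrite lef_pV2 ?posrE ?ltr0n// ler_nat ltnS//.
 by move: (Hle _ Mj) (Hle _ Mk); move: (j.+1%:R^-1) (k.+1%:R^-1) => a b; lra.
have rep x : P x -> ell x = ipv U (L x) v.
 move=> Px; apply/eqP; rewrite -subr_eq0 -sqrf_eq0; apply/eqP/le_anti; rewrite sqr_ge0 andbT.
 apply: (@le0_of_small _ _ (4 * L2vn U (L x))); first by rewrite mulr_ge0// L2vn_ge0.
 move=> e e0; have [M1 HM1] := Hv e e0; have [M2 HM2] := ex_invn_lt e0.
 pose k := maxn M1 M2.
 have Dx := L2vn_ge0 U (L x).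
 have H1 : (ipv U (L (s k)) (L x) - ell x) ^+ 2 <= e * L2vn U (L x).
  apply: (@le_trans _ _ ((J (s k) - m) * L2vn U (L x))).
   (* The inequality [m <= J (s k + t x)] for all [t] is a nonnegative quadratic polynomial in [t].
      Its discriminant bounds the failure of stationarity at [s k] by the defect [J (s k) - m]. *)
   apply: quad_discr => // t.
   have := mJ _ (Plin t x (s k) Px (Ps k)); rewrite JD//.
   by move: (J (s k)) (2 * t * _) (t ^+ 2 * _) => a b c; clear; lra.
  apply: ler_wpM2r => //; have [_ Hk] := Hs k.
  have : k.+1%:R^-1 <= e.
   apply: le_trans (ltW HM2); rewrite lef_pV2 ?posrE ?ltr0n// ler_nat ltnS.
   exact: leq_maxr.
  by move: Hk; move: (k.+1%:R^-1) (J (s k)) => a b; lra.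
 have H2 : (ipv U (L (s k)) (L x) - ipv U (L x) v) ^+ 2 <= e * L2vn U (L x).
  have -> : ipv U (L (s k)) (L x) - ipv U (L x) v = ipv U (fun i z => L (s k) i z - v i z) (L x).
   have -> : (fun i z => L (s k) i z - v i z) = (fun i z => L (s k) i z + (-1) * v i z) by apply/funext => i; apply/funext => z; ring.
   rewrite ipvDl//; [|exact: LP|exact: L2vZ|exact: LP].
   by rewrite ipvZl//; [rewrite mulN1r (ipvC _ v)|exact: LP].
  apply: le_trans (ipv_CS mU _ _) _; [exact: L2vB (LP _ (Ps k)) Lv|exact: LP|].
  by apply: ler_wpM2r => //; apply: HM1; exact: leq_maxl.
 have := sqrD_le (ipv U (L (s k)) (L x) - ipv U (L x) v) (- (ipv U (L (s k)) (L x) - ell x)).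
 rewrite sqrrN (_ : _ + - _ = ell x - ipv U (L x) v); last by ring.
 by move: H1 H2; move: (_ ^+ 2) (_ ^+ 2) (_ ^+ 2) (L2vn U (L x)) => a b c D; lra.
exists v, s; split => //.
- apply/ler_addgt0Pr => e e0; have [M HM] := Hv e e0.
 have := HM M (leqnn M); have := Jlb _ (Ps M).
 have E : L2vn U (fun i z => L (s M) i z - v i z) = L2vn U (L (s M)) + 2 * (-1) * ipv U (L (s M)) v + (-1) ^+ 2 * L2vn U v.
  by rewrite -L2vn_expand//; [congr (L2vn U _); apply/funext => i; apply/funext => z; ring|exact: LP].
 rewrite /J rep//; move: E; rewrite ipvC; move: (ipv _ _ _) (L2vn U (L _)) (L2vn U v) (L2vn U _) => p a b q ->.
 by rewrite sqrrN expr1n; lra.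
Qed.

Lemma cvg_invS_dnbhs {R : realType} : (k.+1%:R^-1 : R) @[k --> \oo] --> (0 : R)^'.
Proof.
move=> A [e /= e0 HA].
have : (k.+1%:R^-1 : R) @[k --> \oo] --> (0 : R) by exact: cvg_harmonic.
move=> /(_ (ball 0 e) (nbhsx_ballx _ _ e0))[N _ HN]; exists N => // k Nk /=.
have k0 : k.+1%:R != 0 :> R by rewrite pnatr_eq0.
by apply: HA; [exact: HN|exact: invr_neq0].
Qed.

(** * Compactly supported functions, convolution and averages over cubes *)

Section compact_support.
Context {R : realType} {n : nat}.
Local Notation V := 'rV[R]_n.
Local Notation mu := (lebesgue_rV R n).
Local Notation e_ i := (basis_vec R i).
Implicit Types (f phi : V -> R) (U : set V) (x y : V) (c d M : R).

Definition bsupp c phi := forall y, c < `|y| -> phi y = 0.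

Lemma far_open c y : c < `|y| -> \forall z \near y, c < `|z|.
Proof.
move=> cy; apply/nbhs_rVP; exists (`|y| - c) => [|z zy]; first by rewrite subr_gt0.
have := ler_normB y (y - z); rewrite opprB addrC subrK => H.
rewrite -(ltrD2r (- c)) subrr; have := ler_distD z y 0; rewrite !subr0 distrC.
by move: zy; lra.
Qed.

Lemma pd_bsupp c phi i : bsupp c phi -> bsupp c (pd i phi).
Proof.
move=> H y cy; rewrite (_ : 0 = pd i (fun=> 0) y); last by rewrite pd_cst.
by apply: pd_near; apply: filterS (far_open cy) => z; exact: H.
Qed.

Lemma partial_bsupp c phi l : bsupp c phi -> bsupp c (partial l phi).
Proof. by move=> H; elim: l => //= i l; exact: pd_bsupp. Qed.

Lemma cube_compact c : compact (cube (0 : V) c).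
Proof.
apply: bounded_closed_compact.
 exists `|c|; split; first exact: num_real.
 move=> M cM y /= Hy; apply: normrV_le; first exact: le_trans (ltW cM).
 move=> i; have := Hy i; rewrite mxE subr0 => /le_trans; apply.
 by apply: le_trans (ler_norm _) _; exact: ltW.
rewrite (_ : cube 0 c = \bigcap_(i in [set: 'I_n]) [set y : V | `|y 0 i| <= c]).
 apply: closed_bigI => i _.
 apply: (@closed_comp _ _ (fun y : V => `|y 0 i|) [set z : R | z <= c]); last exact: closed_le.
 move=> y _; apply: continuous_comp; first exact: coord_continuous.
 exact: norm_continuous.
apply/seteqP; split => y /=.
 by move=> H i _; have := H i; rewrite mxE subr0.
by move=> H i; rewrite mxE subr0; exact: H.
Qed.

Lemma compact_bdfun (K : set V) f : compact K ->
 (forall x, K x -> {for x, continuous f}) -> exists2 M, 0 <= M & forall x, K x -> `|f x| <= M.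
Proof.
move=> cK cf; have [->|/set0P K0] := eqVneq K set0; first by exists 0.
have cfn : {within K, continuous (fun x => `|f x|)}.
 apply: continuous_in_subspaceT => x; rewrite inE => Kx.
 by apply: (@continuous_comp _ _ _ f (fun z : R => `|z|)); [exact: cf|exact: norm_continuous].
have [m mK Hm] := EVT_max_rV K0 cK cfn.
exists `|f m| => // x Kx; apply: Hm; rewrite inE//.
Qed.

Lemma bsupp_bd c phi : continuous phi -> bsupp c phi ->
 exists2 M, 0 <= M & forall x, `|phi x| <= M.
Proof.
move=> cphi sphi; have [M M0 HM] := compact_bdfun (@cube_compact c) (fun x _ => cphi x).
exists M => // x; have [xc|cx] := leP `|x| c; last by rewrite sphi// normr0.
by apply: HM => i; rewrite mxE subr0 (le_trans (le_normrV _ _)).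
Qed.

Lemma smooth_cont phi : smooth setT phi -> continuous phi.
Proof. by move=> H x; apply: (Ck_cont (H 0%N)). Qed.

Lemma Ck_bsupp_bd k c phi l : Ck k setT phi -> (size l <= k)%N -> bsupp c phi ->
 exists2 M, 0 <= M & forall x, `|partial l phi x| <= M.
Proof.
move=> H lk sphi; apply: (@bsupp_bd c); last exact: partial_bsupp.
by move=> x; have [] := H l lk x I.
Qed.

Lemma lipschitz_rV f M : (forall x, pder f x) ->
 (forall i x, `|pd i f x| <= M) -> forall x y, `|f x - f y| <= n%:R * M * `|x - y|.
Proof.
move=> df HM x y; have -> : f x - f y = f (y + (x - y)) - f y by rewrite (addrC y) subrK.
set k := x - y; rewrite slopeCE (le_trans (ler_norm_sum _ _ _))//.
apply: (@le_trans _ _ (\sum_(i < n) M * `|k|)); last by rewrite sumr_const card_ord -[_ *+ n]mulr_natl mulrA.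
apply: ler_sum => i _; rewrite normrM mulrC; apply: ler_pM => //; last exact: le_normrV.
rewrite /slopeC; case: eqP => [_|/eqP k0]; first exact: HM.
have [s [sk E]] := @MVT_line _ _ f (y + trunc_rV k i) i (k 0 i) (fun s _ => df _ i).
by rewrite trunc_rVS addrA E mulrC mulKf.
Qed.

Lemma taylor1_line f i M x (h : R) : Ck 2 setT f -> (forall y, `|pd i (pd i f) y| <= M) ->
 `|f (x + h *: e_ i) - f x - h * pd i f x| <= M * h ^+ 2.
Proof.
move=> C2 HM.
have [s [sh E]] := @MVT_line _ _ f x i h (fun s _ => @Ck_pder _ _ _ _ _ C2 _ I i).
have [t [ts E2]] := @MVT_line _ _ (pd i f) x i s (fun s _ => @Ck_pder _ _ _ _ _ (Ck_pd i C2) _ I i).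
rewrite E -mulrBr E2 !normrM; apply: (@le_trans _ _ (`|h| * (`|h| * M))).
 by apply: ler_wpM2l => //; apply: ler_pM.
by rewrite mulrA mulrC -expr2 real_normK ?num_real.
Qed.

Lemma Rint_shift f (a : V) : mfun setT f ->
 \int[mu]_x f (x + a) = \int[mu]_x f x.
Proof.
move=> mf; rewrite /Rintegral; congr fine.
have mE : mfun setT (EFin \o f) by exact/EFin_meas.
rewrite integralE [in RHS]integralE; congr (_ - _)%E.
- apply: etrans (@ge0_shift _ _ a (EFin \o f)^\+%E _ _) => //.
 + by apply: eq_integral => x _; rewrite !funeposE.
 + exact: measurable_funepos.
- apply: etrans (@ge0_shift _ _ a (EFin \o f)^\-%E _ _) => //.
 + by apply: eq_integral => x _; rewrite !funenegE.
 + exact: measurable_funeneg.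
Qed.

Lemma integ_bd U f M : measurable U -> mfun U f ->
 (forall x, U x -> `|f x| <= M) -> (mu U < +oo)%E -> integ U f.
Proof.
move=> mU mf fM Uoo; apply: (@integ_le _ _ U f (fun=> M)) => //.
apply/integrableP; split; first exact/EFin_meas/measurable_cst.
rewrite integral_cst//= lte_mul_pinfty// lee_fin//.
Qed.

Lemma cube_fin x d : (mu (cube x d) < +oo)%E.
Proof.
have [d0|d0] := leP 0 d; first by rewrite leb_cube// ltry.
apply: (bounded_leb (c := 0) (cube_meas _ _)) => y Hy.
apply: normrV_le => // i; have := Hy i; have := normr_ge0 (y 0 i - x 0 i); lra.
Qed.

Lemma integ_indic U : measurable U -> (mu U < +oo)%E -> integ setT (\1_U : V -> R).
Proof.
move=> mU Uoo; rewrite (_ : (\1_U : V -> R) = ((fun=> 1 : R) \_ U)); last first.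
 by apply/funext => x; rewrite patchE indicE; case: (x \in U).
rewrite /integ -restrict_EFin; apply/(integrable_mkcond _ mU).
by apply: (@integ_bd _ _ 1) => // x _; rewrite normr1.
Qed.

Lemma integ_bsupp f M c : mfun setT f -> (forall x, `|f x| <= M) -> bsupp c f ->
 integ setT f.
Proof.
move=> mf fM sf.
have E : f = f \_ (cube (0 : V) c).
 apply/funext => x; rewrite patchE; case: ifPn => //.
 rewrite notin_setE /= => xc; apply: sf; rewrite ltNge; apply/negP => xc'; apply: xc => i.
 by rewrite mxE subr0 (le_trans (le_normrV _ _)).
rewrite /integ E -restrict_EFin; apply/(integrable_mkcond _ (cube_meas _ _)).
apply: (@integ_bd _ _ M) => //; [exact: cube_meas|exact: mfunTS|exact: cube_fin].
Qed.

(** Difference quotients have integral 0 by translation invariance. They are dominated by the bound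
    of the derivative on the cube of radius [c + 1], since the steps are at most 1. *)
Lemma int_pd_eq0 phi c i : Ck 1 setT phi -> bsupp c phi -> \int[mu]_x pd i phi x = 0.
Proof.
move=> C1 sphi.
have [M M0 HM] := @Ck_bsupp_bd 1 c phi [:: i] C1 isT sphi.
have cphi : continuous phi by move=> x; exact: (Ck_cont C1).
have [M1 M10 HM1] := bsupp_bd cphi sphi.
have mphi : mfun setT phi by exact: cont_meas.
have Iphi : integ setT phi by exact: integ_bsupp mphi HM1 sphi.
pose h (k : nat) : R := k.+1%:R^-1.
have h0 k : 0 < h k by rewrite invr_gt0 ltr0n.
have h1 k : h k <= 1 by rewrite invf_le1 ?ler1n// ltr0n.
pose D k x := (h k)^-1 * (phi (x + h k *: e_ i) - phi x).
have mt k : mfun setT (fun x => phi (x + h k *: e_ i)).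
 exact: (mfun_comp mphi (addrV_meas _)).
have It k : integ setT (fun x => phi (x + h k *: e_ i)).
 apply: (@integ_bsupp _ M1 (c + 1)) => // x cx; apply: sphi.
 have := ler_normB (x + h k *: e_ i) (h k *: e_ i); rewrite addrK.
 rewrite normrZ norm_basis_vec mulr1 (gtr0_norm (h0 k)).
 by move: (h1 k) cx; lra.
have ID k : \int[mu]_x D k x = 0.
 rewrite RintegralZl//; last exact: integB.
 have -> : \int[mu]_x (phi (x + h k *: e_ i) - phi x) = 0; last by rewrite mulr0.
 have -> := RintegralB measurableT (It k) Iphi.
 by apply/eqP; rewrite subr_eq0; apply/eqP; exact: Rint_shift.
have DM k x : `|D k x| <= M * \1_(cube 0 (c + 1)) x.
 rewrite indicE; case: (boolP (x \in cube 0 (c + 1))) => [_|].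
  have [s [sh E]] := @MVT_line _ _ phi x i (h k) (fun s _ => @Ck_pder _ _ _ _ _ C1 _ I i).
  by rewrite /D E mulKf ?gt_eqF// mulr1; exact: HM.
 rewrite notin_setE /= => xc.
 have cx : c + 1 < `|x|.
  rewrite ltNge; apply/negP => xc'; apply: xc => j.
  by rewrite mxE subr0 (le_trans (le_normrV _ _)).
 rewrite /D !sphi ?subrr ?mulr0 ?normr0//; first by lra.
 have := ler_normB (x + h k *: e_ i) (h k *: e_ i); rewrite addrK.
 rewrite normrZ norm_basis_vec mulr1 (gtr0_norm (h0 k)).
 by move: (h1 k) cx; lra.
have Ig : integ setT (fun x => M * \1_(cube 0 (c + 1)) x).
 by apply: integZ => //; apply: integ_indic; [exact: cube_meas|exact: cube_fin].
have cD x : D ^~ x @ \oo --> pd i phi x.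
 have dphi : derivable phi x (e_ i) := @Ck_pder _ _ _ _ _ C1 x I i.
 have h_0 : h k @[k --> \oo] --> (0 : R)^'.
  exact: cvg_invS_dnbhs.
 have := cvg_comp _ _ h_0 dphi.
 rewrite (_ : _ \o h = D ^~ x)//; apply/funext => k.
 by rewrite /D /= /GRing.scale/= (addrC x).
have Dc : (\int[mu]_x (D k x)%:E)%E @[k --> \oo] --> (\int[mu]_x (pd i phi x)%:E)%E.
 apply: (@dominated_cvg _ _ _ mu setT measurableT (fun k x => (D k x)%:E) (fun x => (pd i phi x)%:E)
  (EFin \o (fun x => M * \1_(cube 0 (c + 1)) x))).
 - move=> k; apply/EFin_meas; apply: mfunM => //.
  exact: mfunB.
 - by move=> x _; apply: cvg_EFin; [exact: nearW|exact: cD].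
 - by [].
 - exact: Ig.
 - by move=> k x _; rewrite lee_fin.
have E0 : (fun k => \int[mu]_x (D k x)%:E)%E = fun=> 0%E.
 apply/funext => k; rewrite -[RHS]/(0%R%:E) -(ID k) /Rintegral fineK//.
 apply: integrable_fin_num => //; apply: (@integZ _ _ setT) => //.
 exact: integB.
move: Dc; rewrite E0 => Dc; rewrite /Rintegral.
by rewrite (@cvg_unique _ (@ereal_hausdorff R) _ _ _ _ Dc (cvg_cst _)).
Qed.

Implicit Types (u psi : V -> R).

Lemma subrVl_meas x : mfun [set: V] (fun z => x - z).
Proof.
apply: measurable_fun_rVP => i.
rewrite (_ : (fun z : V => _) = (fun z : V => x 0 i - (z 0 i : measurableTypeR R))); last first.
 by apply/funext => z; rewrite !mxE.
by apply: mfunB => //; exact: measurable_rV_coord.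
Qed.

Definition conv u phi : V -> R := fun x => \int[mu]_z (u z * phi (x - z)).

Lemma integ_convE u phi M x : integ setT u -> mfun setT phi ->
 (forall y, `|phi y| <= M) -> integ setT (fun z => u z * phi (x - z)).
Proof.
move=> Iu mphi HM.
have mu' : mfun setT u by apply/EFin_meas; exact: measurable_int Iu.
apply: (@integ_le _ _ _ _ (fun z => M * `|u z|)) => //.
- apply: mfunM => //; apply: (mfun_comp mphi); exact: subrVl_meas.
- by move=> z _; rewrite normrM mulrC; apply: ler_wpM2r.
- apply: integZ => //; rewrite /integ (_ : _ \o _ = abse \o (EFin \o u))%E//.
 exact: integrable_abse.
Qed.

Lemma integ_abs U f : integ U f -> integ U (fun x => `|f x|).
Proof.
move=> If; rewrite /integ (_ : _ \o _ = abse \o (EFin \o f))%E//.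
exact: integrable_abse.
Qed.

Lemma conv_bound u phi M x : integ setT u -> mfun setT phi ->
 (forall y, `|phi y| <= M) -> `|conv u phi x| <= M * \int[mu]_z `|u z|.
Proof.
move=> Iu mphi HM; have I1 := integ_convE x Iu mphi HM.
apply: le_trans (le_normr_Rintegral measurableT I1) _.
rewrite -RintegralZl//; last exact: integ_abs.
apply: le_Rintegral => //; first exact: integ_abs.
 by apply: integZ => //; exact: integ_abs.
by move=> z _; rewrite normrM mulrC ler_wpM2r.
Qed.

Lemma convB u phi psi M x : integ setT u -> mfun setT phi -> mfun setT psi ->
 (forall y, `|phi y| <= M) -> (forall y, `|psi y| <= M) ->
 conv u phi x - conv u psi x = conv u (fun y => phi y - psi y) x.
Proof.
move=> Iu mp mq Hp Hq; rewrite /conv -RintegralB//; try exact: (integ_convE (M := M)).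
by apply: eq_Rint => z _; rewrite mulrBr.
Qed.

Lemma convZ u phi M c x : integ setT u -> mfun setT phi ->
 (forall y, `|phi y| <= M) -> c * conv u phi x = conv u (fun y => c * phi y) x.
Proof.
move=> Iu mp Hp; rewrite /conv -RintegralZl//; try exact: (integ_convE (M := M)).
by apply: eq_Rint => z _; rewrite mulrCA.
Qed.

Lemma conv_shift u phi a x : conv u phi (x + a) = conv u (fun y => phi (y + a)) x.
Proof. by apply: eq_Rint => z _; rewrite addrAC. Qed.

Lemma conv_cont u phi c : integ setT u -> Ck 1 setT phi -> bsupp c phi ->
 continuous (conv u phi).
Proof.
move=> Iu C1 sphi.
have cphi : continuous phi by move=> x; exact: (Ck_cont C1).
have mphi := cont_meas cphi.
have [M0 M00 HM0] := bsupp_bd cphi sphi.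
have /choice[M HM] i : exists M, 0 <= M /\ forall x, `|pd i phi x| <= M.
 by have [M M0' HM] := @Ck_bsupp_bd 1 c phi [:: i] C1 isT sphi; exists M.
pose A := \sum_i M i.
have A0 : 0 <= A by apply: sumr_ge0 => i _; exact: (HM i).1.
have HA i x : `|pd i phi x| <= A.
 apply: le_trans ((HM i).2 x) _; rewrite /A (bigD1 i)//= lerDl sumr_ge0// => j _.
 exact: (HM j).1.
have dphi x : pder phi x by exact: (Ck_pder C1).
have Lip := lipschitz_rV dphi HA.
pose K := n%:R * A * \int[mu]_z `|u z|.
have K0 : 0 <= K by rewrite !mulr_ge0// Rintegral_ge0.
move=> x; apply/cont_rVP => e e0; exists (e / (K + 1)) => [|y yx].
 by rewrite divr_gt0// ltr_wpDl.
have -> : conv u phi y - conv u phi x = conv u (fun z => phi (z + (y - x)) - phi z) x.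
 rewrite -(@convB _ _ _ M0)//.
  by rewrite -conv_shift (addrC x) subrK.
 by apply: (mfun_comp mphi); exact: addrV_meas.
apply: (@le_ltT _ _ (K * `|y - x|)).
 apply: le_trans (conv_bound (M := n%:R * A * `|y - x|) x Iu _ _) _.
 - apply: mfunB => //; apply: (mfun_comp mphi); exact: addrV_meas.
 - by move=> z; apply: le_trans (Lip _ _) _; rewrite (addrC z) addrK.
 - by rewrite /K mulrAC.
move: yx; rewrite ltr_pdivlMr ?ltr_wpDl// mulrDr mulr1 => yx.
by apply: le_ltT yx; rewrite mulrC lerDl.
Qed.

(** The second order Taylor bound on [phi] is uniform in the point, so the difference quotient of
    the convolution differs from the convolution with [pd i phi] by a multiple of [h]. *)
Lemma conv_pd u phi c i x : integ setT u -> Ck 2 setT phi -> bsupp c phi ->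
 derivable (conv u phi) x (e_ i) /\ pd i (conv u phi) x = conv u (pd i phi) x.
Proof.
move=> Iu C2 sphi.
have cphi : continuous phi by move=> y; exact: (Ck_cont C2).
have mphi := cont_meas cphi.
have [M0 M00 HM0] := bsupp_bd cphi sphi.
have [M M0' HM] := @Ck_bsupp_bd 2 c phi [:: i; i] C2 isT sphi.
have cdphi : continuous (pd i phi) by move=> y; exact: (Ck_cont (Ck_pd i C2)).
have mdphi := cont_meas cdphi.
have [M1 M10 HM1] := bsupp_bd cdphi (pd_bsupp i sphi).
pose K := M * \int[mu]_z `|u z|.
have K0 : 0 <= K by rewrite mulr_ge0// Rintegral_ge0.
suff H : h^-1 *: (conv u phi (h *: e_ i + x) - conv u phi x) @[h --> 0^'] --> conv u (pd i phi) x.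
 by split; [apply/cvg_ex; eexists; exact: H|exact: cvg_lim].
apply/cvgrPdist_le => e e0; near=> h.
have h0 : h != 0 by near: h; exact: nbhs_dnbhs_neq.
have mt : mfun setT (fun z : V => phi (z + h *: e_ i)) by apply: (mfun_comp mphi); exact: addrV_meas.
have -> : conv u (pd i phi) x - h^-1 *: (conv u phi (h *: e_ i + x) - conv u phi x) =
  - h^-1 * conv u (fun z => phi (z + h *: e_ i) - phi z - h * pd i phi z) x.
 rewrite -(@convB u _ _ (M0 + M0 + `|h| * M1))//.
 - rewrite -(@convB u _ _ M0)// -(@convZ u _ M1)// -conv_shift (addrC x) /GRing.scale/=.
  by field.
 - exact: mfunB.
 - exact: mfunM.
 - move=> y; apply: (le_trans (ler_normB _ _)); rewrite -[leLHS]addr0 lerD ?lerD// mulr_ge0//.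
 - by move=> y; rewrite normrM -[leLHS]add0r lerD ?addr_ge0// ler_wpM2l.
rewrite normrM normrN normfV ler_pdivrMl ?normr_gt0//.
apply: le_trans (conv_bound (M := M * h ^+ 2) x Iu _ _) _.
- apply: mfunB; [exact: mfunB|exact: mfunM].
- by move=> y; exact: taylor1_line.
rewrite mulrAC -/K -(real_normK (num_real h)) expr2 mulrCA ler_wpM2l//.
have hK : `|h| < e / (K + 1) by near: h; apply: dnbhs0_lt; rewrite divr_gt0// ltr_wpDl.
move: hK; rewrite ltr_pdivlMr ?ltr_wpDl// mulrDr mulr1 => hK.
by apply: le_trans (ltW hK); rewrite mulrC lerDl.
Unshelve. all: end_near. Qed.

Lemma conv_Ck u phi c k : integ setT u -> smooth setT phi -> bsupp c phi ->
 Ck k setT (conv u phi).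
Proof.
move=> Iu; elim: k phi => [|k IH] phi sm sphi.
 by apply/Ck0 => x _; exact: conv_cont (sm 1%N) sphi _.
apply/CkS; split=> [x _|i].
 split; first exact: conv_cont (sm 1%N) sphi _.
 by move=> i; have [] := conv_pd i x Iu (sm 2%N) sphi.
rewrite (_ : pd i _ = conv u (pd i phi)).
 by apply: IH; [exact: smooth_pd|exact: pd_bsupp].
by apply/funext => x; have [] := conv_pd i x Iu (sm 2%N) sphi.
Qed.

Lemma conv_partial u phi c l : integ setT u -> smooth setT phi -> bsupp c phi ->
 partial l (conv u phi) = conv u (partial l phi).
Proof.
move=> Iu sm sphi; elim: l => //= i l IH; rewrite -/(pd i _).
rewrite IH; apply/funext => x.
by have [] := conv_pd i x Iu (@smooth_part _ _ _ _ l sm 2%N) (partial_bsupp l sphi).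
Qed.

Local Open Scope ereal_scope.

Lemma cubeC x z c : cube x c z <-> cube z c x.
Proof. by split=> H i; rewrite distrC; exact: H. Qed.

Lemma cube2_meas c : measurable [set xz : V * V | cube xz.1 c xz.2].
Proof.
have := @subrV2_meas R n measurableT (cube 0%R c) (cube_meas _ _).
rewrite setTI; congr (measurable _); apply/seteqP; split=> -[x z] /= H i; have := H i.
 by rewrite !mxE subr0 distrC.
by rewrite !mxE subr0 distrC.
Qed.

Definition cube_ker (f : V -> \bar R) c (xz : V * V) :=
 f xz.2 * (\1_[set xz : V * V | cube xz.1 c xz.2] xz)%:E.

Lemma cube_ker_meas (f : V -> \bar R) c : mfun setT f ->
 mfun setT (cube_ker f c).
Proof.
move=> mf; apply: emeasurable_funM; first exact: mfun_comp.
by apply/EFin_meas; apply: measurable_indic; exact: cube2_meas.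
Qed.

Lemma cube_ker_ge0 (f : V -> \bar R) c xz : (forall x, 0 <= f x) -> 0 <= cube_ker f c xz.
Proof. by move=> f0; rewrite mule_ge0// lee_fin indicE. Qed.

Lemma cube_integralE (f : V -> \bar R) c x :
 \int[mu]_(z in cube x c) f z = \int[mu]_z cube_ker f c (x, z).
Proof.
rewrite integral_mkcond; apply: eq_integral => z _.
rewrite patchE /cube_ker /= indicE; case: ifPn => /=.
 by rewrite inE => cxz; rewrite mem_set// mule1.
by rewrite notin_setE => cxz; rewrite memNset// mule0.
Qed.

Lemma cube_int_meas (f : V -> \bar R) c : mfun setT f ->
 (forall x, 0 <= f x) ->
 mfun setT (fun x => \int[mu]_(z in cube x c) f z).
Proof.
move=> mf f0; under eq_fun do rewrite cube_integralE.
apply: (@measurable_fun_fubini_tonelli_F _ _ _ _ _ mu (cube_ker f c)).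
 exact: cube_ker_meas.
by move=> xz; exact: cube_ker_ge0.
Qed.

(** Tonelli with a symmetric kernel: each [z] is counted with the volume of the cube around it. *)
Lemma cube_average (f : V -> \bar R) c : (0 <= c)%R -> mfun setT f ->
 (forall x, 0 <= f x) ->
 \int[mu]_x \int[mu]_(z in cube x c) f z = ((c *+ 2) ^+ n)%:E * \int[mu]_z f z.
Proof.
move=> c0 mf f0.
have mF := cube_ker_meas c mf.
have F0 xz := cube_ker_ge0 c xz f0.
under eq_integral do rewrite cube_integralE.
rewrite (fubini_tonelli _ mF F0) -ge0_integralZl_EFin//; last by rewrite exprn_ge0// mulrn_wge0.
apply: eq_integral => z _; rewrite /cube_ker /=.
have ms : measurable [set x : V | cube x c z].
 by rewrite (_ : [set x : V | _] = cube z c); [exact: cube_meas|apply/seteqP; split => x /cubeC].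
have E x : (\1_[set xz : V * V | cube xz.1 c xz.2] (x, z) : R) = \1_[set x : V | cube x c z] x.
 by rewrite !indicE; congr (_%:R); apply/idP/idP; rewrite !inE.
under eq_integral do rewrite E.
rewrite ge0_integralZl//.
- rewrite muleC; congr (_ * _); rewrite integral_indic// setIT -(@leb_cube R n z c c0).
 by congr (mu _); apply/seteqP; split => x /cubeC.
- exact/EFin_meas/measurable_indic.
Qed.

(** Cauchy-Schwarz on the cube outside which [z |-> phi (x - z)] vanishes. The right side is local,
    so that it can be integrated in [x] afterwards. *)
Lemma conv_sqr_bound u phi M c x : (0 <= c)%R -> (0 <= M)%R -> integ setT u -> L2 setT u -> mfun setT phi ->
 (forall y, `|phi y| <= M)%R -> bsupp c phi ->
 ((conv u phi x ^+ 2)%:E <= (M ^+ 2 * (c *+ 2) ^+ n)%:E * \int[mu]_(z in cube x c) (u z ^+ 2)%:E).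
Proof.
move=> c0 M0 Iu Lu mphi HM sphi.
have mC := cube_meas x c.
have LuC : L2 (cube x c) u by apply: L2_sub Lu.
have L1C : L2 (cube x c) (fun=> 1%R).
 apply: integ_L2 => //; apply: (@integ_bd _ _ 1) => //.
  by move=> y _; rewrite expr1n normr1.
 exact: cube_fin.
have vol : L2n (cube x c) (fun=> 1%R) = ((c *+ 2) ^+ n)%R.
 have E0 : fine (mu (cube x c)) = ((c *+ 2) ^+ n)%R by rewrite leb_cube.
 by rewrite /L2n Rintegral_cst// expr1n mul1r; exact: E0.
have E : (conv u phi x = ip (cube x c) u (fun z : V => phi (x - z)%R))%R.
 rewrite /conv /ip [RHS]Rintegral_mkcond; apply: eq_Rint => z _; rewrite patchE.
 case: ifPn => //; rewrite notin_setE => nC; rewrite sphi ?mulr0// ltNge; apply/negP => xz.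
 by apply: nC => i; have := le_normrV (x - z) i; rewrite !mxE distrC => /le_trans; exact.
have mpx : mfun setT (fun z : V => phi (x - z)%R) by apply: (mfun_comp mphi); exact: subrVl_meas.
have Lp : L2 (cube x c) (fun z : V => phi (x - z)%R).
 apply: integ_L2 => //; first exact: mfunTS.
 apply: (@integ_bd _ _ (M ^+ 2)%R) => //.
 - by apply: mfunX; exact: mfunTS.
 - by move=> y _; rewrite normrX lerXn2r// nnegrE.
 - exact: cube_fin.
have pM : (L2n (cube x c) (fun z : V => phi (x - z)%R) <= M ^+ 2 * (c *+ 2) ^+ n)%R.
 rewrite -vol -RintegralZl//; last exact: L2_integ.
 apply: le_Rintegral => //; [exact: L2_integ|apply: integZ => //; exact: L2_integ|].
 by move=> y _; rewrite expr1n mulr1 -real_normK ?num_real// lerXn2r// nnegrE.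
rewrite L2nE// -EFinM lee_fin E.
apply: le_trans (L2_CS mC LuC Lp) _.
by rewrite mulrC ler_wpM2r// L2n_ge0.
Qed.

End compact_support.

(** * Cut-off profiles *)

Section bumps.
Context {R : realType}.

Fixpoint bpoly (k : nat) : {poly R} :=
 if k is k'.+1 then 'X^2 * (bpoly k' - (bpoly k')^`()) else 1.

(** The [k]-th derivative of [exp (- 1 / s)], extended by 0 to [s <= 0]; the cut-offs, the mollifier
    and the exhaustion function are all built from it. *)
Definition bfun k (s : R) := bump_p (bpoly k) s.

Lemma isd_bfunk k (s : R) : is_derive s (1 : R) (bfun k) (bfun k.+1 s).
Proof. exact: isd_bump_poly. Qed.

Lemma bfun_cont k : continuous (bfun k).
Proof.
move=> s; apply/differentiable_continuous/derivable1_diffP.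
by have [] := isd_bfunk k s.
Qed.

Lemma bfun_le0 k (s : R) : s <= 0 -> bfun k s = 0.
Proof. by move=> s0; rewrite /bfun /bump_p ltNge s0. Qed.

Lemma bfun0_gt0 (s : R) : 0 < s -> 0 < bfun 0 s.
Proof. by move=> s0; rewrite /bfun /bump_p s0 hornerC mul1r expR_gt0. Qed.

Lemma bfun0_ge0 (s : R) : 0 <= bfun 0 s.
Proof. by have [s0|s0] := leP s 0; [rewrite bfun_le0|rewrite ltW ?bfun0_gt0]. Qed.

Lemma bfun1E (s : R) : 0 < s -> bfun 1 s = s ^- 2 * expR (- s^-1).
Proof.
move=> s0; rewrite /bfun /bump_p s0 /= derivC subr0 mulr1 hornerXn.
by rewrite exprVn.
Qed.

Lemma bfun1_gt0 (s : R) : 0 < s -> 0 < bfun 1 s.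
Proof. by move=> s0; rewrite bfun1E// mulr_gt0 ?expR_gt0// invr_gt0 exprn_gt0. Qed.

Lemma bfun1_ge0 (s : R) : 0 <= bfun 1 s.
Proof. by have [s0|s0] := leP s 0; [rewrite bfun_le0|rewrite ltW ?bfun1_gt0]. Qed.

Lemma bfun_bound k : exists2 C : R, 0 <= C & forall s, s <= 1 -> `|bfun k s| <= C.
Proof.
have [C C0 HC] := @bump_p_bound R (bpoly k); exists C => // s s1.
have [s0|s0] := leP s 0; first by rewrite bfun_le0// normr0.
by apply: le_trans (HC s s0 s1) _; rewrite ler_piMr.
Qed.

Lemma bfun_comp {n : nat} U (q : 'rV[R]_n -> R) k : open U -> smooth U q ->
 smooth U (fun x => bfun k (q x)).
Proof.
move=> oU Hq m.
apply: (@Ck_comp1 _ _ m U q (fun a : nat => bfun (a + k)) oU _ _ (Hq m)) => [a s _|].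
 exact: isd_bfunk.
exact: bfun_cont.
Qed.

End bumps.

(** * Test functions, integration by parts and the du Bois-Reymond lemma *)

Section smooth_closure.
Context {R : realType} {n : nat}.
Local Notation V := 'rV[R]_n.
Implicit Types (f g phi psi : V -> R) (U : set V).

Lemma smoothM U f g : open U -> smooth U f -> smooth U g -> smooth U (fun x => f x * g x).
Proof. by move=> oU Hf Hg k; exact: CkM. Qed.
Lemma smoothD U f g : open U -> smooth U f -> smooth U g -> smooth U (fun x => f x + g x).
Proof. by move=> oU Hf Hg k; exact: CkD. Qed.
Lemma smoothB U f g : open U -> smooth U f -> smooth U g -> smooth U (fun x => f x - g x).
Proof. by move=> oU Hf Hg k; exact: CkB. Qed.
Lemma smoothZ U c f : open U -> smooth U f -> smooth U (fun x => c * f x).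
Proof. by move=> oU Hf k; apply: CkZ => //; exact: Hf. Qed.
Lemma smooth_cst U (c : R) : smooth U (fun=> c).
Proof. by move=> k; exact: Ck_cst. Qed.
Lemma smooth_coord U i : smooth U (fun x : V => x 0 i).
Proof. by move=> k; exact: Ck_coord. Qed.
Lemma smooth_sum U (I : Type) (s : seq I) (F : I -> V -> R) : open U ->
 (forall i, smooth U (F i)) -> smooth U (fun x => \sum_(i <- s) F i x).
Proof. by move=> oU H k; apply: Ck_sum => // a _; exact: H. Qed.
Lemma smooth_prod U (I : Type) (s : seq I) (F : I -> V -> R) : open U ->
 (forall i, smooth U (F i)) -> smooth U (fun x => \prod_(i <- s) F i x).
Proof.
move=> oU H; elim: s => [|a s IH].
 by under eq_fun do rewrite big_nil; exact: smooth_cst.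
by under eq_fun do rewrite big_cons; apply: smoothM.
Qed.

Lemma testD U phi psi : tfun U phi -> tfun U psi ->
 tfun U (fun x => phi x + psi x).
Proof.
move=> [s1 [K1 [c1 U1 H1]]] [s2 [K2 [c2 U2 H2]]]; split; first exact: (smoothD openT_rV).
exists (K1 `|` K2); split; first exact: compactU.
 by move=> x [/U1|/U2].
by move=> x /not_orP[n1 n2]; rewrite H1// H2// addr0.
Qed.

Lemma testZ U c phi : tfun U phi -> tfun U (fun x => c * phi x).
Proof.
move=> [s1 [K1 [c1 U1 H1]]]; split; first exact: (smoothZ c openT_rV).
by exists K1; split => // x nK; rewrite H1// mulr0.
Qed.

Lemma test0 U : tfun U (fun=> 0 : R).
Proof.
split; first exact: smooth_cst.
by exists set0; split => //; exact: compact0.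
Qed.

Lemma pd_out (K : set V) phi i : compact K -> (forall x, ~ K x -> phi x = 0) ->
 forall x, ~ K x -> pd i phi x = 0.
Proof.
move=> cK H x nK; rewrite (_ : 0 = pd i (fun=> 0) x); last by rewrite pd_cst.
apply: pd_near.
have oK : open (~` K).
 apply: closed_openC; apply: compact_closed => //; exact: norm_hausdorff.
have : nbhs x (~` K) by exact: open_nb.
by apply: filterS => y; exact: H.
Qed.

Lemma test_pd U phi i : tfun U phi -> tfun U (pd i phi).
Proof.
move=> [s1 [K1 [c1 U1 H1]]]; split; first exact: smooth_pd.
by exists K1; split => //; exact: pd_out.
Qed.

Lemma test_sub U U' phi : U `<=` U' -> tfun U phi -> tfun U' phi.
Proof.
move=> UU' [s1 [K1 [c1 U1 H1]]]; split => //.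
by exists K1; split => //; exact: subset_trans UU'.
Qed.

Lemma compact_rV_bd (K : set V) : compact K -> exists2 c : R, 0 < c & forall x, K x -> `|x| <= c.
Proof.
move=> /compact_bounded[M [Mr HM]]; exists (`|M| + 1); first by rewrite ltr_wpDl.
by move=> x Kx; apply: HM => //; rewrite (le_ltT (ler_norm _))// ltrDl.
Qed.

Lemma test_bsupp U phi : tfun U phi -> exists c, bsupp c phi.
Proof.
move=> [s1 [K1 [c1 U1 H1]]]; have [c c0 Hc] := compact_rV_bd c1.
exists c => y cy; apply: H1 => /Hc; rewrite leNgt cy//.
Qed.

(** [f] is arbitrary outside [U]. Every point lies in [U] or in the open complement of [K], and on
    the latter the product vanishes identically. *)
Lemma Ck_mul_supp k U (K : set V) f phi : open U -> compact K -> K `<=` U ->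
 (forall x, ~ K x -> phi x = 0) -> Ck k setT phi -> Ck k U f ->
 Ck k setT (fun x => f x * phi x).
Proof.
move=> oU cK KU H Cphi Cf l lk x _.
have oK : open (~` K).
 apply: closed_openC; apply: compact_closed => //; exact: norm_hausdorff.
have [Ux|nUx] := pselect (U x).
 apply: (CkM oU Cf (Ck_sub _ Cphi)) => //.
have nK : ~ K x by move=> /KU.
apply: (@Ck_near _ _ k (~` K) (fun=> 0)) => //; last exact: Ck_cst.
move=> y nKy; have : nbhs y (~` K) by exact: open_nb.
by apply: filterS => z nKz; rewrite H// mulr0.
Qed.

Lemma testM_smooth U f phi : open U -> smooth U f -> tfun U phi ->
 tfun U (fun x => f x * phi x).
Proof.
move=> oU sf [s1 [K1 [c1 U1 H1]]]; split.
 by move=> k; apply: (Ck_mul_supp oU c1 U1 H1).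
by exists K1; split => // x nK; rewrite H1// mulr0.
Qed.

Local Notation mu := (lebesgue_rV R n).

Lemma test_integ U U' phi : measurable U' -> tfun U phi -> integ U' phi.
Proof.
move=> mU' tp; have [c sp] := test_bsupp tp.
have cp := smooth_cont tp.1; have [M M0 HM] := bsupp_bd cp sp.
apply: integrableS (integ_bsupp (cont_meas cp) HM sp) => //.
Qed.

Lemma test_L2 U U' phi : measurable U' -> tfun U phi -> L2 U' phi.
Proof.
move=> mU' tp; have [c sp] := test_bsupp tp.
have cp := smooth_cont tp.1; have [M M0 HM] := bsupp_bd cp sp.
have mp := cont_meas cp.
apply: integ_L2 => //; first exact: mfunTS.
apply: (@integrableS _ _ _ mu setT) => //.
apply: (@integ_bsupp _ _ _ (M ^+ 2) c); first exact: mfunX.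
 by move=> x; rewrite normrX lerXn2r// nnegrE.
by move=> y cy; rewrite sp// expr0n.
Qed.

Lemma int_supp U (K : set V) f : measurable U -> K `<=` U -> (forall x, ~ K x -> f x = 0) ->
 \int[mu]_(x in U) f x = \int[mu]_x f x.
Proof.
move=> mU KU H; rewrite Rintegral_mkcond; apply: eq_Rint => x _; rewrite patchE.
by case: ifPn => //; rewrite notin_setE => nU; rewrite H// => /KU.
Qed.

(** The product [f * phi] is of class [C^1] with compact support on the whole space, where the
    integral of a derivative vanishes. *)
Lemma int_by_parts U f phi i : open U -> Ck 1 U f -> tfun U phi ->
 \int[mu]_(x in U) (f x * pd i phi x) = - \int[mu]_(x in U) (pd i f x * phi x).
Proof.
move=> oU C1 tp; move: (tp) => [sp [K [cK KU HK]]].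
have mU := open_meas oU.
have Cfp : Ck 1 setT (fun x => f x * phi x) by exact: (Ck_mul_supp oU cK KU HK (sp 1%N) C1).
have [c c0 Hc] := compact_rV_bd cK.
have sfp : bsupp c (fun x => f x * phi x) by move=> y cy; rewrite HK ?mulr0// => /Hc; rewrite leNgt cy.
have E0 := int_pd_eq0 i Cfp sfp.
have dHK := pd_out i cK HK.
have E x : U x -> pd i (fun x => f x * phi x) x = pd i f x * phi x + f x * pd i phi x.
 by move=> Ux; rewrite pdM//; [exact: (Ck_pder C1)|exact: (Ck_pder (sp 1%N))].
have I1 (g : V -> R) (q : V -> R) : Ck 0 U g -> Ck 0 setT q -> (forall x, ~ K x -> q x = 0) ->
  integ U (fun x => g x * q x).
 move=> Cg Cq Hq.
 have Cgq := Ck_mul_supp oU cK KU Hq Cq Cg.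
 have sgq : bsupp c (fun x => g x * q x) by move=> y cy; rewrite Hq ?mulr0// => /Hc; rewrite leNgt cy.
 have cgq : continuous (fun x => g x * q x) by move=> x; exact: (Ck_cont Cgq).
 have [M M0 HM] := bsupp_bd cgq sgq.
 exact: integrableS (integ_bsupp (cont_meas cgq) HM sgq).
have Ia := I1 _ _ (Ck_pd i C1) (sp 0%N) HK.
have Ib := I1 _ _ (Ck_le (leq0n 1) C1) (@smooth_pd _ _ _ _ i sp 0%N) dHK.
apply/eqP; rewrite -addr_eq0 addrC -RintegralD// -E0; apply/eqP.
rewrite -(@int_supp U K)//.
 by apply: eq_Rint => x Ux; rewrite E.
by apply: pd_out => // x nK; rewrite HK// mulr0.
Qed.

Implicit Types (x : V).

Lemma smoothX U f k : open U -> smooth U f -> smooth U (fun x => f x ^+ k).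
Proof.
move=> oU sf; elim: k => [|k IH]; first exact: smooth_cst.
by under eq_fun do rewrite exprS; exact: smoothM.
Qed.

Definition cube_bump (c : V) (r : R) x := \prod_i bfun 0 (r ^+ 2 - (x 0 i - c 0 i) ^+ 2).

Lemma cube_compact_rV (c : V) (r : R) : compact (cube c r).
Proof.
have -> : cube c r = [set y + c | y in cube (0 : V) r].
 apply/seteqP; split => x /=.
  move=> H; exists (x - c); last by rewrite subrK.
  by move=> i; have := H i; rewrite !mxE subr0.
 by move=> [y Hy <-] i; rewrite !mxE addrK; have := Hy i; rewrite mxE subr0.
apply: continuous_compact; last exact: cube_compact.
by apply: continuous_subspaceT => x; apply: continuousD; [exact: cvg_id|exact: cst_continuous].
Qed.

Lemma cube_bump_test (c : V) (r : R) U : 0 < r -> cube c r `<=` U ->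
 tfun U (cube_bump c r).
Proof.
move=> r0 cU; split.
 apply: smooth_prod => [|i]; first exact: openT_rV.
 apply: bfun_comp; first exact: openT_rV.
 apply: smoothB; [exact: openT_rV|exact: smooth_cst|].
 apply: smoothX; first exact: openT_rV.
 by apply: smoothB; [exact: openT_rV|exact: smooth_coord|exact: smooth_cst].
exists (cube c r); split => //; first exact: cube_compact_rV.
move=> x /existsNP[i /negP]; rewrite -ltNge => Hi.
rewrite /cube_bump (bigD1 i)//= bfun_le0 ?mul0r// subr_le0.
by rewrite -[leRHS]real_normK ?num_real// lerXn2r ?nnegrE// ltW.
Qed.

Lemma cube_bump_gt0 (c : V) (r : R) x : `|x - c| < r -> 0 < cube_bump c r x.
Proof.
move=> H; apply: prodr_gt0 => i _; apply: bfun0_gt0; rewrite subr_gt0.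
rewrite -[ltLHS]real_normK ?num_real// ltrXn2r ?nnegrE// ?(le_trans _ (ltW H))//.
by apply: le_ltT H; have := le_normrV (x - c) i; rewrite !mxE.
Qed.

(** These sets generate the measurable sets, are stable under intersection, and have indicators that
    are limits of smooth functions. *)
Definition quadrant (a : V) : set V := [set x | forall i, a 0 i < x 0 i].

Lemma quadrant_open a : open (quadrant a).
Proof.
rewrite openE => x Hx; rewrite /interior.
apply/nbhs_rVP.
pose d : R := \big[Num.min/1]_i (x 0 i - a 0 i).
exists d; first by apply: lt_bigmin => // i _; rewrite subr_gt0; exact: Hx.
move=> y yd i; have := le_normrV (y - x) i; rewrite !mxE => /le_ltT /(_ yd) H.
have : d <= x 0 i - a 0 i by exact: bigmin_le_cond.
by move=> /(lt_leT H); rewrite ltr_distl => /andP[+ _]; rewrite opprB addrC subrK.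
Qed.

Lemma quadrant_meas :
 @measurable _ V = <<s range quadrant >>.
Proof.
apply/seteqP; split; last first.
 apply: smallest_sub; first exact: sigma_algebra_measurable.
 by move=> _ [a _ <-]; apply: open_meas; exact: quadrant_open.
apply: smallest_sub; first exact: smallest_sigma_algebra.
move=> _ [i [B mB ->]].
have H : mfun [set: g_sigma_algebraType (range quadrant)]
  (fun x : g_sigma_algebraType (range quadrant) => (x : V) 0 i : measurableTypeR R).
 apply: (measurability _ (RGenOInfty.measurableE R)).
 move=> _ [_ [t ->] <-]; rewrite setTI.
 rewrite [X in measurable X](_ : _ = \bigcup_k quadrant (\row_j (if j == i then t else - k%:R))).
  by apply: bigcup_measurable => k _; apply: sub_sigma_algebra; eexists.
 apply/seteqP; split => x /=.
  rewrite in_itv/= andbT => tx.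
  exists (Num.bound `|x|).+1 => // j; rewrite mxE; case: eqP => [->//|_].
  rewrite ltrNl; apply: le_ltT (ler_norm _) _; rewrite normrN.
  apply: le_ltT (le_normrV x j) _; apply: lt_trans (archi_boundP _) _ => //.
  by rewrite ltr_nat.
 by move=> [k _ /(_ i)]; rewrite mxE eqxx in_itv/= andbT.
by have := H measurableT B mB; rewrite setTI.
Qed.

Lemma quadrant_setI : setI_closed (range quadrant).
Proof.
move=> _ _ [a _ <-] [b _ <-]; exists (\row_i Num.max (a 0 i) (b 0 i)) => //.
apply/seteqP; split => x /=.
 by move=> H; split => i; have := H i; rewrite mxE gt_max => /andP[].
by move=> [H1 H2] i; rewrite mxE gt_max H1 H2.
Qed.

Definition qbump (a : V) x := \prod_i bfun 0 (x 0 i - a 0 i).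

Lemma bfun0_lt1 (s : R) : bfun 0 s < 1.
Proof.
have [s0|s0] := leP s 0; first by rewrite bfun_le0.
by rewrite /bfun /bump_p s0 /= hornerC mul1r expR_lt1 oppr_lt0 invr_gt0.
Qed.

Lemma qbumpP a x : 0 <= 1 - qbump a x <= 1.
Proof.
have H0 : 0 <= qbump a x by apply: prodr_ge0 => i _; exact: bfun0_ge0.
rewrite subr_ge0 gerBl H0 andbT.
by apply: prodr_ile1 => i _; rewrite bfun0_ge0 ltW ?bfun0_lt1.
Qed.

Lemma qbump_gt0 a x : quadrant a x -> 0 < qbump a x.
Proof. by move=> H; apply: prodr_gt0 => i _; rewrite bfun0_gt0 ?subr_gt0. Qed.

Lemma qbump_eq0 a x : ~ quadrant a x -> qbump a x = 0.
Proof.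
move=> /existsNP[i /negP]; rewrite -leNgt => H.
by rewrite /qbump (bigD1 i)//= bfun_le0 ?mul0r// subr_le0.
Qed.

Lemma qbump_smooth a : smooth setT (qbump a).
Proof.
apply: smooth_prod => [|i]; first exact: openT_rV.
apply: bfun_comp; first exact: openT_rV.
by apply: smoothB; [exact: openT_rV|exact: smooth_coord|exact: smooth_cst].
Qed.

(* [1 - (1 - q) ^+ k] increases to the indicator of the quadrant. *)
Lemma qbump_cvg a x :
 (1 - (1 - qbump a x) ^+ k) @[k --> \oo] --> (\1_(quadrant a) x : R).
Proof.
rewrite indicE; have [H|H] := boolP (x \in quadrant a).
 rewrite -[X in _ --> X](subr0 (1 : R)); apply: cvgB; first exact: cvg_cst.
 apply: cvg_expr; move: H; rewrite inE => /qbump_gt0 H.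
 by have /andP[h0 h1] := qbumpP a x; rewrite ger0_norm// ltrBlDr ltrDl.
rewrite qbump_eq0; last by move: H; rewrite notin_setE.
rewrite subr0 (_ : (fun k => _) = fun=> 0); first exact: cvg_cst.
by apply/funext => k; rewrite expr1n subrr.
Qed.

Lemma integ_mul_bd U f g M : measurable U -> integ U f -> mfun U g ->
 (forall x, U x -> `|g x| <= M) -> integ U (fun x => f x * g x).
Proof.
move=> mU fi mg Hg; apply: (@integ_le _ _ _ _ (fun x => M * `|f x|)) => //.
- by apply: mfunM => //; apply/EFin_meas; exact: measurable_int fi.
- by move=> x Ux; rewrite normrM mulrC ler_wpM2r// Hg.
- by apply: integZ => //; exact: integ_abs.
Qed.

Lemma integ_patch U f : measurable U -> integ U f <-> integ setT (f \_ U).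
Proof. by move=> mU; rewrite /integ -restrict_EFin; exact: integrable_mkcond. Qed.

Lemma integ_fun U f : integ U f -> mfun U f.
Proof. by move=> fi; apply/EFin_meas; exact: measurable_int fi. Qed.

Lemma Rint0_integral U f : measurable U -> integ U f -> \int[mu]_(x in U) f x = 0 ->
 (\int[mu]_(x in U) (f x)%:E = 0)%E.
Proof.
by move=> mU fi H; rewrite -[LHS]fineK ?integrable_fin_num//; congr (_%:E).
Qed.

Lemma int_quadrant_eq0 f a : integ setT f ->
 (forall k, \int[mu]_x (f x * (1 - (1 - qbump a x) ^+ k)) = 0) ->
 (\int[mu]_(x in quadrant a) (f x)%:E = 0)%E.
Proof.
move=> fi H.
have mq k : mfun setT (fun x : V => 1 - (1 - qbump a x) ^+ k).
 apply: cont_meas; apply: smooth_cont.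
 apply: smoothB; [exact: openT_rV|exact: smooth_cst|].
 apply: smoothX; [exact: openT_rV|].
 apply: smoothB; [exact: openT_rV|exact: smooth_cst|].
 exact: qbump_smooth.
have Hq k x : `|1 - (1 - qbump a x) ^+ k| <= 1.
 have /andP[h0 h1] := qbumpP a x.
 have p0 : 0 <= (1 - qbump a x) ^+ k by exact: exprn_ge0.
 have p1 : (1 - qbump a x) ^+ k <= 1 by exact: exprn_ile1.
 by rewrite ger0_norm ?subr_ge0// gerBl.
have mf := integ_fun fi.
have mQ : measurable (quadrant a) by apply: open_meas; exact: quadrant_open.
rewrite integral_mkcond.
pose F k x : \bar R := (f x * (1 - (1 - qbump a x) ^+ k))%:E.
have L : (\int[mu]_x F k x @[k --> \oo] --> \int[mu]_x ((EFin \o f) \_ (quadrant a)) x)%E.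
 apply: (@dominated_cvg _ _ _ _ _ _ _ _ (fun x => `|f x|%:E)) => //.
 - by move=> k; apply/EFin_meas; apply: mfunM.
 - move=> x _; rewrite restrict_EFin /F; apply: cvg_EFin; first by near=> k.
  have -> : (f \_ (quadrant a)) x = f x * \1_(quadrant a) x by rewrite patchE indicE; case: ifP => _; rewrite ?mulr1 ?mulr0.
  by apply: cvgM; [exact: cvg_cst|exact: qbump_cvg].
 - exact: integ_abs.
 - by move=> k x _; rewrite /F /= lee_fin normrM ler_piMr.
have E k : (\int[mu]_x F k x = 0)%E.
 apply: Rint0_integral => //.
 by apply: (@integ_mul_bd _ _ _ 1) => // x _; exact: Hq.
have := cvg_lim (@ereal_hausdorff R) L.
under eq_fun do rewrite E.
by rewrite lim_cst// => <-.
Unshelve. all: by end_near.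
Qed.

(** The sets over which [f] has integral 0 form a Dynkin system that contains the quadrants, hence
    all measurable sets. *)
Lemma int_meas_eq0 f : integ setT f ->
 (forall a k, \int[mu]_x (f x * (1 - (1 - qbump a x) ^+ k)) = 0) ->
 \int[mu]_x f x = 0 ->
 {ae mu, forall x, f x = 0}.
Proof.
move=> fi Hq H0.
have fiS (E : set V) : measurable E -> mu.-integrable E (EFin \o f) by move=> mE; apply: (@integrableS _ _ _ mu setT).
have H (E : set V) : measurable E -> (\int[mu]_(x in E) (f x)%:E = 0)%E.
 rewrite quadrant_meas.
 apply: (@dynkin_induction _ V (range quadrant) (fun E => (\int[mu]_(x in E) (f x)%:E = 0)%E)).
 - exact: quadrant_meas.
 - exact: quadrant_setI.
 - exact: Rint0_integral.
 - by move=> _ [a _ <-]; exact: int_quadrant_eq0.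
 - move=> S mS HS.
  have := @integral_setU _ _ _ mu S (~` S) (EFin \o f) mS (measurableC mS).
  rewrite setUv; move=> /(_ (measurable_int _ fi)).
  rewrite (Rint0_integral measurableT fi H0) => ->; last by rewrite disj_set2E setICr.
  by rewrite HS add0e.
 - move=> F mF tF HF; rewrite integral_bigcup//.
   by apply: eseries0 => i _ _; exact: HF.
  by apply: fiS; exact: bigcup_measurable.
have := @integral_ae_eq _ _ _ mu setT measurableT (cst 0%E) (EFin \o f) fi.
have -> : (forall E : set V, E `<=` setT -> measurable E ->
 (\int[mu]_(x in E) (EFin \o f) x)%E = (\int[mu]_(x in E) cst 0 x)%E) = True.
 by apply/propext; split => // _ E _ mE; rewrite integral0 H.
move=> /(_ (measurable_cst _) I); apply: filterS => x /(_ I) [].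
exact.
Qed.

(** For a test function [phi], the function [f * phi] is integrable on the whole space, and
    integrating it against the smooth approximations of quadrants is again testing [f]. So [f * phi]
    vanishes almost everywhere, and countably many cube bumps cover [U]. *)
Lemma du_bois_reymond U f : open U -> integ U f ->
 (forall phi, tfun U phi -> \int[mu]_(x in U) (f x * phi x) = 0) ->
 {ae mu, forall x, U x -> f x = 0}.
Proof.
move=> oU fi H; have mU := open_meas oU.
have K phi : tfun U phi -> {ae mu, forall x, U x -> f x * phi x = 0}.
 move=> tp; have [c sp] := test_bsupp tp.
 have cp := smooth_cont tp.1; have [M M0 HM] := bsupp_bd cp sp.
 have i1 : integ U (fun x => f x * phi x).
  apply: (@integ_mul_bd _ _ _ M) => //.
  by apply: mfunTS; exact: cont_meas.
 have : {ae mu, forall x, ((fun x => f x * phi x) \_ U) x = 0}.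
  apply: int_meas_eq0; [exact: (integ_patch _ mU).1| |].
   move=> a k; rewrite -(H (fun x => (1 - (1 - qbump a x) ^+ k) * phi x)).
    rewrite [RHS]Rintegral_mkcond; apply: eq_Rint => x _; rewrite !patchE.
    by case: ifP => _; rewrite ?mul0r// mulrAC mulrA.
   apply: testM_smooth => //.
   apply: smoothB => //; first exact: smooth_cst.
   apply: smoothX => //; apply: smoothB => //; first exact: smooth_cst.
   by move=> j; apply: (@Ck_sub _ _ j U setT) => //; exact: qbump_smooth.
  by rewrite -Rintegral_mkcond; exact: H.
 by apply: filterS => x + Ux; rewrite patchE mem_set.
have [c [r [c2U cover]]] := open_cube_cover oU.
have cU k : 0 < r k -> cube (c k) (r k) `<=` U by move=> r0 x Hx; apply: (c2U k r0) => i; apply: le_trans (Hx i) _; rewrite ler_pMl// ler1n.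
have : {ae mu, forall x, forall k, U x -> 0 < r k -> f x * cube_bump (c k) (r k) x = 0}.
 apply: ae_foralln => k; have [r0|r0] := ltP 0 (r k).
  have := K _ (cube_bump_test r0 (cU k r0)); by apply: filterS => x Hx Ux _; exact: Hx.
 by apply/aeW => x.
apply: filterS => x Hx Ux; have [k Hk] := cover x Ux.
have r0 : 0 < r k by exact: le_ltT Hk.
have /eqP := Hx k Ux r0; rewrite mulf_eq0 => /orP[/eqP //|].
by rewrite gt_eqF// cube_bump_gt0.
Qed.

End smooth_closure.

(** * Derivation rules in terms of [is_derive] *)

Section derive_rules.
Context {R : realType} {W : normedModType R}.
Implicit Types (f g : W -> R) (x v : W).

Lemma isdD f g x v (a b : R) : is_derive x v f a -> is_derive x v g b ->
 is_derive x v (fun y => f y + g y) (a + b).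
Proof. exact: is_deriveD. Qed.

Lemma isdN f x v (a : R) : is_derive x v f a -> is_derive x v (fun y => - f y) (- a).
Proof. exact: is_deriveN. Qed.

Lemma isdB f g x v (a b : R) : is_derive x v f a -> is_derive x v g b ->
 is_derive x v (fun y => f y - g y) (a - b).
Proof. by move=> fa gb; apply: isdD => //; exact: isdN. Qed.

Lemma isdM f g x v (a b : R) : is_derive x v f a -> is_derive x v g b ->
 is_derive x v (fun y => f y * g y) (a * g x + f x * b).
Proof.
move=> fa gb; have H := is_deriveM fa gb; apply: (@isd_eq _ _ _ _ _ _ _ _ H).
by rewrite addrC [g x *: a]mulrC.
Qed.

Lemma isd_cst x v (c : R) : is_derive x v (fun=> c) 0.
Proof. exact: is_derive_cst. Qed.

Lemma isdZ c f x v (a : R) : is_derive x v f a -> is_derive x v (fun y => c * f y) (c * a).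
Proof. exact: is_deriveZ. Qed.

Lemma isdX f x v (a : R) k : is_derive x v f a ->
 is_derive x v (fun y => f y ^+ k) (k%:R * f x ^+ k.-1 * a).
Proof.
move=> fa; have H := is_deriveX k fa.
rewrite (_ : (fun y => _) = f ^+ k)//.
by elim: {H} k => [|k IH]; apply/funext => y; rewrite ?expr0// !exprS -IH.
Qed.

Lemma isd_sum (I : Type) (s : seq I) (P : pred I) (F : I -> W -> R) (dF : I -> R) x v :
 (forall i, P i -> is_derive x v (F i) (dF i)) ->
 is_derive x v (fun y => \sum_(i <- s | P i) F i y) (\sum_(i <- s | P i) dF i).
Proof.
move=> H; elim: s => [|i s IH].
 by rewrite big_nil; under eq_fun do rewrite big_nil; exact: isd_cst.
rewrite big_cons; under eq_fun do rewrite big_cons.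
by case: ifPn => // Pi; apply: isdD => //; exact: H.
Qed.

End derive_rules.

(** * Mollifiers, mean values and Weyl's lemma *)

Section is_derive_rV.
Context {R : realType} {n : nat}.
Local Notation V := 'rV[R]_n.
Local Notation e_ i := (basis_vec R i).
Implicit Types (f : V -> R).

Lemma isd_pd f i x : pder f x -> is_derive x (e_ i) f (pd i f x).
Proof. by move=> H; exact: DeriveDef. Qed.

Lemma isd_coord i j (x : V) : is_derive x (e_ i) (fun y : V => y 0 j) (i == j)%:R.
Proof. by apply: DeriveDef; [exact: pder_coord|exact: pd_coord]. Qed.

Lemma pdE f i x (d : R) : is_derive x (e_ i) f d -> pd i f x = d.
Proof. by case. Qed.

Lemma isd_comp1 (W : normedModType R) (q : W -> R) (g : R -> R) (dg : R) x v (dq : R) :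
 is_derive (q x) (1 : R) g dg -> is_derive x v q dq ->
 is_derive x v (fun y => g (q y)) (dg * dq).
Proof.
move=> Hg [Hq <-].
exact: (is_derive_comp1 (dg := fun=> dg) Hg Hq).
Qed.

Local Notation mu := (lebesgue_rV R n).
Implicit Types (u phi : V -> R) (U : set V) (x y z : V) (a : R).

Definition lap f x := \sum_i pd i (pd i f) x.

Definition sqn x : R := \sum_i (x 0 i) ^+ 2.

Lemma sqn_ge0 x : 0 <= sqn x.
Proof. by apply: sumr_ge0 => i _; exact: sqr_ge0. Qed.

Lemma sqn_coord x i : (x 0 i) ^+ 2 <= sqn x.
Proof. by rewrite /sqn (bigD1 i)//= lerDl sumr_ge0// => j _; exact: sqr_ge0. Qed.

Lemma normrV_sqn x (c : R) : 0 <= c -> c < `|x| -> c ^+ 2 < sqn x.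
Proof.
move=> c0 cx; rewrite ltNge; apply: contraTN cx => H; rewrite -leNgt.
apply: normrV_le => // i; rewrite -(@ler_sqr _ `|x 0 i|) ?nnegrE// real_normK ?num_real//.
exact: le_trans (sqn_coord x i) H.
Qed.

Lemma sqn_le x : sqn x <= n%:R * `|x| ^+ 2.
Proof.
rewrite mulr_natl -[X in _ *+ X]card_ord -sumr_const; apply: ler_sum => i _.
by rewrite -[leLHS]real_normK ?num_real// lerXn2r ?nnegrE// le_normrV.
Qed.

Lemma sqnN x : sqn (- x) = sqn x.
Proof. by apply: eq_bigr => i _; rewrite mxE sqrrN. Qed.

Lemma sqnZ (c : R) x : sqn (c *: x) = c ^+ 2 * sqn x.
Proof. by rewrite /sqn mulr_sumr; apply: eq_bigr => i _; rewrite mxE exprMn. Qed.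

Lemma sqn_smooth U : open U -> smooth U sqn.
Proof. by move=> oU; apply: smooth_sum => // i; apply: smoothX => //; exact: smooth_coord. Qed.

Definition chi_raw y : R := bfun 1 (1 - sqn y).

Definition kappa : R := (\int[mu]_y chi_raw y)^-1.

(* The radial mollifier of radius [1 / a]. *)
Definition chi a y : R := kappa * (a ^+ n * bfun 1 (1 - a ^+ 2 * sqn y)).

Definition psi0 a y : R := bfun 0 (1 - a ^+ 2 * sqn y).

Definition dchi a y : R :=
 kappa * (n%:R * a ^+ n.-1 * bfun 1 (1 - a ^+ 2 * sqn y)
      - 2 * a ^+ n.+1 * sqn y * bfun 2 (1 - a ^+ 2 * sqn y)).

Lemma bfun_sqn_smooth k a U : open U -> smooth U (fun y => bfun k (1 - a ^+ 2 * sqn y)).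
Proof.
move=> oU; apply: bfun_comp => //; apply: smoothB => //; first exact: smooth_cst.
by apply: smoothZ => //; exact: sqn_smooth.
Qed.

Lemma chi_smooth a : smooth setT (chi a).
Proof.
have oT := @openT_rV R n; apply: smoothZ => //; apply: smoothZ => //.
exact: bfun_sqn_smooth.
Qed.

Lemma bfun_sqn_supp k a y : 0 < a -> a^-1 < `|y| -> bfun k (1 - a ^+ 2 * sqn y) = 0.
Proof.
move=> a0 ay; apply: bfun_le0; rewrite subr_le0.
have := normrV_sqn _ ay; rewrite invr_ge0 ltW// => /(_ isT) /ltW.
by rewrite exprVn -ler_pdivrMl ?exprn_gt0// mulr1.
Qed.

Lemma chi_bsupp a : 0 < a -> bsupp a^-1 (chi a).
Proof. by move=> a0 y ay; rewrite /chi bfun_sqn_supp// !mulr0. Qed.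

Lemma dchi_smooth a : smooth setT (dchi a).
Proof.
have oT := @openT_rV R n; apply: smoothZ => //; apply: smoothB => //.
 by apply: smoothZ => //; exact: bfun_sqn_smooth.
apply: smoothM => //; last exact: bfun_sqn_smooth.
by apply: smoothZ => //; exact: sqn_smooth.
Qed.

Lemma dchi_bsupp a : 0 < a -> bsupp a^-1 (dchi a).
Proof. by move=> a0 y ay; rewrite /dchi !bfun_sqn_supp// !mulr0 subr0 mulr0. Qed.

Lemma isd_chi a y : is_derive a (1 : R) (chi^~ y) (dchi a y).
Proof.
have Hq : is_derive a (1 : R) (fun b : R => 1 - b ^+ 2 * sqn y) (- (2 * a * sqn y)).
 have id1 := @is_derive_id R R a 1.
 have := isdB (isd_cst a 1 1) (isdM (isdX 2 id1) (isd_cst a 1 (sqn y))).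
 by move/isd_eq; apply; rewrite mulr0 addr0 sub0r mulr1.
have id1 := @is_derive_id R R a 1.
have := isdZ kappa (isdM (isdX n id1) (isd_comp1 (isd_bfunk 1 _) Hq)).
move/isd_eq; apply; rewrite /dchi; congr (_ * _); rewrite mulr1; congr (_ + _).
rewrite mulrN mulrN; congr (- _); rewrite [a ^+ n.+1]exprS; move: (bfun 2 _) => b; ring.
Qed.

(** Since [bfun 1] is the derivative of [bfun 0], the change of the mollifier with its scale is a
    multiple of the Laplacian of a function supported in the same ball. This is the mean value
    property in a form that applies to weak solutions. *)
Lemma lap_psi0 a x z : 0 < a ->
 dchi a (x - z) = - (kappa * a ^+ n / (2 * a ^+ 3)) * lap (fun z => psi0 a (x - z)) z.
Proof.
move=> a0.
have Hc i z' j : is_derive z' (e_ i) (fun z : V => (x - z) 0 j) (- (i == j)%:R).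
 rewrite (_ : (fun z => _) = fun z : V => x 0 j - z 0 j).
  have := isdB (isd_cst z' (e_ i) (x 0 j)) (isd_coord i j z'). by rewrite sub0r.
 by apply/funext => w; rewrite !mxE.
have Hs i z' : is_derive z' (e_ i) (fun z : V => sqn (x - z)) (- (2 * (x - z') 0 i)).
 have := isd_sum (index_enum 'I_n) (P := xpredT) (fun j _ => isdX 2 (Hc i z' j)).
 move/isd_eq; apply; rewrite (bigD1 i)//= big1 ?addr0 ?eqxx; last first.
  by move=> j ji; rewrite eq_sym (negbTE ji) oppr0 mulr0.
 by rewrite mulrN mulr1 expr1.
have Hq i z' : is_derive z' (e_ i) (fun z : V => 1 - a ^+ 2 * sqn (x - z)) (2 * a ^+ 2 * (x - z') 0 i).
 have := isdB (isd_cst z' (e_ i) 1) (isdZ (a ^+ 2) (Hs i z')).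
 by move/isd_eq; apply; rewrite sub0r mulrN opprK; ring.
have E1 i : pd i (fun z => psi0 a (x - z)) = fun z => bfun 1 (1 - a ^+ 2 * sqn (x - z)) * (2 * a ^+ 2 * (x - z) 0 i).
 by apply/funext => z'; apply: pdE; exact: (isd_comp1 (isd_bfunk 0 _) (Hq i z')).
have E2 i : pd i (pd i (fun z => psi0 a (x - z))) z =
  4 * a ^+ 4 * bfun 2 (1 - a ^+ 2 * sqn (x - z)) * (x - z) 0 i ^+ 2
  - 2 * a ^+ 2 * bfun 1 (1 - a ^+ 2 * sqn (x - z)).
 rewrite E1; apply: pdE.
 have := isdM (isd_comp1 (isd_bfunk 1 _) (Hq i z)) (isdZ (2 * a ^+ 2) (Hc i z i)).
 by move/isd_eq; apply; rewrite eqxx /=; move: (bfun 1 _) (bfun 2 _) ((x - z) 0 i) => b1 b2 w; ring.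
rewrite /lap (eq_bigr _ (fun i _ => E2 i)) big_split/= -mulr_sumr -/(sqn _).
rewrite sumr_const card_ord -[_ *+ n]mulr_natr /dchi.
move: (bfun 1 _) (bfun 2 _) => b1 b2; move: (sqn _) kappa => s kap.
case: (n) => [|m].
 rewrite !mul0r !mulr0 expr0 expr1 addr0 sub0r; field.
 by rewrite gt_eqF.
rewrite /= ![a ^+ m.+1]exprS ![a ^+ m.+2]exprS ![a ^+ m.+1]exprS; field.
by rewrite gt_eqF.
Qed.

Definition wharm U u := forall phi, tfun U phi ->
 \int[mu]_(z in U) (u z * lap phi z) = 0.

Lemma Rint_cst0 U : \int[mu]_(x in U) (0 : R) = 0.
Proof. by rewrite /Rintegral integral0. Qed.

Lemma lap_out (K : set V) phi : compact K -> (forall x, ~ K x -> phi x = 0) ->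
 forall x, ~ K x -> lap phi x = 0.
Proof.
move=> cK H x nK; apply: big1 => i _.
exact: (pd_out i cK (pd_out i cK H)).
Qed.

Lemma wharm_integralT U u phi : open U -> wharm U u -> tfun U phi ->
 \int[mu]_z (u z * lap phi z) = 0.
Proof.
move=> oU uh tp; rewrite -(uh phi tp); have [sp [K [cK KU HK]]] := tp.
rewrite (@int_supp _ _ U K)//; first exact: open_meas.
by move=> x nK; rewrite (lap_out cK HK nK) mulr0.
Qed.

Lemma psi0_test U a x : 0 < a -> cube x a^-1 `<=` U -> tfun U (fun z => psi0 a (x - z)).
Proof.
move=> a0 cU; have oT := @openT_rV R n; split.
 apply: bfun_comp => //; apply: smoothB => //; first exact: smooth_cst.
 apply: smoothZ => //; apply: smooth_sum => // i; apply: smoothX => //.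
 rewrite (_ : (fun z => _) = fun z : V => x 0 i - z 0 i); last first.
  by apply/funext => z; rewrite !mxE.
 by apply: smoothB => //; [exact: smooth_cst|exact: smooth_coord].
exists (cube x a^-1); split => //; first exact: cube_compact_rV.
move=> z /existsNP[i /negP]; rewrite -ltNge => Hi; apply: bfun_sqn_supp => //.
apply: lt_leT Hi _; have := le_normrV (x - z) i.
by rewrite !mxE distrC.
Qed.

Lemma chi_neg a y : chi a (- y) = chi a y.
Proof. by rewrite /chi sqnN. Qed.

Lemma dchi_bound a : 0 < a -> exists2 C, 0 <= C &
 forall b y, a / 2 < b < 2 * a -> `|dchi b y| <= C.
Proof.
move=> a0; have [C1 C10 H1] := @bfun_bound R 1; have [C2 C20 H2] := @bfun_bound R 2.
exists (`|kappa| * (n%:R * (2 * a) ^+ n.-1 * C1 + 2 * ((2 * a) ^+ n * (2 / a)) * C2)).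
 have a20 : 0 <= 2 * a by rewrite mulr_ge0// ltW.
 have aV0 : 0 <= 2 / a by rewrite divr_ge0// ltW.
 by rewrite mulr_ge0// addr_ge0// !mulr_ge0// ?exprn_ge0// ?invr_ge0 ltW.
move=> b y /andP[ab ba]; have b0 : 0 < b by apply: lt_trans ab; rewrite divr_gt0.
have q1 : 1 - b ^+ 2 * sqn y <= 1 by rewrite gerBl mulr_ge0 ?sqr_ge0 ?sqn_ge0.
rewrite /dchi normrM ler_wpM2l//; apply: le_trans (ler_normB _ _) _; apply: lerD.
 rewrite normrM ler_pM// ?H1// ger0_norm; last by rewrite mulr_ge0// exprn_ge0 ?ltW.
 by rewrite ler_wpM2l// lerXn2r// ?nnegrE ltW// mulr_gt0.
(* Outside the support the term vanishes; inside, [b ^ 2 * sqn y < 1] bounds the otherwise unbounded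
   factor [sqn y]. *)
have [q0|q0] := leP (1 - b ^+ 2 * sqn y) 0.
 rewrite [bfun 2 _]bfun_le0// mulr0 normr0.
 by rewrite !mulr_ge0// ?exprn_ge0// ?invr_ge0 ltW// mulr_gt0.
rewrite normrM ler_pM// ?H2// ger0_norm; last by rewrite !mulr_ge0 ?sqn_ge0// exprn_ge0 ?ltW.
have s0 := sqn_ge0 y.
rewrite -mulrA ler_wpM2l// exprSr -mulrA; apply: ler_pM.
- by rewrite exprn_ge0// ltW.
- by rewrite mulr_ge0// ltW.
- by apply: lerXn2r; rewrite ?nnegrE ltW// mulr_gt0.
have h1 : b * (b * sqn y) < 1 by move: q0; rewrite subr_gt0 expr2 mulrA.
rewrite ltW// -(ltr_pM2l b0); apply: lt_leT h1 _.
move: ab; rewrite ltr_pdivrMr// => /ltW ab.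
by rewrite mulrA ler_pdivlMr// mul1r.
Qed.

Lemma smooth_bd phi (c : R) : smooth setT phi -> bsupp c phi ->
 exists2 M, 0 <= M & forall x, `|phi x| <= M.
Proof. by move=> /smooth_cont; exact: bsupp_bd. Qed.

Lemma smooth_meas phi : smooth setT phi -> mfun setT phi.
Proof. by move=> /smooth_cont; exact: cont_meas. Qed.

Lemma isd_conv_chi u a x : integ setT u -> 0 < a ->
 is_derive a (1 : R) (fun b => conv u (chi b) x) (\int[mu]_z (u z * dchi a (x - z))).
Proof.
move=> ui a0; have [C C0 HC] := dchi_bound a0.
pose f (b : R) z := u z * chi b (x - z).
have Ia : `](a / 2)%R, (2 * a)%R[%classic a.
 rewrite /= in_itv/= ltr_pdivrMr// ltr_pMr// ltr_pMl// !ltr1n//.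
have fb (b : R) : `](a / 2)%R, (2 * a)%R[%classic b -> mu.-integrable setT (EFin \o f b).
 rewrite /= in_itv/= => /andP[ab _].
 have b0 : 0 < b by apply: lt_trans ab; rewrite divr_gt0.
 have [M M0 HM] := smooth_bd (chi_smooth b) (chi_bsupp b0).
 exact: (integ_convE x ui (smooth_meas (chi_smooth b)) HM).
have df (b : R) z : is_derive b (1 : R) (f^~ z) (u z * dchi b (x - z)) by apply: isdZ; exact: isd_chi.
have d1 b z : partial1of2 f b z = u z * dchi b (x - z) by rewrite partial1of2E; have [] := df b z.
have G1 z : 0 <= C * `|u z| by rewrite mulr_ge0.
have G2 : mu.-integrable setT (EFin \o (fun z => C * `|u z|)) by apply: integZ => //; exact: integ_abs.
have G3 (b : R) z : `](a / 2)%R, (2 * a)%R[%classic b -> setT z -> `|partial1of2 f b z| <= C * `|u z|.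
 by rewrite /= in_itv/= => Hb _; rewrite d1 normrM mulrC ler_wpM2r// HC.
have df' (b : R) z : `](a / 2)%R, (2 * a)%R[%classic b -> setT z -> derivable (f^~ z) b 1 by move=> _ _; have [] := df b z.
apply: DeriveDef.
 exact: (derivable_under_integral measurableT Ia fb df' G1 G2 G3).
rewrite -derive1E.
rewrite (differentiation_under_integral measurableT Ia fb df' G1 G2 G3).
by apply: eq_Rint => z _; rewrite d1.
Qed.

(** The derivative in the scale is the integral of [u] against the Laplacian of a test function in
    [U], which is 0. *)
Lemma conv_chi_const U u a0 a1 x : open U -> integ setT u -> wharm U u -> 0 < a0 -> a0 <= a1 ->
 cube x a0^-1 `<=` U -> conv u (chi a1) x = conv u (chi a0) x.
Proof.
move=> oU ui uh a00 a01 cU.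
have H (b : R) : a0 <= b -> is_derive b (1 : R) (fun b => conv u (chi b) x) 0.
 move=> ab; have b0 := lt_leT a00 ab.
 apply: isd_eq; first exact: isd_conv_chi.
 have cb : cube x b^-1 `<=` U by move=> z Hz; apply: cU => i; apply: le_trans (Hz i) _; rewrite lef_pV2.
 have E z : u z * dchi b (x - z) = - (kappa * b ^+ n / (2 * b ^+ 3)) * (u z * lap (fun z => psi0 b (x - z)) z).
  by rewrite lap_psi0// mulrCA.
 have tb := psi0_test b0 cb.
 have [M M0 HM] := smooth_bd (dchi_smooth b) (dchi_bsupp b0).
 rewrite (eq_Rint (fun z _ => E z)).
 have [->|/eqP k0] := eqVneq (- (kappa * b ^+ n / (2 * b ^+ 3))) 0.
  by rewrite (eq_Rint (v := fun=> 0)) ?Rint_cst0// => z _; rewrite mul0r.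
 rewrite RintegralZl//; last first.
  have := integ_convE x ui (smooth_meas (dchi_smooth b)) HM.
  under eq_fun do rewrite E.
  move=> /(integZ (- (kappa * b ^+ n / (2 * b ^+ 3)))^-1 measurableT).
  by apply: eq_integ => // z _; rewrite mulKf//; exact/eqP.
 by rewrite (wharm_integralT oU uh tb) mulr0.
have cts : {within `[a0, a1], continuous (fun b => conv u (chi b) x)}.
 apply: derivable_within_continuous => b; rewrite in_itv/= => /andP[ab _].
 by have [] := H b ab.
have Hd (b : R) : b \in `]a0, a1[%R -> is_derive b 1 (fun b => conv u (chi b) x) ((fun=> 0) b).
 by rewrite in_itv/= => /andP[ab _]; apply: H; exact: ltW.
have [c _ /eqP] := MVT_segment a01 Hd cts.
by rewrite mul0r subr_eq0 => /eqP.
Qed.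

Lemma cube0P (c : R) y : `|y| <= c -> cube (0 : V) c y.
Proof. by move=> yc i; rewrite mxE subr0; apply: le_trans yc; exact: le_normrV. Qed.

Lemma Rint_indic U : measurable U -> \int[mu]_x (\1_U x : R) = fine (mu U).
Proof. by move=> mU; rewrite /Rintegral integral_indic// setIT. Qed.

Lemma chi_raw_int_gt0 : 0 < \int[mu]_y chi_raw y.
Proof.
have n0 : 0 < (2 * (n%:R + 1))^-1 :> R by rewrite invr_gt0 mulr_gt0// ltr_wpDl.
(* With this radius [sqn y <= n * r <= 1 / 2] on the cube, so that [chi_raw] is at least [exp (- 2)]
   there. *)
pose r : R := (2 * (n%:R + 1))^-1.
have r1 : r <= 1 by rewrite /r invf_le1 ?mulr_gt0 ?ltr_wpDl//; have := ler0n R n; move: (n%:R) => m; lra.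
have Ec : 0 < expR (- 2) :> R by exact: expR_gt0.
have lb y : expR (- 2) * \1_(cube 0 r) y <= chi_raw y.
 rewrite indicE; case: (boolP (y \in _)) => [|_]; last by rewrite mulr0; exact: bfun1_ge0.
 rewrite inE mulr1 => Hy; have yr : `|y| <= r.
  by apply: normrV_le => [|i]; [exact: ltW|have := Hy i; rewrite mxE subr0].
 have q1 : 1 / 2 <= 1 - sqn y.
  rewrite lerBrDr -lerBrDl; apply: le_trans (sqn_le y) _.
  apply: (@le_trans _ _ (n%:R * r)).
   rewrite ler_wpM2l// expr2; apply: le_trans (ler_wpM2l _ yr) _ => //.
   by rewrite ler_piMl// ?(le_trans yr)// ltW.
  rewrite /r; have := ler0n R n; move: (n%:R) => m m0.
  rewrite -[1 - _]/(1 - 1 / 2) ler_pdivrMr ?mulr_gt0 ?ltr_wpDl//; lra.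
 have q0 : 0 < 1 - sqn y by apply: lt_leT q1; rewrite divr_gt0.
 rewrite /chi_raw bfun1E//; have s0 := sqn_ge0 y.
 have w1 : 1 <= (1 - sqn y)^-1 by rewrite invf_ge1// gerBl.
 have w2 : (1 - sqn y)^-1 <= 2 by rewrite -[2]invrK lef_pV2 ?posrE// -div1r.
 rewrite -[leLHS]mul1r; apply: ler_pM; rewrite ?expR_ge0//.
  by rewrite -exprVn exprn_ege1.
 by rewrite ler_expR lerN2.
apply: lt_leT (_ : 0 < expR (- 2) * fine (mu (cube 0 r))) _.
 rewrite mulr_gt0// leb_cube ?ltW//= exprn_gt0// pmulrn_rgt0//.
have mc := @cube_meas R n 0 r.
rewrite -Rint_indic// -RintegralZl//; last exact: integ_indic (cube_fin _ _).
apply: le_Rintegral => //; first by apply: integZ => //; exact: integ_indic (cube_fin _ _).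
have oT := @openT_rV R n.
have scr : smooth setT chi_raw.
 apply: bfun_comp => //; apply: smoothB => //; first exact: smooth_cst.
 exact: sqn_smooth.
have bcr : bsupp 1 chi_raw.
 move=> y y1; apply: bfun_le0; rewrite subr_le0; apply: ltW.
 by have := normrV_sqn ler01 y1; rewrite expr1n.
have [M M0 HM] := smooth_bd scr bcr.
exact: integ_bsupp (smooth_meas scr) HM bcr.
Qed.

Lemma chi_integ a : 0 < a -> integ setT (chi a).
Proof.
move=> a0; have [M M0 HM] := smooth_bd (chi_smooth a) (chi_bsupp a0).
exact: integ_bsupp (smooth_meas (chi_smooth a)) HM (chi_bsupp a0).
Qed.

Lemma chi_int1 a : 0 < a -> \int[mu]_y chi a y = 1.
Proof.
have chi1 : \int[mu]_y chi 1 y = 1.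
 have E y : chi 1 y = kappa * chi_raw y by rewrite /chi /chi_raw !expr1n !mul1r.
 rewrite (eq_Rint (fun y _ => E y)) RintegralZl//.
  by rewrite /kappa mulVf// gt_eqF// chi_raw_int_gt0.
 have := chi_integ ltr01; move=> /(integZ kappa^-1 measurableT).
 apply: eq_integ => // y _; rewrite E mulKf// invr_eq0 gt_eqF//.
 exact: chi_raw_int_gt0.
(* In place of a change of variables: the indicator of the cube of radius [c] is weakly harmonic in
   the open cube, and its mollification at 0 is the integral of [chi], which therefore does not
   depend on the scale. *)
have H a0 a1 : 0 < a0 -> a0 <= a1 -> \int[mu]_y chi a1 y = \int[mu]_y chi a0 y.
 move=> a00 a01; pose c := a0^-1 + 1; have c0 : 0 < c by rewrite addr_gt0// invr_gt0.
 pose U : set V := [set z | `|z - 0| < c].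
 have oU : open U.
  rewrite openE => z Uz; apply/nbhs_rVP; exists (c - `|z - 0|); first by rewrite subr_gt0.
  move=> y; rewrite ltrBrDr; apply: le_ltT.
  by apply: le_trans (ler_normD _ _); rewrite addrA subrK.
 have iu : integ setT (\1_(cube 0 c) : V -> R) by apply: integ_indic; [exact: cube_meas|exact: cube_fin].
 have wh : wharm U (\1_(cube 0 c) : V -> R).
  move=> phi tp; have [sp [K [cK KU HK]]] := tp.
  have [d sd] := test_bsupp tp.
  rewrite (@eq_Rint _ _ _ _ (fun z => \sum_i 1 * pd i (pd i phi) z)); last first.
   move=> z Uz; rewrite indicE mem_set ?mul1r.
    by apply: eq_bigr => i _; rewrite mul1r.
   by apply: cube0P; move: Uz; rewrite /U /= subr0 => /ltW.
  rewrite (@int_supp _ _ U K) //; [|exact: open_meas|]; last first.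
   move=> z nK; apply: big1 => i _.
   by rewrite (pd_out i cK (pd_out i cK HK) nK) mulr0.
  rewrite Rint_sum//; last first.
   by move=> i _; apply: integZ => //; apply: (@test_integ _ _ U) => //; do 2 apply: test_pd.
  apply: big1 => i _; rewrite (eq_Rint (v := pd i (pd i phi))) => [|z _]; last by rewrite mul1r.
  by apply: (@int_pd_eq0 _ _ _ d); [apply: (@smooth_pd _ _ _ _ i sp 1%N)|exact: pd_bsupp].
 have cU : cube 0 a0^-1 `<=` U.
  move=> z Hz; rewrite /U /= subr0; apply: (@le_ltT _ _ a0^-1); last by rewrite ltrDl.
  by apply: normrV_le => [|i]; [rewrite invr_ge0 ltW|have := Hz i; rewrite mxE subr0].
 have E b : a0 <= b -> conv (\1_(cube 0 c)) (chi b) 0 = \int[mu]_y chi b y.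
  move=> ab; apply: eq_Rint => z _; rewrite sub0r chi_neg indicE.
  have [|/negP zc] := boolP (z \in _); first by rewrite mul1r.
  rewrite mul0r chi_bsupp//; first exact: lt_leT ab.
  rewrite ltNge; apply/negP => zb; apply: zc; rewrite inE; apply: cube0P.
  apply: le_trans zb _; rewrite -[leLHS]addr0 lerD//.
  by rewrite lef_pV2// posrE (lt_leT a00).
 by rewrite -(E a1 a01) -(E a0 (lexx _)); exact: (conv_chi_const oU iu wh a00 a01 cU).
move=> a0; have [a1|/ltW a1] := leP a 1; first by rewrite -(H a 1).
by rewrite (H 1 a).
Qed.

Lemma kappa_gt0 : 0 < kappa.
Proof. by rewrite invr_gt0 chi_raw_int_gt0. Qed.

Lemma chi_ge0 a y : 0 < a -> 0 <= chi a y.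
Proof.
by move=> a0; apply: mulr_ge0; [exact: ltW kappa_gt0|apply: mulr_ge0; [exact/exprn_ge0/ltW|exact: bfun1_ge0]].
Qed.

Lemma int_reflect_shift phi z : mfun setT phi -> (forall y, phi (- y) = phi y) ->
 \int[mu]_x phi (z - x) = \int[mu]_x phi x.
Proof.
move=> mp ev; rewrite -(Rint_shift (- z) mp).
by apply: eq_Rint => x _; rewrite -ev opprB.
Qed.

Lemma chi_scale a y : chi a y = a ^+ n * chi 1 (a *: y).
Proof. by rewrite /chi !expr1n !mul1r sqnZ; ring. Qed.

Lemma partial_scale f a l : smooth setT f ->
 partial l (fun y => f (a *: y)) = fun y => a ^+ size l * partial l f (a *: y).
Proof.
move=> sf; elim: l => [|i l IH]; first by apply/funext => y; rewrite mul1r.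
apply/funext => y; rewrite /= -/(pd i _ _) -/(pd i _ _) IH.
apply: pdE; have dl := @smooth_part _ _ _ _ l sf.
have := @isd_pd (partial l f) i (a *: y) (@Ck_pder _ _ _ _ _ (dl 1%N) _ I).
set d := pd i _ _ => Hd.
rewrite exprSr -mulrA; apply: isdZ.
have C1 : C1at (partial l f) (a *: y).
 exact: (@Ck_C1at _ _ 0 setT _ _ openT_rV (dl 1%N) I).
have Hc k j z : is_derive z (e_ k) (fun w : V => (a *: w) 0 j) (a * (k == j)%:R).
 rewrite (_ : (fun w => _) = fun w : V => a * w 0 j).
  by apply: isdZ; exact: isd_coord.
 by apply/funext => w; rewrite mxE.
have dG j : pder (fun w : V => (a *: w) 0 j) y by move=> k; have [] := Hc k j y.
have [D E] := pd_comp (G := fun w : V => a *: w) i C1 dG.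
apply: DeriveDef => //; rewrite -/(pd i _ _) E (bigD1 i)//= big1 => [|j ji].
 by rewrite addr0 (pdE (Hc i i y)) eqxx mulr1 mulrC.
by rewrite (pdE (Hc i j y)) eq_sym (negbTE ji) !mulr0.
Qed.

Lemma partialZ f (c : R) l : smooth setT f -> partial l (fun y => c * f y) = fun y => c * partial l f y.
Proof.
move=> sf; elim: l => [//|i l IH]; apply/funext => y /=; rewrite -/(pd i _ _) IH.
by apply: pdZ; apply: (@Ck_pder _ _ _ _ _ (@smooth_part _ _ _ _ l sf 1%N)).
Qed.

(** By homogeneity: [chi a] is [a ^ n] times a dilation of [chi 1], and each derivative produces one
    more factor [a]. *)
Lemma chi_partial_bound l : exists2 M, 0 <= M & forall a y, 0 < a ->
 `|partial l (chi a) y| <= M * a ^+ (n + size l).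
Proof.
have [M M0 HM] := smooth_bd (smooth_part l (chi_smooth 1)) (partial_bsupp l (chi_bsupp ltr01)).
exists M => // a y a0.
have -> : chi a = fun y => a ^+ n * chi 1 (a *: y) by apply/funext => z; exact: chi_scale.
have ss : smooth setT (fun y => chi 1 (a *: y)).
 have -> : (fun y => chi 1 (a *: y)) = fun y => (a ^+ n)^-1 * chi a y.
  by apply/funext => z; rewrite [chi a z]chi_scale mulKf// expf_neq0// gt_eqF.
 by apply: smoothZ; [exact: openT_rV|exact: chi_smooth].
rewrite partialZ// partial_scale; last exact: chi_smooth.
have p0 k : 0 <= a ^+ k by apply/exprn_ge0/ltW.
rewrite !normrM exprD !(ger0_norm (p0 _)).
rewrite [leLHS]mulrA [leLHS]mulrC; apply: ler_wpM2r => //.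
exact: mulr_ge0.
Qed.

Implicit Types (g v : V -> R) (W : set V).

Lemma integ_abs_lty U f : integ U f -> (\int[mu]_(x in U) `|f x|%:E < +oo)%E.
Proof. by move=> /integrableP[]. Qed.

Lemma conv_swap u phi chi (M c : R) : integ setT u -> continuous phi -> bsupp c phi ->
 continuous chi -> (forall y, `|chi y| <= M) -> (forall y, chi (- y) = chi y) ->
 \int[mu]_x (conv u chi x * phi x) = \int[mu]_z (u z * conv phi chi z).
Proof.
move=> ui cphi sphi cchi HM ev.
have aux (a b d e : R) : 0 <= a -> 0 <= d -> b <= e -> a * b * d <= e * d * a.
 by move=> a0 d0 be; rewrite mulrAC mulrC [leRHS]mulrAC -!mulrA ler_wpM2r// mulr_ge0.
have mphi := cont_meas cphi; have mchi := cont_meas cchi.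
have [P P0 HP] := bsupp_bd cphi sphi.
have phii : integ setT phi := integ_bsupp mphi HP sphi.
pose F (xz : V * V) : R := u xz.2 * chi (xz.1 - xz.2) * phi xz.1.
have mF : mfun setT F.
 apply: mfunM; first apply: mfunM.
 - exact: (mfun_comp (integ_fun ui) measurable_snd).
 - exact: (mfun_comp mchi subrV2_meas).
 - exact: (mfun_comp mphi measurable_fst).
have M0 : 0 <= M by apply: le_trans (HM 0).
have Fi : (mu \x mu)%E.-integrable setT (EFin \o F).
 apply/integrable12ltyP; first exact/EFin_meas.
 pose I := \int[mu]_z `|u z|.
 have uI : (\int[mu]_z `|u z|%:E = I%:E)%E by rewrite -[LHS]fineK// integrable_fin_num//; exact: integ_abs.
 apply: (@le_ltT _ _ (\int[mu]_x (M * I * `|phi x|)%:E)%E).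
  apply: ge0_le_integral => //.
  - by move=> x _; apply: integral_ge0.
  - apply: (measurable_fun_fubini_tonelli_F (fun xz => `|(EFin \o F) xz|%E)) => //.
   by apply: mfun_comp => //; exact/EFin_meas.
  - by apply/EFin_meas; apply: mfunM => //; exact: mfun_comp.
  move=> x _; apply: (@le_trans _ _ (\int[mu]_z ((M * `|phi x|)%:E * `|u z|%:E))%E).
   apply: ge0_le_integral => //.
   - apply: mfun_comp => //; apply/EFin_meas.
    exact: (mfunM (mfunM (integ_fun ui)
     (mfun_comp mchi (subrVl_meas x))) (measurable_cst (phi x))).
   - apply: emeasurable_funM => //; apply/EFin_meas.
    by apply: mfun_comp => //; exact: integ_fun ui.
   by move=> z _; rewrite -EFinM lee_fin /F /= !normrM; exact: aux.
  rewrite ge0_integralZl//; last 2 first.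
   by apply/EFin_meas; apply: mfun_comp => //; exact: integ_fun ui.
   by rewrite lee_fin mulr_ge0.
  by rewrite uI -EFinM lee_fin mulrAC.
 have : integ setT (fun x => M * I * `|phi x|) by apply: integZ => //; exact: integ_abs.
 move=> /integ_abs_lty; apply: le_ltT; apply: ge0_le_integral => //.
 - by move=> x _; rewrite lee_fin !mulr_ge0//; exact: Rintegral_ge0.
 - by apply/EFin_meas; apply: mfunM => //; exact: mfun_comp.
 - by apply/EFin_meas; apply: mfun_comp => //; apply: mfunM => //; exact: mfun_comp.
 - by move=> x _; rewrite lee_fin ler_norm.
have := Fubini Fi.
have E1 x : (\int[mu]_z (EFin \o F) (x, z) = (conv u chi x * phi x)%:E)%E.
 have i1 := integ_convE x ui mchi HM.
 have i2 : integ setT (fun z => u z * chi (x - z) * phi x).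
  by have := integZ (phi x) measurableT i1; apply: eq_integ => // z _; rewrite mulrC.
 rewrite -[LHS]fineK; last exact: integrable_fin_num i2.
 by rewrite /conv -RintegralZr.
have E2 z : (\int[mu]_x (EFin \o F) (x, z) = (u z * conv phi chi z)%:E)%E.
 have i1 := integ_convE z phii mchi HM.
 have i2 : integ setT (fun x => F (x, z)).
  have := integZ (u z) measurableT i1; apply: eq_integ => // x _.
  by rewrite /F /= -(ev (z - x)) opprB mulrCA mulrC mulrAC -mulrA mulrCA [phi x * _]mulrC.
 rewrite -[LHS]fineK; last exact: integrable_fin_num i2.
 rewrite /conv -RintegralZl//; congr (_%:E); apply: eq_Rint => x _.
 by rewrite /F /= -(ev (z - x)) opprB -mulrA [phi x * _]mulrC.
under eq_integral do rewrite E1.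
under [in RHS]eq_integral do rewrite E2.
by move=> H; rewrite /Rintegral H.
Qed.

Lemma mollify_approx phi M c a z : Ck 1 setT phi -> bsupp c phi ->
 (forall i y, `|pd i phi y| <= M) -> 0 <= M -> 0 < a ->
 `|conv phi (chi a) z - phi z| <= n%:R * M * a^-1.
Proof.
move=> C1 sphi HM M0 a0.
have cphi : continuous phi by move=> y; exact: (Ck_cont C1).
have mphi := cont_meas cphi.
have [P P0 HP] := bsupp_bd cphi sphi.
have phii : integ setT phi := integ_bsupp mphi HP sphi.
have mchi := smooth_meas (chi_smooth a).
have [Q Q0 HQ] := smooth_bd (chi_smooth a) (chi_bsupp a0).
have i1 := integ_convE z phii mchi HQ.
have ci : integ setT (fun x => chi a (z - x)).
 apply: (@integ_bsupp _ _ _ Q (`|z| + a^-1)) => [|y|y yc].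
 - exact: (mfun_comp mchi (subrVl_meas z)).
 - exact: HQ.
 - apply: chi_bsupp => //; rewrite -(ltrD2l `|z|); apply: lt_leT yc _.
  by rewrite -[X in `|X|](subKr z); apply: ler_normB.
have c1 : \int[mu]_x chi a (z - x) = 1 by rewrite int_reflect_shift ?chi_int1//; exact: chi_neg.
have i2 := integZ (phi z) measurableT ci.
have -> : phi z = \int[mu]_x (phi z * chi a (z - x)) by rewrite RintegralZl// c1 mulr1.
rewrite /conv -RintegralB//.
apply: le_trans (le_normr_Rintegral measurableT _) _; first exact: integB.
have -> : n%:R * M * a^-1 = \int[mu]_x (n%:R * M * a^-1 * chi a (z - x)) by rewrite RintegralZl// c1 mulr1.
apply: le_Rintegral => //.
- by apply: integ_abs; exact: integB.
- exact: integZ.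
move=> x _; rewrite -mulrBl normrM (ger0_norm (chi_ge0 _ a0)).
have [zx|zx] := leP `|z - x| a^-1; last by rewrite chi_bsupp// !mulr0.
apply: ler_wpM2r; first exact: chi_ge0.
apply: le_trans (lipschitz_rV _ HM x z) _ => [y|]; first exact: (Ck_pder C1).
by rewrite [`|x - z|]distrC; exact: (ler_wpM2l (mulr_ge0 (ler0n _ _) M0) zx).
Qed.

(** Tested against [phi], the mollifier moves from [u] to [phi]; moreover [conv u (chi a0)] may be
    replaced by [conv u (chi a)] with [a] arbitrarily large. Since [conv phi (chi a)] tends to [phi]
    uniformly, the difference [u - conv u (chi a0)] is orthogonal to all test functions. *)
Lemma weyl_mean U W u a0 : open U -> open W -> (mu W < +oo)%E -> integ setT u -> wharm U u ->
 0 < a0 -> (forall x, W x -> cube x a0^-1 `<=` U) ->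
 {ae mu, forall x, W x -> u x = conv u (chi a0) x}.
Proof.
move=> oU oW Woo ui uh a00 WU; have mW := open_meas oW.
have [M M0 HM] := smooth_bd (chi_smooth a0) (chi_bsupp a00).
have Hc : continuous (conv u (chi a0)).
 exact: (conv_cont ui (@chi_smooth a0 1%N) (chi_bsupp a00)).
have mH := cont_meas Hc.
have Hi : integ W (conv u (chi a0)).
 apply: (@integ_bd _ _ _ _ (M * \int[mu]_z `|u z|)) => //; first exact: mfunTS.
 by move=> x _; apply: conv_bound => //; exact: smooth_meas (chi_smooth _).
have uiW : integ W u by apply: (@integrableS _ _ _ mu setT).
suff : {ae mu, forall x, W x -> u x - conv u (chi a0) x = 0} by apply: filterS => x H Wx; apply: subr0_eq; exact: H.
apply: du_bois_reymond => //; first exact: integB.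
move=> phi tp; have [sp [K [cK KW HK]]] := tp.
have cphi := smooth_cont sp.
have [c sc] := test_bsupp tp.
have [P P0 HP] := bsupp_bd cphi sc.
have mphi := cont_meas cphi.
rewrite (@int_supp _ _ W K)//; last by move=> x nK; rewrite HK// mulr0.
have [D D0 HD] : exists2 D, 0 <= D & forall i y, `|pd i phi y| <= D.
 have H i : {D : R | 0 <= D & forall y, `|pd i phi y| <= D}.
  apply/cid2; have sdp := smooth_pd i sp.
  exact: smooth_bd sdp (pd_bsupp i sc).
 exists (\sum_i s2val (H i)); first by apply: sumr_ge0 => i _; case: (H i).
 move=> i y; rewrite (bigD1 i)//=; case: (H i) => /= Di Di0 HDi.
 by rewrite (le_trans (HDi y))// lerDl; apply: sumr_ge0 => j _; case: (H j).
have up : integ setT (fun x => u x * phi x) by apply: (@integ_mul_bd _ _ _ _ _ P).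
have key a : a0 <= a -> `|\int[mu]_x ((u x - conv u (chi a0) x) * phi x)| <=
  n%:R * D * a^-1 * \int[mu]_x `|u x|.
 move=> a0a; have ap := lt_leT a00 a0a.
 have [Q Q0 HQ] := smooth_bd (chi_smooth a) (chi_bsupp ap).
 have cchi := smooth_cont (chi_smooth a).
 have phii : integ setT phi := integ_bsupp mphi HP sc.
 have cpc : continuous (conv phi (chi a)).
  exact: (conv_cont phii (@chi_smooth a 1%N) (chi_bsupp ap)).
 have up2 : integ setT (fun x => u x * conv phi (chi a) x).
  exact: (integ_mul_bd measurableT ui (cont_meas cpc)
   (fun x _ => conv_bound x phii (smooth_meas (@chi_smooth a)) HQ)).
 have hp : integ setT (fun x => conv u (chi a0) x * phi x).
  apply: (@integ_bsupp _ _ _ (M * \int[mu]_z `|u z| * P) c).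
  - by apply: mfunM.
  - move=> x; rewrite normrM ler_pM//; apply: conv_bound => //.
   exact: smooth_meas (chi_smooth _).
  - by move=> y cy; rewrite sc// mulr0.
 have -> : \int[mu]_x ((u x - conv u (chi a0) x) * phi x) =
   \int[mu]_x (u x * (phi x - conv phi (chi a) x)).
  have E : \int[mu]_x (conv u (chi a0) x * phi x) = \int[mu]_x (conv u (chi a) x * phi x).
   apply: eq_Rint => x _; have [Kx|nK] := pselect (K x); last by rewrite (HK x nK) !mulr0.
   have cU := WU x (KW x Kx).
   by rewrite (conv_chi_const oU ui uh a00 a0a cU).
  transitivity (\int[mu]_x (u x * phi x) - \int[mu]_x (conv u (chi a0) x * phi x)).
   by rewrite -(RintegralB measurableT up hp); apply: eq_Rint => x _; rewrite mulrBl.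
  rewrite E (conv_swap ui cphi sc cchi HQ (chi_neg a)) -(RintegralB measurableT up up2).
  by apply: eq_Rint => x _; rewrite mulrBr.
 apply: le_trans (le_normr_Rintegral measurableT _) _.
  have := integB measurableT up up2; apply: eq_integ => // x _; by rewrite mulrBr.
 rewrite -RintegralZl//; last exact: integ_abs.
 apply: le_Rintegral => //.
 - apply: integ_abs.
  have := integB measurableT up up2; apply: eq_integ => // x _; by rewrite mulrBr.
 - by apply: integZ => //; exact: integ_abs.
 - move=> x _; rewrite normrM mulrC ler_wpM2r// distrC.
  exact: (mollify_approx _ (sp 1%N) sc HD).
apply/eqP; rewrite -normr_le0; set J := `|_|.
have K0 : 0 <= n%:R * D * \int[mu]_x `|u x| by rewrite mulr_ge0 ?mulr_ge0//; exact: Rintegral_ge0.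
apply: (le0_of_small K0) => e e0.
have -> : e * (n%:R * D * \int[mu]_x `|u x|) = n%:R * D * e * \int[mu]_x `|u x| by rewrite mulrCA -!mulrA.
apply: le_trans (key (Num.max a0 e^-1) _) _; first by rewrite le_max lexx.
apply: ler_wpM2r; first exact: Rintegral_ge0.
apply: ler_wpM2l; first exact: mulr_ge0.
have m0 : 0 < Num.max a0 e^-1 by rewrite lt_max a00.
by rewrite -[leRHS]invrK lef_pV2 ?posrE ?invr_gt0// le_max lexx orbT.
Qed.

Lemma ball_open x (d : R) : open [set y : V | `|y - x| < d].
Proof.
rewrite openE => z Uz; apply/nbhs_rVP; exists (d - `|z - x|); first by rewrite subr_gt0.
move=> y; rewrite ltrBrDr; apply: le_ltT.
by apply: le_trans (ler_normD _ _); rewrite addrA subrK.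
Qed.

Lemma ball_fin x (d : R) : (mu [set y : V | (`|y - x| < d)%R] < +oo)%E.
Proof.
apply: (@bounded_leb _ _ _ (d + `|x|)).
 by apply: open_meas; exact: ball_open.
move=> y /= yd; rewrite -[y](subrK x); apply: le_trans (ler_normD _ _) _.
by rewrite lerD2r ltW.
Qed.

Lemma cube_sub_ball x (c d : R) : 0 <= c -> c < d -> cube x c `<=` [set y | `|y - x| < d].
Proof.
move=> c0 cd y Hy /=; apply: le_ltT cd; apply: normrV_le => // i.
by have := Hy i; rewrite !mxE.
Qed.

Lemma ball_sub_cube x (c : R) y : `|y - x| <= c -> cube x c y.
Proof.
by move=> yc i; apply: le_trans yc; have := le_normrV (y - x) i; rewrite !mxE.
Qed.

Lemma ae_cont_eq W f g : open W -> (forall x, W x -> {for x, continuous f}) ->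
 (forall x, W x -> {for x, continuous g}) -> {ae mu, forall x, W x -> f x = g x} ->
 forall x, W x -> f x = g x.
Proof.
move=> oW cf cg [A [mA A0 HA]] x Wx; apply/eqP; apply: contraT => fg.
have h0 : 0 < `|f x - g x| / 2 by rewrite divr_gt0// normr_gt0 subr_eq0.
have /cont_rVP /(_ _ h0) [d1 d10 H1] := cf x Wx.
have /cont_rVP /(_ _ h0) [d2 d20 H2] := cg x Wx.
have [d3 d30 H3] := open_ballP oW Wx.
pose d := Num.min d1 (Num.min d2 d3) / 2.
have d0 : 0 < d by rewrite divr_gt0// !lt_min d10 d20.
have dlt : d < Num.min d1 (Num.min d2 d3) by rewrite /d ltr_pdivrMr// ltr_pMr ?ltr1n// !lt_min d10 d20.
have cA : cube x d `<=` A.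
 move=> y /(cube_sub_ball (ltW d0) dlt) /=; rewrite !lt_min => /and3P[y1 y2 y3].
 apply: HA => /= H; have E := H (H3 y y3).
 have k1 := H1 y y1; have k2 := H2 y y2; rewrite E in k1.
 exact: dist_half_lt k1 k2.
have : (mu (cube x d) <= mu A)%E by apply: le_measure => //; rewrite inE//; exact: cube_meas.
have := leb_cube x (ltW d0); rewrite A0 => ->; rewrite lee_fin leNgt.
by rewrite exprn_gt0// pmulrn_rgt0.
Qed.

(** Localized to a ball that stays away from the boundary of [U], where a continuous function is
    integrable. *)
Lemma du_bois_cont U g : open U -> (forall x, U x -> {for x, continuous g}) ->
 (forall phi, tfun U phi -> \int[mu]_(x in U) (g x * phi x) = 0) ->
 forall x, U x -> g x = 0.
Proof.
move=> oU cg H x Ux; have [d d0 Hd] := open_ballP oU Ux.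
pose W := [set y : V | `|y - x| < d / 2].
have d20 : 0 < d / 2 by rewrite divr_gt0.
have oW : open W by exact: ball_open.
have mW := open_meas oW.
have cU : cube x (d / 2) `<=` U.
 move=> y /(@cube_sub_ball _ _ d (ltW d20)) Hy; apply: Hd; apply: Hy.
 by rewrite ltr_pdivrMr// ltr_pMr// ltr1n.
have WU : W `<=` U by move=> y /= Wy; apply: cU; apply: ball_sub_cube; exact: ltW.
have [M M0 HM] := compact_bdfun (cube_compact_rV (c := x) (r := d / 2)) (fun y cy => cg y (cU y cy)).
have gi : integ W g.
 apply: (@integ_bd _ _ _ _ M) => //.
 - by apply: open_cont_meas => // y Wy; apply: cg; exact: WU.
 - by move=> y Wy; apply: HM; apply: ball_sub_cube; exact: ltW.
 - exact: ball_fin.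
apply: (@ae_cont_eq W g (fun=> 0)) => //.
- by move=> y Wy; apply: cg; exact: WU.
- by move=> y _; exact: cst_continuous.
- apply: du_bois_reymond => // phi tp.
 have [sp [K [cK KW HK]]] := tp.
 rewrite -[RHS](H phi); last exact: test_sub tp.
 have KU : K `<=` U by apply: subset_trans WU.
 rewrite (@int_supp _ _ W K)// ?(@int_supp _ _ U K)//.
 + exact: open_meas.
 + by move=> y nK; rewrite HK// mulr0.
 + by move=> y nK; rewrite HK// mulr0.
- by rewrite /W /= subrr normr0.
Qed.

Lemma Ck_integ U f phi : open U -> Ck 0 U f -> tfun U phi ->
 integ U (fun x => f x * phi x).
Proof.
move=> oU C0 tp; have [sp [K [cK KU HK]]] := tp.
have C := Ck_mul_supp oU cK KU HK (sp 0%N) C0.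
have [c sc] := test_bsupp tp.
have sfc : bsupp c (fun x => f x * phi x) by move=> y cy; rewrite sc// mulr0.
have cf : continuous (fun x => f x * phi x) by move=> y; exact: (Ck_cont C).
have [M M0 HM] := bsupp_bd cf sfc.
apply: (@integrableS _ _ _ mu setT) => //; first exact: open_meas.
exact: integ_bsupp (cont_meas cf) HM sfc.
Qed.

Lemma int_by_parts2 U f phi i : open U -> Ck 2 U f -> tfun U phi ->
 \int[mu]_(x in U) (f x * pd i (pd i phi) x) = \int[mu]_(x in U) (pd i (pd i f) x * phi x).
Proof.
move=> oU C2 tp; rewrite int_by_parts//; last 2 first.
 exact: Ck_le C2.
 exact: test_pd.
rewrite int_by_parts ?opprK//; exact: Ck_pd.
Qed.

Lemma lap_by_parts U f phi : open U -> Ck 2 U f -> tfun U phi ->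
 \int[mu]_(x in U) (f x * lap phi x) = \int[mu]_(x in U) (lap f x * phi x).
Proof.
move=> oU C2 tp; have mU := open_meas oU.
transitivity (\sum_i \int[mu]_(x in U) (f x * pd i (pd i phi) x)).
 rewrite -Rint_sum//; first by apply: eq_Rint => x _; rewrite mulr_sumr.
 move=> i _; apply: Ck_integ => //; first exact: Ck_le C2.
 by do 2 apply: test_pd.
rewrite (eq_bigr _ (fun i _ => int_by_parts2 i oU C2 tp)) -Rint_sum//.
 by apply: eq_Rint => x _; rewrite mulr_suml.
by move=> i _; apply: Ck_integ => //; do 2 apply: Ck_pd.
Qed.

Definition harm U f := Ck 2 U f /\ forall x, U x -> lap f x = 0.

Lemma harm_wharm U f : open U -> harm U f -> wharm U f.
Proof.
move=> oU [C2 L0] phi tp; rewrite lap_by_parts// -[RHS](Rint_cst0 U).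
by apply: eq_Rint => x Ux; rewrite L0// mul0r.
Qed.

Lemma harm_sub U W f : W `<=` U -> harm U f -> harm W f.
Proof. by move=> WU [C2 L0]; split=> [|x /WU]; [exact: Ck_sub C2|exact: L0]. Qed.

Lemma wharm_restrict U u : wharm U u -> wharm U (u \_ U).
Proof.
move=> uh phi tp; rewrite -(uh phi tp); apply: eq_Rint => x Ux.
by rewrite patchE mem_set.
Qed.

Lemma harm_mean U f a x : open U -> integ U f -> harm U f -> 0 < a -> cube x a^-1 `<=` U ->
 f x = conv (f \_ U) (chi a) x.
Proof.
move=> oU fi hf a0 cU; have mU := open_meas oU.
have fi' : integ setT (f \_ U) by exact: (integ_patch _ mU).1.
have fh := wharm_restrict (harm_wharm oU hf).
have aa : a <= 2 * a by rewrite ler_pMl// ler1n.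
have a20 : 0 < 2 * a by rewrite mulr_gt0.
rewrite -(conv_chi_const oU fi' fh a0 aa cU).
(* At the doubled scale all points of a neighbourhood [W] of [x] keep their cubes in [U], so the
   almost everywhere identity on [W] becomes an identity at [x] by continuity. *)
pose W := [set y : V | `|y - x| < (2 * a)^-1].
have oW : open W by exact: ball_open.
have Wx : W x by rewrite /W /= subrr normr0 invr_gt0.
have hV : (2 * a)^-1 + (2 * a)^-1 = a^-1 by rewrite invfM; have := splitr a^-1; rewrite [_^-1 * _]mulrC => <-.
have WU y : W y -> cube y (2 * a)^-1 `<=` U.
 move=> Wy z Hz; apply: cU => i; rewrite -hV.
 apply: le_trans (ler_distD (y 0 i) _ _) _; apply: lerD; first exact: Hz.
 by have := le_normrV (y - x) i; rewrite !mxE => /le_trans; apply; exact: ltW.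
have WU' : W `<=` U by move=> y Wy; apply: (WU y Wy); apply: ball_sub_cube; rewrite subrr normr0 invr_ge0 ltW.
have H := weyl_mean oU oW (ball_fin _ _) fi' fh a20 WU.
apply: (@ae_cont_eq W f (conv (f \_ U) (chi (2 * a)))) => //.
- by move=> y Wy; apply: (Ck_cont hf.1); exact: WU'.
- move=> y _; exact: (conv_cont fi' (@chi_smooth (2 * a) 1%N) (chi_bsupp a20)).
- apply: filterS H => y + Wy => /(_ Wy) <-.
 by rewrite patchE mem_set//; exact: WU'.
Qed.

Lemma cont_ball_integ U f x : open U -> (forall y, U y -> {for y, continuous f}) -> U x ->
 exists2 d : R, 0 < d & cube x d `<=` U /\ integ [set y | `|y - x| < d] f.
Proof.
move=> oU cf Ux; have [d d0 Hd] := open_ballP oU Ux.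
have d20 : 0 < d / 2 by rewrite divr_gt0.
have cU : cube x (d / 2) `<=` U.
 move=> y /(@cube_sub_ball _ _ d (ltW d20)) Hy; apply: Hd; apply: Hy.
 by rewrite ltr_pdivrMr// ltr_pMr// ltr1n.
exists (d / 2) => //; split => //.
have [M M0 HM] := compact_bdfun (cube_compact_rV (c := x) (r := d / 2)) (fun y cy => cf y (cU y cy)).
apply: (@integ_bd _ _ _ _ M) => //.
- by apply: open_meas; exact: ball_open.
- apply: open_cont_meas => [|y Wy]; first exact: ball_open.
 by apply: cf; apply: cU; apply: ball_sub_cube; exact: ltW.
- by move=> y Wy; apply: HM; apply: ball_sub_cube; exact: ltW.
- exact: ball_fin.
Qed.

Lemma conv_chi_smooth u a : integ setT u -> 0 < a -> smooth setT (conv u (chi a)).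
Proof. by move=> ui a0 k; exact: (@conv_Ck _ _ u (chi a) a^-1 k ui (chi_smooth a) (chi_bsupp a0)). Qed.

(** Near each point a harmonic function coincides with a mollification of itself at a fixed
    scale. *)
Lemma harm_smooth U f : open U -> harm U f -> smooth U f.
Proof.
move=> oU hf k.
suff H x : U x -> exists g, smooth setT g /\ \forall y \near x, f y = g y.
 have L l : (size l <= k)%N -> forall x, U x -> {for x, continuous (partial l f)} /\
  ((size l < k)%N -> forall i, derivable (partial l f) x (e_ i)).
  move=> lk x Ux; have [g [sg E]] := H x Ux.
  have [cg dg] := sg k l lk x I.
  have E2 : \forall y \near x, partial l g y = partial l f y by apply: filterS (partial_near l E) => y ->.
  split; first exact: cont_near E2 cg.
  move=> lk' i; exact: (pder_near E2 (dg lk')).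
 exact: L.
move=> Ux; have [d d0 [cU fi]] := cont_ball_integ oU (Ck_cont hf.1) Ux.
pose W := [set y : V | `|y - x| < d].
have oW : open W by exact: ball_open.
have WU : W `<=` U by move=> y Wy; apply: cU; apply: ball_sub_cube; exact: ltW.
have a0 : 0 < (d / 3)^-1 by rewrite invr_gt0 divr_gt0.
have fi' : integ setT (f \_ W) by apply: (integ_patch _ _).1 => //; exact: open_meas.
exists (conv (f \_ W) (chi (d / 3)^-1)); split; first exact: conv_chi_smooth.
apply/nbhs_rVP; exists (d / 3); first by rewrite divr_gt0.
move=> y yd; apply: harm_mean => //; first exact: harm_sub hf.
rewrite invrK => z /(@cube_sub_ball y (d / 3) (d / 3 * 2)) /= Hz.
have {}Hz : `|z - y| < d / 3 * 2 by apply: Hz; rewrite ?ltr_pMr ?ltr1n ?divr_gt0// divr_ge0// ltW.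
rewrite /W /= -[z](subrK y) -addrA; apply: le_ltT (ler_normD _ _) _.
by apply: lt_leT (ltrD Hz yd) _; lra.
Qed.

Lemma lap_pd U f i x : open U -> smooth U f -> U x -> lap (pd i f) x = pd i (lap f) x.
Proof.
move=> oU sf Ux.
have E j : pd j (pd j (pd i f)) x = pd i (pd j (pd j f)) x.
 rewrite -(pdC _ _ oU (@smooth_pd _ _ _ _ j sf 2%N) Ux).
 apply: pd_near; have := open_nb (conj oU Ux).
 by apply: filterS => y Uy; rewrite (pdC _ _ oU (sf 2%N)).
have H : is_derive x (e_ i) (lap f) (\sum_j pd i (pd j (pd j f)) x).
 apply: isd_sum => j _; apply: isd_pd.
 exact: (@Ck_pder _ _ 0 U _ (@smooth_pd _ _ _ _ j (smooth_pd j sf) 1%N) x Ux).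
by rewrite (pdE H); exact: eq_bigr.
Qed.

Lemma harm_pd U f i : open U -> harm U f -> harm U (pd i f).
Proof.
move=> oU hf; have sf := harm_smooth oU hf; split; first exact: (@smooth_pd _ _ _ _ i sf).
move=> x Ux; rewrite (lap_pd _ oU sf Ux) -[RHS](_ : pd i (fun=> 0) x = 0); last by rewrite pd_cst.
apply: pd_near; have := open_nb (conj oU Ux).
by apply: filterS => y; exact: hf.2.
Qed.

Lemma harm_partial U f l : open U -> harm U f -> harm U (partial l f).
Proof. by move=> oU hf; elim: l => [//|i l IH]; exact: (@harm_pd U (partial l f) i oU IH). Qed.

Lemma L2_restrict U u : measurable U -> L2 U u -> L2 setT (u \_ U).
Proof.
move=> mU [mu1 lu]; split.
 by apply/(measurable_restrictT _ mU).
rewrite [X in (X < _)%E](_ : _ = (\int[mu]_(x in U) ((u x) ^+ 2)%:E)%E)// [in RHS]integral_mkcond.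
apply: eq_integral => x _; rewrite !patchE; case: ifP => // _.
by rewrite expr0n.
Qed.

(** Mean value formula and Cauchy-Schwarz on the cube of radius [1 / a]; the constant depends on the
    dimension only. *)
Lemma harm_bound : exists2 C : R, 0 <= C & forall U f a x, open U -> integ U f -> L2 U f ->
 harm U f -> 0 < a -> cube x a^-1 `<=` U ->
 ((f x ^+ 2)%:E <= (C * a ^+ n)%:E * \int[mu]_(z in cube x a^-1) ((f \_ U) z ^+ 2)%:E)%E.
Proof.
have [M M0 HM] := @chi_partial_bound [::].
exists (M ^+ 2 * 2 ^+ n); first by rewrite mulr_ge0 ?sqr_ge0 ?exprn_ge0.
move=> U f a x oU fi f2 hf a0 cU; have mU := open_meas oU.
have fi' : integ setT (f \_ U) by exact: (integ_patch _ mU).1.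
have f2' := L2_restrict mU f2.
rewrite (harm_mean oU fi hf a0 cU).
have HB y : `|chi a y| <= M * a ^+ n by have := HM a y a0; rewrite addn0.
have Ma0 : 0 <= M * a ^+ n by rewrite mulr_ge0// exprn_ge0// ltW.
have aV0 : 0 <= a^-1 by rewrite invr_ge0 ltW.
have := conv_sqr_bound x aV0 Ma0 fi' f2' (smooth_meas (@chi_smooth a)) HB (chi_bsupp a0).
congr (_ <= _ * _)%E; congr (_%:E).
have an0 : a ^+ n != 0 by rewrite expf_neq0// gt_eqF.
by rewrite -[_ *+ 2]mulr_natr !exprMn exprVn; move: (a ^+ n) an0 (2 ^+ n) => p p0 q; field.
Qed.

Lemma weyl U u : open U -> integ U u -> wharm U u ->
 exists v, harm U v /\ {ae mu, forall x, U x -> u x = v x}.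
Proof.
move=> oU ui uh; have mU := open_meas oU.
have ui' : integ setT (u \_ U) by exact: (integ_patch _ mU).1.
have uh' := wharm_restrict uh.
(* A scale for each point of [U], with a dummy value outside. Constancy in the scale makes [v]
   independent of the choice. *)
have H x : {a : R | U x -> 0 < a /\ cube x a^-1 `<=` U}.
 apply: cid; have [Ux|nU] := pselect (U x); last by exists 0.
 have [d d0 [cU _]] := cont_ball_integ (f := fun=> 0) oU (fun y _ => @cst_continuous _ _ 0 y) Ux.
 by exists d^-1 => _; rewrite invr_gt0 invrK.
pose v x := conv (u \_ U) (chi (sval (H x))) x.
have vE x a : U x -> 0 < a -> cube x a^-1 `<=` U -> v x = conv (u \_ U) (chi a) x.
 move=> Ux a0 cU; rewrite /v; case: (H x) => b /= /(_ Ux) [b0 cb].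
 have [ab|/ltW ba] := leP a b; first exact: (conv_chi_const oU ui' uh' a0 ab cU).
 by apply/esym; exact: (conv_chi_const oU ui' uh' b0 ba cb).
have loc x (d : R) : 0 < d -> cube x d `<=` U ->
  forall y, `|y - x| < d / 2 -> U y /\ cube y (d / 2) `<=` U /\ v y = conv (u \_ U) (chi (d / 2)^-1) y.
 move=> d0 cU y yd.
 have d20 : 0 < d / 2 by rewrite divr_gt0.
 have cy : cube y (d / 2) `<=` U.
  move=> z Hz; apply: cU => i; rewrite [d]splitr.
  apply: le_trans (ler_distD (y 0 i) _ _) _; apply: lerD; first exact: Hz.
  by have := le_normrV (y - x) i; rewrite !mxE => /le_trans; apply; exact: ltW.
 have Uy : U y by apply: cy; apply: ball_sub_cube; rewrite subrr normr0 ltW.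
 split; [exact: Uy|split; [exact: cy|apply: vE; [exact: Uy| |by rewrite invrK]]].
 by rewrite invr_gt0.
have sv : smooth U v.
 have near_v x : U x -> exists2 g, smooth setT g & \forall y \near x, g y = v y.
  move=> Ux; have [d d0 [cU _]] := cont_ball_integ (f := fun=> 0) oU (fun y _ => @cst_continuous _ _ 0 y) Ux.
  exists (conv (u \_ U) (chi (d / 2)^-1)).
   by apply: conv_chi_smooth => //; rewrite invr_gt0 divr_gt0.
  apply/nbhs_rVP; exists (d / 2); first by rewrite divr_gt0.
  by move=> y yd; have [_ [_ ->]] := loc x d d0 cU y yd.
 move=> k l lk x Ux; have [g sg E] := near_v x Ux.
 have [cg dg] := sg k l lk x I.
 have E2 := partial_near l E.
 split; first exact: cont_near E2 cg.
 move=> lk' i; exact: (pder_near E2 (dg lk')).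
have uv : {ae mu, forall x, U x -> u x = v x}.
 have [c [r [cU cover]]] := open_cube_cover oU.
 have : {ae mu, forall x, forall k, 0 < r k -> `|x - c k| < r k -> u x = v x}.
  apply: ae_foralln => k; have [r0|r0] := ltP 0 (r k); last first.
   by apply: aeW => x.
  have r2 : 0 < 2 * r k by rewrite mulr_gt0.
  have E : 2 * r k / 2 = r k by rewrite mulrC mulKf.
  have loc' := loc _ _ r2 (cU k r0); rewrite E in loc'.
  have r20 : 0 < (r k)^-1 by rewrite invr_gt0.
  have WU x : `|x - c k| < r k -> cube x (r k)^-1^-1 `<=` U by rewrite invrK => /loc' [_ []].
  have := weyl_mean oU (@ball_open (c k) (r k)) (ball_fin _ _) ui' uh' r20 WU.
  apply: filterS => x Hx _ xc; have [Ux [_ ->]] := loc' x xc.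
  by rewrite -Hx// patchE mem_set.
 apply: filterS => x Hx Ux; have [k Hk] := cover x Ux.
 by apply: (Hx k) => //; apply: le_ltT Hk.
(* Harmonicity is obtained by testing: [v] agrees with [u] almost everywhere, so [lap v] is
   orthogonal to all test functions. *)
have hv x : U x -> lap v x = 0.
 move: x; apply: du_bois_cont => //.
  move=> x Ux; apply: (Ck_cont (k := 0) (U := U)) => //.
  apply: Ck_sum => // i _; exact: (@smooth_pd _ _ _ _ i (smooth_pd i sv) 0%N).
 move=> phi tp; rewrite -(lap_by_parts oU (sv 2%N) tp).
 have mlp : mfun U (lap phi).
  have [sp _] := tp; apply: mfunTS; apply: cont_meas => y.
  apply: (Ck_cont (k := 0) (U := setT)) => //; apply: Ck_sum => [|i _]; first exact: openT_rV.
  exact: (@smooth_pd _ _ _ _ i (smooth_pd i sp) 0%N).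
 rewrite -[RHS](uh phi tp); apply: Rint_ae => //.
 - by apply: mfunM => //; exact: Ck_meas (sv 0%N).
 - by apply: mfunM => //; exact: integ_fun ui.
 - by apply: filterS uv => y Ey Uy; rewrite Ey.
by exists v; split => //; split => //; exact: sv.
Qed.

End is_derive_rV.

Ltac gen_pd := repeat match goal with |- context [@pd ?R ?n ?a ?f ?x] =>
 generalize (@pd R n a f x); intro end.

(** * Integrands that are divergences *)

Section zero_mean.
Context {R : realType} {n : nat}.
Local Notation V := 'rV[R]_n.
Local Notation mu := (lebesgue_rV R n).
Local Notation e_ i := (basis_vec R i).
Implicit Types (f g q phi tau : V -> R) (U : set V) (x : V).

(** Working modulo such integrands turns a chain of integrations by parts into one pointwise
    algebraic identity. *)
Definition zint U f := integ U f /\ \int[mu]_(x in U) f x = 0.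

Lemma zintD U f g : measurable U -> zint U f -> zint U g -> zint U (fun x => f x + g x).
Proof.
move=> mU [fi f0] [gi g0]; split; first exact: integD.
by rewrite (RintegralD mU fi gi) f0 g0 addr0.
Qed.

Lemma zintZ U c f : measurable U -> zint U f -> zint U (fun x => c * f x).
Proof.
move=> mU [fi f0]; split; first exact: integZ.
by rewrite RintegralZl// f0 mulr0.
Qed.

Lemma zintN U f : measurable U -> zint U f -> zint U (fun x => - f x).
Proof.
move=> mU fz; have := zintZ (-1) mU fz.
by congr (zint U _); apply/funext => x; rewrite mulN1r.
Qed.

Lemma zintB U f g : measurable U -> zint U f -> zint U g -> zint U (fun x => f x - g x).
Proof. by move=> mU fz gz; apply: zintD => //; exact: zintN. Qed.

Lemma eq_zint U f g : measurable U -> (forall x, U x -> f x = g x) -> zint U f -> zint U g.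
Proof.
move=> mU E [fi f0]; split; first exact: eq_integ fi.
by rewrite -f0; apply: eq_Rint => x Ux; rewrite E.
Qed.

Lemma zint_pd_mul U q phi a : open U -> Ck 1 U q -> tfun U phi ->
 zint U (fun x => pd a q x * phi x + q x * pd a phi x).
Proof.
move=> oU C1 tp; have mU := open_meas oU.
have i1 : integ U (fun x => pd a q x * phi x) by apply: Ck_integ => //; exact: Ck_pd.
have i2 : integ U (fun x => q x * pd a phi x) by apply: Ck_integ => //; [exact: Ck_le C1|exact: test_pd].
split; first exact: integD.
by rewrite (RintegralD mU i1 i2) int_by_parts// addrN.
Qed.

Lemma testM U f g : open U -> tfun U f -> tfun U g ->
 tfun U (fun x => f x * g x).
Proof.
move=> oU [sf _] tg; apply: testM_smooth => // k.
by apply: (@Ck_sub _ _ k U setT) => //; exact: sf.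
Qed.

Lemma test_pder U f (x : V) : tfun U f -> pder f x.
Proof. by move=> [sf _]; exact: (@Ck_pder _ _ 0 setT _ (sf 1%N) x I). Qed.

Lemma pd_test_pd U f a b x : tfun U f -> pd a (pd b f) x = pd b (pd a f) x.
Proof. by move=> [sf _]; exact: (pdC _ _ (@openT_rV R n) (sf 2%N) I). Qed.

(** The integrand is [pd a (tau * f * pd b g) - pd b (tau * f * pd a g)]; the second derivatives of
    [g] cancel. *)
Lemma zint_null U tau f g a b : open U -> Ck 2 U tau -> tfun U f -> tfun U g ->
 zint U (fun x => tau x * (pd a f x * pd b g x - pd b f x * pd a g x)
         + f x * (pd a tau x * pd b g x - pd b tau x * pd a g x)).
Proof.
move=> oU C2 tf tg; have mU := open_meas oU.
have tab := testM oU tf (test_pd b tg).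
have taa := testM oU tf (test_pd a tg).
have C1 : Ck 1 U tau by exact: Ck_le C2.
have z1 := zint_pd_mul a oU C1 tab.
have z2 := zint_pd_mul b oU C1 taa.
apply: eq_zint (zintB mU z1 z2) => // x Ux.
rewrite (pdM a (test_pder (x := x) tf) (test_pder (x := x) (test_pd b tg))).
rewrite (pdM b (test_pder (x := x) tf) (test_pder (x := x) (test_pd a tg))).
move: (pd_test_pd a b x tg); clear; gen_pd; intros; subst; ring.
Qed.

Lemma zint_div2 U tau f g c d : open U -> Ck 2 U tau -> tfun U f -> tfun U g ->
 zint U (fun x => pd d (pd c tau) x * (f x * g x)
         + pd c tau x * (pd d f x * g x + f x * pd d g x)).
Proof.
move=> oU C2 tf tg; have mU := open_meas oU.
have z1 := zint_pd_mul d oU (Ck_pd c C2) (testM oU tf tg).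
apply: eq_zint z1 => // x Ux; by rewrite (pdM d (test_pder (x := x) tf) (test_pder (x := x) tg)).
Qed.

Lemma zint_le U f g X : measurable U -> integ U f -> integ U g -> zint U X ->
 (forall x, U x -> f x <= g x + X x) ->
 \int[mu]_(x in U) f x <= \int[mu]_(x in U) g x.
Proof.
move=> mU fi gi [Xi X0] H; apply: (@le_trans _ _ (\int[mu]_(x in U) (g x + X x))).
 by apply: le_Rintegral => //; exact: integD.
by rewrite (RintegralD mU gi Xi) X0 addr0.
Qed.

Lemma Ck_integ2 U q f g : open U -> Ck 0 U q -> tfun U f -> tfun U g ->
 integ U (fun x => q x * (f x * g x)).
Proof. by move=> oU C0 tf tg; apply: Ck_integ => //; exact: testM. Qed.

End zero_mean.

Definition i0 : 'I_4 := @Ordinal 4 0 isT.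
Definition i1 : 'I_4 := @Ordinal 4 1 isT.
Definition i2 : 'I_4 := @Ordinal 4 2 isT.
Definition i3 : 'I_4 := @Ordinal 4 3 isT.

Lemma sum4 (M : nmodType) (F : 'I_4 -> M) : \sum_i F i = F i0 + F i1 + F i2 + F i3.
Proof.
rewrite !big_ord_recr big_ord0/= Monoid.mul1m.
by congr (F _ + F _ + F _ + F _); exact: val_inj.
Qed.

Lemma ord4P (P : 'I_4 -> Prop) : P i0 -> P i1 -> P i2 -> P i3 -> forall i, P i.
Proof.
move=> p0 p1 p2 p3 [[|[|[|[|//]]]] Hi].
- by rewrite (_ : Ordinal Hi = i0)//; exact: val_inj.
- by rewrite (_ : Ordinal Hi = i1)//; exact: val_inj.
- by rewrite (_ : Ordinal Hi = i2)//; exact: val_inj.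
- by rewrite (_ : Ordinal Hi = i3)//; exact: val_inj.
Qed.

(** * The twisted basic inequality and L2 solutions of the [dbar] equation *)

Section basic_inequality.
Context {R : realType}.
Local Notation V := 'rV[R]_4.
Local Notation mu := (lebesgue_rV R 4).
Implicit Types (p : 'I_4 -> V -> R) (U : set V) (x : V) (sigma : V -> R).

(* With [P = p0 + i p1] and [Q = p2 + i p3], [A1 + i A2] is twice
  [dP/dz1 + dQ/dz2] and [B1 + i B2] is twice [dQ/dzbar1 - dP/dzbar2]. *)
Definition opA1 p x := pd i0 (p i0) x + pd i1 (p i1) x + pd i2 (p i2) x + pd i3 (p i3) x.
Definition opA2 p x := - pd i1 (p i0) x + pd i0 (p i1) x - pd i3 (p i2) x + pd i2 (p i3) x.
Definition opB1 p x := pd i0 (p i2) x - pd i1 (p i3) x - pd i2 (p i0) x + pd i3 (p i1) x.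
Definition opB2 p x := pd i0 (p i3) x + pd i1 (p i2) x - pd i2 (p i1) x - pd i3 (p i0) x.

Definition hess sigma x (v w : 'I_4 -> R) := \sum_i \sum_j pd i (pd j sigma) x * v i * w j.

Definition rotJ (v : 'I_4 -> R) (i : 'I_4) : R :=
 if i == i0 then v i1 else if i == i1 then - v i0 else if i == i2 then v i3 else - v i2.

(** Four times the complex Hessian of [sigma] on the vector [v] of [C^2]; [rotJ] is multiplication
    by [- i]. *)
Definition levi sigma x v := hess sigma x v v + hess sigma x (rotJ v) (rotJ v).

Definition testv U p := forall i, tfun U (p i).

(** Four times the sum of the squared moduli of all [zbar_k] derivatives of [P] and [Q]. *)
Definition dbar2 p x :=
 (pd i0 (p i0) x - pd i1 (p i1) x) ^+ 2 + (pd i0 (p i1) x + pd i1 (p i0) x) ^+ 2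
+ (pd i2 (p i0) x - pd i3 (p i1) x) ^+ 2 + (pd i2 (p i1) x + pd i3 (p i0) x) ^+ 2
+ (pd i0 (p i2) x - pd i1 (p i3) x) ^+ 2 + (pd i0 (p i3) x + pd i1 (p i2) x) ^+ 2
+ (pd i2 (p i2) x - pd i3 (p i3) x) ^+ 2 + (pd i2 (p i3) x + pd i3 (p i2) x) ^+ 2.

(* Real and imaginary parts of twice [P dtau/dz1 + Q dtau/dz2]. *)
Definition gradA1 tau p x := pd i0 tau x * p i0 x + pd i1 tau x * p i1 x
 + pd i2 tau x * p i2 x + pd i3 tau x * p i3 x.
Definition gradA2 tau p x := - pd i1 tau x * p i0 x + pd i0 tau x * p i1 x
 - pd i3 tau x * p i2 x + pd i2 tau x * p i3 x.

Definition pvec p x : 'I_4 -> R := fun i => p i x.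

Lemma leviE sigma U p x : open U -> Ck 2 U sigma -> U x ->
 levi sigma x (pvec p x) =
 (pd i0 (pd i0 sigma) x + pd i1 (pd i1 sigma) x) * (p i0 x * p i0 x + p i1 x * p i1 x)
 + (pd i2 (pd i2 sigma) x + pd i3 (pd i3 sigma) x) * (p i2 x * p i2 x + p i3 x * p i3 x)
 + 2 * ((pd i0 (pd i2 sigma) x + pd i1 (pd i3 sigma) x) * (p i0 x * p i2 x + p i1 x * p i3 x)
    + (pd i0 (pd i3 sigma) x - pd i1 (pd i2 sigma) x) * (p i0 x * p i3 x - p i1 x * p i2 x)).
Proof.
move=> oU C2 Ux; rewrite /levi /hess !sum4 /pvec /rotJ /=.
have E a b := pdC a b oU C2 Ux.
move: (E i1 i0) (E i2 i0) (E i3 i0) (E i2 i1) (E i3 i1) (E i3 i2).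
clear; gen_pd; move: (p i0 x) (p i1 x) (p i2 x) (p i3 x) => *; subst; ring.
Qed.

(** For forms with compact support there are no boundary terms. Commuting the [z] and [zbar]
    derivatives leaves the gradient term and the Levi term of [tau], and the whole integrand is an
    explicit combination of the divergences of [zint_null] and [zint_div2]. *)
Lemma twisted_identity U tau p : open U -> Ck 2 U tau -> testv U p ->
 zint U (fun x => tau x * (opA1 p x ^+ 2 + opA2 p x ^+ 2 + opB1 p x ^+ 2 + opB2 p x ^+ 2)
  - tau x * dbar2 p x
  + 2 * (gradA1 tau p x * opA1 p x + gradA2 tau p x * opA2 p x)
  + levi tau x (pvec p x)).
Proof.
move=> oU C2 tp; have mU := open_meas oU.
have N f g a b := @zint_null _ _ U tau (p f) (p g) a b oU C2 (tp f) (tp g).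
have D f g c d := @zint_div2 _ _ U tau (p f) (p g) c d oU C2 (tp f) (tp g).
(* The coefficients are found by matching monomials: the [z] terms account for the products of two
   first derivatives of [p], the [y] terms for the second derivatives of [tau]. *)
have z1 := zintD mU (zintZ 4 mU (N i0 i1 i0 i1)) (zintZ 4 mU (N i2 i3 i2 i3)).
have z2 := zintD mU (zintD mU (N i0 i2 i0 i2) (N i0 i3 i0 i3)) (zintD mU (N i1 i2 i1 i2) (N i1 i3 i1 i3)).
have z3 := zintB mU (zintB mU (N i1 i3 i0 i2) (N i1 i2 i0 i3)) (zintB mU (N i0 i3 i1 i2) (N i0 i2 i1 i3)).
have y1 := zintD mU (zintD mU (D i0 i0 i0 i0) (D i1 i1 i0 i0)) (zintD mU (D i0 i0 i1 i1) (D i1 i1 i1 i1)).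
have y2 := zintD mU (zintD mU (D i2 i2 i2 i2) (D i3 i3 i2 i2)) (zintD mU (D i2 i2 i3 i3) (D i3 i3 i3 i3)).
have y3 := zintD mU (zintB mU (D i0 i1 i1 i0) (D i0 i1 i0 i1)) (zintB mU (D i2 i3 i3 i2) (D i2 i3 i2 i3)).
have y4 := zintD mU (zintD mU (D i0 i2 i2 i0) (D i0 i3 i3 i0)) (zintD mU (D i1 i2 i2 i1) (D i1 i3 i3 i1)).
have y5 := zintD mU (zintB mU (D i1 i3 i2 i0) (D i1 i2 i3 i0)) (zintB mU (D i0 i2 i3 i1) (D i0 i3 i2 i1)).
have y := zintD mU (zintD mU y1 y2) (zintZ 2 mU (zintD mU y3 (zintD mU y4 y5))).
apply: eq_zint (zintD mU (zintD mU z1 (zintZ 2 mU (zintD mU z2 z3))) y) => // x Ux.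
rewrite (leviE p oU C2 Ux) /opA1 /opA2 /opB1 /opB2 /gradA1 /gradA2 /dbar2.
move: (pdC i1 i0 oU C2 Ux) (pdC i3 i2 oU C2 Ux).
clear; gen_pd; move: (p i0 x) (p i1 x) (p i2 x) (p i3 x) (tau x) => *; subst; ring.
Qed.

Lemma dbar2_ge0 p x : 0 <= dbar2 p x.
Proof. by rewrite /dbar2 !addr_ge0 ?sqr_ge0. Qed.

Definition nsq p x : R := p i0 x ^+ 2 + p i1 x ^+ 2 + p i2 x ^+ 2 + p i3 x ^+ 2.

Lemma testv_pd U p i j : testv U p -> tfun U (pd i (p j)).
Proof. by move=> tp; apply: test_pd. Qed.

Lemma testB U (f g : V -> R) : tfun U f -> tfun U g ->
 tfun U (fun x => f x - g x).
Proof.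
move=> tf tg; rewrite (_ : (fun x => _) = fun x => f x + -1 * g x); last first.
 by apply/funext => x; rewrite mulN1r.
by apply: testD => //; exact: testZ.
Qed.

Lemma opA_test U p : testv U p -> tfun U (opA1 p) /\ tfun U (opA2 p).
Proof.
move=> tp; have T i j := testv_pd i j tp; split.
 by rewrite /opA1; do ! apply: testD.
rewrite (_ : opA2 p = fun x => pd i0 (p i1) x - pd i1 (p i0) x - pd i3 (p i2) x + pd i2 (p i3) x).
 by apply: testD => //; do ! apply: testB.
by apply/funext => x; rewrite /opA2 [- _ + _]addrC.
Qed.

Lemma opB_test U p : testv U p -> tfun U (opB1 p) /\ tfun U (opB2 p).
Proof.
move=> tp; have T i j := testv_pd i j tp; split; rewrite /opB1 /opB2.
 by apply: testD => //; do ! apply: testB.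
by apply: testB => //; apply: testB => //; exact: testD.
Qed.

Lemma test_sqr_integ U q (f : V -> R) : open U -> Ck 0 U q -> tfun U f ->
 integ U (fun x => q x * f x ^+ 2).
Proof. by move=> oU C0 tf; exact: Ck_integ2. Qed.

Lemma test_L2_int U (f : V -> R) : open U -> tfun U f -> integ U (fun x => f x ^+ 2).
Proof.
move=> oU tf; have := @test_sqr_integ U (fun=> 1) f oU (@Ck_cst _ _ 0 U 1) tf.
by under eq_fun do rewrite mul1r.
Qed.

Lemma cauchy4 (M a0 a1 a2 a3 b0 b1 b2 b3 : R) : `|a0| <= M -> `|a1| <= M -> `|a2| <= M -> `|a3| <= M ->
 (a0 * b0 + a1 * b1 + a2 * b2 + a3 * b3) ^+ 2 <= 4 * M ^+ 2 * (b0 ^+ 2 + b1 ^+ 2 + b2 ^+ 2 + b3 ^+ 2).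
Proof.
move=> h0 h1 h2 h3.
have H (a b : R) : `|a| <= M -> (a * b) ^+ 2 <= M ^+ 2 * b ^+ 2.
 move=> ha; rewrite exprMn ler_wpM2r ?sqr_ge0// -[a ^+ 2]real_normK ?num_real//.
 by rewrite lerXn2r ?nnegrE// (le_trans _ ha).
have := (H _ b0 h0, H _ b1 h1, H _ b2 h2, H _ b3 h3).
move: (a0 * b0) (a1 * b1) (a2 * b2) (a3 * b3) => u0 u1 u2 u3 [[[k0 k1] k2] k3].
have S (x y : R) : 2 * (x * y) <= x ^+ 2 + y ^+ 2 by have := sqr_ge0 (x - y); rewrite sqrrB; lra.
have := (S u0 u1, S u0 u2, S u0 u3, S u1 u2, S u1 u3, S u2 u3).
move=> [[[[[s1 s2] s3] s4] s5] s6].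
have -> : (u0 + u1 + u2 + u3) ^+ 2 = u0 ^+ 2 + u1 ^+ 2 + u2 ^+ 2 + u3 ^+ 2 +
 2 * (u0 * u1) + 2 * (u0 * u2) + 2 * (u0 * u3) + 2 * (u1 * u2) + 2 * (u1 * u3) + 2 * (u2 * u3) by ring.
have -> : 4 * M ^+ 2 * (b0 ^+ 2 + b1 ^+ 2 + b2 ^+ 2 + b3 ^+ 2) =
 4 * (M ^+ 2 * b0 ^+ 2) + 4 * (M ^+ 2 * b1 ^+ 2) + 4 * (M ^+ 2 * b2 ^+ 2) + 4 * (M ^+ 2 * b3 ^+ 2) by ring.
lra.
Qed.

Lemma young_pair (c M g1 g2 A1 A2 N : R) : 0 < c -> 0 < M ->
 g1 ^+ 2 <= 4 * M ^+ 2 * N -> g2 ^+ 2 <= 4 * M ^+ 2 * N ->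
 - (2 * (g1 * A1 + g2 * A2)) <= c / 2 * N + 16 * M ^+ 2 / c * (A1 ^+ 2 + A2 ^+ 2).
Proof.
move=> c0 M0 h1 h2.
(* Parameter of Young's inequality for which the two gradient terms together use up exactly half of
   the coercive term [c * N]. *)
pose d := c / (16 * M ^+ 2).
have M20 : 0 < 16 * M ^+ 2 by rewrite mulr_gt0// exprn_gt0.
have d0 : 0 < d by rewrite divr_gt0.
have H (g A : R) : - (2 * (g * A)) <= d * g ^+ 2 + d^-1 * A ^+ 2.
 have := mulr_ge0 (ltW d0) (sqr_ge0 (g + d^-1 * A)).
 have -> : d * (g + d^-1 * A) ^+ 2 = d * g ^+ 2 + d^-1 * A ^+ 2 + 2 * (g * A) by field; rewrite gt_eqF.
 lra.
have k1 := H g1 A1; have k2 := H g2 A2.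
have e1 : d * g1 ^+ 2 <= d * (4 * M ^+ 2 * N) by rewrite ler_pM2l.
have e2 : d * g2 ^+ 2 <= d * (4 * M ^+ 2 * N) by rewrite ler_pM2l.
have E : d * (4 * M ^+ 2 * N) = c / 4 * N by rewrite /d; field; rewrite gt_eqF.
have E2 : d^-1 = 16 * M ^+ 2 / c by rewrite /d invf_div.
rewrite E in e1 e2; rewrite -E2; lra.
Qed.

Lemma levi_cst (t : R) x v : levi (fun=> t) x v = 0.
Proof.
rewrite /levi /hess !big1 ?addr0// => i _; apply: big1 => j _.
 by rewrite !pd_cst !mul0r.
by rewrite !pd_cst !mul0r.
Qed.

(** The twist is [t - sigma], obtained from the identities for the constant [t] and for [sigma]. Its
    Levi form is that of [- sigma], which makes the form coercive; the gradient term is absorbed by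
    Young's inequality at the cost of the constant in front of the [opA] part. *)
Lemma basic_inequality U sigma t c M p : open U -> Ck 2 U sigma -> testv U p -> 0 < c -> 0 < M ->
 (forall x v, U x -> c * \sum_i v i ^+ 2 <= levi sigma x v) ->
 (forall x, U x -> 0 <= t - sigma x <= M) ->
 (forall x i, U x -> `|pd i sigma x| <= M) ->
 c / 2 * \int[mu]_(x in U) nsq p x <=
  \int[mu]_(x in U) ((t - sigma x) * (opB1 p x ^+ 2 + opB2 p x ^+ 2)) +
  (M + 16 * M ^+ 2 / c) * \int[mu]_(x in U) (opA1 p x ^+ 2 + opA2 p x ^+ 2).
Proof.
move=> oU C2 tp c0 M0 HL Hr HM; have mU := open_meas oU.
have zs := twisted_identity oU C2 tp.
have zt := twisted_identity oU (@Ck_cst _ _ 2 U t) tp.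
have [TA1 TA2] := opA_test tp; have [TB1 TB2] := opB_test tp.
have Cr : Ck 0 U (fun x => t - sigma x) by apply: CkB => //; [exact: Ck_cst|exact: Ck_le C2].
have iN : integ U (nsq p) by rewrite /nsq; do ! apply: integD => //; exact: test_L2_int.
have iA : integ U (fun x => opA1 p x ^+ 2 + opA2 p x ^+ 2) by apply: integD => //; exact: test_L2_int.
have iB : integ U (fun x => (t - sigma x) * (opB1 p x ^+ 2 + opB2 p x ^+ 2)).
 under eq_fun do rewrite mulrDr.
 by apply: integD => //; exact: test_sqr_integ.
rewrite -!RintegralZl// -RintegralD//; last exact: integZ.
apply: (zint_le mU _ _ (zintB mU zs zt)); [exact: integZ|by apply: integD => //; exact: integZ|].
move=> x Ux; rewrite levi_cst /gradA1 /gradA2 !pd_cst.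
have hl := HL x (pvec p x) Ux.
have {}hl : c * nsq p x <= levi sigma x (pvec p x) by apply: le_trans hl; rewrite sum4.
have hd := dbar2_ge0 p x.
have /andP[r0 rM] := Hr x Ux.
have g1 := cauchy4 (p i0 x) (p i1 x) (p i2 x) (p i3 x) (HM x i0 Ux) (HM x i1 Ux) (HM x i2 Ux) (HM x i3 Ux).
have HMN i : `|- pd i sigma x| <= M by rewrite normrN; exact: HM.
have g2 := cauchy4 (p i0 x) (p i1 x) (p i2 x) (p i3 x) (HMN i1) (HM x i0 Ux) (HMN i3) (HM x i2 Ux).
have yp := young_pair (opA1 p x) (opA2 p x) c0 M0 g1 g2.
move: yp hl hd; rewrite -/(nsq p x).
have rA : (t - sigma x) * (opA1 p x ^+ 2 + opA2 p x ^+ 2) <= M * (opA1 p x ^+ 2 + opA2 p x ^+ 2) by rewrite ler_wpM2r// addr_ge0// sqr_ge0.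
have rD : 0 <= (t - sigma x) * dbar2 p x by rewrite mulr_ge0// dbar2_ge0.
move: rA rD.
move: (16 * M ^+ 2 / c) (nsq p x) (levi sigma x _) (dbar2 p x) => K N L D.
move: (opA1 p x) (opA2 p x) (opB1 p x) (opB2 p x) (sigma x) => A1 A2 B1 B2 s.
rewrite [- pd i3 sigma x * _]mulNr.
set G1 := (pd i0 sigma x * _ + _ + _ + _); set G2 := (- pd i1 sigma x * _ + _ - _ + _).
move: G1 G2 => G1 G2 h1 h2 h3 h4 h5.
rewrite !oppr0 !mul0r !addr0 ?subr0 ?mulr0 ?addr0.
clear - h1 h2 h3 h4 h5; lra.
Qed.

Lemma bfun2E (s : R) : 0 < s -> bfun 2 s = (s ^- 4 - 2 * s ^- 3) * expR (- s^-1).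
Proof.
move=> s0; rewrite /bfun /bump_p s0; congr (_ * _).
rewrite /= derivC subr0 mulr1 derivXn !hornerE /=; field.
by rewrite gt_eqF.
Qed.

Lemma bfun_tail (u : R) : 1 <= u ->
 [/\ 1 - u^-1 <= bfun 0 u <= 1, `|bfun 1 u| <= u ^- 2 & `|bfun 2 u| <= 3 * u ^- 3].
Proof.
move=> u1; have u0 : 0 < u by apply: lt_leT u1.
have e1 : expR (- u^-1) <= 1 by rewrite -[leRHS]expR0 ler_expR oppr_le0 invr_ge0 ltW.
have e0 : 0 <= expR (- u^-1) by exact: expR_ge0.
have v0 : 0 < u^-1 by rewrite invr_gt0.
have v1 : u^-1 <= 1 by rewrite invf_le1.
split.
- rewrite /bfun /bump_p u0 hornerC mul1r e1 andbT.
 exact: expR_ge1Dx.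
- have w0 : 0 <= u ^- 2 by rewrite invr_ge0 exprn_ge0// ltW.
 by rewrite bfun1E// normrM !ger0_norm// ler_piMr.
- rewrite bfun2E// normrM [`|expR _|]ger0_norm//.
 rewrite -!exprVn; move: (u^-1) v0 v1 e0 e1 => v v0 v1; move: (expR _) => e e0 e1.
 have H : `|v ^+ 4 - 2 * v ^+ 3| <= 3 * v ^+ 3.
  have v3 : 0 <= v ^+ 3 by rewrite exprn_ge0 ?ltW.
  have v4 : v ^+ 4 <= v ^+ 3 by rewrite exprSr ler_piMr.
  have v40 : 0 <= v ^+ 4 by rewrite exprn_ge0 ?ltW.
  rewrite ler_norml; lra.
 by apply: le_trans (ler_pM _ _ H e1) _; rewrite ?mulr1.
Qed.

(** Scale invariant bounds, applied with [s] equal to [k.+1] times the weight; they are therefore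
    uniform in [k]. *)
Lemma cutoff_bounds : exists2 C : R, 0 <= C & forall s : R, 0 < s ->
 [/\ 0 <= bfun 0 (s - 1) <= 1, `|s * bfun 1 (s - 1)| <= C & `|s ^+ 2 * bfun 2 (s - 1)| <= C].
Proof.
have [C1 C10 H1] := @bfun_bound R 1; have [C2 C20 H2] := @bfun_bound R 2.
exists (2 * C1 + 4 * C2 + 12); first by rewrite !addr_ge0// mulr_ge0.
move=> s s0.
have b0 : 0 <= bfun 0 (s - 1) <= 1 by rewrite bfun0_ge0 ltW ?bfun0_lt1.
have [s2|s2] := leP s 2.
 have u1 : s - 1 <= 1 by lra.
 have h1 := H1 _ u1; have h2 := H2 _ u1.
 have S : s ^+ 2 <= 4.
  have -> : 4 = 2 ^+ 2 :> R by ring.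
  by rewrite lerXn2r// nnegrE ltW.
 split => //.
  rewrite normrM (gtr0_norm s0).
  by apply: le_trans (ler_pM (ltW s0) _ s2 h1) _ => //; lra.
 rewrite normrM ger0_norm ?sqr_ge0//.
 by apply: le_trans (ler_pM (sqr_ge0 s) _ S h2) _ => //; lra.
have u1 : 1 <= s - 1 by lra.
have [_ k1 k2] := bfun_tail u1.
have u0 : 0 < s - 1 by lra.
have su : s <= 2 * (s - 1) by lra.
have v1 : (s - 1)^-1 <= 1 by rewrite invf_le1.
split => //; rewrite normrM.
 rewrite (gtr0_norm s0); apply: le_trans (ler_pM (ltW s0) _ su k1) _ => //.
 have -> : 2 * (s - 1) * (s - 1) ^- 2 = 2 * (s - 1)^-1 by field; rewrite gt_eqF.
 lra.
rewrite ger0_norm ?sqr_ge0//.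
have su2 : s ^+ 2 <= (2 * (s - 1)) ^+ 2 by rewrite lerXn2r// nnegrE ltW// mulr_gt0.
apply: le_trans (ler_pM (sqr_ge0 s) _ su2 k2) _ => //.
have -> : (2 * (s - 1)) ^+ 2 * (3 * (s - 1) ^- 3) = 12 * (s - 1)^-1 by field; rewrite gt_eqF.
lra.
Qed.

Lemma near_large (r B : R) : 0 < r -> \forall k \near \oo, B <= k.+1%:R * r.
Proof.
move=> r0; exists (Num.bound (`|B| / r)) => // k /= Nk.
rewrite -ler_pdivrMr//; apply: le_trans (ler_wpM2r _ (ler_norm B)) _; first by rewrite invr_ge0 ltW.
have h0 : 0 <= `|B| / r by rewrite divr_ge0// ltW.
apply: le_trans (ltW (archi_boundP h0)) _; rewrite ler_nat.
exact: leq_trans Nk (leqnSn _).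
Qed.

(** With [r] the weight [t - sigma], and with [L] and [N] the Laplacian and the squared gradient of
    [sigma], this is the pointwise limit of the Laplacians of the cut-off weights. *)
Lemma cutoff_cvg (r L N : R) : 0 < r ->
 (- L * (bfun 0 (k.+1%:R * r - 1) + k.+1%:R * r * bfun 1 (k.+1%:R * r - 1))
  + N * (2 * k.+1%:R * bfun 1 (k.+1%:R * r - 1) + k.+1%:R ^+ 2 * r * bfun 2 (k.+1%:R * r - 1)))
 @[k --> \oo] --> - L.
Proof.
move=> r0; apply/cvgrPdist_le => e e0.
pose B := `|L| * 3 + `|N| / r * 16.
near=> k.
have s2 : 2 <= k.+1%:R * r by near: k; exact: near_large.
have sB : B / e + 1 <= k.+1%:R * r by near: k; exact: near_large.
set a : R := k.+1%:R in s2 sB *.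
have a0 : 0 < a by rewrite ltr0n.
set s := a * r in s2 sB *.
have u1 : 1 <= s - 1 by lra.
have u0 : 0 < s - 1 by lra.
have [/andP[k00 k01] k1 k2] := bfun_tail u1.
have su : s <= 2 * (s - 1) by lra.
have s0 : 0 < s by lra.
have j1 : `|s * bfun 1 (s - 1)| <= 2 * (s - 1)^-1.
 rewrite normrM (gtr0_norm s0); apply: le_trans (ler_pM (ltW s0) _ su k1) _ => //.
 by apply: eqW; field; rewrite gt_eqF.
have j2 : `|s ^+ 2 * bfun 2 (s - 1)| <= 12 * (s - 1)^-1.
 have su2 : s ^+ 2 <= (2 * (s - 1)) ^+ 2 by rewrite lerXn2r// nnegrE ltW// mulr_gt0.
 rewrite normrM ger0_norm ?sqr_ge0//; apply: le_trans (ler_pM (sqr_ge0 s) _ su2 k2) _ => //.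
 by apply: eqW; field; rewrite gt_eqF.
have j0 : `|1 - bfun 0 (s - 1)| <= (s - 1)^-1 by rewrite ger0_norm; lra.
have uB : B * (s - 1)^-1 <= e.
 rewrite ler_pdivrMr//; have : B / e <= s - 1 by lra.
 by rewrite ler_pdivrMr// mulrC.
set b0 := bfun 0 _ in j0 *; set b1 := bfun 1 _ in j1 *; set b2 := bfun 2 _ in j2 *.
have -> : - L - (- L * (b0 + s * b1) + N * (2 * a * b1 + a ^+ 2 * r * b2)) =
  - L * (1 - b0) + L * (s * b1) - N / r * (2 * (s * b1) + s ^+ 2 * b2).
 by rewrite /s; field; rewrite gt_eqF.
apply: le_trans uB.
have EB : B * (s - 1)^-1 = `|L| * (3 * (s - 1)^-1) + `|N| / r * (16 * (s - 1)^-1) by rewrite /B mulrDl -(mulrA `|L|) -(mulrA (`|N| / r)).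
rewrite EB; apply: le_trans (ler_normB _ _) _; apply: lerD.
 apply: le_trans (ler_normD _ _) _; rewrite [`|- L * _|]normrM [`|L * _|]normrM normrN.
 rewrite -mulrDr; apply: ler_wpM2l => //; lra.
rewrite normrM normf_div (gtr0_norm r0); apply: ler_wpM2l; first by rewrite divr_ge0// ltW.
apply: le_trans (ler_normD _ _) _; rewrite [X in X + _]normrM gtr0_norm//; lra.
Unshelve. all: end_near. Qed.

Local Notation e_ i := (basis_vec R i).
Implicit Types (f g : V -> R).

(** A domain with a strictly plurisubharmonic [sigma] and uniform constants. The condition [gd_exh]
    says that the weight [t - sigma] tends to 0 at the boundary, so that its cut-offs have compact
    support. *)
Record good_domain U sigma (t c M : R) : Prop := GoodDomain {
 gd_open : open U;
 gd_fin : (mu U < +oo)%E;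
 gd_smooth : smooth U sigma;
 gd_c : 0 < c;
 gd_M : 0 < M;
 gd_levi : forall x v, U x -> c * \sum_i v i ^+ 2 <= levi sigma x v;
 gd_r : forall x, U x -> 0 < t - sigma x <= M;
 gd_d1 : forall x i, U x -> `|pd i sigma x| <= M;
 gd_d2 : forall x i j, U x -> `|pd i (pd j sigma) x| <= M;
 gd_exh : forall d, 0 < d -> exists K, [/\ compact K, K `<=` U &
  forall x, U x -> d <= t - sigma x -> K x] }.

Lemma restrict_test U (K : set V) f : open U -> smooth U f -> compact K -> K `<=` U ->
 (forall x, U x -> ~ K x -> f x = 0) -> tfun U (f \_ U).
Proof.
move=> oU sf cK KU H; split; last first.
 exists K; split => // x nK; rewrite patchE; case: ifPn => //; rewrite inE => Ux.
 exact: H.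
have oK : open (~` K).
 apply: closed_openC; apply: compact_closed => //; exact: norm_hausdorff.
move=> k l lk x _; have [Ux|nUx] := pselect (U x).
 have C : Ck k U (f \_ U) by apply: Ck_eq (sf k) => // y Uy; rewrite patchE mem_set.
 exact: C.
have nK : ~ K x by move=> /KU.
apply: (@Ck_near _ _ k (~` K) (fun=> 0)) => //; last exact: Ck_cst.
move=> y nKy; have : nbhs y (~` K) by exact: open_nb.
apply: filterS => z nKz; rewrite patchE; case: ifPn => //; rewrite inE => Uz.
by rewrite H.
Qed.

Lemma lap_near f g x : (\forall y \near x, f y = g y) -> lap f x = lap g x.
Proof.
move=> E; apply: eq_bigr => i _; apply: pd_near.
exact: (partial_near [:: i] E).
Qed.

(** The weight, cut off where it is at most [1 / k.+1]: test functions that increase to the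
    weight. *)
Definition cutf sigma t (k : nat) x : R :=
 (t - sigma x) * bfun 0 (k.+1%:R * (t - sigma x) - 1).

Lemma pd2_cutf U sigma t k i x : open U -> smooth U sigma -> U x ->
 pd i (pd i (cutf sigma t k)) x =
 - pd i (pd i sigma) x * (bfun 0 (k.+1%:R * (t - sigma x) - 1)
   + k.+1%:R * (t - sigma x) * bfun 1 (k.+1%:R * (t - sigma x) - 1))
 + pd i sigma x ^+ 2 * (2 * k.+1%:R * bfun 1 (k.+1%:R * (t - sigma x) - 1)
   + k.+1%:R ^+ 2 * (t - sigma x) * bfun 2 (k.+1%:R * (t - sigma x) - 1)).
Proof.
move=> oU ss Ux; set a : R := k.+1%:R.
have Hs y : U y -> is_derive y (e_ i) sigma (pd i sigma y) by move=> Uy; apply: isd_pd; exact: (@Ck_pder _ _ 0 U _ (ss 1%N)).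
have Hr y : U y -> is_derive y (e_ i) (fun y => t - sigma y) (- pd i sigma y).
 by move=> Uy; rewrite -[- pd i sigma y]sub0r; apply: isdB (isd_cst _ _ _) (Hs y Uy).
have Hq y : U y -> is_derive y (e_ i) (fun y => a * (t - sigma y) - 1) (- (a * pd i sigma y)).
 move=> Uy; have := isdB (isdZ a (Hr y Uy)) (isd_cst y (e_ i) 1).
 by move/isd_eq; apply; rewrite subr0 mulrN.
have Hb j y : U y -> is_derive y (e_ i) (fun y => bfun j (a * (t - sigma y) - 1))
  (bfun j.+1 (a * (t - sigma y) - 1) * - (a * pd i sigma y)).
 by move=> Uy; exact: isd_comp1 (isd_bfunk j _) (Hq y Uy).
have E1 y : U y -> pd i (cutf sigma t k) y = - pd i sigma y *
  (bfun 0 (a * (t - sigma y) - 1) + a * (t - sigma y) * bfun 1 (a * (t - sigma y) - 1)).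
 move=> Uy; rewrite (pdE (isdM (Hr y Uy) (Hb 0%N y Uy))).
 move: (bfun 0 _) (bfun 1 _) (pd i sigma y) => b0 b1 d; ring.
have N : \forall y \near x, pd i (cutf sigma t k) y = - pd i sigma y *
  (bfun 0 (a * (t - sigma y) - 1) + a * (t - sigma y) * bfun 1 (a * (t - sigma y) - 1)).
 have := open_nb (conj oU Ux); apply: filterS => y Uy; exact: E1.
rewrite (pd_near i N); apply: pdE.
have Hd : is_derive x (e_ i) (fun y => - pd i sigma y) (- pd i (pd i sigma) x).
 by apply: isdN; apply: isd_pd; exact: (@Ck_pder _ _ 0 U _ (@smooth_pd _ _ _ _ i ss 1%N)).
have := isdM Hd (isdD (Hb 0%N x Ux) (isdM (isdZ a (Hr x Ux)) (Hb 1%N x Ux))).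
move/isd_eq; apply.
move: (pd i (pd i sigma) x) (pd i sigma x) => d2 d1.
move: (bfun 0 _) (bfun 1 _) (bfun 2 _) => b0 b1 b2; ring.
Qed.

Lemma lap_cutf U sigma t k x : open U -> smooth U sigma -> U x ->
 lap (cutf sigma t k) x =
 - lap sigma x * (bfun 0 (k.+1%:R * (t - sigma x) - 1)
   + k.+1%:R * (t - sigma x) * bfun 1 (k.+1%:R * (t - sigma x) - 1))
 + (\sum_i pd i sigma x ^+ 2) * (2 * k.+1%:R * bfun 1 (k.+1%:R * (t - sigma x) - 1)
   + k.+1%:R ^+ 2 * (t - sigma x) * bfun 2 (k.+1%:R * (t - sigma x) - 1)).
Proof.
move=> oU ss Ux.
transitivity (\sum_i (- pd i (pd i sigma) x * (bfun 0 (k.+1%:R * (t - sigma x) - 1)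
   + k.+1%:R * (t - sigma x) * bfun 1 (k.+1%:R * (t - sigma x) - 1))
 + pd i sigma x ^+ 2 * (2 * k.+1%:R * bfun 1 (k.+1%:R * (t - sigma x) - 1)
   + k.+1%:R ^+ 2 * (t - sigma x) * bfun 2 (k.+1%:R * (t - sigma x) - 1)))).
 by apply: eq_bigr => i _; exact: (pd2_cutf t k i oU ss Ux).
rewrite big_split -!mulr_suml; congr (_ * _ + _).
by rewrite sumrN.
Qed.

Lemma cutf_smooth U sigma t k : open U -> smooth U sigma -> smooth U (cutf sigma t k).
Proof.
move=> oU ss; have sr : smooth U (fun x => t - sigma x).
 by apply: smoothB; [exact: oU|exact: smooth_cst|exact: ss].
apply: smoothM; [exact: oU|exact: sr|].
apply: bfun_comp; [exact: oU|].
apply: smoothB; [exact: oU| |exact: smooth_cst].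
by apply: smoothZ; [exact: oU|exact: sr].
Qed.

Lemma cutf_test U sigma t c M k : good_domain U sigma t c M ->
 tfun U (cutf sigma t k \_ U).
Proof.
move=> gd; have oU := gd_open gd; have k0 : 0 < k.+1%:R^-1 :> R by rewrite invr_gt0.
have [K [cK KU HK]] := gd_exh gd k0; apply: (restrict_test oU) cK KU _.
 exact: cutf_smooth oU (gd_smooth gd).
move=> x Ux nK; rewrite /cutf bfun_le0 ?mulr0// subr_le0 -ler_pdivlMl// mulr1.
by rewrite leNgt; apply/negP => /ltW /(HK x Ux).
Qed.

(** The Laplacian is the sum of the values of [levi] on the two complex coordinate directions. *)
Lemma lap_sigma_ge U sigma t c M x : good_domain U sigma t c M -> U x -> 2 * c <= lap sigma x.
Proof.
move=> gd Ux; have H := gd_levi gd; have oU := gd_open gd.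
have ss := gd_smooth gd; have C2 : Ck 2 U sigma by exact: ss.
pose v0 : 'I_4 -> R := fun i => (i == i0)%:R; pose v2 : 'I_4 -> R := fun i => (i == i2)%:R.
have e0 := leviE (fun i (_ : V) => v0 i) oU C2 Ux.
have e2 := leviE (fun i (_ : V) => v2 i) oU C2 Ux.
have h0 := H x _ Ux; have h2 := h0 (pvec (fun i (_ : V) => v2 i) x).
have {}h0 := h0 (pvec (fun i (_ : V) => v0 i) x).
rewrite e0 in h0; rewrite e2 in h2; move: h0 h2.
rewrite !sum4 /lap sum4 /pvec /v0 /v2; clear; gen_pd; rewrite /=.
rewrite ?mulr0n ?mulr1n ?mulr0 ?mul0r ?expr0n ?expr1n /= ?mulr1n ?mulr0n ?addr0 ?add0r ?subr0 ?mulr0 ?addr0 ?mulr1.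
move=> h0 h2; lra.
Qed.

Lemma cutf_lap_bound U sigma t c M : good_domain U sigma t c M ->
 exists2 C, 0 <= C & forall k x, U x -> `|lap (cutf sigma t k) x| <= C / (t - sigma x).
Proof.
move=> gd; have oU := gd_open gd; have M0 := gd_M gd.
have [C C0 HC] := @cutoff_bounds.
exists (4 * M * (1 + C) * M + 4 * M ^+ 2 * (3 * C)).
 by rewrite !addr_ge0 ?mulr_ge0 ?addr_ge0 ?sqr_ge0// ltW.
move=> k x Ux; rewrite (lap_cutf t k oU (gd_smooth gd) Ux).
have /andP[r0 rM] := gd_r gd Ux.
have L : `|lap sigma x| <= 4 * M.
 rewrite /lap sum4; have D i := gd_d2 gd i i Ux.
 have := (D i0, D i1, D i2, D i3); gen_pd => -[[[]]]; rewrite !ler_norml; lra.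
have N : `|\sum_i pd i sigma x ^+ 2| <= 4 * M ^+ 2.
 rewrite ger0_norm; last by apply: sumr_ge0 => i _; exact: sqr_ge0.
 have D i : pd i sigma x ^+ 2 <= M ^+ 2.
  rewrite -[leLHS]real_normK ?num_real// lerXn2r ?nnegrE ?(ltW M0)//; exact: (gd_d1 gd i Ux).
 rewrite sum4; have := (D i0, D i1, D i2, D i3); gen_pd => -[[[]]]; lra.
set r := t - sigma x in r0 rM *; set a : R := k.+1%:R.
have a0 : 0 < a by rewrite ltr0n.
have ar : 0 < a * r by rewrite mulr_gt0.
have [/andP[k00 k01] k1 k2] := HC _ ar.
move: (lap sigma x) (\sum_i _) L N => L N hL hN.
set b0 := bfun 0 _ in k00 k01 *; set b1 := bfun 1 _ in k1 *; set b2 := bfun 2 _ in k2 *.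
apply: le_trans (ler_normD _ _) _; rewrite [leRHS]mulrDl; apply: lerD.
 rewrite normrM normrN; apply: (@le_trans _ _ (4 * M * (1 + C))).
  apply: ler_pM => //; apply: le_trans (ler_normD _ _) _.
  by rewrite (ger0_norm k00); exact: (lerD k01 k1).
 rewrite -[leRHS]mulrA ler_peMr ?mulr_ge0 ?addr_ge0 ?(ltW M0)//.
 by rewrite ler_pdivlMr// mul1r.
have -> : 2 * a * b1 + a ^+ 2 * r * b2 = (2 * (a * r * b1) + (a * r) ^+ 2 * b2) / r by field; rewrite gt_eqF.
rewrite normrM normf_div (gtr0_norm r0) [leLHS]mulrA ler_pM2r ?invr_gt0//.
apply: ler_pM => //; apply: le_trans (ler_normD _ _) _.
rewrite [X in X + _]normrM gtr0_norm//; lra.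
Qed.

(** [v ^ 2] is subharmonic, so its integrals against the Laplacians of the cut-off weights are
    nonnegative. These Laplacians are bounded by a multiple of the inverse weight, hence dominated
    convergence makes the integral of [v ^ 2 * - lap sigma] nonnegative, while
    [lap sigma >= 2 * c]. *)
Lemma harm_weighted0 U sigma t c M v : good_domain U sigma t c M -> harm U v ->
 integ U (fun x => v x ^+ 2 / (t - sigma x)) -> forall x, U x -> v x = 0.
Proof.
move=> gd hv iv; have oU := gd_open gd; have mU := open_meas oU.
have sv := harm_smooth oU hv; have ss := gd_smooth gd.
have Cc : forall (g : V -> R), smooth U g -> Ck 0 U (lap g).
 move=> g sg; apply: Ck_sum => // i _; exact: (@smooth_pd _ _ _ _ i (smooth_pd i sg) 0%N).
have sv2 : smooth U (fun x => v x ^+ 2) by exact: smoothX.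
have lv2 x : U x -> lap (fun x => v x ^+ 2) x = 2 * \sum_i pd i v x ^+ 2.
 move=> Ux.
 have Dv i y : U y -> is_derive y (e_ i) v (pd i v y) by move=> Uy; apply: isd_pd; exact: (@Ck_pder _ _ 0 U _ (sv 1%N)).
 have E i : pd i (pd i (fun x => v x ^+ 2)) x = 2 * pd i v x ^+ 2 + 2 * v x * pd i (pd i v) x.
  have E1 y : U y -> pd i (fun x => v x ^+ 2) y = 2 * v y * pd i v y by move=> Uy; rewrite (pdE (isdX 2 (Dv i y Uy))) expr1.
  have N : \forall y \near x, pd i (fun x => v x ^+ 2) y = 2 * v y * pd i v y by have := open_nb (conj oU Ux); apply: filterS.
  rewrite (pd_near i N); apply: pdE.
  have D2 : is_derive x (e_ i) (pd i v) (pd i (pd i v) x) by apply: isd_pd; exact: (@Ck_pder _ _ 0 U _ (@smooth_pd _ _ _ _ i sv 1%N)).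
  have := isdM (isdZ 2 (Dv i x Ux)) D2; move/isd_eq; apply.
  by rewrite expr2 mulrA.
 rewrite /lap (eq_bigr _ (fun i _ => E i)) big_split/= -!mulr_sumr.
 by have := hv.2 x Ux; rewrite /lap => ->; rewrite mulr0 addr0.
have [C C0 HC] := cutf_lap_bound gd.
pose F k x := v x ^+ 2 * lap (cutf sigma t k) x.
have Fpos k : 0 <= \int[mu]_(x in U) F k x.
 have tk := cutf_test k gd.
 have lk x : U x -> v x ^+ 2 * lap (cutf sigma t k \_ U) x = F k x.
  move=> Ux; rewrite (@lap_near _ (cutf sigma t k))//.
  have := open_nb (conj oU Ux); apply: filterS => y Uy.
  by rewrite patchE mem_set.
 rewrite -(eq_Rint lk) (lap_by_parts oU (sv2 2%N) tk).
 apply: Rintegral_ge0 => x Ux; rewrite (lv2 x Ux) patchE mem_set//.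
 rewrite !mulr_ge0 ?bfun0_ge0//; first by apply: sumr_ge0 => i _; exact: sqr_ge0.
 by have /andP[/ltW] := gd_r gd Ux.
have mv : mfun U (fun x => v x ^+ 2) by exact: Ck_meas (sv2 0%N).
have mF k : mfun U (F k).
 apply: mfunM => //.
 exact: (Ck_meas oU (Cc _ (cutf_smooth t k oU ss))).
pose G x := v x ^+ 2 * - lap sigma x.
have mG : mfun U G.
 apply: mfunM => //.
 exact: (Ck_meas oU (CkN oU (Cc _ ss))).
have L : (\int[mu]_(x in U) (F k x)%:E @[k --> \oo] --> \int[mu]_(x in U) (G x)%:E)%E.
 apply: (@dominated_cvg _ _ _ _ _ _ _ _ (fun x => (C * (v x ^+ 2 / (t - sigma x)))%:E)) => //.
 - by move=> k; apply/EFin_meas.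
 - move=> x Ux; apply: cvg_EFin; first by near=> k.
  rewrite /F /G /=; apply: cvgM; first exact: cvg_cst.
  under eq_fun do rewrite (lap_cutf _ _ oU ss Ux).
  by apply: cutoff_cvg; have /andP[] := gd_r gd Ux.
 - exact: integZ.
 - move=> k x Ux; rewrite lee_fin normrM ger0_norm ?sqr_ge0//.
  by rewrite mulrCA ler_wpM2l ?sqr_ge0//; exact: HC.
have Gi : integ U G.
 apply: (@integ_le _ _ _ _ (fun x => (4 * M) * M * (v x ^+ 2 / (t - sigma x)))) => //; last exact: integZ.
 move=> x Ux; rewrite /G normrM normrN ger0_norm ?sqr_ge0// mulrCA ler_wpM2l ?sqr_ge0//.
 have /andP[r0 rM] := gd_r gd Ux.
 apply: (@le_trans _ _ (4 * M)); last first.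
  by rewrite -[leRHS]mulrA ler_peMr ?mulr_ge0 ?(ltW (gd_M gd))// ler_pdivlMr// mul1r.
 rewrite /lap sum4; have D i := gd_d2 gd i i Ux.
 have := (D i0, D i1, D i2, D i3); clear; gen_pd => -[[[]]]; rewrite !ler_norml; lra.
have Fi k : integ U (F k).
 apply: (@integ_le _ _ _ _ (fun x => C * (v x ^+ 2 / (t - sigma x)))) => //; last exact: integZ.
 move=> x Ux; rewrite normrM ger0_norm ?sqr_ge0//.
 by rewrite mulrCA ler_wpM2l ?sqr_ge0//; exact: HC.
have G0 : 0 <= \int[mu]_(x in U) G x.
 apply: fine_ge0; apply: (@cvge_ge _ \oo _ _ _ _ _ _ L).
 near=> k; rewrite -[X in (_ <= X)%E]fineK ?integrable_fin_num ?lee_fin//; first exact: Fpos.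
 exact: (Fi k).
have iv2 : integ U (fun x => v x ^+ 2).
 apply: (@integ_le _ _ _ _ (fun x => M * (v x ^+ 2 / (t - sigma x)))) => //; last exact: integZ.
 move=> x Ux; have /andP[r0 rM] := gd_r gd Ux.
 by rewrite ger0_norm ?sqr_ge0// mulrCA ler_peMr ?sqr_ge0// ler_pdivlMr// mul1r.
have Lv : L2 U v by apply: integ_L2 => //; exact: Ck_meas (sv 0%N).
have Z : L2n U v = 0.
 apply/eqP; rewrite eq_le L2n_ge0 andbT.
 have c20 : 0 < 2 * c by rewrite mulr_gt0// (gd_c gd).
 rewrite -(ler_pM2l c20) mulr0 /L2n -RintegralZl//.
 apply: (@le_trans _ _ (- \int[mu]_(x in U) G x)); last by rewrite oppr_le0.
 rewrite -mulN1r -RintegralZl//; apply: le_Rintegral => //; [exact: integZ|exact: integZ|].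
 move=> x Ux; rewrite /G mulN1r mulrN opprK mulrC ler_wpM2l ?sqr_ge0//.
 exact: lap_sigma_ge gd Ux.
move=> x Ux; apply: (@ae_cont_eq _ _ U v (fun=> 0)) => //.
- exact: (Ck_cont (sv 0%N)).
- by move=> y _; exact: cst_continuous.
- exact: L2n_eq0.
Unshelve. all: end_near. Qed.

Implicit Types (q : 'I_4 -> V -> R).

Lemma integ_L2_fin U (u : V -> R) : measurable U -> (mu U < +oo)%E -> L2 U u -> integ U u.
Proof.
move=> mU Uoo Lu; apply: (@integ_le _ _ _ _ (fun x => 1 + u x ^+ 2)) => //; first by case: Lu.
 move=> x _; have := sqr_ge0 (`|u x| - 1); rewrite sqrrB mulr1 real_normK ?num_real// expr1n.
 by have := normr_ge0 (u x); move: `|u x| => a; have := sqr_ge0 (u x); move: (u x ^+ 2) => b; lra.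
apply: integD => //; last exact: L2_integ.
by apply: (@integ_bd _ _ _ _ 1) => // x _; rewrite normr1.
Qed.

(** * Density of Laplacians in the weighted L2 space *)

Section weighted.
Context (U : set V) (sigma : V -> R) (t c M : R) (gd : good_domain U sigma t c M).

Let oU := gd_open gd.
Let mU := open_meas (gd_open gd).
Let r x := t - sigma x.
Let w x := Num.sqrt (r x).

Lemma gd_mr : mfun U r.
Proof.
apply: (@Ck_meas _ _ 0) => //; apply: CkB => //; first exact: Ck_cst.
exact: (gd_smooth gd).
Qed.

Lemma gd_cw x : U x -> {for x, continuous w}.
Proof.
move=> Ux; apply: continuous_comp; last exact: sqrt_continuous.
have : Ck 0 U r by apply: CkB => //; [exact: Ck_cst|exact: (gd_smooth gd)].
by move=> /Ck_cont; apply.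
Qed.

Lemma gd_mw : mfun U w.
Proof. by apply: open_cont_meas => // x; exact: gd_cw. Qed.

Lemma gd_w x : U x -> 0 < w x /\ w x ^+ 2 = r x.
Proof.
move=> Ux; have /andP[r0 _] := gd_r gd Ux.
by rewrite sqrtr_gt0 r0 sqr_sqrtr ?ltW.
Qed.

Lemma wharm_weighted0 K : L2 U (fun x => K x / w x) -> mfun U K -> wharm U K ->
 {ae mu, forall x, U x -> K x = 0}.
Proof.
move=> LK mK wK; have M0 := gd_M gd.
have LK2 : L2 U K.
 apply: integ_L2 => //; apply: (@integ_le _ _ _ _ (fun x => M * (K x / w x) ^+ 2)) => //.
 - exact: mfunX.
 - move=> x Ux; have [w0 w2] := gd_w Ux; have /andP[r0 rM] := gd_r gd Ux.
  rewrite ger0_norm ?sqr_ge0// expr_div_n w2 mulrCA ler_peMr ?sqr_ge0//.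
  by rewrite ler_pdivlMr// mul1r.
 - by apply: integZ => //; exact: L2_integ.
have [v [hv Ev]] := weyl oU (integ_L2_fin mU (gd_fin gd) LK2) wK.
have mv : mfun U v by exact: Ck_meas hv.1.
have Lv : L2 U (fun x => v x / w x).
 have [] := @L2_ae _ _ U (fun x => K x / w x) (fun x => v x / w x) mU LK _ _ => //.
  apply: mfunM => //; apply: open_cont_meas => // x Ux.
  have [w0 _] := gd_w Ux; exact: cvgV (lt0r_neq0 w0) (gd_cw Ux).
 by apply: filterS Ev => x H Ux; rewrite H.
have v0 : forall x, U x -> v x = 0.
 apply: (harm_weighted0 gd hv); have := L2_integ mU Lv.
 apply: eq_integ => // x Ux; have [w0 w2] := gd_w Ux.
 by rewrite expr_div_n w2.
by apply: filterS Ev => x H Ux; rewrite H// v0.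
Qed.

Lemma lap_lin (k : R) g h x : tfun U g -> tfun U h ->
 lap (fun x => k * g x + h x) x = k * lap g x + lap h x.
Proof.
move=> tg th; rewrite /lap mulr_sumr -big_split; apply: eq_bigr => i _.
have E : pd i (fun x => k * g x + h x) = fun y => k * pd i g y + pd i h y.
 apply/funext => y; apply: pdE; apply: isdD.
  by apply: isdZ; apply: isd_pd; exact: test_pder tg.
 by apply: isd_pd; exact: test_pder th.
rewrite E; apply: pdE; apply: isdD.
 by apply: isdZ; apply: isd_pd; exact: test_pder (test_pd i tg).
by apply: isd_pd; exact: test_pder (test_pd i th).
Qed.

Lemma lap_test g : tfun U g -> tfun U (lap g).
Proof.
move=> tg; rewrite (_ : lap g = fun x => pd i0 (pd i0 g) x + pd i1 (pd i1 g) x + pd i2 (pd i2 g) x + pd i3 (pd i3 g) x).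
 by do 3 (apply: testD; last by do 2 apply: test_pd); do 2 apply: test_pd.
by apply/funext => x; rewrite /lap sum4.
Qed.

Lemma w_test_L2 f : tfun U f -> L2 U (fun x => w x * f x).
Proof.
move=> tf; apply: integ_L2 => //.
 apply: mfunM; first exact: gd_mw.
 by apply: integ_fun; exact: test_integ tf.
have Cr : Ck 0 U r by apply: CkB => //; [exact: Ck_cst|exact: (gd_smooth gd)].
have := Ck_integ2 oU Cr tf tf.
apply: eq_integ => // x Ux; have [_ w2] := gd_w Ux.
by rewrite exprMn w2 expr2.
Qed.

(** Let [v] be the projection of [w * f] on the closure of the functions [w * lap g], where
    [w ^ 2 = r]. Then [K = r * f - w * v] is weakly harmonic and [K / w] is square integrable; such
    a [K] vanishes, so [v = w * f]. *)
Lemma laplacian_dense f d : tfun U f -> 0 < d -> exists g, tfun U g /\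
 \int[mu]_(x in U) (r x * (lap g x - f x) ^+ 2) <= d.
Proof.
move=> tf d0.
pose X : lmodType R := V -> R^o.
pose P (g : X) := tfun U g.
pose L (g : X) (_ : 'I_1) x : R := w x * lap g x.
pose ell (g : X) : R := ip U (fun x => w x * lap g x) (fun x => w x * f x).
have Lf := w_test_L2 tf.
have LL g : P g -> L2 U (fun x => w x * lap g x) by move=> tg; apply: w_test_L2; exact: lap_test.
have Plin (k : R) (g h : X) : P g -> P h -> P (k *: g + h) by move=> tg th; apply: testD => //; exact: testZ.
have Llin (k : R) (g h : X) : P g -> P h -> forall (i : 'I_1) x, L (k *: g + h) i x = k * L g i x + L h i x.
 move=> tg th i x; change (w x * lap (fun x => k * g x + h x) x = k * (w x * lap g x) + w x * lap h x).
 by rewrite (lap_lin k x tg th) mulrDr mulrCA.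
have elin (k : R) (g h : X) : P g -> P h -> ell (k *: g + h) = k * ell g + ell h.
 move=> tg th; rewrite /ell -(ipZl k mU (LL g tg) Lf) -ipDl//; last 2 first.
 - exact: L2Z (LL g tg).
 - exact: LL.
 by apply: eq_Rint => x _; congr (_ * _); exact: (Llin k g h tg th ord0 x).
have bnd (g : X) : P g -> ell g ^+ 2 <= L2n U (fun x => w x * f x) * L2vn U (L g).
 by move=> tg; rewrite /L2vn big_ord1 mulrC; apply: L2_CS => //; exact: LL.
have [v [s [Lv _ Ev Ps Hs]]] := @riesz_subspace R 4 1 X P U L ell _ mU (L2n_ge0 _ _)
 (test0 U) Plin (fun g tg i => LL g tg) Llin elin bnd.
pose K x := r x * f x - w x * v ord0 x.
have LKw : L2 U (fun x => K x / w x).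
 apply: (@eq_L2 _ _ _ (fun x => w x * f x - v ord0 x)); last by apply: L2B => //; exact: Lv.
 move=> x Ux; have [w0 w2] := gd_w Ux; rewrite /K -w2; field.
 by rewrite gt_eqF.
have mf : mfun U f by apply: integ_fun; exact: test_integ tf.
have mK : mfun U K by apply: mfunB; apply: mfunM => //; [exact: gd_mr|exact: gd_mw|case: (Lv ord0)].
have wK : wharm U K.
 move=> g tg; have := Ev g tg; rewrite /ipv big_ord1 /ell /ip => /eqP; rewrite -subr_eq0 => /eqP <-.
 rewrite -RintegralB//; last 2 first.
 - by apply: L2_mul => //; exact: LL.
 - by apply: L2_mul => //; exact: LL.
 apply: eq_Rint => x Ux; have [_ w2] := gd_w Ux; rewrite /K /L -w2; ring.
have K0 := wharm_weighted0 LKw mK wK.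
have [N HN] := Hs d d0.
exists (s N); split; first exact: Ps.
have := HN N (leqnn N); rewrite /L2vn big_ord1; apply: le_trans.
apply: eqW.
have mlg : mfun U (lap (s N)) by apply: integ_fun; exact: test_integ (lap_test (Ps N)).
have mv : mfun U (v ord0) by case: (Lv ord0).
apply: Rint_ae => //.
- apply: mfunM; first exact: gd_mr.
 by apply: mfunX; exact: mfunB.
- by apply: mfunX; apply: mfunB => //; apply: mfunM => //; exact: gd_mw.
- apply: filterS K0 => x H Ux; have := H Ux; rewrite /K /L.
 have [w0 w2] := gd_w Ux; rewrite -w2 => /eqP; rewrite subr_eq0 => /eqP E.
 have -> : v ord0 x = w x * f x by apply: (mulfI (lt0r_neq0 w0)); rewrite -E; ring.
 ring.
Qed.

End weighted.

(* A parametrization of the kernel of [(opA1, opA2)]. *)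
Definition th (g0 g1 : V -> R) (i : 'I_4) : V -> R :=
 if i == i0 then fun x => pd i2 g0 x + pd i3 g1 x
 else if i == i1 then fun x => pd i2 g1 x - pd i3 g0 x
 else if i == i2 then fun x => -1 * pd i0 g0 x - pd i1 g1 x
 else fun x => pd i1 g0 x - pd i0 g1 x.

Lemma th_test U g0 g1 : tfun U g0 -> tfun U g1 -> testv U (th g0 g1).
Proof.
move=> t0 t1; have T0 i := test_pd i t0; have T1 i := test_pd i t1.
apply: ord4P.
- by rewrite /th /=; apply: testD.
- by rewrite /th /=; apply: testB.
- by rewrite /th /=; apply: testB => //; exact: testZ.
- by rewrite /th /=; apply: testB.
Qed.

Lemma lap4 f x : lap f x = pd i0 (pd i0 f) x + pd i1 (pd i1 f) x + pd i2 (pd i2 f) x + pd i3 (pd i3 f) x.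
Proof. exact: (sum4 (fun i => pd i (pd i f) x)). Qed.

Lemma th_ops_aux U g0 g1 p x : tfun U g0 -> tfun U g1 ->
 p i0 = (fun x => pd i2 g0 x + pd i3 g1 x) -> p i1 = (fun x => pd i2 g1 x - pd i3 g0 x) ->
 p i2 = (fun x => -1 * pd i0 g0 x - pd i1 g1 x) -> p i3 = (fun x => pd i1 g0 x - pd i0 g1 x) ->
 [/\ opA1 p x = 0, opA2 p x = 0, opB1 p x = - lap g0 x & opB2 p x = - lap g1 x].
Proof.
move=> t0 t1 p0 p1 p2 p3.
have D0 i j : is_derive x (e_ i) (pd j g0) (pd i (pd j g0) x) by apply: isd_pd; exact: test_pder (test_pd j t0).
have D1 i j : is_derive x (e_ i) (pd j g1) (pd i (pd j g1) x) by apply: isd_pd; exact: test_pder (test_pd j t1).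
have C0 a b := pd_test_pd a b x t0; have C1 a b := pd_test_pd a b x t1.
rewrite /opA1 /opA2 /opB1 /opB2 p0 p1 p2 p3.
have E0 i : pd i (fun x => pd i2 g0 x + pd i3 g1 x) x = pd i (pd i2 g0) x + pd i (pd i3 g1) x := pdE (isdD (D0 i i2) (D1 i i3)).
have E1 i : pd i (fun x => pd i2 g1 x - pd i3 g0 x) x = pd i (pd i2 g1) x - pd i (pd i3 g0) x := pdE (isdB (D1 i i2) (D0 i i3)).
have E2 i : pd i (fun x => -1 * pd i0 g0 x - pd i1 g1 x) x = -1 * pd i (pd i0 g0) x - pd i (pd i1 g1) x := pdE (isdB (isdZ (-1) (D0 i i0)) (D1 i i1)).
have E3 i : pd i (fun x => pd i1 g0 x - pd i0 g1 x) x = pd i (pd i1 g0) x - pd i (pd i0 g1) x := pdE (isdB (D0 i i1) (D1 i i0)).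
rewrite (lap4 g0) (lap4 g1).
move: (E0 i0) (E0 i1) (E0 i2) (E0 i3) (E1 i0) (E1 i1) (E1 i2) (E1 i3)
 (E2 i0) (E2 i1) (E2 i2) (E2 i3) (E3 i0) (E3 i1) (E3 i2) (E3 i3)
 (C0 i1 i0) (C0 i2 i0) (C0 i3 i0) (C0 i2 i1) (C0 i3 i1) (C0 i3 i2)
 (C1 i1 i0) (C1 i2 i0) (C1 i3 i0) (C1 i2 i1) (C1 i3 i1) (C1 i3 i2).
by clear; gen_pd; intros; subst; split; ring.
Qed.

Lemma th_ops U g0 g1 x : tfun U g0 -> tfun U g1 ->
 [/\ opA1 (th g0 g1) x = 0, opA2 (th g0 g1) x = 0,
   opB1 (th g0 g1) x = - lap g0 x & opB2 (th g0 g1) x = - lap g1 x].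
Proof. by move=> t0 t1; apply: th_ops_aux t0 t1 _ _ _ _; reflexivity. Qed.

Lemma ops_add U p q x : testv U p -> testv U q ->
 let s := fun i x => p i x + q i x in
 [/\ opA1 s x = opA1 p x + opA1 q x, opA2 s x = opA2 p x + opA2 q x,
   opB1 s x = opB1 p x + opB1 q x & opB2 s x = opB2 p x + opB2 q x].
Proof.
move=> tp tq s; have E i j : pd i (s j) x = pd i (p j) x + pd i (q j) x.
 by apply: pdE; apply: isdD; apply: isd_pd; [exact: test_pder (tp j)|exact: test_pder (tq j)].
rewrite /opA1 /opA2 /opB1 /opB2.
move: (E i0 i0) (E i0 i1) (E i0 i2) (E i0 i3) (E i1 i0) (E i1 i1) (E i1 i2) (E i1 i3)
 (E i2 i0) (E i2 i1) (E i2 i2) (E i2 i3) (E i3 i0) (E i3 i1) (E i3 i2) (E i3 i3).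
by clear; gen_pd; intros; subst; split; ring.
Qed.

Lemma ops_scale U (k : R) p x : testv U p ->
 let s := fun i x => k * p i x in
 [/\ opA1 s x = k * opA1 p x, opA2 s x = k * opA2 p x,
   opB1 s x = k * opB1 p x & opB2 s x = k * opB2 p x].
Proof.
move=> tp s; have E i j : pd i (s j) x = k * pd i (p j) x.
 by apply: pdE; apply: isdZ; apply: isd_pd; exact: test_pder (tp j).
rewrite /opA1 /opA2 /opB1 /opB2.
move: (E i0 i0) (E i0 i1) (E i0 i2) (E i0 i3) (E i1 i0) (E i1 i1) (E i1 i2) (E i1 i3)
 (E i2 i0) (E i2 i1) (E i2 i2) (E i2 i3) (E i3 i0) (E i3 i1) (E i3 i2) (E i3 i3).
by clear; gen_pd; intros; subst; split; ring.
Qed.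

Definition opAv p (i : 'I_2) : V -> R := if i == ord0 then opA1 p else opA2 p.

Lemma opAv_test U p i : testv U p -> tfun U (opAv p i).
Proof. by move=> /opA_test[t1 t2]; rewrite /opAv; case: ifP. Qed.

Lemma testv_L2v U p : open U -> testv U p -> L2v U p.
Proof. by move=> oU tp i; apply: test_L2 (tp i); exact: open_meas. Qed.

Lemma L2vn_nsq U p : open U -> testv U p -> L2vn U p = \int[mu]_(x in U) nsq p x.
Proof.
move=> oU tp; have mU := open_meas oU; have I i := test_L2_int oU (tp i).
have I1 := integD mU (I i0) (I i1); have I2 := integD mU I1 (I i2).
by rewrite /L2vn sum4 /L2n -(RintegralD mU (I i0) (I i1)) -(RintegralD mU I1 (I i2)) -(RintegralD mU I2 (I i3)).
Qed.

Lemma L2vn_opAv U p : open U -> testv U p ->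
 L2vn U (opAv p) = \int[mu]_(x in U) (opA1 p x ^+ 2 + opA2 p x ^+ 2).
Proof.
move=> oU tp; have mU := open_meas oU; have [t1 t2] := opA_test tp.
rewrite /L2vn big_ord_recl big_ord1 /L2n -RintegralD//; exact: test_L2_int.
Qed.

Definition solve_cst (c M : R) := 2 / c * (M + 16 * M ^+ 2 / c).

(** [p] is changed by some [th g0 g1], which [opA] kills, which is orthogonal to [e], and on which
    [opB] is minus the Laplacians of [g0] and [g1]. By density the weighted [opB] part of the
    changed form is as small as desired, and only [opA p] remains in the basic inequality. *)
Lemma solve_bound U sigma t c M e p : good_domain U sigma t c M -> L2v U e ->
 (forall g0 g1, tfun U g0 -> tfun U g1 -> ipv U e (th g0 g1) = 0) ->
 testv U p -> ipv U e p ^+ 2 <= solve_cst c M * L2vn U e * L2vn U (opAv p).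
Proof.
move=> gd Le cl tp; have oU := gd_open gd; have mU := open_meas oU.
have c0 := gd_c gd; have M0 := gd_M gd.
rewrite -subr_le0; apply: (@le0_of_small _ _ (4 / c * L2vn U e)).
 by rewrite mulr_ge0 ?L2vn_ge0// divr_ge0// ltW.
move=> d d0; have [tB1 tB2] := opB_test tp.
have [g0 [t0 H0]] := laplacian_dense gd tB1 d0.
have [g1 [t1 H1]] := laplacian_dense gd tB2 d0.
have tth := th_test t0 t1.
pose q i x := p i x + th g0 g1 i x.
have tq : testv U q by move=> i; apply: testD; [exact: tp|exact: tth].
have opq x : [/\ opA1 q x = opA1 p x, opA2 q x = opA2 p x,
  opB1 q x = opB1 p x - lap g0 x & opB2 q x = opB2 p x - lap g1 x].
 have [a1 a2 b1 b2] := ops_add x tp tth.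
 have [e1 e2 f1 f2] := th_ops x t0 t1.
 by split; [rewrite a1 e1 addr0|rewrite a2 e2 addr0|rewrite b1 f1|rewrite b2 f2].
have Lp := testv_L2v oU tp; have Lq := testv_L2v oU tq; have Lth := testv_L2v oU tth.
have -> : ipv U e p = ipv U e q.
 rewrite ipvC [RHS]ipvC (_ : q = fun i x => p i x + th g0 g1 i x)// (ipvDl mU Lp Lth Le).
 by rewrite [X in _ + X]ipvC cl// addr0.
have rM x : U x -> 0 <= t - sigma x <= M by move=> Ux; have /andP[/ltW -> ->] := gd_r gd Ux.
have ss := gd_smooth gd; have C2 : Ck 2 U sigma by exact: ss.
have := basic_inequality oU C2 tq c0 M0 (fun x v => @gd_levi _ _ _ _ _ gd x v) rM (fun x i => @gd_d1 _ _ _ _ _ gd x i).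
rewrite -(L2vn_nsq oU tq).
have -> : \int[mu]_(x in U) (opA1 q x ^+ 2 + opA2 q x ^+ 2) = L2vn U (opAv p).
 rewrite (L2vn_opAv oU tp); apply: eq_Rint => x _; have [a1 a2 _ _] := opq x.
 exact: (congr2 (fun a b : R => a ^+ 2 + b ^+ 2) a1 a2).
have Cr : Ck 0 U (fun x => t - sigma x) by apply: CkB; [exact: oU|exact: Ck_cst|exact: ss].
have -> : \int[mu]_(x in U) ((t - sigma x) * (opB1 q x ^+ 2 + opB2 q x ^+ 2)) =
  \int[mu]_(x in U) ((t - sigma x) * (lap g0 x - opB1 p x) ^+ 2) +
  \int[mu]_(x in U) ((t - sigma x) * (lap g1 x - opB2 p x) ^+ 2).
 rewrite -RintegralD//; last 2 first.
 - apply: test_sqr_integ => //; apply: testB => //; exact: lap_test t0.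
 - apply: test_sqr_integ => //; apply: testB => //; exact: lap_test t1.
 apply: eq_Rint => x _; have [_ _ b1 b2] := opq x.
 have S (a b : R) : (a - b) ^+ 2 = (b - a) ^+ 2 by rewrite -sqrrN opprB.
 rewrite -[RHS]mulrDr [X in _ = _ * (X + _)]S [X in _ = _ * (_ + X)]S.
 exact: (congr2 (fun a b : R => (t - sigma x) * (a ^+ 2 + b ^+ 2)) b1 b2).
move: H0 H1; set I0 := \int[mu]_(x in U) _; set I1 := \int[mu]_(x in U) _ => H0 H1.
have CS := ipv_CS mU Le Lq.
have e0 := L2vn_ge0 U e; have a0 := L2vn_ge0 U (opAv p).
move: (L2vn U e) (L2vn U q) (L2vn U (opAv p)) CS e0 a0 => E Q A CS e0 a0 HQ.
have HQ' : Q <= 2 / c * (d + d + (M + 16 * M ^+ 2 / c) * A).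
 rewrite -(ler_pM2l (_ : 0 < c / 2)); last by rewrite divr_gt0.
 apply: le_trans HQ _.
 have -> : c / 2 * (2 / c * (d + d + (M + 16 * M ^+ 2 / c) * A)) = d + d + (M + 16 * M ^+ 2 / c) * A by field; rewrite gt_eqF.
 by rewrite lerD2r lerD.
rewrite lerBlDr; apply: le_trans CS _; apply: le_trans (ler_wpM2l e0 HQ') _.
rewrite /solve_cst; apply: eqW; field.
by rewrite gt_eqF.
Qed.

(** By [solve_bound] the functional [p |-> - ipv U e p] is bounded in terms of [opAv p] alone, so it
    is represented by some [v]. *)
Lemma solve U sigma t c M e : good_domain U sigma t c M -> L2v U e ->
 (forall g0 g1, tfun U g0 -> tfun U g1 -> ipv U e (th g0 g1) = 0) ->
 exists v, [/\ L2v U v, L2vn U v <= solve_cst c M * L2vn U e &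
  forall p, testv U p -> ipv U (opAv p) v = - ipv U e p].
Proof.
move=> gd Le cl; have oU := gd_open gd; have mU := open_meas oU.
have c0 := gd_c gd; have M0 := gd_M gd.
have C0 : 0 <= solve_cst c M * L2vn U e.
 rewrite mulr_ge0 ?L2vn_ge0// mulr_ge0 ?divr_ge0 ?addr_ge0// ?(ltW c0) ?(ltW M0)//.
 by rewrite divr_ge0 ?(ltW c0)// mulr_ge0 ?sqr_ge0.
pose X : lmodType R := 'I_4 -> V -> R^o.
pose P (p : X) := testv U p.
pose ell (p : X) : R := - ipv U e p.
have P0 : P 0 by move=> i; exact: test0.
have Plin (k : R) (p q : X) : P p -> P q -> P (k *: p + q) by move=> tp tq i; apply: testD; [apply: testZ; exact: tp|exact: tq].
have Llin (k : R) (p q : X) : P p -> P q -> forall i x, opAv (k *: p + q) i x = k * opAv p i x + opAv q i x.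
 move=> tp tq i x.
 have tkp : testv U (fun i x => k * p i x) by move=> j; apply: testZ; exact: tp.
 have [a1 a2 _ _] := ops_add x tkp tq.
 have [b1 b2 _ _] := ops_scale k x tp.
 rewrite /opAv; case: ifP => _.
  by rewrite -b1; exact: a1.
 by rewrite -b2; exact: a2.
have elin (k : R) (p q : X) : P p -> P q -> ell (k *: p + q) = k * ell p + ell q.
 move=> tp tq; rewrite /ell.
 have Lp := testv_L2v oU tp; have Lq := testv_L2v oU tq.
 rewrite ipvC (ipvDl mU (L2vZ k mU Lp) Lq Le) (ipvZl k mU Lp Le).
 by rewrite [in RHS]ipvC [ipv U e q]ipvC opprD mulrN.
have bnd (p : X) : P p -> ell p ^+ 2 <= solve_cst c M * L2vn U e * L2vn U (opAv p).
 by move=> tp; rewrite /ell sqrrN; exact: solve_bound gd Le cl tp.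
have LL (p : X) : P p -> L2v U (opAv p) by move=> tp i; apply: test_L2 mU _; exact: opAv_test tp.
have [v [s [Lv nv Ev _ _]]] := @riesz_subspace R 4 2 X P U opAv ell _ mU C0 P0 Plin LL Llin elin bnd.
by exists v; split => // p tp; rewrite -Ev.
Qed.

Implicit Types (phi : V -> R).

(* The Dirac operator whose first two columns are [th]; it is elliptic. *)
Definition D0 q x := pd i2 (q i0) x + pd i3 (q i1) x + pd i0 (q i2) x - pd i1 (q i3) x.
Definition D1 q x := pd i2 (q i1) x - pd i3 (q i0) x + pd i1 (q i2) x + pd i0 (q i3) x.
Definition D2 q x := - pd i0 (q i0) x - pd i1 (q i1) x + pd i2 (q i2) x - pd i3 (q i3) x.
Definition D3 q x := pd i1 (q i0) x - pd i0 (q i1) x + pd i3 (q i2) x + pd i2 (q i3) x.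
Definition Dop q (i : 'I_4) : V -> R :=
 if i == i0 then D0 q else if i == i1 then D1 q else if i == i2 then D2 q else D3 q.

Lemma testN U f : tfun U f -> tfun U (fun x => - f x).
Proof.
move=> tf; rewrite (_ : (fun x => _) = fun x => -1 * f x); first exact: testZ.
by apply/funext => x; rewrite mulN1r.
Qed.

Lemma Dop_test U q : testv U q -> testv U (Dop q).
Proof.
move=> tq; have T i j := testv_pd i j tq; apply: ord4P; rewrite /Dop /=.
- apply: testB; last exact: T.
 by apply: testD; [apply: testD|]; exact: T.
- apply: testD; last exact: T.
 by apply: testD; [apply: testB|]; exact: T.
- apply: testB; last exact: T.
 apply: testD; last exact: T.
 by apply: testB; [apply: testN|]; exact: T.
- apply: testD; last exact: T.
 by apply: testD; [apply: testB|]; exact: T.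
Qed.

Definition dir0 q x := pd i0 (q i0) x ^+ 2 + pd i0 (q i1) x ^+ 2 + pd i0 (q i2) x ^+ 2 + pd i0 (q i3) x ^+ 2.

Lemma zint_null1 U f g a b : open U -> tfun U f -> tfun U g ->
 zint U (fun x => pd a f x * pd b g x - pd b f x * pd a g x).
Proof.
move=> oU tf tg; have := zint_null a b oU (@Ck_cst _ _ 2 U 1) tf tg.
apply: eq_zint; first exact: open_meas.
by move=> x _; rewrite (pd_cst _ a) (pd_cst _ b); clear; gen_pd => *; ring.
Qed.

Definition nD q x := D0 q x ^+ 2 + D1 q x ^+ 2 + D2 q x ^+ 2 + D3 q x ^+ 2.

(** The adjoint of [Dop] composed with [Dop] is minus the Laplacian in each component, so [nD] and
    the full Dirichlet integrand differ by Jacobian determinants, which integrate to 0. The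
    derivatives in direction [i0] are all that the Poincare inequality uses. *)
Lemma dirac_identity U q : open U -> testv U q -> exists2 X, zint U X &
 forall x, dir0 q x <= nD q x + X x.
Proof.
move=> oU tq; have mU := open_meas oU.
have J (j k a b : 'I_4) := @zint_null1 U (q j) (q k) a b oU (tq j) (tq k).
have z01 := zintD mU (J i0 i1 i2 i3) (J i0 i1 i0 i1).
have z02 := zintB mU (J i0 i2 i1 i3) (J i0 i2 i0 i2).
have z03 := zintD mU (J i0 i3 i1 i2) (J i0 i3 i0 i3).
have z12 := zintN mU (zintD mU (J i1 i2 i0 i3) (J i1 i2 i1 i2)).
have z13 := zintB mU (J i1 i3 i1 i3) (J i1 i3 i0 i2).
have z23 := zintN mU (zintD mU (J i2 i3 i0 i1) (J i2 i3 i2 i3)).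
have z := zintZ (-2) mU (zintD mU (zintD mU (zintD mU z01 z02) (zintD mU z03 z12)) (zintD mU z13 z23)).
eexists; first exact: z.
move=> x; rewrite /dir0 /nD /D0 /D1 /D2 /D3; clear.
generalize (pd i0 (q i0) x) => a00.
generalize (pd i0 (q i1) x) => a01.
generalize (pd i0 (q i2) x) => a02.
generalize (pd i0 (q i3) x) => a03.
generalize (pd i1 (q i0) x) => a10.
generalize (pd i1 (q i1) x) => a11.
generalize (pd i1 (q i2) x) => a12.
generalize (pd i1 (q i3) x) => a13.
generalize (pd i2 (q i0) x) => a20.
generalize (pd i2 (q i1) x) => a21.
generalize (pd i2 (q i2) x) => a22.
generalize (pd i2 (q i3) x) => a23.
generalize (pd i3 (q i0) x) => a30.
generalize (pd i3 (q i1) x) => a31.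
generalize (pd i3 (q i2) x) => a32.
generalize (pd i3 (q i3) x) => a33.
have H : 0 <= a10 ^+ 2 + a11 ^+ 2 + a12 ^+ 2 + a13 ^+ 2 + a20 ^+ 2 + a21 ^+ 2 + a22 ^+ 2 + a23 ^+ 2 + a30 ^+ 2 + a31 ^+ 2 + a32 ^+ 2 + a33 ^+ 2.
 by rewrite !addr_ge0 ?sqr_ge0.
rewrite -subr_ge0; apply: le_trans H _; apply: eqW; ring.
Qed.

(** Integration by parts against the coordinate [x0]: modulo a divergence, [phi ^ 2] is
    [- 2 * x0 * phi * pd i0 phi]. *)
Lemma poincare U phi c : open U -> (forall x, U x -> `|x 0 i0| <= c) -> tfun U phi ->
 L2n U phi <= 4 * c ^+ 2 * L2n U (pd i0 phi).
Proof.
move=> oU Hc tp; have mU := open_meas oU.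
have z := zint_pd_mul i0 oU (@Ck_coord R 4 1 U i0) (testM oU tp tp).
have td := test_pd i0 tp.
rewrite /L2n -RintegralZl//; last exact: test_L2_int.
apply: (zint_le mU _ _ (zintZ 2 mU z)).
- exact: test_L2_int.
- by apply: integZ => //; exact: test_L2_int.
move=> x Ux; rewrite pd_coord eqxx mul1r.
rewrite (pdM i0 (test_pder (x := x) tp) (test_pder (x := x) tp)).
have hc : (x 0 i0) ^+ 2 <= c ^+ 2.
 rewrite -[leLHS]real_normK ?num_real// lerXn2r ?nnegrE ?Hc// (le_trans _ (Hc x Ux))//.
move: (x 0 i0) (phi x) (pd i0 phi x) hc => s u d hc.
have h1 := sqr_ge0 (u + 2 * s * d).
have h2 : s ^+ 2 * d ^+ 2 <= c ^+ 2 * d ^+ 2 by rewrite ler_wpM2r ?sqr_ge0.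
have E : (u + 2 * s * d) ^+ 2 = u ^+ 2 + 4 * (s * (u * d)) + 4 * (s ^+ 2 * d ^+ 2) by ring.
rewrite E in h1; rewrite [d * u]mulrC.
have -> : 4 * c ^+ 2 * d ^+ 2 = 4 * (c ^+ 2 * d ^+ 2) by rewrite mulrA.
have -> : u * u = u ^+ 2 by rewrite expr2.
rewrite mulrDr; lra.
Qed.

Lemma nD_L2vn U q : open U -> testv U q -> L2vn U (Dop q) = \int[mu]_(x in U) nD q x.
Proof. by move=> oU tq; rewrite (L2vn_nsq oU (Dop_test tq)). Qed.

Lemma dirac_bound U q c : open U -> (forall x, U x -> `|x 0 i0| <= c) -> testv U q ->
 L2vn U q <= 4 * c ^+ 2 * L2vn U (Dop q).
Proof.
move=> oU Hc tq; have mU := open_meas oU.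
have c20 : 0 <= 4 * c ^+ 2 by rewrite mulr_ge0 ?sqr_ge0.
have tdq : testv U (fun i => pd i0 (q i)) by move=> i; exact: test_pd.
apply: (@le_trans _ _ (4 * c ^+ 2 * L2vn U (fun i => pd i0 (q i)))).
 by rewrite /L2vn mulr_sumr; apply: ler_sum => i _; exact: poincare.
apply: ler_wpM2l => //; rewrite (nD_L2vn oU tq) (L2vn_nsq oU tdq).
have [X zX HX] := dirac_identity oU tq.
apply: (zint_le mU _ _ zX) => [||x _]; last exact: HX.
- have T i := test_L2_int oU (tdq i).
 exact: (integD mU (integD mU (integD mU (T i0) (T i1)) (T i2)) (T i3)).
- have tD := Dop_test tq; have T i := test_L2_int oU (tD i).
 exact: (integD mU (integD mU (integD mU (T i0) (T i1)) (T i2)) (T i3)).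
Qed.

Lemma Dop_lin U (k : R) p q i x : testv U p -> testv U q ->
 Dop (fun i x => k * p i x + q i x) i x = k * Dop p i x + Dop q i x.
Proof.
move=> tp tq.
have E a b : pd a (fun x => k * p b x + q b x) x = k * pd a (p b) x + pd a (q b) x.
 apply: pdE; apply: isdD; first apply: isdZ.
  by apply: isd_pd; exact: test_pder (tp b).
 by apply: isd_pd; exact: test_pder (tq b).
rewrite /Dop /D0 /D1 /D2 /D3.
do 3 (case: ifP => _; first by rewrite !E; clear; gen_pd; intros; ring).
by rewrite !E; clear; gen_pd; intros; ring.
Qed.

(** Weak surjectivity of the adjoint of [Dop], dual to the a priori bound. It removes the residual
    of an approximate solution at a price proportional to the residual. *)
Lemma dirac_correct U G c : open U -> (forall x, U x -> `|x 0 i0| <= c) -> L2v U G ->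
 exists W, [/\ L2v U W, L2vn U W <= 4 * c ^+ 2 * L2vn U G &
  forall q, testv U q -> ipv U W (Dop q) = ipv U G q].
Proof.
move=> oU Hc LG; have mU := open_meas oU.
have c20 : 0 <= 4 * c ^+ 2 by rewrite mulr_ge0 ?sqr_ge0.
have C0 : 0 <= 4 * c ^+ 2 * L2vn U G by rewrite mulr_ge0 ?L2vn_ge0.
pose X : lmodType R := 'I_4 -> V -> R^o.
pose P (q : X) := testv U q.
pose ell (q : X) : R := ipv U G q.
have P0 : P 0 by move=> i; exact: test0.
have Plin (k : R) (p q : X) : P p -> P q -> P (k *: p + q) by move=> tp tq i; apply: testD; [apply: testZ; exact: tp|exact: tq].
have Llin (k : R) (p q : X) : P p -> P q -> forall i x, Dop (k *: p + q) i x = k * Dop p i x + Dop q i x.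
 by move=> tp tq i x; exact: (Dop_lin k i x tp tq).
have elin (k : R) (p q : X) : P p -> P q -> ell (k *: p + q) = k * ell p + ell q.
 move=> tp tq; rewrite /ell.
 have Lp := testv_L2v oU tp; have Lq := testv_L2v oU tq.
 by rewrite ipvC (ipvDl mU (L2vZ k mU Lp) Lq LG) (ipvZl k mU Lp LG) ![ipv U G _]ipvC.
have LL (q : X) : P q -> L2v U (Dop q) by move=> tq; apply: (testv_L2v oU); exact: Dop_test.
have bnd (q : X) : P q -> ell q ^+ 2 <= 4 * c ^+ 2 * L2vn U G * L2vn U (Dop q).
 move=> tq; apply: le_trans (ipv_CS mU LG (testv_L2v oU tq)) _.
 rewrite [4 * c ^+ 2 * L2vn U G]mulrC -[leRHS]mulrA; apply: ler_wpM2l; first exact: L2vn_ge0.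
 exact: (dirac_bound oU Hc tq).
have [v [s [Lv nv Ev _ _]]] := @riesz_subspace R 4 4 X P U Dop ell _ mU C0 P0 Plin LL Llin elin bnd.
by exists v; split => // q tq; rewrite ipvC -Ev.
Qed.

End basic_inequality.

(** * Taylor polynomials at points shifted along a vector field *)

Section taylor_shift.
Context {R : realType} {n : nat}.
Local Notation V := 'rV[R]_n.
Local Notation e_ i := (basis_vec R i).
Implicit Types (f : V -> R) (x : V) (nu : 'I_n -> V -> R) (W Om : set V) (eps : R).

Definition shiftv nu eps x : V := \row_a (x 0 a + eps * nu a x).

(** The [l]-th derivative of [f] along [nu x] at the shifted point, with the direction frozen at
    [x]. *)
Fixpoint htay nu l f eps x : R :=
 if l is l'.+1 then \sum_a nu a x * htay nu l' (pd a f) eps x else f (shiftv nu eps x).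

(* The Taylor polynomial of [f] at the shifted point, evaluated back at [x]. *)
Definition Tay nu m f eps x : R :=
 \sum_(l < m) (- eps) ^+ l / (l`!)%:R * htay nu l f eps x.

Lemma htayS nu l f eps x : htay nu l.+1 f eps x = \sum_a nu a x * htay nu l (pd a f) eps x.
Proof. by []. Qed.

Lemma isd_htay_eps nu Om l f eps x : open Om -> smooth Om f -> Om (shiftv nu eps x) ->
 is_derive eps (1 : R) (fun z => htay nu l f z x) (htay nu l.+1 f eps x).
Proof.
move=> oO; elim: l f => [|l IH] f sf Oy.
 have H i : is_derive eps (1 : R) (fun z => shiftv nu z x 0 i) (nu i x).
  rewrite (_ : (fun z => _) = fun z => x 0 i + z * nu i x); last by apply/funext => z; rewrite mxE.
  have := isdD (isd_cst eps 1 (x 0 i)) (isdM (@is_derive_id R R eps 1) (isd_cst eps 1 (nu i x))).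
  by move/isd_eq; apply; rewrite add0r mulr0 addr0 mul1r.
 have C1 : C1at f (shiftv nu eps x) by exact: (@Ck_C1at _ _ 0 Om _ _ oO (sf 1%N) Oy).
 have := isd_comp (G := fun z => shiftv nu z x) (dG := fun i => nu i x) C1 H; move/isd_eq; apply.
 by apply: eq_bigr => i _; rewrite mulrC.
rewrite [X in is_derive _ _ _ X]htayS; apply: isd_sum => a _; apply: isdZ.
by apply: IH; [exact: smooth_pd|exact: Oy].
Qed.

Lemma htay_eq0 nu Om l f eps x : open Om -> (forall y, Om y -> f y = 0) ->
 Om (shiftv nu eps x) -> htay nu l f eps x = 0.
Proof.
move=> oO; elim: l f => [|l IH] f f0 Oy; first exact: f0.
rewrite htayS; apply: big1 => a _; rewrite IH ?mulr0// => y Oy'.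
rewrite (@pd_near _ _ f (fun=> 0)) ?pd_cst//.
by have := open_nb (conj oO Oy'); apply: filterS.
Qed.

Lemma htay_sum nu Om l (I : Type) (s : seq I) (c : I -> R) (F : I -> V -> R) eps x : open Om ->
 (forall i, smooth Om (F i)) -> Om (shiftv nu eps x) ->
 htay nu l (fun y => \sum_(i <- s) c i * F i y) eps x = \sum_(i <- s) c i * htay nu l (F i) eps x.
Proof.
move=> oO; elim: l F => [//|l IH] F sF Oy; rewrite htayS.
have near_eq f g : (forall y, Om y -> f y = g y) -> smooth Om f -> smooth Om g ->
  htay nu l f eps x = htay nu l g eps x.
 move=> E sf sg; elim: l f g E sf sg {IH} => [|l IH] f g E sf sg /=; first exact: E.
 apply: eq_bigr => a _; congr (_ * _); apply: IH; [|exact: smooth_pd|exact: smooth_pd].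
 move=> y Oy'; apply: pd_near; have := open_nb (conj oO Oy').
 by apply: filterS => z; exact: E.
have E a y : Om y -> pd a (fun y => \sum_(i <- s) c i * F i y) y = \sum_(i <- s) c i * pd a (F i) y.
 move=> Oy'; apply: pdE; apply: isd_sum => i _; apply: isdZ; apply: isd_pd.
 exact: (@Ck_pder _ _ 0 Om _ (sF i 1%N)).
transitivity (\sum_a nu a x * \sum_(i <- s) c i * htay nu l (pd a (F i)) eps x).
 apply: eq_bigr => a _; congr (_ * _); rewrite -IH => [|i|//]; last exact: smooth_pd.
 apply: near_eq; [exact: E| |].
  by apply: smooth_pd; apply: (smooth_sum _ oO) => i; exact: (smoothZ _ oO (sF i)).
 by apply: (smooth_sum _ oO) => i; exact: (smoothZ _ oO (smooth_pd a (sF i))).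
under eq_bigr do rewrite mulr_sumr.
rewrite exchange_big; apply: eq_bigr => i _ /=; rewrite mulr_sumr.
by apply: eq_bigr => a _; rewrite mulrCA.
Qed.

Lemma isd_shiftv nu W eps x a j : smooth W (nu a) -> W x ->
 is_derive x (e_ j) (fun y => shiftv nu eps y 0 a) ((j == a)%:R + eps * pd j (nu a) x).
Proof.
move=> sn Wx; rewrite (_ : (fun y => _) = fun y : V => y 0 a + eps * nu a y); last first.
 by apply/funext => z; rewrite mxE.
apply: isdD; first exact: isd_coord.
by apply: isdZ; apply: isd_pd; exact: (@Ck_pder _ _ 0 W _ (sn 1%N)).
Qed.

Lemma htay_pdC nu Om l f eps x a b : open Om -> smooth Om f -> Om (shiftv nu eps x) ->
 htay nu l (pd a (pd b f)) eps x = htay nu l (pd b (pd a f)) eps x.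
Proof.
move=> oO sf Oy.
have H (g h : V -> R) : (forall y, Om y -> g y = h y) -> htay nu l g eps x = htay nu l h eps x.
 elim: l g h => [|l IH] g h E /=; first exact: E.
 apply: eq_bigr => c _; congr (_ * _); apply: IH.
 move=> y Oy'; apply: pd_near; have := open_nb (conj oO Oy').
 by apply: filterS => z; exact: E.
by apply: H => y Oy'; exact: (pdC _ _ oO (sf 2%N)).
Qed.

Lemma htay_aux (c e k X X' : R) (d Y Y' Z Z' : 'I_n -> R) : X = X' ->
 (forall i, Y i = Y' i) -> (forall i, Z i = Z' i) ->
 c * (X + \sum_i d i * (e * Y i + k * Z i)) =
 c * X' + \sum_i d i * (e * (c * Y' i) + k * (c * Z' i)).
Proof.
move=> -> EY EZ; rewrite mulrDr mulr_sumr; congr (_ + _); apply: eq_bigr => i _.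
by rewrite EY EZ; ring.
Qed.

Lemma isd_htay nu Om W l f eps x j : open Om -> open W -> (forall a, smooth W (nu a)) ->
 smooth Om f -> W x -> Om (shiftv nu eps x) ->
 is_derive x (e_ j) (htay nu l f eps)
  (htay nu l (pd j f) eps x
   + \sum_i pd j (nu i) x * (eps * htay nu l (pd i f) eps x
                + l%:R * htay nu l.-1 (pd i f) eps x)).
Proof.
move=> oO oW sn; elim: l f => [|l IH] f sf Wx Oy.
 have C1 : C1at f (shiftv nu eps x) by exact: (@Ck_C1at _ _ 0 Om _ _ oO (sf 1%N) Oy).
 have := isd_comp (G := shiftv nu eps) (dG := fun a => (j == a)%:R + eps * pd j (nu a) x) C1 (fun a => isd_shiftv eps j (sn a) Wx); move/isd_eq; apply.
 under eq_bigr do rewrite mulrDr.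
 rewrite big_split /=; congr (_ + _).
  rewrite (bigD1 j)//= eqxx mulr1 big1 ?addr0// => i ij.
  by rewrite eq_sym (negbTE ij) mulr0.
 by apply: eq_bigr => i _; rewrite mul0r addr0 mulrCA [RHS]mulrCA; congr (_ * _); exact: mulrC.
have dn a : is_derive x (e_ j) (nu a) (pd j (nu a) x) by apply: isd_pd; exact: (@Ck_pder _ _ 0 W _ (sn a 1%N)).
have H a := isdM (dn a) (IH (pd a f) (smooth_pd a sf) Wx Oy).
have := isd_sum (index_enum 'I_n) (P := xpredT) (fun a _ => H a).
move/isd_eq; apply => /=.
rewrite big_split /=.
have E a : nu a x * (htay nu l (pd j (pd a f)) eps x + \sum_i pd j (nu i) x *
   (eps * htay nu l (pd i (pd a f)) eps x + l%:R * htay nu l.-1 (pd i (pd a f)) eps x)) =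
  nu a x * htay nu l (pd a (pd j f)) eps x + \sum_i pd j (nu i) x *
   (eps * (nu a x * htay nu l (pd a (pd i f)) eps x) + l%:R * (nu a x * htay nu l.-1 (pd a (pd i f)) eps x)).
 exact: (htay_aux _ _ _ _ (htay_pdC l j a oO sf Oy) (fun i => htay_pdC l i a oO sf Oy)
  (fun i => htay_pdC l.-1 i a oO sf Oy)).
rewrite (eq_bigr _ (fun a _ => E a)) big_split /= addrCA; congr (_ + _).
rewrite exchange_big -big_split; apply: eq_bigr => i _ /=.
rewrite -mulr_sumr -mulrDr; congr (_ * _).
rewrite big_split /= -!mulr_sumr addrCA; congr (_ + _).
case: (l) => [|k]; first by rewrite mul0r addr0 mul1r.
by rewrite [k.+2%:R]mulrSr mulrDl mul1r addrC.
Qed.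

Lemma cont_coords (G : V -> V) x : (forall a, {for x, continuous (fun y => G y 0 a)}) ->
 {for x, continuous G}.
Proof.
move=> H A /nbhs_rVP[d d0 HA].
have K a : exists r : R, 0 < r /\ forall y, `|y - x| < r -> `|G y 0 a - G x 0 a| < d.
 by have [r r0 Hr] := (cont_rVP _ _).1 (H a) d d0; exists r.
have [r Hr] := choice K.
apply/nbhs_rVP; exists (\big[Num.min/1]_a r a).
 by apply: lt_bigmin => // a _; have [] := Hr a.
move=> y yr; apply: HA; apply: normrV_lt => // a; rewrite !mxE; have [_] := Hr a; apply.
by apply: lt_leT yr _; exact: bigmin_le_cond.
Qed.

Lemma TayS nu m f eps x :
 Tay nu m.+1 f eps x = Tay nu m f eps x + (- eps) ^+ m / (m`!)%:R * htay nu m f eps x.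
Proof. by rewrite /Tay big_ord_recr. Qed.

Lemma factS_ratio m : (m.+1%:R : R) / (m.+1`!)%:R = ((m`!)%:R)^-1.
Proof.
by rewrite factS natrM invfM mulrA mulfV ?mul1r// pnatr_eq0.
Qed.

(** The sum telescopes: the derivative of each coefficient cancels the derivative of the previous
    term in the shift, and only the last term remains. *)
Lemma isd_Tay_eps nu Om m f eps x : open Om -> smooth Om f -> Om (shiftv nu eps x) ->
 is_derive eps (1 : R) (fun z => Tay nu m.+1 f z x)
  ((- eps) ^+ m / (m`!)%:R * htay nu m.+1 f eps x).
Proof.
move=> oO sf Oy; elim: m => [|m IH].
 rewrite (_ : (fun z => _) = fun z => 1 * htay nu 0 f z x); last first.
  by apply/funext => z; rewrite /Tay big_ord1 expr0 fact0 divr1.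
 by rewrite expr0 fact0 divr1; apply: isdZ; exact: isd_htay_eps oO sf Oy.
rewrite (_ : (fun z => _) = fun z => Tay nu m.+1 f z x + (- z) ^+ m.+1 / (m.+1`!)%:R * htay nu m.+1 f z x); last first.
 by apply/funext => z; rewrite TayS.
have dz : is_derive eps (1 : R) (fun z : R => (- z) ^+ m.+1 / (m.+1`!)%:R) (- ((- eps) ^+ m / (m`!)%:R)).
 have := isdM (isdX m.+1 (isdN (@is_derive_id R R eps 1))) (isd_cst eps 1 ((m.+1`!)%:R^-1)).
 move/isd_eq; apply; rewrite mulr0 addr0 /= mulrN1 mulNr; congr (- _).
 by rewrite mulrAC factS_ratio mulrC.
have := isdD IH (isdM dz (isd_htay_eps m.+1 oO sf Oy)).
by move/isd_eq; apply; rewrite addrA mulNr subrr add0r.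
Qed.

(** The same cancellation takes place among the terms with derivatives of [nu]: differentiation
    commutes with the Taylor polynomial up to a single term of order [eps ^ (m + 1)]. *)
Lemma isd_Tay nu Om W m f eps x j : open Om -> open W -> (forall a, smooth W (nu a)) ->
 smooth Om f -> W x -> Om (shiftv nu eps x) ->
 is_derive x (e_ j) (Tay nu m.+1 f eps)
  (Tay nu m.+1 (pd j f) eps x
   + \sum_i pd j (nu i) x * (eps * ((- eps) ^+ m / (m`!)%:R * htay nu m (pd i f) eps x))).
Proof.
move=> oO oW sn sf Wx Oy; elim: m => [|m IH].
 rewrite (_ : Tay nu 1 f eps = fun z => 1 * htay nu 0 f eps z); last first.
  by apply/funext => z; rewrite /Tay big_ord1 expr0 fact0 divr1.
 have := isdZ 1 (isd_htay 0 j oO oW sn sf Wx Oy); move/isd_eq; apply.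
 rewrite mul1r /Tay big_ord1 expr0 fact0 divr1 mul1r; congr (_ + _).
 by apply: eq_bigr => i _; rewrite mul0r addr0 mul1r.
rewrite (_ : Tay nu m.+2 f eps = fun z => Tay nu m.+1 f eps z + (- eps) ^+ m.+1 / (m.+1`!)%:R * htay nu m.+1 f eps z); last first.
 by apply/funext => z; rewrite TayS.
have := isdD IH (isdZ ((- eps) ^+ m.+1 / (m.+1`!)%:R) (isd_htay m.+1 j oO oW sn sf Wx Oy)).
move/isd_eq; apply.
rewrite [Tay nu m.+2 _ _ _]TayS mulrDr addrACA -!addrA; congr (_ + (_ + _)).
rewrite mulr_sumr -big_split; apply: eq_bigr => i _ /=.
have E : (- eps) ^+ m.+1 / (m.+1`!)%:R * m.+1%:R = - (eps * ((- eps) ^+ m / (m`!)%:R)).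
 by rewrite mulrAC -mulrA factS_ratio exprS !mulNr mulrA.
move: (\sum_(a < n) _) (htay nu m (pd i f) eps x) (pd j (nu i) x) => H1 H0 d.
move: E; set A := (- eps) ^+ m.+1 / _; set B := (- eps) ^+ m / _; move: A B => A B E.
have -> : A * (d * (eps * H1 + m.+1%:R * H0)) = d * (eps * (A * H1)) + d * ((A * m.+1%:R) * H0) by ring.
by rewrite E; ring.
Qed.

Lemma htay_bound nu l f eps x M B : (forall a, `|nu a x| <= M) -> 0 <= M ->
 (forall s, size s = l -> `|partial s f (shiftv nu eps x)| <= B) ->
 `|htay nu l f eps x| <= (n%:R * M) ^+ l * B.
Proof.
move=> HM M0; elim: l f => [|l IH] f HB; first by rewrite expr0 mul1r; exact: (HB [::]).
rewrite htayS; apply: le_trans (ler_norm_sum _ _ _) _.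
apply: (@le_trans _ _ (\sum_(a < n) M * ((n%:R * M) ^+ l * B))).
 apply: ler_sum => a _; rewrite normrM; apply: ler_pM => //.
 apply: IH => s sl; rewrite -partial_rcons; apply: HB.
 by rewrite size_rcons sl.
by rewrite sumr_const card_ord -[leLHS]mulr_natl exprS -!mulrA.
Qed.

Lemma Tay_bound nu m f eps x M B : (forall a, `|nu a x| <= M) -> 0 <= M -> 0 <= B ->
 0 <= eps <= 1 ->
 (forall s, (size s < m)%N -> `|partial s f (shiftv nu eps x)| <= B) ->
 `|Tay nu m f eps x| <= m%:R * (1 + n%:R * M) ^+ m * B.
Proof.
move=> HM M0 B0 /andP[e0 e1] HB; apply: le_trans (ler_norm_sum _ _ _) _.
rewrite -mulrA mulr_natl -[X in _ *+ X]card_ord -sumr_const; apply: ler_sum => l _.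
have nM : 0 <= n%:R * M by rewrite mulr_ge0.
rewrite normrM; apply: (@le_trans _ _ (1 * ((n%:R * M) ^+ l * B))).
 apply: ler_pM => //; last by apply: (@htay_bound _ _ _ _ _ _ B) => // s sl; apply: HB; rewrite sl.
 rewrite normf_div normrX normrN (ger0_norm e0) [`|_%:R|]ger0_norm// ler_pdivrMr ?ltr0n ?fact_gt0// mul1r.
 apply: (@le_trans _ _ 1); first by apply: exprn_ile1.
 by rewrite ler1n fact_gt0.
rewrite mul1r ler_wpM2r//; apply: (@le_trans _ _ ((1 + n%:R * M) ^+ l)).
 by apply: lerXn2r; rewrite ?nnegrE ?addr_ge0// lerDr.
by apply: ler_weXn2l; rewrite ?lerDl// ltnW.
Qed.

Lemma cont_htay nu Om W l f eps x : open Om -> open W -> (forall a, smooth W (nu a)) ->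
 smooth Om f -> W x -> Om (shiftv nu eps x) -> {for x, continuous (htay nu l f eps)}.
Proof.
move=> oO oW sn; elim: l f => [|l IH] f sf Wx Oy.
 have cs : {for x, continuous (shiftv nu eps)}.
  apply: cont_coords => a.
  have : Ck 0 W (fun y => shiftv nu eps y 0 a).
   rewrite (_ : (fun y => _) = fun y : V => y 0 a + eps * nu a y); last first.
    by apply/funext => z; rewrite mxE.
   apply: (CkD oW); first exact: Ck_coord.
   by apply: (CkZ _ oW); exact: sn.
  by move=> /Ck_cont; apply.
 exact: continuous_comp cs (Ck_cont (sf 0%N) Oy).
apply: (@cvg_sum_ord _ _ (nbhs x) (nbhs_filter x) n (fun a y => nu a y * htay nu l (pd a f) eps y)) => a.
apply: (@cvgM _ _ (nbhs x) (nbhs_filter x)); first exact: (Ck_cont (sn a 0%N) Wx).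
by apply: IH; [exact: smooth_pd|exact: Wx|exact: Oy].
Qed.

Lemma cont_Tay nu Om W m f eps x : open Om -> open W -> (forall a, smooth W (nu a)) ->
 smooth Om f -> W x -> Om (shiftv nu eps x) -> {for x, continuous (Tay nu m f eps)}.
Proof.
move=> oO oW sn sf Wx Oy.
apply: (@cvg_sum_ord _ _ (nbhs x) (nbhs_filter x) m (fun l y => (- eps) ^+ l / (l`!)%:R * htay nu l f eps y)) => l.
apply: (@cvgM _ _ (nbhs x) (nbhs_filter x)); first exact: cvg_cst.
exact: (cont_htay oO oW sn sf Wx Oy).
Qed.

Lemma Ck1_Tay nu Om W m f eps : open Om -> open W -> (forall a, smooth W (nu a)) ->
 smooth Om f -> (forall x, W x -> Om (shiftv nu eps x)) -> Ck 1 W (Tay nu m.+1 f eps).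
Proof.
move=> oO oW sn sf HO; apply/CkS; split=> [x Wx|j].
 split; first exact: (cont_Tay oO oW sn sf Wx (HO x Wx)).
 by move=> j; have [] := isd_Tay m j oO oW sn sf Wx (HO x Wx).
apply: (@Ck_eq _ _ 0 W (fun x => Tay nu m.+1 (pd j f) eps x
   + \sum_i pd j (nu i) x * (eps * ((- eps) ^+ m / (m`!)%:R * htay nu m (pd i f) eps x)))) => //.
 by move=> x Wx; apply/esym; apply: pdE; exact: (isd_Tay m j oO oW sn sf Wx (HO x Wx)).
apply: (CkD oW).
 apply/Ck0 => x Wx; exact: (cont_Tay oO oW sn (smooth_pd j sf) Wx (HO x Wx)).
apply: Ck_sum => [|i _]; first exact: oW.
apply: (CkM oW); first exact: (smooth_pd j (sn i)).
do 2 apply: (CkZ _ oW).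
apply/Ck0 => x Wx; exact: (cont_htay oO oW sn (smooth_pd i sf) Wx (HO x Wx)).
Qed.

End taylor_shift.

(** * Exhaustions, and uniform L2 bounds for the shifted Taylor polynomials *)

Section approximation.
Context {R : realType}.
Local Notation V := 'rV[R]_4.
Local Notation mu := (lebesgue_rV R 4).
Local Notation e_ i := (basis_vec R i).
Implicit Types (U Om N : set V) (sigma g : V -> R) (x : V) (e : 'I_4 -> V -> R).

Definition sublev N sigma t : set V := [set x | N x /\ sigma x < t].

Definition dirn sigma (a : 'I_4) x : R := - pd a sigma x.

(** [kap * eps] is both the level up to which a shift by [eps] along [dirn] leads back into [Om] and
    the room left around the shifted point. [lam * t] bounds from below the distance from [Om] to
    the complement of the sublevel set at [t]. *)
Record exhaustion Om N sigma (c M B t0 kap eps0 lam : R) : Prop := Exhaustion {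
 ex_Om : Om = sublev N sigma 0;
 ex_N : open N;
 ex_smooth : smooth N sigma;
 ex_t0 : 0 < t0;
 ex_gd : forall t, 0 < t <= t0 -> good_domain (sublev N sigma t) sigma t c M;
 ex_B : forall x, N x -> `|x 0 i0| <= B;
 ex_fin : (mu Om < +oo)%E;
 ex_kap : 0 < kap;
 ex_eps0 : 0 < eps0 <= 1;
 ex_kap0 : kap * eps0 <= t0;
 ex_lam : 0 < lam;
 ex_shift : forall eps x, 0 < eps <= eps0 -> sublev N sigma (kap * eps) x ->
  cube (shiftv (dirn sigma) eps x) (kap * eps) `<=` Om;
 ex_dist : forall t x, 0 < t <= t0 -> Om x -> cube x (lam * t) `<=` sublev N sigma t }.

Lemma sublev_open N sigma t : open N -> smooth N sigma -> open (sublev N sigma t).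
Proof.
move=> oN ss; rewrite openE => x [Nx sx]; rewrite /interior.
have h0 : 0 < t - sigma x by rewrite subr_gt0.
have /cont_rVP /(_ _ h0) [d d0 Hd] := Ck_cont (ss 0%N) Nx.
have [d' d'0 Hd'] := open_ballP oN Nx.
apply/nbhs_rVP; exists (Num.min d d'); first by rewrite lt_min d0.
move=> y; rewrite lt_min => /andP[yd yd']; split; first exact: Hd'.
by have := Hd y yd; rewrite ltr_norml => /andP[_]; rewrite ltrD2r.
Qed.

Lemma sublev_le N sigma t t' : t <= t' -> sublev N sigma t `<=` sublev N sigma t'.
Proof. by move=> tt' x [Nx sx]; split => //; exact: lt_leT tt'. Qed.

Definition jetsum m e x : R :=
 \sum_(i < 4) \sum_(j < m) \sum_(s : j.-tuple 'I_4) (partial s (e i) x) ^+ 2.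

Lemma jetsum_ge0 m e x : 0 <= jetsum m e x.
Proof. by do 3 (apply: sumr_ge0 => ? _); exact: sqr_ge0. Qed.

Lemma jetsum_le m e x l i : (size l < m)%N -> (partial l (e i) x) ^+ 2 <= jetsum m e x.
Proof.
move=> lm; rewrite /jetsum (bigD1 i)//= (bigD1 (Ordinal lm))//= (bigD1 (in_tuple l))//=.
rewrite -!addrA lerDl !addr_ge0//.
- by apply: sumr_ge0 => ? _; exact: sqr_ge0.
- by do 2 (apply: sumr_ge0 => ? _); exact: sqr_ge0.
- by do 3 (apply: sumr_ge0 => ? _); exact: sqr_ge0.
Qed.

Lemma jetsum_integ m e Om : measurable Om ->
 (forall i l, (size l < m)%N -> L2 Om (partial l (e i))) -> integ Om (jetsum m e).
Proof.
move=> mO H; apply: integ_sum => // i _; apply: integ_sum => // j _.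
by apply: integ_sum => // s _; apply: L2_integ => //; apply: H; rewrite size_tuple.
Qed.

(** Pointwise bounds by local integrals are integrated with [cube_average]: each point is counted
    with the volume of a cube. *)
Lemma L2_cube_bound U g (F : V -> \bar R) (b r K : R) : measurable U -> mfun U g ->
 mfun setT F -> (forall x, (0 <= F x)%E) -> 0 <= b -> 0 <= r ->
 (\int[mu]_z F z <= K%:E)%E ->
 (forall x, U x -> ((g x ^+ 2)%:E <= b%:E * \int[mu]_(z in cube x r) F z)%E) ->
 L2 U g /\ L2n U g <= b * ((r *+ 2) ^+ 4 * K).
Proof.
move=> mU mg mF F0 b0 r0 FK H.
have mI := cube_int_meas r mF F0.
have I0 x : (0 <= \int[mu]_(z in cube x r) F z)%E by apply: integral_ge0.
have K1 : (\int[mu]_(x in U) (g x ^+ 2)%:E <= (b * ((r *+ 2) ^+ 4 * K))%:E)%E.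
 apply: (@le_trans _ _ (\int[mu]_(x in U) (b%:E * \int[mu]_(z in cube x r) F z))%E).
  apply: ge0_le_integral => //.
  - by move=> x _; rewrite lee_fin sqr_ge0.
  - by apply/EFin_meas; exact: mfunX.
  - by apply: mfunTS; exact: measurable_funeM.
 apply: (@le_trans _ _ (\int[mu]_x (b%:E * \int[mu]_(z in cube x r) F z))%E).
  apply: ge0_subset_integral => //; first exact: measurable_funeM.
  by move=> x _; rewrite mule_ge0.
 rewrite ge0_integralZl ?lee_fin//.
 rewrite cube_average// [leRHS]EFinM; apply: lee_wpmul2l; first by rewrite lee_fin.
 by rewrite [leRHS]EFinM; apply: lee_wpmul2l => //; rewrite lee_fin exprn_ge0// mulrn_wge0.
have Lg : L2 U g by split => //; apply: le_ltT K1 _; rewrite ltry.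
by split => //; rewrite -lee_fin -L2nE.
Qed.

Section bounds.
Context (Om N : set V) (sigma : V -> R) (c M B t0 kap eps0 lam : R)
 (ex : exhaustion Om N sigma c M B t0 kap eps0 lam)
 (m : nat) (e : 'I_4 -> V -> R)
 (he : forall i, harm Om (e i))
 (eL2 : forall i l, (size l < m.+2)%N -> L2 Om (partial l (e i))).

Local Notation nu := (dirn sigma).
Let Ut t := sublev N sigma t.

Lemma ex_open : open Om.
Proof. by rewrite (ex_Om ex); apply: sublev_open; [exact: ex_N ex|exact: ex_smooth ex]. Qed.

Let oO := ex_open.
Let mO := open_meas ex_open.

Lemma e_smooth i : smooth Om (e i).
Proof. exact: harm_smooth oO (he i). Qed.

Definition jets (z : V) : \bar R := ((jetsum m.+2 e \_ Om) z)%:E.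

Lemma jets_ge0 z : (0 <= jets z)%E.
Proof. by rewrite /jets patchE; case: ifP => _; rewrite lee_fin ?jetsum_ge0. Qed.

Lemma jets_integ : integ setT (jetsum m.+2 e \_ Om).
Proof. by apply/(integ_patch _ mO); exact: jetsum_integ. Qed.

Lemma jets_meas : mfun setT jets.
Proof. by apply/EFin_meas; exact: integ_fun jets_integ. Qed.

Lemma ex_t0t0 : 0 < t0 <= t0.
Proof. by rewrite (ex_t0 ex) lexx. Qed.

Lemma ex_M0 : 0 < M.
Proof. exact: gd_M (ex_gd ex ex_t0t0). Qed.

Lemma dirn_bound t x a : t <= t0 -> Ut t x -> `|nu a x| <= M.
Proof.
move=> tt Ux; rewrite normrN; apply: (gd_d1 (ex_gd ex ex_t0t0)).
exact: sublev_le tt _ Ux.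
Qed.

Lemma dirn_bound2 t x a j : t <= t0 -> Ut t x -> `|pd j (nu a) x| <= M.
Proof.
move=> tt Ux; have Ux0 := sublev_le tt Ux.
have -> : pd j (nu a) x = - pd j (pd a sigma) x.
 apply: pdE; apply: isdN; apply: isd_pd.
 by apply: (@Ck_pder _ _ 0 N _ (@smooth_pd _ _ _ _ a (ex_smooth ex) 1%N)); case: Ux.
by rewrite normrN; exact: (gd_d2 (ex_gd ex ex_t0t0) j a Ux0).
Qed.

Lemma dirn_smooth a : smooth N (nu a).
Proof.
have H := smooth_pd a (ex_smooth ex).
have -> : nu a = fun x => -1 * pd a sigma x by apply/funext => x; rewrite mulN1r.
by apply: smoothZ => //; exact: ex_N ex.
Qed.

(** Interior estimate for harmonic functions at the shifted point. The cube around the shifted point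
    is then enclosed in a larger one around [x], which replaces a change of variables along the
    shift. *)
Lemma pointwise_bound : exists2 C : R, 0 <= C &
 forall (h eps : R) x l i, 0 < h <= eps0 -> h / 2 <= eps <= h -> Ut (kap * eps) x ->
  (size l < m.+2)%N ->
  ((partial l (e i) (shiftv nu eps x) ^+ 2)%:E <=
   (C / h ^+ 4)%:E * \int[mu]_(z in cube x ((M + kap) * h)) jets z)%E.
Proof.
have [C C0 HC] := @harm_bound R 4.
have k0 := ex_kap ex; have M0 := ex_M0.
exists (C * (2 / kap) ^+ 4); first by rewrite mulr_ge0// exprn_ge0// divr_ge0// ltW.
move=> h eps x l i /andP[h0 he0] /andP[e1 e2] Ux lm.
have eps_gt0 : 0 < eps by apply: lt_leT e1; rewrite divr_gt0.
have ee : 0 < eps <= eps0 by rewrite eps_gt0 (le_trans e2).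
have a0 : 0 < 2 / (kap * h) by rewrite divr_gt0// mulr_gt0.
have aV : (2 / (kap * h))^-1 = kap * (h / 2) by rewrite invf_div mulrA.
have cO : cube (shiftv nu eps x) (2 / (kap * h))^-1 `<=` Om.
 move=> z Hz; apply: (ex_shift ex ee Ux) => j; apply: le_trans (Hz j) _.
 by rewrite aV ler_pM2l.
have L2l := eL2 i lm; have hl := harm_partial l oO (he i).
have il := integ_L2_fin mO (ex_fin ex) L2l.
apply: le_trans (HC _ _ _ _ oO il L2l hl a0 cO) _.
have -> : C * (2 / (kap * h)) ^+ 4 = C * (2 / kap) ^+ 4 / h ^+ 4 by field; rewrite !gt_eqF.
apply: lee_wpmul2l; first by rewrite lee_fin mulr_ge0 ?mulr_ge0 ?exprn_ge0 ?divr_ge0 ?invr_ge0 ?exprn_ge0// ltW.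
have mc (y : V) r : measurable (cube y r) by exact: cube_meas.
have mp : mfun setT (fun z => ((partial l (e i) \_ Om) z ^+ 2)%:E).
 apply/EFin_meas; apply: mfunX.
 by apply: integ_fun; apply/(integ_patch _ mO).
apply: (@le_trans _ _ (\int[mu]_(z in cube (shiftv nu eps x) (2 / (kap * h))^-1) jets z)%E).
 apply: ge0_le_integral => //.
 - by move=> z _; rewrite lee_fin sqr_ge0.
 - exact: mfunTS.
 - by apply: mfunTS; exact: jets_meas.
 - move=> z _; rewrite /jets !patchE; case: ifP => _; last by rewrite expr0n.
  by rewrite lee_fin; exact: jetsum_le.
apply: ge0_subset_integral => //.
- by apply: mfunTS; exact: jets_meas.
- by move=> z _; exact: jets_ge0.
move=> z Hz j; have := Hz j; rewrite aV mxE => hz.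
have nb : `|eps * nu j x| <= h * M.
 rewrite normrM (gtr0_norm eps_gt0); apply: ler_pM => //; first exact: ltW.
 apply: (dirn_bound _ _ Ux); apply: le_trans (ex_kap0 ex).
 by rewrite ler_pM2l// (le_trans e2).
have -> : z 0 j - x 0 j = (z 0 j - (x 0 j + eps * nu j x)) + eps * nu j x by ring.
apply: le_trans (ler_normD _ _) _; apply: le_trans (lerD hz nb) _.
by rewrite mulrDl addrC [h * M]mulrC lerD2l ler_pM2l// ler_pdivrMr// ler_pMr// ler1n.
Qed.

(** A transfer principle for the estimates that follow: a function dominated pointwise by the jets
    at shifted points is bounded in L2, the factor [1 / h ^ 4] being compensated by the volume of
    the cubes. The range of shifts from [h / 2] to [h] serves the comparison of consecutive dyadic
    scales. *)
Lemma L2_jet_bound : exists2 K : R, 0 <= K &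
 forall h U g A, 0 < h <= eps0 -> measurable U -> mfun U g -> 0 <= A ->
  (forall x Bd, U x -> 0 <= Bd ->
   (forall eps l i, h / 2 <= eps <= h -> Ut (kap * eps) x -> (size l < m.+2)%N ->
    `|partial l (e i) (shiftv nu eps x)| <= Bd) -> `|g x| <= A * Bd) ->
  L2 U g /\ L2n U g <= K * A ^+ 2.
Proof.
have [C C0 HC] := pointwise_bound.
pose J := \int[mu]_z ((jetsum m.+2 e \_ Om) z).
have J0 : 0 <= J by apply: Rintegral_ge0 => z _; rewrite -lee_fin; exact: jets_ge0.
have jJ : (\int[mu]_z jets z = J%:E)%E by rewrite -[LHS]fineK// integrable_fin_num//; exact: jets_integ.
have Mk0 : 0 <= M + kap by rewrite addr_ge0 ?ltW ?ex_M0// (ex_kap ex).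
exists (C * (2 * (M + kap)) ^+ 4 * J); first by rewrite !mulr_ge0// exprn_ge0// mulr_ge0.
move=> h U g A /andP[h0 he0] mU mg A0 H.
have h40 : 0 <= C / h ^+ 4 by rewrite divr_ge0// exprn_ge0// ltW.
have b0 : 0 <= A ^+ 2 * (C / h ^+ 4) by rewrite mulr_ge0// sqr_ge0.
have r0 : 0 <= (M + kap) * h by rewrite mulr_ge0// ltW.
have jle : (\int[mu]_z jets z <= J%:E)%E by rewrite jJ.
have E : A ^+ 2 * (C / h ^+ 4) * ((((M + kap) * h) *+ 2) ^+ 4 * J) = C * (2 * (M + kap)) ^+ 4 * J * A ^+ 2.
 by rewrite -[_ *+ 2]mulr_natr; field; rewrite gt_eqF.
rewrite -E; apply: (L2_cube_bound mU mg jets_meas jets_ge0 b0 r0 jle) => x Ux.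
set I := (\int[mu]_(z in cube x _) jets z)%E.
have I0 : (0 <= I)%E by apply: integral_ge0 => z _; exact: jets_ge0.
have Ifin : I \is a fin_num.
 rewrite ge0_fin_numE//; apply: (@le_ltT _ _ J%:E); last by rewrite ltry.
 rewrite -jJ; apply: ge0_subset_integral => //; first exact: cube_meas.
  exact: jets_meas.
 by move=> z _; exact: jets_ge0.
pose b2 := C / h ^+ 4 * fine I.
have b20 : 0 <= b2 by rewrite mulr_ge0// fine_ge0.
have := H x (Num.sqrt b2) Ux (sqrtr_ge0 _) _.
have HB eps l i : h / 2 <= eps <= h -> Ut (kap * eps) x -> (size l < m.+2)%N ->
  `|partial l (e i) (shiftv nu eps x)| <= Num.sqrt b2.
 move=> ee Ue lm; rewrite -(@ler_sqr _ `|_|) ?nnegrE ?sqrtr_ge0// real_normK ?num_real// sqr_sqrtr//.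
 have hh : 0 < h <= eps0 by rewrite h0.
 have := HC h eps x l i hh ee Ue lm; rewrite -/I -(fineK Ifin) -EFinM lee_fin.
 exact.
move=> /(_ HB) gB.
rewrite -(fineK Ifin) -EFinM lee_fin -mulrA -/b2.
rewrite -[leLHS]real_normK ?num_real// -(sqr_sqrtr b20) -exprMn.
by rewrite lerXn2r// nnegrE// mulr_ge0// sqrtr_ge0.
Qed.

Lemma half_le (h : R) : 0 < h -> h / 2 <= h <= h.
Proof. by move=> h0; rewrite lexx andbT ler_pdivrMr// ler_pMr// ler1n. Qed.

Lemma ex_kap_le h : 0 < h <= eps0 -> kap * h <= t0.
Proof. by move=> /andP[h0 hle]; apply: le_trans (ex_kap0 ex); rewrite ler_pM2l// (ex_kap ex). Qed.

Lemma shift_in h x : 0 < h <= eps0 -> Ut (kap * h) x -> Om (shiftv nu h x).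
Proof.
move=> hh Ux; apply: (ex_shift ex hh Ux) => i; rewrite subrr normr0 mulr_ge0//.
 exact: ltW (ex_kap ex).
by case/andP: hh => /ltW.
Qed.

Lemma Ut_open t : open (Ut t).
Proof. exact: sublev_open (ex_N ex) (ex_smooth ex). Qed.

Lemma dirn_smoothU t a : smooth (Ut t) (nu a).
Proof. by move=> k; apply: (@Ck_sub _ _ k (Ut t) N); [by move=> x []|exact: dirn_smooth]. Qed.

Lemma Tay_Ck1 h i : 0 < h <= eps0 -> Ck 1 (Ut (kap * h)) (Tay nu m.+1 (e i) h).
Proof.
move=> hh; have sn a := @dirn_smoothU (kap * h) a.
exact: (@Ck1_Tay _ _ nu Om (Ut (kap * h)) m (e i) h oO (@Ut_open (kap * h)) sn (e_smooth i) (fun x => @shift_in h x hh)).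
Qed.

Lemma Tay_L2 : exists2 K : R, 0 <= K & forall h i, 0 < h <= eps0 ->
 L2 (Ut (kap * h)) (Tay nu m.+1 (e i) h) /\ L2n (Ut (kap * h)) (Tay nu m.+1 (e i) h) <= K.
Proof.
have [K K0 HK] := L2_jet_bound; have M0 := ltW ex_M0.
pose A : R := m.+1%:R * (1 + 4 * M) ^+ m.+1.
have A0 : 0 <= A by rewrite mulr_ge0// exprn_ge0// addr_ge0// mulr_ge0.
exists (K * A ^+ 2); first by rewrite mulr_ge0// sqr_ge0.
move=> h i hh; have oU := @Ut_open (kap * h); have mU := open_meas oU; have mT := Ck_meas oU (Tay_Ck1 i hh).
apply: (HK h _ _ _ hh mU mT A0) => x Bd Ux B0 HB; have /andP[h0 hle] := hh; have /andP[_ e1] := ex_eps0 ex.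
have tt := ex_kap_le hh.
apply: (@Tay_bound _ _ nu m.+1 (e i) h x M Bd) => //.
- by move=> a; exact: dirn_bound Ux.
- by rewrite (ltW h0) (le_trans hle).
- by move=> s sm; apply: HB (half_le h0) Ux _; rewrite ltnW.
Qed.

Lemma powfact_le (h : R) k : 0 <= h -> `|(- h) ^+ k / (k`!)%:R| <= h ^+ k.
Proof.
move=> h0; rewrite normf_div normrX normrN (ger0_norm h0) [`|_%:R|]ger0_norm//.
by rewrite ler_pdivrMr ?ltr0n ?fact_gt0// ler_peMr ?exprn_ge0// ler1n fact_gt0.
Qed.

(** The derivative in the length of the shift is a single term with a factor [eps ^ m], and the
    interval of lengths contributes one more factor of order [h]. *)
Lemma Tay_diff_L2 : exists2 K : R, 0 <= K & forall h i, 0 < h <= eps0 ->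
 L2n (Ut (kap * (h / 2))) (fun x => Tay nu m.+1 (e i) (h / 2) x - Tay nu m.+1 (e i) h x)
  <= K * (h ^+ m.+1) ^+ 2.
Proof.
have [K K0 HK] := L2_jet_bound; have M0 := ltW ex_M0.
pose A : R := (4 * M) ^+ m.+1.
have A0 : 0 <= A by rewrite exprn_ge0// mulr_ge0.
exists (K * A ^+ 2); first by rewrite mulr_ge0// sqr_ge0.
move=> h i hh; have /andP[h0 hle] := hh.
have h2 : 0 < h / 2 <= eps0 by rewrite divr_gt0//=; apply: le_trans hle; case/andP: (half_le h0).
have oU := @Ut_open (kap * (h / 2)); have mU := open_meas oU.
have k0 := ex_kap ex.
have sub : Ut (kap * (h / 2)) `<=` Ut (kap * h) by apply: sublev_le; rewrite ler_pM2l//; case/andP: (half_le h0).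
have m1 : mfun (Ut (kap * (h / 2))) (fun x => Tay nu m.+1 (e i) (h / 2) x - Tay nu m.+1 (e i) h x).
 apply: mfunB; first exact: (Ck_meas oU (Tay_Ck1 i h2)).
 exact: (Ck_meas oU (Ck_sub sub (Tay_Ck1 i hh))).
have Ah0 : 0 <= A * h ^+ m.+1 by rewrite mulr_ge0// exprn_ge0// ltW.
rewrite -mulrA -exprMn; apply: (HK h _ _ _ hh mU m1 Ah0 _).2 => x Bd Ux B0 HB.
have Ueps eps : h / 2 <= eps -> Ut (kap * eps) x by move=> he2; apply: sublev_le Ux; rewrite ler_pM2l.
have eps_ok eps : h / 2 <= eps <= h -> 0 < eps <= eps0.
 move=> /andP[h1 h3]; rewrite (le_trans h3 hle) andbT; apply: lt_leT h1; by rewrite divr_gt0.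
have D eps : h / 2 <= eps <= h -> is_derive eps (1 : R) (fun z => Tay nu m.+1 (e i) z x)
  ((- eps) ^+ m / (m`!)%:R * htay nu m.+1 (e i) eps x).
 move=> ee; apply: (isd_Tay_eps m oO (e_smooth i)); apply: shift_in; first exact: eps_ok.
 by apply: Ueps; case/andP: ee.
have h2h : h / 2 <= h by case/andP: (half_le h0).
have cts : {within `[(h / 2), h], continuous (fun z => Tay nu m.+1 (e i) z x)}.
 apply: derivable_within_continuous => z; rewrite in_itv/= => zz.
 by have [] := D z zz.
have Dz (z : R) : z \in `](h / 2), h[%R -> is_derive z 1 (fun z => Tay nu m.+1 (e i) z x)
  ((- z) ^+ m / (m`!)%:R * htay nu m.+1 (e i) z x).
 by rewrite in_itv/= => /andP[z1 z2]; apply: D; rewrite !ltW.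
have [z] := MVT_segment h2h Dz cts.
rewrite in_itv/= => zz E; rewrite distrC E normrM.
have /andP[z1 z2] := zz; have /andP[z0 zle] := eps_ok z zz.
have hb : `|htay nu m.+1 (e i) z x| <= (4 * M) ^+ m.+1 * Bd.
 apply: htay_bound => // [a|s sm].
  by apply: dirn_bound (Ueps z z1); apply: ex_kap_le; exact: eps_ok.
 by apply: HB => //; [exact: Ueps|rewrite sm].
rewrite normrM.
have p1 : `|(- z) ^+ m / (m`!)%:R| <= h ^+ m by apply: le_trans (powfact_le _ (ltW z0)) _; rewrite lerXn2r// nnegrE ltW.
have p2 : `|h - h / 2| <= h.
 have -> : h - h / 2 = h / 2 by field.
 by rewrite ger0_norm// divr_ge0// ltW.
apply: (@le_trans _ _ (h ^+ m * ((4 * M) ^+ m.+1 * Bd) * h)).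
 by apply: ler_pM => //; apply: ler_pM.
by rewrite /A !exprSr; apply: eqW; ring.
Qed.

End bounds.
End approximation.

(** * Correcting the Taylor polynomials to closed and coclosed data *)

Section residual.
Context {R : realType}.
Local Notation V := 'rV[R]_4.
Local Notation mu := (lebesgue_rV R 4).
Local Notation e_ i := (basis_vec R i).
Implicit Types (U N : set V) (sigma : V -> R) (x : V) (q T e : 'I_4 -> V -> R).

(* [Dop q k] is the sum over [j] of [dsg k j] times the derivative of [q j] in
  the direction [ddir k j]. *)
Definition ddir (k j : 'I_4) : 'I_4 :=
 nth i0 (nth [::] [:: [:: i2; i3; i0; i1]; [:: i3; i2; i1; i0];
            [:: i0; i1; i2; i3]; [:: i1; i0; i3; i2]] k) j.

Definition dsg (k j : 'I_4) : R :=
 nth 0 (nth [::] [:: [:: 1; 1; 1; -1]; [:: -1; 1; 1; 1];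
           [:: -1; -1; 1; -1]; [:: 1; -1; 1; 1]] k) j.

Lemma dsg_norm k j : `|dsg k j| = 1.
Proof. by elim/ord4P: k; elim/ord4P: j; rewrite /dsg /= ?normrN normr1. Qed.

Lemma DopE q k x : Dop q k x = \sum_j dsg k j * pd (ddir k j) (q j) x.
Proof.
rewrite sum4; elim/ord4P: k; rewrite /Dop /dsg /ddir /= /D0 /D1 /D2 /D3; gen_pd; ring.
Qed.

(* The formal adjoint of [- Dop]. *)
Definition Dadj T j x := \sum_k dsg k j * pd (ddir k j) (T k) x.

Lemma ip_Dop U T q k j : open U -> Ck 1 U (T k) -> tfun U (q j) ->
 \int[mu]_(x in U) (dsg k j * (T k x * pd (ddir k j) (q j) x)) =
 - \int[mu]_(x in U) (dsg k j * (pd (ddir k j) (T k) x * q j x)).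
Proof.
move=> oU C1 tq; have mU := open_meas oU.
rewrite RintegralZl//; last by apply: Ck_integ => //; [exact: Ck_le C1|exact: test_pd].
rewrite RintegralZl//; last by apply: Ck_integ => //; exact: Ck_pd.
by rewrite int_by_parts// mulrN.
Qed.

Lemma ipv_Dop U T q : open U -> (forall k, Ck 1 U (T k)) -> testv U q ->
 ipv U T (Dop q) = - ipv U (Dadj T) q.
Proof.
move=> oU C1 tq; have mU := open_meas oU.
have i1 k j : integ U (fun x => dsg k j * (T k x * pd (ddir k j) (q j) x)).
 by apply: integZ => //; apply: Ck_integ => //; [exact: Ck_le (C1 k)|exact: test_pd].
have i2 k j : integ U (fun x => dsg k j * (pd (ddir k j) (T k) x * q j x)) by apply: integZ => //; apply: Ck_integ => //; exact: Ck_pd.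
rewrite /ipv /ip.
transitivity (\sum_k \sum_j \int[mu]_(x in U) (dsg k j * (T k x * pd (ddir k j) (q j) x))).
 apply: eq_bigr => k _; rewrite -Rint_sum//; apply: eq_Rint => x _.
 by rewrite DopE mulr_sumr; apply: eq_bigr => j _; rewrite mulrCA.
transitivity (- \sum_j \sum_k \int[mu]_(x in U) (dsg k j * (pd (ddir k j) (T k) x * q j x))).
 rewrite exchange_big -sumrN; apply: eq_bigr => j _; rewrite -sumrN; apply: eq_bigr => k _.
 exact: ip_Dop.
congr (- _); apply: eq_bigr => j _; rewrite -Rint_sum//; apply: eq_Rint => x _.
by rewrite /Dadj mulr_suml; apply: eq_bigr => k _; rewrite mulrA.
Qed.

Section estimates.
Context (Om N : set V) (sigma : V -> R) (c M B t0 kap eps0 lam : R)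
 (ex : exhaustion Om N sigma c M B t0 kap eps0 lam)
 (m : nat) (e : 'I_4 -> V -> R)
 (he : forall i, harm Om (e i))
 (eL2 : forall i l, (size l < m.+2)%N -> L2 Om (partial l (e i)))
 (e_adj : forall j x, Om x -> Dadj e j x = 0).

Local Notation nu := (dirn sigma).
Let Ut t := sublev N sigma t.
Let oO := ex_open ex.
Let mO := open_meas oO.

Definition Tv (h : R) (i : 'I_4) : V -> R := Tay nu m.+1 (e i) h.

(** The Taylor polynomial of [Dadj e j] vanishes, so only the remainder terms of [isd_Tay] are
    left. *)
Lemma Dadj_Tv h j x : 0 < h <= eps0 -> Ut (kap * h) x ->
 Dadj (Tv h) j x = \sum_k dsg k j * \sum_i pd (ddir k j) (nu i) x *
   (h * ((- h) ^+ m / (m`!)%:R * htay nu m (pd i (e k)) h x)).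
Proof.
move=> hh Ux; have oU := @Ut_open _ _ _ _ _ _ _ _ _ _ _ ex (kap * h).
have sn a := @dirn_smoothU _ _ _ _ _ _ _ _ _ _ _ ex (kap * h) a.
have Oy := shift_in ex hh Ux.
have sf k := e_smooth ex he k.
transitivity (\sum_k (dsg k j * Tay nu m.+1 (pd (ddir k j) (e k)) h x + dsg k j * \sum_i pd (ddir k j) (nu i) x *
   (h * ((- h) ^+ m / (m`!)%:R * htay nu m (pd i (e k)) h x)))).
 apply: eq_bigr => k _; rewrite -mulrDr; congr (_ * _).
 exact: pdE (isd_Tay m (ddir k j) oO oU sn (sf k) Ux Oy).
rewrite big_split /= -[RHS]add0r; congr (_ + _).
transitivity (\sum_(l < m.+1) (- h) ^+ l / (l`!)%:R * htay nu l (fun y => \sum_k dsg k j * pd (ddir k j) (e k) y) h x).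
 under [RHS]eq_bigr => l _ do rewrite (htay_sum l (index_enum 'I_4) (fun k => dsg k j) oO (fun k => smooth_pd (ddir k j) (sf k)) Oy) mulr_sumr.
 rewrite exchange_big; apply: eq_bigr => k _; rewrite /Tay mulr_sumr; apply: eq_bigr => l _.
 by rewrite mulrCA.
apply: big1 => l _; rewrite (htay_eq0 l oO _ Oy) ?mulr0// => y Oy'.
exact: e_adj.
Qed.

Lemma Tv_Ck1 h i : 0 < h <= eps0 -> Ck 1 (Ut (kap * h)) (Tv h i).
Proof. exact: (Tay_Ck1 ex m he). Qed.

Lemma Dadj_Tv_L2 : exists2 K : R, 0 <= K & forall h, 0 < h <= eps0 ->
 L2v (Ut (kap * h)) (Dadj (Tv h)) /\ L2vn (Ut (kap * h)) (Dadj (Tv h)) <= K * (h ^+ m.+1) ^+ 2.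
Proof.
have [K K0 HK] := L2_jet_bound ex he eL2; have M0 := ltW (ex_M0 ex).
(* [16] counts the pairs [(k, i)], [(4 * M) ^ m] bounds the directions in [htay], and the last [M]
   bounds the derivatives of [nu]. *)
pose A : R := 16 * (4 * M) ^+ m * M.
have A0 : 0 <= A by rewrite mulr_ge0// mulr_ge0// exprn_ge0// mulr_ge0.
exists (\sum_(j < 4) K * A ^+ 2); first by apply: sumr_ge0 => j _; rewrite mulr_ge0// sqr_ge0.
move=> h hh; have /andP[h0 hle] := hh.
have oU := @Ut_open _ _ _ _ _ _ _ _ _ _ _ ex (kap * h); have mU := open_meas oU.
have tt := ex_kap_le ex hh.
suff H j : L2 (Ut (kap * h)) (Dadj (Tv h) j) /\ L2n (Ut (kap * h)) (Dadj (Tv h) j) <= K * A ^+ 2 * (h ^+ m.+1) ^+ 2.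
 split; first by move=> j; have [] := H j.
 by rewrite mulr_suml; apply: ler_sum => j _; have [] := H j.
have m1 : mfun (Ut (kap * h)) (Dadj (Tv h) j).
 apply: (Ck_meas (k := 0) oU); apply: Ck_sum => // k _; apply: CkZ => //.
 by apply: Ck_pd; exact: Tv_Ck1.
have Ah0 : 0 <= A * h ^+ m.+1 by rewrite mulr_ge0// exprn_ge0// ltW.
rewrite -mulrA -exprMn; apply: (HK h _ _ _ hh mU m1 Ah0) => x Bd Ux B0 HB.
have nb a : `|nu a x| <= M by exact: (dirn_bound ex a tt Ux).
have hb k i : `|htay nu m (pd i (e k)) h x| <= (4 * M) ^+ m * Bd.
 apply: htay_bound => // s sm; rewrite -partial_rcons; apply: HB (half_le h0) Ux _.
 by rewrite size_rcons sm.
rewrite (Dadj_Tv j hh Ux).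
have tb k i : `|pd (ddir k j) (nu i) x * (h * ((- h) ^+ m / (m`!)%:R * htay nu m (pd i (e k)) h x))|
  <= M * (h * (h ^+ m * ((4 * M) ^+ m * Bd))).
 rewrite !normrM (gtr0_norm h0); apply: ler_pM => //; first by rewrite !mulr_ge0// ltW.
  exact: (dirn_bound2 ex i _ tt Ux).
 apply: ler_pM => //; first exact: ltW.
 apply: ler_pM => //.
 by have := powfact_le m (ltW h0); rewrite normrM.
apply: (@le_trans _ _ (\sum_(k < 4) \sum_(i < 4) M * (h * (h ^+ m * ((4 * M) ^+ m * Bd))))).
 apply: le_trans (ler_norm_sum _ _ _) _; apply: ler_sum => k _.
 rewrite normrM dsg_norm mul1r; apply: le_trans (ler_norm_sum _ _ _) _.
 by apply: ler_sum => i _; exact: tb.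
by rewrite !sumr_const card_ord -mulrnA -[_ *+ _]mulr_natl /A exprSr; apply: eqW; ring.
Qed.

(* The Taylor approximations, corrected to be weakly closed and coclosed. *)
Lemma approx_correct : exists2 K : R, 0 <= K & forall h, 0 < h <= eps0 -> exists E,
 [/\ L2v (Ut (kap * h)) E,
   forall q, testv (Ut (kap * h)) q -> ipv (Ut (kap * h)) E (Dop q) = 0,
   L2vn (Ut (kap * h)) E <= K &
   L2vn (Ut (kap * h)) (fun i x => Tv h i x - E i x) <= K * (h ^+ m.+1) ^+ 2].
Proof.
have [K K0 HK] := Dadj_Tv_L2; have [K' K'0 HK'] := Tay_L2 ex he eL2.
pose C := 4 * B ^+ 2 * K.
have C0 : 0 <= C by rewrite /C mulr_ge0// mulr_ge0// sqr_ge0.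
exists (2 * (\sum_(i < 4) K') + 2 * C).
 by rewrite addr_ge0// mulr_ge0// sumr_ge0.
move=> h hh; have /andP[h0 hle] := hh; have /andP[_ e1] := ex_eps0 ex.
have oU := @Ut_open _ _ _ _ _ _ _ _ _ _ _ ex (kap * h); have mU := open_meas oU.
have [LD nD] := HK h hh.
have Bx x : Ut (kap * h) x -> `|x 0 i0| <= B by move=> [Nx _]; exact: (ex_B ex).
have [W [LW nW HW]] := dirac_correct oU Bx LD.
have LT : L2v (Ut (kap * h)) (Tv h) by move=> i; have [] := HK' h i hh.
have nT : L2vn (Ut (kap * h)) (Tv h) <= \sum_(i < 4) K' by apply: ler_sum => i _; have [] := HK' h i hh.
have LW' : L2v (Ut (kap * h)) (fun i x => 1 * W i x) by exact: L2vZ.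
have nW' : L2vn (Ut (kap * h)) W <= C * (h ^+ m.+1) ^+ 2.
 by apply: le_trans nW _; rewrite /C -[leRHS]mulrA; apply: ler_wpM2l nD; rewrite mulr_ge0// sqr_ge0.
have h1 : (h ^+ m.+1) ^+ 2 <= 1 by rewrite -exprM exprn_ile1// ?(ltW h0)// (le_trans hle).
have sq1 : 0 <= \sum_(i < 4) K' by apply: sumr_ge0.
exists (fun i x => Tv h i x + W i x); split.
- exact: L2vD.
- move=> q tq; have tD := Dop_test tq.
 rewrite ipvDl//; last exact: testv_L2v.
 by rewrite HW// ipv_Dop// ?addNr// => k; exact: Tv_Ck1.
- apply: le_trans (L2vn_add_le mU LT LW) _; apply: lerD; first by rewrite ler_pM2l.
 by rewrite ler_pM2l//; apply: le_trans nW' _; rewrite ler_piMr.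
- have -> : L2vn (Ut (kap * h)) (fun i x => Tv h i x - (Tv h i x + W i x)) = L2vn (Ut (kap * h)) W.
  apply: eq_bigr => i _; apply: eq_Rint => x _; by rewrite opprD addNKr sqrrN.
 apply: le_trans nW' _; rewrite ler_wpM2r ?sqr_ge0//.
 by rewrite ler_wpDl ?mulr_ge0// ler_peMl// ler1n.
Qed.

End estimates.
End residual.

(** * The L2 norm and geometrically convergent sequences *)

Section L2_norm.
Context {R : realType} {n : nat}.
Local Notation V := 'rV[R]_n.
Local Notation mu := (lebesgue_rV R n).
Implicit Types (f u v : V -> R) (U : set V).

Definition L2norm U u : R := Num.sqrt (L2n U u).

Lemma L2norm_ge0 U u : 0 <= L2norm U u.
Proof. exact: sqrtr_ge0. Qed.

Lemma L2norm_sqr U u : L2norm U u ^+ 2 = L2n U u.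
Proof. by rewrite sqr_sqrtr// L2n_ge0. Qed.

Lemma L2norm_le U u (a : R) : 0 <= a -> L2n U u <= a ^+ 2 -> L2norm U u <= a.
Proof. by move=> a0 ua; rewrite /L2norm -(ger0_norm a0) -sqrtr_sqr ler_wsqrtr. Qed.

Lemma L2n_le U u (a : R) : L2norm U u <= a -> L2n U u <= a ^+ 2.
Proof.
move=> ua; rewrite -L2norm_sqr lerXn2r// nnegrE ?L2norm_ge0//.
exact: le_trans (L2norm_ge0 _ _) ua.
Qed.

Lemma L2norm0 U : L2norm U (fun=> 0) = 0.
Proof.
rewrite /L2norm /L2n (_ : \int[mu]_(x in U) _ = 0) ?sqrtr0//.
by under eq_Rint => x _ do rewrite expr0n; exact: Rint_cst0.
Qed.

Lemma L2norm_ip U u v : measurable U -> L2 U u -> L2 U v -> `|ip U u v| <= L2norm U u * L2norm U v.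
Proof.
move=> mU Lu Lv; rewrite /L2norm -sqrtrM ?L2n_ge0// -sqrtr_sqr ler_wsqrtr//.
exact: L2_CS.
Qed.

Lemma L2normD U u v : measurable U -> L2 U u -> L2 U v ->
 L2norm U (fun x => u x + v x) <= L2norm U u + L2norm U v.
Proof.
move=> mU Lu Lv; apply: L2norm_le; first by rewrite addr_ge0// L2norm_ge0.
have := @L2nD_expand _ _ U u v 1 mU Lu Lv; rewrite expr1n mul1r mulr1.
under eq_fun do rewrite mul1r.
move=> ->; rewrite sqrrD !L2norm_sqr lerD2r lerD2l mulr_natl ler_pMn2r//.
exact: le_trans (ler_norm _) (L2norm_ip mU Lu Lv).
Qed.

Lemma L2normN U u : L2norm U (fun x => - u x) = L2norm U u.
Proof. by congr Num.sqrt; apply: eq_Rint => x _; rewrite sqrrN. Qed.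

Lemma L2norm_sum U (F : nat -> V -> R) (b : nat -> R) k : measurable U -> (forall j, L2 U (F j)) ->
 (forall j, L2norm U (F j) <= b j) ->
 L2norm U (fun x => \sum_(j < k) F j x) <= \sum_(j < k) b j.
Proof.
move=> mU LF Fb; elim: k => [|k IH].
 by rewrite big_ord0; under eq_fun do rewrite big_ord0; rewrite L2norm0.
rewrite big_ord_recr/=; under eq_fun do rewrite big_ord_recr/=.
apply: le_trans (L2normD mU _ (LF k)) _; first exact: L2_sum.
exact: lerD.
Qed.

Lemma geom_sum_le (q : R) k : 0 <= q < 1 -> \sum_(j < k) q ^+ j <= (1 - q)^-1.
Proof.
move=> /andP[q0 q1]; have q1' : 0 < 1 - q by rewrite subr_gt0.
rewrite -(ler_pM2l q1') mulfV ?gt_eqF//.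
have -> : (1 - q) * \sum_(j < k) q ^+ j = 1 - q ^+ k by rewrite -[X in X - q ^+ k](expr1n _ k) subrXX; congr (_ * _); apply: eq_bigr => j _; rewrite expr1n mul1r.
by rewrite gerBl exprn_ge0.
Qed.

Lemma L2norm_geom U (u : nat -> V -> R) (K q : R) k r : measurable U -> (forall j, L2 U (u j)) ->
 0 <= K -> 0 <= q < 1 ->
 (forall j, L2norm U (fun x => u j.+1 x - u j x) <= K * q ^+ j) ->
 L2norm U (fun x => u (k + r)%N x - u k x) <= K / (1 - q) * q ^+ k.
Proof.
move=> mU Lu K0 q01 H; have /andP[q0 q1] := q01.
have -> : (fun x => u (k + r)%N x - u k x) = fun x => \sum_(j < r) (u (k + j).+1 x - u (k + j)%N x).
 apply/funext => x; elim: r => [|r IH]; first by rewrite big_ord0 addn0 subrr.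
 by rewrite big_ord_recr/= -IH addnS addrC subrKA.
apply: le_trans (@L2norm_sum _ (fun j x => u (k + j).+1 x - u (k + j)%N x) (fun j => K * q ^+ (k + j)) r mU _ _) _.
- by move=> j; exact: L2B.
- by move=> j; exact: H.
under eq_bigr => j _ do rewrite exprD mulrA.
rewrite -mulr_sumr [leRHS]mulrAC; apply: ler_wpM2l; first by rewrite mulr_ge0// exprn_ge0.
exact: geom_sum_le.
Qed.

Lemma expr_small (q e : R) : 0 <= q < 1 -> 0 < e -> exists N, forall k, (N <= k)%N -> q ^+ k <= e.
Proof.
move=> /andP[q0 q1] e0; have : (GRing.exp q) @ \oo --> (0 : R) by apply: cvg_expr; rewrite ger0_norm.
move=> /cvgrPdist_le /(_ e e0) [N _ HN]; exists N => k /HN.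
by rewrite /= sub0r normrN ger0_norm// exprn_ge0.
Qed.

Lemma geom_small (K q e : R) : 0 <= K -> 0 <= q < 1 -> 0 < e ->
 exists N, forall k, (N <= k)%N -> K * q ^+ k <= e.
Proof.
move=> K0 q01 e0; have K1 : 0 < K + 1 by rewrite ltr_wpDl.
have [N HN] := expr_small q01 (divr_gt0 e0 K1); exists N => k /HN.
have /andP[q0 _] := q01.
rewrite ler_pdivlMr// mulrDr mulr1 mulrC => h; apply: le_trans h.
by rewrite lerDl exprn_ge0.
Qed.

Lemma le_of_small (a b : R) : (forall e, 0 < e -> a <= b + e) -> a <= b.
Proof. by move=> H; apply/ler_addgt0Pr. Qed.

Lemma L2_geom_limit U (u : nat -> V -> R) (K q : R) : measurable U -> (forall j, L2 U (u j)) ->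
 0 <= K -> 0 <= q < 1 ->
 (forall j, L2norm U (fun x => u j.+1 x - u j x) <= K * q ^+ j) ->
 exists v, L2 U v /\ forall k, L2norm U (fun x => v x - u k x) <= K / (1 - q) * q ^+ k.
Proof.
move=> mU Lu K0 q01 H; have /andP[q0 q1] := q01.
have C0 : 0 <= K / (1 - q) by rewrite divr_ge0// subr_ge0 ltW.
have D k r := L2norm_geom k r mU Lu K0 q01 H.
have DC j k : L2norm U (fun x => u j x - u k x) = L2norm U (fun x => u k x - u j x).
 by rewrite -L2normN; congr Num.sqrt; apply: eq_Rint => x _; rewrite opprB.
have [] := L2_complete mU Lu.
 move=> e e0; have se0 : 0 < Num.sqrt e by rewrite sqrtr_gt0.
 have [N HN] := geom_small C0 q01 se0; exists N => j k.
 wlog jk : j k / (j <= k)%N.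
  move=> W Nj Nk; have /orP[jk|kj] := leq_total j k; first exact: W.
  by rewrite -L2norm_sqr DC L2norm_sqr; exact: W.
 move=> Nj Nk; rewrite -(sqr_sqrtr (ltW e0)); apply: L2n_le; rewrite DC.
 have := D j (k - j)%N; rewrite subnKC// => h; apply: le_trans h _; exact: HN.
move=> v [Lv Hv]; exists v; split => // k; apply: le_of_small => e e0.
have [M HM] := Hv (e ^+ 2) (exprn_gt0 2 e0).
have l1 : L2 U (fun x => u (k + M)%N x - u k x) by exact: L2B.
have l2 : L2 U (fun x => v x - u (k + M)%N x) by exact: L2B.
have -> : (fun x => v x - u k x) = fun x => (u (k + M)%N x - u k x) + (v x - u (k + M)%N x) by apply/funext => x; ring.
apply: le_trans (L2normD mU l1 l2) _; apply: lerD; first exact: D.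
have := L2norm_le (ltW e0) (HM (k + M)%N (leq_addl _ _)).
by rewrite -L2normN; under eq_fun do rewrite opprB.
Qed.

Lemma L2_geom_pw U (u : nat -> V -> R) f (K q : R) k : measurable U -> (forall j, L2 U (u j)) ->
 0 <= K -> 0 <= q < 1 -> L2 U f ->
 (forall j, L2norm U (fun x => u j.+1 x - u j x) <= K * q ^+ j) ->
 (forall x, U x -> u^~ x @ \oo --> f x) ->
 L2norm U (fun x => f x - u k x) <= K / (1 - q) * q ^+ k.
Proof.
move=> mU Lu K0 q01 Lf H cu; have /andP[q0 q1] := q01.
have C0 : 0 <= K / (1 - q) by rewrite divr_ge0// subr_ge0 ltW.
have L1 j : L2 U (fun x => u (k + j)%N x - u k x) by exact: L2B.
have Lfk : L2 U (fun x => f x - u k x) by exact: L2B.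
apply: L2norm_le; first by rewrite mulr_ge0// exprn_ge0.
rewrite -lee_fin -L2nE//.
apply: (@fatou_le _ _ _ mu U (fun j x => ((u (k + j)%N x - u k x) ^+ 2)%:E) _ _ 0) => //.
- by move=> j; apply/EFin_meas; apply: mfunX; case: (L1 j).
- by move=> j x _; rewrite lee_fin sqr_ge0.
- by apply/EFin_meas; apply: mfunX; case: Lfk.
- by move=> x _; rewrite lee_fin sqr_ge0.
- apply: aeW => x Ux; apply: cvg_EFin; first by apply: nearW.
 apply: (@cvg_comp _ _ _ (fun j => u (k + j)%N x - u k x) (fun z => z ^+ 2)); last exact: exprn_continuous.
 apply: cvgB; last exact: cvg_cst.
 have := cu x Ux; rewrite -(cvg_shiftn k); apply: cvg_trans; apply: near_eq_cvg.
 by near=> j; rewrite addnC.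
- move=> j _; rewrite L2nE// lee_fin; apply: L2n_le; exact: L2norm_geom.
Unshelve. all: by end_near.
Qed.

End L2_norm.

(** * Solutions for the dyadic differences of the data *)

Section dyadic.
Context {R : realType}.
Local Notation V := 'rV[R]_4.
Local Notation mu := (lebesgue_rV R 4).
Local Notation e_ i := (basis_vec R i).
Implicit Types (U Om N : set V) (f phi : V -> R) (x : V) (p q T e : 'I_4 -> V -> R).

Lemma half01 : 0 <= (2^-1 : R) < 1.
Proof. by rewrite invr_ge0 ler0n/= invf_lt1// ltr1n. Qed.

Lemma ip_test_sub U U' f phi : measurable U -> measurable U' -> U `<=` U' -> tfun U phi ->
 ip U' f phi = ip U f phi.
Proof.
move=> mU mU' UU' [_ [K [_ KU HK]]].
rewrite /ip (int_supp (K := K) mU')//; last 2 first.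
- by move=> x Kx; apply: UU'; exact: KU.
- by move=> x nK; rewrite HK// mulr0.
by rewrite (int_supp (K := K) mU)// => x nK; rewrite HK// mulr0.
Qed.

Definition qsel (a b c d : V -> R) (i : 'I_4) : V -> R :=
 if i == i0 then a else if i == i1 then b else if i == i2 then c else d.

Lemma qsel_test U a b c d : tfun U a -> tfun U b -> tfun U c ->
 tfun U d -> testv U (qsel a b c d).
Proof. by move=> ta tb tc td; apply: ord4P. Qed.

Lemma th_Dop g0 g1 i x : th g0 g1 i x = Dop (qsel g0 g1 (fun=> 0) (fun=> 0)) i x.
Proof.
elim/ord4P: i; rewrite /th /Dop /D0 /D1 /D2 /D3 /qsel /= !pd_cst; gen_pd; ring.
Qed.

Let Z0 : V -> R := fun=> 0.

Lemma A_Dop2 U phi x : tfun U phi ->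
 opA1 (Dop (qsel Z0 Z0 phi Z0)) x = lap phi x /\ opA2 (Dop (qsel Z0 Z0 phi Z0)) x = 0.
Proof.
move=> tp; have tq := @qsel_test U Z0 Z0 phi Z0 (test0 _) (test0 _) tp (test0 _).
have E i : Dop (qsel Z0 Z0 phi Z0) i = pd i phi.
 apply/funext => y; elim/ord4P: i; rewrite /Dop /D0 /D1 /D2 /D3 /qsel /= !pd_cst; gen_pd; ring.
rewrite /opA1 /opA2 !E lap4; split; first by [].
have := (pd_test_pd i0 i1 x tp, pd_test_pd i2 i3 x tp); case; gen_pd; intros; subst; ring.
Qed.

Lemma A_Dop3 U phi x : tfun U phi ->
 opA1 (Dop (qsel Z0 Z0 Z0 phi)) x = 0 /\ opA2 (Dop (qsel Z0 Z0 Z0 phi)) x = lap phi x.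
Proof.
move=> tp; pose q := qsel Z0 Z0 Z0 phi.
have E0 : Dop q i0 = fun y => - pd i1 phi y by apply/funext => y; rewrite /Dop /D0 /q /qsel /= !pd_cst; gen_pd; ring.
have E1 : Dop q i1 = pd i0 phi by apply/funext => y; rewrite /Dop /D1 /q /qsel /= !pd_cst; gen_pd; ring.
have E2 : Dop q i2 = fun y => - pd i3 phi y by apply/funext => y; rewrite /Dop /D2 /q /qsel /= !pd_cst; gen_pd; ring.
have E3 : Dop q i3 = pd i2 phi by apply/funext => y; rewrite /Dop /D3 /q /qsel /= !pd_cst; gen_pd; ring.
have N i j : pd i (fun y => - pd j phi y) x = - pd i (pd j phi) x by apply: pdN; exact: test_pder (test_pd j tp).
rewrite /opA1 /opA2 -/q E0 E1 E2 E3 !N lap4.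
have := (pd_test_pd i0 i1 x tp, pd_test_pd i2 i3 x tp); case; gen_pd; intros; subst; split; ring.
Qed.

(** Testing the equation on the last two columns of [Dop] gives [lap phi] against one component of
    [v] on the left side, and 0 on the right side because the datum is orthogonal to the image of
    [Dop]. *)
Lemma solution_wharm U (v : 'I_2 -> V -> R) D : open U ->
 (forall q, testv U q -> ipv U D (Dop q) = 0) ->
 (forall p, testv U p -> ipv U (opAv p) v = - ipv U D p) -> forall i, wharm U (v i).
Proof.
move=> oU HD Hv i phi tp.
have t0 : tfun U Z0 by exact: test0.
have S (F : 'I_2 -> R) : \sum_j F j = F ord0 + F (lift ord0 ord0) by rewrite big_ord_recl big_ord1.
have z (f : V -> R) : \int[mu]_(x in U) (0 * f x) = 0 by under eq_Rint => x _ do rewrite mul0r; exact: Rint_cst0.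
have [->|] := eqVneq i ord0.
 have tq := qsel_test t0 t0 tp t0.
 have := Hv _ (Dop_test tq); rewrite HD// oppr0 /ipv S /ip /opAv /=.
 under eq_Rint => x _ do rewrite (A_Dop2 x tp).1.
 under [X in _ + X]eq_Rint => x _ do rewrite (A_Dop2 x tp).2.
 rewrite z addr0 => h; rewrite -[RHS]h; by apply: eq_Rint => x _; rewrite mulrC.
move=> ine; have -> : i = lift ord0 ord0.
 by apply: val_inj; move: ine; case: i => [[|[|]]].
have tq := qsel_test t0 t0 t0 tp.
have := Hv _ (Dop_test tq); rewrite HD// oppr0 /ipv S /ip /opAv /=.
under eq_Rint => x _ do rewrite (A_Dop3 x tp).1.
under [X in _ + X]eq_Rint => x _ do rewrite (A_Dop3 x tp).2.
rewrite z add0r => h; rewrite -[RHS]h; by apply: eq_Rint => x _; rewrite mulrC.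
Qed.

Lemma L2norm_comp (I : finType) U (f : I -> V -> R) (a : R) : 0 <= a ->
 \sum_i L2n U (f i) <= a ^+ 2 -> forall i, L2norm U (f i) <= a.
Proof.
move=> a0 H i; apply: L2norm_le => //; apply: le_trans H.
by rewrite (bigD1 i)//= lerDl sumr_ge0// => j _; exact: L2n_ge0.
Qed.

Section solutions.
Context (Om N : set V) (sigma : V -> R) (c M B t0 kap eps0 lam : R)
 (ex : exhaustion Om N sigma c M B t0 kap eps0 lam)
 (m : nat) (e : 'I_4 -> V -> R)
 (he : forall i, harm Om (e i))
 (eL2 : forall i l, (size l < m.+2)%N -> L2 Om (partial l (e i)))
 (e_adj : forall j x, Om x -> Dadj e j x = 0).

Definition dyad k : R := eps0 * 2^-1 ^+ k.
Local Notation Uk k := (sublev N sigma (kap * dyad k)).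
Local Notation T := (Tv sigma m e).

Lemma dyad_in k : 0 < dyad k <= eps0.
Proof.
have /andP[h0 _] := ex_eps0 ex; rewrite /dyad mulr_gt0 ?exprn_gt0//=.
by rewrite ler_piMr ?(ltW h0)// exprn_ile1 ?invr_ge0// invf_le1// ler1n.
Qed.

Lemma dyadS k : dyad k.+1 = dyad k / 2.
Proof. by rewrite /dyad exprSr mulrA. Qed.

Lemma dyad_sub k : Uk k.+1 `<=` Uk k.
Proof.
apply: sublev_le; rewrite dyadS ler_pM2l ?(ex_kap ex)//.
by have /andP[] := half_le (andP (dyad_in k)).1.
Qed.

Lemma Om_sub k : Om `<=` Uk k.
Proof.
rewrite (ex_Om ex); apply: sublev_le; rewrite mulr_ge0 ?(ltW (ex_kap ex))//.
by have /andP[/ltW] := dyad_in k.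
Qed.

Lemma Uk_open k : open (Uk k).
Proof. exact: (Ut_open ex). Qed.

Let mU k := open_meas (@Uk_open k).
Let mO := open_meas (ex_open ex).

Lemma Tv_diff_norm : exists2 K : R, 0 <= K & forall k i,
 L2norm (Uk k.+1) (fun x => T (dyad k.+1) i x - T (dyad k) i x) <= K * dyad k ^+ m.+1.
Proof.
have [K K0 HK] := Tay_diff_L2 ex he eL2; exists (Num.sqrt K); first exact: sqrtr_ge0.
move=> k i; have := HK (dyad k) i (dyad_in k); rewrite -dyadS => h.
apply: L2norm_le; last by rewrite exprMn sqr_sqrtr.
by rewrite mulr_ge0 ?sqrtr_ge0// exprn_ge0// ltW//; have /andP[] := dyad_in k.
Qed.

Lemma Tv_L2 k i : L2 (Uk k) (T (dyad k) i).
Proof. by have [K _ HK] := Tay_L2 ex he eL2; have [] := HK _ i (dyad_in k). Qed.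

Lemma approx_seq : exists2 K : R, 0 <= K & exists E : nat -> 'I_4 -> V -> R, forall k,
 [/\ L2v (Uk k) (E k), forall q, testv (Uk k) q -> ipv (Uk k) (E k) (Dop q) = 0,
   forall i, L2norm (Uk k) (E k i) <= K &
   forall i, L2norm (Uk k) (fun x => T (dyad k) i x - E k i x) <= K * dyad k ^+ m.+1].
Proof.
have [K K0 HK] := approx_correct ex he eL2 e_adj; exists (Num.sqrt K); first exact: sqrtr_ge0.
have [E HE] := choice (fun k => HK (dyad k) (dyad_in k)).
exists E => k; have [LE oE nE dE] := HE k; split => //.
 by apply: L2norm_comp; [exact: sqrtr_ge0|rewrite sqr_sqrtr].
apply: L2norm_comp; last by rewrite exprMn sqr_sqrtr.
by rewrite mulr_ge0 ?sqrtr_ge0// exprn_ge0// ltW//; have /andP[] := dyad_in k.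
Qed.

Definition pdiff (E : nat -> 'I_4 -> V -> R) k : 'I_4 -> V -> R :=
 if k is k'.+1 then fun i x => E k i x - E k' i x else E 0%N.

Lemma pdiff_sum E k i x : \sum_(j < k.+1) pdiff E j i x = E k i x.
Proof.
elim: k => [|k IH]; first by rewrite big_ord1.
by rewrite big_ord_recr/= IH addrC subrK.
Qed.

(** Two consecutive corrected data are compared through their Taylor polynomials, on the smaller of
    the two domains. *)
Lemma pdiff_bound : exists2 K : R, 0 <= K & exists E : nat -> 'I_4 -> V -> R, forall k,
 [/\ L2v (Uk k) (pdiff E k), forall q, testv (Uk k) q -> ipv (Uk k) (pdiff E k) (Dop q) = 0,
   forall i, L2norm (Uk k) (pdiff E k i) <= K * dyad k ^+ m.+1,
   L2v Om (E k) &
   forall i, L2norm Om (fun x => T (dyad k) i x - E k i x) <= K * dyad k ^+ m.+1].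
Proof.
have [K1 K10 HK1] := Tv_diff_norm; have [K K0 [E HE]] := approx_seq.
have /andP[e0 e1] := ex_eps0 ex.
have E0 : 0 < eps0 ^+ m.+1 by rewrite exprn_gt0.
have dp k : 0 <= dyad k ^+ m.+1 by rewrite exprn_ge0// ltW//; have /andP[] := dyad_in k.
have d2 k : dyad k ^+ m.+1 = 2 ^+ m.+1 * dyad k.+1 ^+ m.+1 by rewrite dyadS -exprMn mulrCA mulfV ?mulr1.
(* [2 ^ m.+1] pays for passing from [dyad k] to [dyad k.+1]; the last summand makes the bound true
   for the initial datum [E 0], which is not a difference. *)
pose C := (K1 + K) * 2 ^+ m.+1 + K + K / eps0 ^+ m.+1.
have C1 : 0 <= (K1 + K) * 2 ^+ m.+1 by rewrite mulr_ge0 ?addr_ge0// exprn_ge0.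
have C2 : 0 <= K / eps0 ^+ m.+1 by rewrite divr_ge0// ltW.
exists C; first by rewrite !addr_ge0.
exists E => k; have [LE oE nE dE] := HE k.
have KC : K <= C by rewrite /C -addrA addrCA lerDl addr_ge0.
have OE : L2v Om (E k) by move=> i; apply: (@L2_sub _ _ Om (Uk k)) => //; exact: Om_sub.
have LT := @Tv_L2 k.
have OT i : L2norm Om (fun x => T (dyad k) i x - E k i x) <= C * dyad k ^+ m.+1.
 apply: (@le_trans _ _ (K * dyad k ^+ m.+1)); last by rewrite ler_wpM2r.
 apply: le_trans (dE i); rewrite ler_wsqrtr// L2n_sub//; first exact: Om_sub.
 exact: L2B.
case: k {OE OT} LE oE nE dE LT (OE) (OT) => [|k] LE oE nE dE LT OE OT.
 split => // i; apply: le_trans (nE i) _; rewrite /dyad expr0 mulr1 -ler_pdivrMr//.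
 by rewrite /C lerDr addr_ge0.
have [LE' oE' nE' dE'] := HE k.
have sub := @dyad_sub k.
have LEs i : L2 (Uk k.+1) (E k i) by apply: (@L2_sub _ _ _ (Uk k)).
have LTs i : L2 (Uk k.+1) (T (dyad k) i) by apply: (@L2_sub _ _ _ (Uk k)) => //; exact: Tv_L2.
have LN i : L2 (Uk k.+1) (fun x => -1 * E k i x) by exact: L2Z.
have Ed : pdiff E k.+1 = fun i x => E k.+1 i x + -1 * E k i x by apply/funext => i; apply/funext => x; rewrite mulN1r.
split => //.
- by rewrite Ed; exact: L2vD.
- move=> q tq; have tD := testv_L2v (Uk_open (k := k.+1)) (Dop_test tq).
 rewrite Ed ipvDl// oE// add0r ipvZl//.
 have -> : ipv (Uk k.+1) (E k) (Dop q) = ipv (Uk k) (E k) (Dop q).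
  by apply: eq_bigr => i _; apply/esym; apply: (ip_test_sub _ _ _ sub) => //; exact: Dop_test.
 by rewrite oE' ?mulr0// => i; exact: test_sub sub (tq i).
move=> i.
have -> : pdiff E k.+1 i = fun x => (T (dyad k.+1) i x - T (dyad k) i x) +
  (- (T (dyad k.+1) i x - E k.+1 i x) + (T (dyad k) i x - E k i x)).
 by apply/funext => x /=; ring.
have l1 := L2B (mU k.+1) (LT i) (LTs i); have l2 := L2B (mU k.+1) (LT i) (LE i).
have l3 := L2B (mU k.+1) (LTs i) (LEs i); have l4 := L2N (mU k.+1) l2.
apply: le_trans (L2normD (mU _) l1 (L2D (mU _) l4 l3)) _.
have h3 : L2norm (Uk k.+1) (fun x => T (dyad k) i x - E k i x) <= K * dyad k ^+ m.+1.
 by apply: le_trans (dE' i); rewrite ler_wsqrtr// L2n_sub//; apply: L2B => //; exact: Tv_L2.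
apply: le_trans (lerD (HK1 k i) (L2normD (mU _) l4 l3)) _; rewrite L2normN.
apply: le_trans (lerD (lexx _) (lerD (dE i) h3)) _.
have -> : K1 * dyad k ^+ m.+1 + (K * dyad k.+1 ^+ m.+1 + K * dyad k ^+ m.+1) =
  ((K1 + K) * 2 ^+ m.+1 + K) * dyad k.+1 ^+ m.+1 by rewrite d2; ring.
by rewrite ler_wpM2r// /C lerDl.
Qed.

Lemma Tv_cvg i x : Om x -> (fun k => T (dyad k) i x) @ \oo --> e i x.
Proof.
move=> Ox; have sx : shiftv (dirn sigma) 0 x = x by apply/rowP => a; rewrite mxE mul0r addr0.
have T0 : T 0 i x = e i x.
 rewrite /Tv /Tay big_ord_recl expr0 fact0 divr1 mul1r/= sx big1 ?addr0// => l _.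
 by rewrite oppr0 expr0n/= !mul0r.
have [+ _] := isd_Tay_eps m (ex_open ex) (e_smooth ex he i) (eps := 0) (nu := dirn sigma) (x := x) ltac:(by rewrite sx).
move=> /derivable1_diffP/differentiable_continuous ct.
rewrite -T0; apply: (@cvg_comp _ _ _ dyad (fun z => Tay (dirn sigma) m.+1 (e i) z x)); last exact: ct.
apply/cvgrPdist_le => d d0; have /andP[/ltW e0 _] := ex_eps0 ex.
have q01 := half01.
have [M' HM'] := geom_small e0 q01 d0; exists M' => // k /HM' H.
by rewrite sub0r normrN ger0_norm// /dyad mulr_ge0// exprn_ge0.
Qed.

(** On [Om] the corrected data converge to [e] in L2, since both the correction and the Taylor error
    are geometrically small in [k]. *)
Lemma dyadic_weak E K : 0 <= K ->
 (forall k, L2v Om (E k) /\ forall i, L2norm Om (fun x => T (dyad k) i x - E k i x) <= K * dyad k ^+ m.+1) ->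
 forall p, testv Om p -> forall d, 0 < d -> exists M', forall k, (M' <= k)%N ->
  `|ipv Om (E k) p - ipv Om e p| <= d.
Proof.
move=> K0 HE p tp d d0; have [K1 K10 HK1] := Tv_diff_norm.
have oO := ex_open ex; have /andP[e0 e1] := ex_eps0 ex.
have q01 := half01.
have /andP[q0 _] := q01.
have dq k : dyad k ^+ m.+1 <= 2^-1 ^+ k.
 rewrite exprMn -exprM; apply: (@le_trans _ _ (1 * (2^-1 ^+ (k * m.+1)))).
  by apply: ler_pM; rewrite ?exprn_ge0 ?(ltW e0)// exprn_ile1// ltW.
 by rewrite mul1r mulnS exprD ler_piMr ?exprn_ge0// exprn_ile1// invf_le1// ler1n.
have LT k i : L2 Om (T (dyad k) i) by apply: (@L2_sub _ _ Om (Uk k)) => //; [exact: Om_sub|exact: Tv_L2].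
have Le i : L2 Om (e i) by exact: (eL2 i (l := [::])).
have D1 k i : L2norm Om (fun x => T (dyad k.+1) i x - T (dyad k) i x) <= K1 * 2^-1 ^+ k.
 apply: (@le_trans _ _ (K1 * dyad k ^+ m.+1)); last by rewrite ler_wpM2l.
 apply: le_trans (HK1 k i); rewrite ler_wsqrtr// L2n_sub//; first exact: Om_sub.
 by apply: L2B => //; [exact: Tv_L2|apply: (@L2_sub _ _ _ (Uk k)) => //; [exact: dyad_sub|exact: Tv_L2]].
have D2 k i : L2norm Om (fun x => e i x - T (dyad k) i x) <= K1 / (1 - 2^-1) * 2^-1 ^+ k.
 apply: (L2_geom_pw k mO (fun j => LT j i) K10 q01 (Le i) (fun j => D1 j i)) => x.
 exact: Tv_cvg.
pose K2 := K + K1 / (1 - 2^-1).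
have h2 : 0 <= 1 - 2^-1 :> R by rewrite subr_ge0 invf_le1// ler1n.
have K20 : 0 <= K2 by rewrite addr_ge0// divr_ge0.
have D3 k i : L2norm Om (fun x => E k i x - e i x) <= K2 * 2^-1 ^+ k.
 have [LE nE] := HE k.
 have -> : (fun x => E k i x - e i x) = fun x => - (T (dyad k) i x - E k i x) + - (e i x - T (dyad k) i x) by apply/funext => x; ring.
 apply: le_trans (L2normD _ _ _) _ => //; [exact/L2N/L2B|exact/L2N/L2B|].
 rewrite !L2normN mulrDl; apply: lerD (D2 k i).
 by apply: le_trans (nE i) _; rewrite ler_wpM2l.
have Lp i : L2 Om (p i) by exact: testv_L2v.
pose P := \sum_i L2norm Om (p i).
have P0 : 0 <= P by apply: sumr_ge0 => i _; exact: L2norm_ge0.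
have [M' HM'] := geom_small (mulr_ge0 K20 P0) q01 d0; exists M' => k /HM'.
apply: le_trans; have [LE _] := HE k.
rewrite /ipv -sumrB; apply: le_trans (ler_norm_sum _ _ _) _.
rewrite mulrAC /P mulr_sumr; apply: ler_sum => i _.
have -> : ip Om (E k i) (p i) - ip Om (e i) (p i) = ip Om (fun x => E k i x - e i x) (p i).
 rewrite /ip -RintegralB//; try exact: L2_mul.
 by apply: eq_Rint => x _; rewrite mulrBl.
apply: le_trans (L2norm_ip mO (L2B mO (LE i) (Le i)) (Lp i)) _.
by apply: ler_wpM2r; [exact: L2norm_ge0|exact: D3].
Qed.

(** Each solution keeps its own enlarged domain. Restricted to [Om], the sum of the equations
    telescopes to the equation for a corrected datum, which tends to [e]. *)
Lemma dyadic_solutions : exists2 K : R, 0 <= K & exists v : nat -> 'I_2 -> V -> R,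
 [/\ forall k i, L2 (Uk k) (v k i), forall k i, wharm (Uk k) (v k i),
   forall k i, L2norm (Uk k) (v k i) <= K * dyad k ^+ m.+1 &
   forall p, testv Om p -> forall d, 0 < d -> exists M', forall k, (M' <= k)%N ->
    `|\sum_(j < k) ipv Om (opAv p) (v j) + ipv Om e p| <= d].
Proof.
have [K K0 [E HE]] := pdiff_bound.
have gd k : good_domain (Uk k) sigma (kap * dyad k) c M.
 apply: (ex_gd ex); rewrite mulr_gt0 ?(ex_kap ex)//=; last by have /andP[] := dyad_in k.
 exact: (ex_kap_le ex (dyad_in k)).
have S k : exists v, [/\ L2v (Uk k) v, L2vn (Uk k) v <= solve_cst c M * L2vn (Uk k) (pdiff E k) &
  forall p, testv (Uk k) p -> ipv (Uk k) (opAv p) v = - ipv (Uk k) (pdiff E k) p].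
 have [LD oD _ _ _] := HE k.
 apply: (solve (gd k) LD) => g0 g1 t0' t1.
 rewrite -(oD (qsel g0 g1 Z0 Z0)).
  by apply: eq_bigr => i _; apply: eq_Rint => x _; rewrite th_Dop.
 by apply: qsel_test => //; exact: test0.
have [v Hv] := choice S.
have s0 : 0 <= solve_cst c M.
 have c0 := gd_c (gd 0%N); have M0 := gd_M (gd 0%N).
 by rewrite /solve_cst mulr_ge0 ?divr_ge0 ?(ltW c0)// addr_ge0 ?(ltW M0)// divr_ge0 ?(ltW c0)// mulr_ge0 ?sqr_ge0.
have dp k : 0 <= dyad k ^+ m.+1 by rewrite exprn_ge0// ltW//; have /andP[] := dyad_in k.
pose C := Num.sqrt (solve_cst c M * 4) * K.
exists C; first by rewrite mulr_ge0// sqrtr_ge0.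
exists v; split.
- by move=> k i; have [Lv _ _] := Hv k.
- move=> k; have [_ _ Ev] := Hv k; have [_ oD _ _ _] := HE k.
 exact: (solution_wharm (@Uk_open k) oD Ev).
- move=> k; apply: L2norm_comp; first by rewrite mulr_ge0// mulr_ge0// sqrtr_ge0.
 have [_ nv _] := Hv k; apply: le_trans nv _; have [_ _ nD _ _] := HE k.
 have -> : (C * dyad k ^+ m.+1) ^+ 2 = solve_cst c M * (4 * (K * dyad k ^+ m.+1) ^+ 2).
  by rewrite /C -mulrA exprMn sqr_sqrtr; [rewrite -[LHS]mulrA|rewrite mulr_ge0].
 apply: ler_wpM2l => //; apply: (@le_trans _ _ (\sum_(i < 4) (K * dyad k ^+ m.+1) ^+ 2)).
  by apply: ler_sum => i _; exact: L2n_le.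
 by rewrite sumr_const card_ord mulr_natl.
move=> p tp d d0.
have HE2 k : L2v Om (E k) /\ forall i, L2norm Om (fun x => T (dyad k) i x - E k i x) <= K * dyad k ^+ m.+1 by have [_ _ _ LE nE] := HE k.
(* The first [k.+1] solutions telescope to the datum [E k], hence the threshold [M'.+1]. *)
have [M' HM'] := dyadic_weak K0 HE2 tp d0; exists M'.+1 => -[//|k] /HM'.
have -> : \sum_(j < k.+1) ipv Om (opAv p) (v j) = - ipv Om (E k) p.
 have Ej j : ipv Om (opAv p) (v j) = - ipv Om (pdiff E j) p.
  have [_ _ Ev] := Hv j; have tpj i := test_sub (@Om_sub j) (tp i).
  have := Ev p tpj; rewrite [ipv (Uk j) (opAv p) _]ipvC [ipv Om (opAv p) _]ipvC /ipv.
  under eq_bigr => i _ do rewrite (ip_test_sub _ mO (mU j) (@Om_sub j) (opAv_test i tp)).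
  under [in X in _ = - X]eq_bigr => i _ do rewrite (ip_test_sub _ mO (mU j) (@Om_sub j) (tp i)).
  exact.
 under eq_bigr => j _ do rewrite Ej; rewrite sumrN; congr (- _).
 rewrite /ipv exchange_big; apply: eq_bigr => i _; rewrite /ip -Rint_sum//.
  by apply: eq_Rint => x _; rewrite -(pdiff_sum E k) mulr_suml.
 move=> j _; apply: L2_mul => //; last exact: testv_L2v (ex_open ex) tp i.
 have [LD _ _ _ _] := HE j; apply: (@L2_sub _ _ Om (Uk j)) => //; exact: Om_sub.
by rewrite -normrN opprD opprK.
Qed.

End solutions.
End dyadic.

(** * Finite Gagliardo seminorm from a translation estimate *)

Section gagliardo_bound.
Context {R : realType} {n : nat}.
Local Notation V := 'rV[R]_n.
Local Notation mu := (lebesgue_rV R n).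
Implicit Types (g : V -> R) (Om : set V) (x y : V).

Lemma dyadic_shell (D r : R) : 0 < r <= D ->
 exists j, D * 2^-1 ^+ j / 2 <= r <= D * 2^-1 ^+ j.
Proof.
move=> /andP[r0 rD]; have D0 : 0 < D by exact: lt_leT rD.
have ex0 : exists j, D * 2^-1 ^+ j / 2 <= r.
 have [N HN] := geom_small (ltW D0) (@half01 R) r0; exists N.
 apply: le_trans (HN N (leqnn _)); rewrite ler_pdivrMr// ler_peMr ?ler1n//.
 by rewrite mulr_ge0 ?(ltW D0)// exprn_ge0// invr_ge0.
exists (ex_minn ex0); case: ex_minnP => -[|j] Hj Hmin; rewrite Hj/=; first by rewrite expr0 mulr1.
rewrite leNgt; apply/negP => h; suff /Hmin : D * 2^-1 ^+ j / 2 <= r by rewrite ltnn.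
by apply: ltW; rewrite -mulrA -exprSr.
Qed.

Lemma norm_le_eucl x y : `|x - y| <= eucl_dist x y.
Proof.
apply: normrV_le => [|i]; first exact: sqrtr_ge0.
rewrite -sqrtr_sqr ler_wsqrtr// (bigD1 i)//= !mxE lerDl sumr_ge0// => j _.
exact: sqr_ge0.
Qed.

Lemma coord1_meas i : mfun setT (fun xy : V * V => xy.1 0 i).
Proof.
rewrite (_ : (fun xy => _) = (fun x : V => x 0 i : measurableTypeR R) \o fst)//.
by apply: mfun_comp => //; exact: measurable_rV_coord.
Qed.

Lemma coord2_meas i : mfun setT (fun xy : V * V => xy.2 0 i).
Proof.
rewrite (_ : (fun xy => _) = (fun x : V => x 0 i : measurableTypeR R) \o snd)//.
by apply: mfun_comp => //; exact: measurable_rV_coord.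
Qed.

Lemma eucl_meas : mfun setT (fun xy : V * V => eucl_dist xy.1 xy.2).
Proof.
rewrite /eucl_dist; apply: mfun_comp; first by apply: continuous_measurable_fun; exact: sqrt_continuous.
apply: measurable_sum => i; apply: mfunX; apply: mfunB.
 exact: coord1_meas.
exact: coord2_meas.
Qed.

Lemma geom_nneseries (b q : R) (F : nat -> \bar R) : 0 <= b -> 0 <= q < 1 ->
 (forall j, (0 <= F j)%E) -> (forall j, (F j <= (b * q ^+ j)%:E)%E) ->
 (\sum_(0 <= j <oo) F j < +oo)%E.
Proof.
move=> b0 q01 F0 FB; apply: (@le_ltT _ _ (b / (1 - q))%:E); last by rewrite ltry.
apply: lime_le; first by apply: is_cvg_nneseries => *; exact: F0.
apply: nearW => N; rewrite big_mkord; apply: (@le_trans _ _ (\sum_(j < N) (b * q ^+ j)%:E)%E).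
 by apply: lee_sum => j _; exact: FB.
by rewrite sumEFin lee_fin -mulr_sumr ler_wpM2l// geom_sum_le.
Qed.

Lemma powR_exp (a k : R) j : 0 <= a -> (a ^+ j) `^ k = (a `^ k) ^+ j.
Proof.
move=> a0; rewrite -(powR_mulrn j a0) -powRrM mulrC powRrM powR_mulrn//.
exact: powR_ge0.
Qed.

Lemma powR_split (r s t : R) : 0 < r ->
 r `^ (2 * (s - t)) = r `^ (- (n%:R + 2 * t)) * r `^ s * r `^ s * r ^+ n.
Proof.
move=> r0; have N (z : R) : (z == 0) ==> (r != 0) by rewrite (gt_eqF r0) implybT.
rewrite -(powR_mulrn n (ltW r0)) -(powRD (N _)) -(powRD (N _)) -(powRD (N _)).
by congr (powR _ _); ring.
Qed.

Section translation.
Context (Om : set V) (g : V -> R) (K D b theta : R)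
 (mO : measurable Om) (Lg : L2 setT g) (K0 : 0 <= K) (D0 : 0 < D) (th0 : 0 < theta) (thb : theta < b)
 (Hg : forall h, L2norm setT (fun x => g (x + h) - g x) <= K * `|h| `^ b)
 (OD : forall x y, Om x -> Om y -> `|x - y| <= D).

Let p := n%:R + 2 * theta.
Let rad j := D * 2^-1 ^+ j.
(** Upper bound of the singular kernel where [|x - y|] is at least [rad j / 2]. *)
Let a j := (rad j / 2) `^ (- p).

Lemma rad_gt0 j : 0 < rad j.
Proof. by rewrite mulr_gt0// exprn_gt0// invr_gt0. Qed.

(** The dyadic shell is enlarged to the full cube: this is an upper bound, and its integral is an
    average of translation differences. *)
Definition gker j (xy : V * V) : \bar R :=
 ((a j * (g xy.1 - g xy.2) ^+ 2) * (\1_[set xz : V * V | cube xz.1 (rad j) xz.2] xy))%:E.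

Let mg1 : mfun setT (fun xy : V * V => g xy.1).
Proof. exact: (mfun_comp Lg.1 measurable_fst). Qed.
Let mg2 : mfun setT (fun xy : V * V => g xy.2).
Proof. exact: (mfun_comp Lg.1 measurable_snd). Qed.

Lemma gker_meas j : mfun setT (gker j).
Proof.
apply/EFin_meas; apply: mfunM; last by apply: measurable_indic; exact: cube2_meas.
by apply: mfunM => //; apply: mfunX; exact: mfunB.
Qed.

Lemma gker_ge0 j xy : (0 <= gker j xy)%E.
Proof. by rewrite lee_fin mulr_ge0// mulr_ge0 ?powR_ge0 ?sqr_ge0. Qed.

Definition gint (xy : V * V) : \bar R :=
 ((g xy.1 - g xy.2) ^+ 2 / eucl_dist xy.1 xy.2 `^ p)%:E.

Lemma gint_meas : mfun setT gint.
Proof.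
apply/EFin_meas.
rewrite (_ : (fun w => _) = fun xy : V * V => (g xy.1 - g xy.2) ^+ 2 * eucl_dist xy.1 xy.2 `^ (- p)); last first.
 by apply/funext => xy; rewrite powRN.
apply: mfunM; first by apply: mfunX; exact: mfunB.
exact: (mfun_comp (measurable_powR (- p)) eucl_meas).
Qed.

Lemma gint_ge0 xy : (0 <= gint xy)%E.
Proof. by rewrite lee_fin divr_ge0 ?sqr_ge0 ?powR_ge0. Qed.

Lemma gint_le x y : Om x -> Om y -> (gint (x, y) <= \sum_(0 <= j <oo) gker j (x, y))%E.
Proof.
move=> Ox Oy; have [<-|xy] := eqVneq x y.
 by rewrite /gint subrr expr0n mul0r nneseries_ge0// => j _ _; exact: gker_ge0.
have d0 : 0 < `|x - y| by rewrite normr_gt0 subr_eq0.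
have [|j /andP[j1 j2]] := @dyadic_shell D `|x - y|; first by rewrite d0 OD.
apply: le_trans (@nneseries_lim_ge _ _ xpredT 0 j.+1 _) => [|i _ _]; last exact: gker_ge0.
rewrite big_nat_recr//=; apply: (@le_trans _ _ (gker j (x, y))); last first.
 by rewrite leeDr// sume_ge0// => i _; exact: gker_ge0.
rewrite /gint /gker indicE mem_set /=; last first.
 by move=> i; apply: le_trans j2; rewrite distrC; have := le_normrV (x - y) i; rewrite !mxE.
rewrite mulr1 mulrC lee_fin ler_wpM2r ?sqr_ge0// /a powRN.
have r0 : 0 < rad j / 2 by rewrite divr_gt0 ?rad_gt0.
rewrite lef_pV2 ?posrE ?powR_gt0//; last exact: lt_leT d0 (norm_le_eucl _ _).
apply: ge0_ler_powR; rewrite ?nnegrE ?sqrtr_ge0 ?(ltW r0)//.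
 by rewrite addr_ge0// mulr_ge0// ltW.
exact: le_trans j1 (norm_le_eucl _ _).
Qed.

(** Writing [y = z + x] makes the inner variable a translation; after Tonelli the inner integral is
    the squared L2 norm of a translation difference, bounded by the hypothesis. *)
Lemma gker_integral j : (\int[mu]_x \int[mu]_y gker j (x, y) <=
 (a j * (K * rad j `^ b) ^+ 2 * (rad j *+ 2) ^+ n)%:E)%E.
Proof.
pose G (xz : V * V) : \bar R := (a j * (g xz.1 - g (xz.2 + xz.1)) ^+ 2 * \1_(cube (0 : V) (rad j)) xz.2)%:E.
have mG : mfun setT G.
 apply/EFin_meas; apply: mfunM; last first.
  apply: (mfun_comp _ measurable_snd); apply: measurable_indic; exact: cube_meas.
 apply: mfunM => //; apply: mfunX; apply: mfunB => //.
 apply: mfun_comp (Lg.1) _; apply: measurable_fun_rVP => i.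
 rewrite (_ : (fun w => _) = fun xz : V * V => xz.2 0 i + xz.1 0 i); last by apply/funext => xz; rewrite mxE.
 by apply: measurable_funD; [exact: coord2_meas|exact: coord1_meas].
have G0 xz : (0 <= G xz)%E by rewrite lee_fin mulr_ge0// mulr_ge0 ?powR_ge0 ?sqr_ge0.
have E x : (\int[mu]_y gker j (x, y) = \int[mu]_z G (x, z))%E.
 rewrite -(ge0_shift x); last 2 first.
 - by apply: mfun_comp (gker_meas j) _; exact: measurable_pair1.
 - by move=> y; exact: gker_ge0.
 apply: eq_integral => z _; rewrite /gker /G /=; congr (_ * _)%:E.
 rewrite !indicE; congr ((nat_of_bool _)%:R); apply/idP/idP; rewrite !inE => H i; have := H i; by rewrite !mxE addrK subr0.
under eq_integral do rewrite E.
rewrite (fubini_tonelli _ mG G0).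
have B0 : 0 <= a j * (K * rad j `^ b) ^+ 2 by rewrite mulr_ge0 ?powR_ge0 ?sqr_ge0.
apply: (@le_trans _ _ (\int[mu]_(z in cube 0 (rad j)) (a j * (K * rad j `^ b) ^+ 2)%:E)%E); last first.
 rewrite integral_cst; last exact: cube_meas.
 by rewrite [leRHS]EFinM -(@leb_cube R n 0 (rad j) (ltW (rad_gt0 j))).
rewrite [leRHS]integral_mkcond; apply: ge0_le_integral => //.
- by move=> z _; apply: integral_ge0 => x _; exact: G0.
- by have := @measurable_fun_fubini_tonelli_G _ _ _ _ _ mu _ mG G0.
- by apply/(measurable_restrictT _ (cube_meas _ _)).
move=> z _; rewrite /G patchE; case: ifPn => [/set_mem|] cz; last first.
 under eq_integral do rewrite /= indicE (negbTE cz) mulr0.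
 by rewrite integral0.
have mgz : mfun setT (fun x => g x - g (z + x)).
 apply: mfunB; first exact: Lg.1.
 rewrite (_ : (fun x => _) = g \o (fun x => x + z)); last by apply/funext => x /=; rewrite addrC.
 by apply: mfun_comp (Lg.1) _; exact: addrV_meas.
under eq_integral => x _ do rewrite /= indicE mem_set// mulr1 EFinM.
rewrite ge0_integralZl_EFin//; last 3 first.
- by move=> x _; rewrite lee_fin sqr_ge0.
- by apply/EFin_meas; exact: mfunX.
- exact: powR_ge0.
rewrite [leRHS]EFinM; apply: lee_wpmul2l; first by rewrite lee_fin powR_ge0.
have mzx : mfun setT (fun x : V => x + z) by exact: addrV_meas.
have Lz : L2 setT (fun x => g (x + z) - g x).
 apply: L2B => //; split; first exact: mfun_comp (Lg.1) mzx.
 rewrite (ge0_shift z (f := fun x => (g x ^+ 2)%:E)) ?(Lg.2)//.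
  by apply/EFin_meas; apply: mfunX; exact: Lg.1.
 by move=> x; rewrite lee_fin sqr_ge0.
rewrite (_ : (\int[mu]_x _ = \int[mu]_x ((g (x + z) - g x) ^+ 2)%:E)%E); last first.
 by apply: eq_integral => x _; rewrite /= (addrC x z) -[in RHS]sqrrN opprB.
rewrite L2nE// lee_fin; apply: L2n_le; apply: le_trans (Hg z) _; rewrite ler_wpM2l//.
have zr : `|z| <= rad j by apply: normrV_le => [|i]; [exact: ltW (rad_gt0 j)|have := cz i; rewrite !mxE subr0].
by apply: ge0_ler_powR; rewrite ?nnegrE ?normr_ge0 ?(ltW (rad_gt0 j))// ltW// (lt_trans th0).
Qed.

(** The shells contribute a geometric series of ratio [2 ^ (- 2 (b - theta))], which converges
    because [theta < b]. *)
Lemma gagliardo_shift : (gagliardo theta Om g < +oo)%E.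
Proof.
pose Q (xy : V * V) : \bar R := (gint xy * (\1_Om xy.2)%:E)%E.
have Q0 xy : (0 <= Q xy)%E by rewrite mule_ge0 ?gint_ge0// lee_fin.
have mQ : mfun setT Q.
 apply: emeasurable_funM; first exact: gint_meas.
 apply/EFin_meas; apply: (mfun_comp _ measurable_snd); exact: measurable_indic.
pose S (xy : V * V) := (\sum_(0 <= j <oo) gker j xy)%E.
have S0 xy : (0 <= S xy)%E by apply: nneseries_ge0 => j _ _; exact: gker_ge0.
have mS : mfun setT S.
 have := @ge0_emeasurable_sum _ _ R setT gker xpredT (fun k w _ _ => gker_ge0 k w) (fun k _ => gker_meas k).
 by [].
have kap0 : 0 < 2 * (b - theta) by rewrite mulr_gt0// subr_gt0.
pose q : R := 2^-1 `^ (2 * (b - theta)).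
pose C := 2^-1 `^ (- p) * K ^+ 2 * 2 ^+ n * D `^ (2 * (b - theta)).
have C0 : 0 <= C by rewrite !mulr_ge0 ?powR_ge0 ?sqr_ge0// exprn_ge0.
have q01 : 0 <= q < 1.
 have h1 : 1 `^ (2 * (b - theta)) = 1 :> R by rewrite powR1.
 rewrite powR_ge0/= -[ltRHS]h1; apply: gt0_ltr_powR; rewrite ?nnegrE//.
 by rewrite invf_lt1// ltr1n.
have E j : a j * (K * rad j `^ b) ^+ 2 * (rad j *+ 2) ^+ n = C * q ^+ j.
 have r0 := rad_gt0 j; have r0' := ltW r0.
 have -> : C * q ^+ j = 2^-1 `^ (- p) * K ^+ 2 * 2 ^+ n * rad j `^ (2 * (b - theta)).
  rewrite /C -[LHS]mulrA; congr (_ * _).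
  rewrite /rad powRM ?(ltW D0) ?exprn_ge0 ?invr_ge0//; congr (_ * _).
  by apply/esym; apply: powR_exp; rewrite invr_ge0.
 have -> : rad j `^ (2 * (b - theta)) = rad j `^ (- p) * rad j `^ b * rad j `^ b * rad j ^+ n.
  exact: powR_split.
 rewrite /a powRM ?invr_ge0// exprMn -[rad j *+ 2]mulr_natr exprMn.
 by ring.
rewrite /gagliardo -/p.
apply: (@le_ltT _ _ (\int[mu]_x \int[mu]_y S (x, y))%E).
 apply: (@le_trans _ _ (\int[mu]_(x in Om) \int[mu]_y S (x, y))%E); last first.
  apply: ge0_subset_integral => //.
   by have := @measurable_fun_fubini_tonelli_F _ _ _ _ _ mu _ mS S0.
  by move=> x _; exact: integral_ge0.
 rewrite (_ : (\int[mu]_(x in Om) _ = \int[mu]_(x in Om) \int[mu]_y Q (x, y))%E); last first.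
  apply: eq_integral => x _; rewrite [LHS]integral_mkcond; apply: eq_integral => y _.
  by rewrite patchE /Q indicE /=; case: (y \in Om); rewrite ?mule1 ?mule0.
 apply: ge0_le_integral => //.
 - by move=> x _; exact: integral_ge0.
 - by apply: mfunTS; have := @measurable_fun_fubini_tonelli_F _ _ _ _ _ mu _ mQ Q0.
 - by apply: mfunTS; have := @measurable_fun_fubini_tonelli_F _ _ _ _ _ mu _ mS S0.
 move=> x Ox; apply: ge0_le_integral => //.
 - by apply: mfun_comp mQ _; exact: measurable_pair1.
 - by apply: mfun_comp mS _; exact: measurable_pair1.
 move=> y _; rewrite /Q indicE /=; have [/set_mem Oy|_] := boolP (y \in Om).
  by rewrite mule1; exact: gint_le.
 by rewrite mule0.
rewrite (_ : (\int[mu]_x _ = \sum_(0 <= j <oo) \int[mu]_x \int[mu]_y gker j (x, y))%E).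
 apply: (geom_nneseries C0 q01) => j; last by rewrite -E; exact: gker_integral.
 by apply: integral_ge0 => x _; apply: integral_ge0 => y _; exact: gker_ge0.
rewrite -integral_nneseries//.
- apply: eq_integral => x _; rewrite -integral_nneseries//.
 + by move=> j; apply: mfun_comp (gker_meas j) _; exact: measurable_pair1.
 + by move=> j y _; exact: gker_ge0.
- by move=> j; have := @measurable_fun_fubini_tonelli_F _ _ _ _ _ mu _ (gker_meas j) (gker_ge0 j).
- by move=> j x _; apply: integral_ge0 => y _; exact: gker_ge0.
Qed.

End translation.
End gagliardo_bound.

(** * Sobolev regularity of a series of smooth functions *)

Section partial_parts.
Context {R : realType} {n : nat}.
Local Notation V := 'rV[R]_n.
Local Notation mu := (lebesgue_rV R n).
Implicit Types (f u phi : V -> R) (U : set V) (x h : V).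

Lemma partial_pdC phi l i : smooth setT phi -> partial l (pd i phi) = pd i (partial l phi).
Proof.
move=> sp; elim: l => [//|j l IH]; apply/funext => x.
rewrite -[LHS]/(pd j (partial l (pd i phi)) x) IH.
have C2 : Ck 2 setT (partial l phi) by exact: smooth_part.
exact: (pdC j i (@openT_rV R n) C2 I).
Qed.

Lemma test_partial U phi l : tfun U phi -> tfun U (partial l phi).
Proof. by move=> tp; elim: l => [//|i l IH]; exact: test_pd. Qed.

Lemma partial_by_parts U f phi l : open U -> smooth U f -> tfun U phi ->
 \int[mu]_(x in U) (f x * partial l phi x) =
 (-1) ^+ size l * \int[mu]_(x in U) (partial l f x * phi x).
Proof.
move=> oU sf; elim: l phi => [|i l IH] phi tp; first by rewrite expr0 mul1r.
have -> : partial (i :: l) phi = partial l (pd i phi) by rewrite partial_pdC//; case: tp.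
rewrite IH; last exact: test_pd.
have C1 : Ck 1 U (partial l f) by exact: smooth_part.
rewrite int_by_parts//.
by rewrite exprS mulN1r mulrN mulNr.
Qed.

Lemma L2_shift u h : L2 setT u -> L2 setT (fun x => u (x + h)).
Proof.
move=> Lu; split; first exact: mfun_comp (Lu.1) (addrV_meas h).
rewrite (ge0_shift h (f := fun x => (u x ^+ 2)%:E)) ?(Lu.2)//.
 by apply/EFin_meas; apply: mfunX; exact: Lu.1.
by move=> x; rewrite lee_fin sqr_ge0.
Qed.

Lemma L2norm_shift u h : L2 setT u -> L2norm setT (fun x => u (x + h)) = L2norm setT u.
Proof.
move=> Lu; congr Num.sqrt; apply: (Rint_shift (f := fun x => u x ^+ 2)).
by apply: mfunX; exact: Lu.1.
Qed.

Lemma interpolation_le (a X Y b : R) : 0 <= a -> a <= X -> a <= Y -> 0 < b < 1 ->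
 a <= X `^ (1 - b) * Y `^ b.
Proof.
move=> a0 aX aY /andP[b0 b1]; have X0 := le_trans a0 aX; have Y0 := le_trans a0 aY.
have b1' : 0 < 1 - b by rewrite subr_gt0.
have -> : a = a `^ (1 - b) * a `^ b.
 rewrite -powRD; first by rewrite subrK powRr1.
 by rewrite subrK oner_eq0.
by apply: ler_pM; rewrite ?powR_ge0//; apply: ge0_ler_powR; rewrite ?nnegrE// ltW.
Qed.

Lemma half_between (t : R) : 0 < t -> t < 1 -> 0 < (t + 1) / 2 < 1 /\ t < (t + 1) / 2.
Proof. by move=> t0 t1; split; [apply/andP; split|]; lra. Qed.

Implicit Types (g : V -> R) (Om : set V) (y : V) (l : seq 'I_n).
Context (W : nat -> V -> R) (m : nat) (C : R)
 (C0 : 0 <= C) (sW : forall k, smooth setT (W k))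
 (HL : forall l k, (size l <= m)%N -> L2 setT (partial l (W k)))
 (HN : forall l k, (size l <= m)%N -> L2norm setT (partial l (W k)) <= C * 2^-1 ^+ k)
 (HT : forall l k h, size l = m ->
 L2norm setT (fun x => partial l (W k) (x + h) - partial l (W k) x) <= C * `|h|).

Let mT : measurable [set: V]. Proof. exact: measurableT. Qed.
Let C2 := C / (1 - 2^-1).

Definition psum l k x := \sum_(j < k) partial l (W j) x.

Lemma psum_L2 l k : (size l <= m)%N -> L2 setT (psum l k).
Proof. by move=> lm; apply: L2_sum => // j _; exact: HL. Qed.

Lemma series_limit l : exists g, (size l <= m)%N -> L2 setT g /\
 forall k, L2norm setT (fun x => g x - psum l k x) <= C2 * 2^-1 ^+ k.
Proof.
(* Orders above [m] get a dummy limit, so that [choice] can be applied to all multi-indices. *)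
have [lm|_] := boolP (size l <= m)%N; last by exists (fun=> 0).
have D j : L2norm setT (fun x => psum l j.+1 x - psum l j x) <= C * 2^-1 ^+ j.
 rewrite (_ : (fun x => _) = partial l (W j)); first exact: HN.
 by apply/funext => x; rewrite /psum big_ord_recr/= [LHS]addrC addKr.
by have [g Hg] := L2_geom_limit mT (fun j => psum_L2 j lm) C0 (@half01 R) D; exists g.
Qed.

(** The translation differences of the terms are bounded both by a multiple of [2 ^ (- k)] and by a
    multiple of [|h|]. The geometric mean with exponents [1 - b] and [b] is summable in [k] and
    keeps the factor [|h| ^ b]. *)
Lemma translation_bound l g b : size l = m -> 0 < b < 1 -> L2 setT g ->
 (forall k, L2norm setT (fun x => g x - psum l k x) <= C2 * 2^-1 ^+ k) ->
 exists2 K, 0 <= K & forall h, L2norm setT (fun x => g (x + h) - g x) <= K * `|h| `^ b.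
Proof.
move=> lm b01 Lg Hg; have lm' : (size l <= m)%N by rewrite lm.
have /andP[b0 b1] := b01.
have C20 : 0 <= C2 by rewrite divr_ge0// subr_ge0 invf_le1// ler1n.
pose q : R := 2^-1 `^ (1 - b).
have q01 : 0 <= q < 1.
 have h1 : 1 `^ (1 - b) = 1 :> R by rewrite powR1.
 rewrite powR_ge0/= -[ltRHS]h1; apply: gt0_ltr_powR; rewrite ?nnegrE ?subr_gt0//.
 by rewrite invf_lt1// ltr1n.
have K10 : 0 <= (2 * C) `^ (1 - b) * C `^ b by rewrite mulr_ge0 ?powR_ge0.
pose K := (2 * C) `^ (1 - b) * C `^ b / (1 - q).
have K0 : 0 <= K by rewrite divr_ge0// subr_ge0 ltW//; case/andP: q01.
exists K => // h; apply: le_of_small => d d0.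
have [N HN'] := geom_small (mulr_ge0 (ler0n R 2) C20) (@half01 R) d0.
have {HN'} HN' := HN' N (leqnn _).
have LS := psum_L2 N lm'; have L1 := L2B mT Lg LS.
have L2' : L2 setT (fun x => psum l N (x + h) - psum l N x) by apply: L2B => //; exact: L2_shift.
have -> : (fun x => g (x + h) - g x) = fun x => (psum l N (x + h) - psum l N x) +
  ((g (x + h) - psum l N (x + h)) + - (g x - psum l N x)).
 by apply/funext => x; ring.
have L3 := L2_shift h L1; have L4 := L2N mT L1.
apply: le_trans (L2normD mT L2' (L2D mT L3 L4)) _; apply: lerD; last first.
 apply: le_trans (L2normD mT L3 L4) _; rewrite (L2norm_shift h L1) L2normN.
 apply: le_trans (lerD (Hg N) (Hg N)) _; apply: le_trans HN'.
 by apply: eqW; ring.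
rewrite (_ : (fun x => _) = fun x => \sum_(j < N) (partial l (W j) (x + h) - partial l (W j) x)); last first.
 by apply/funext => x; rewrite /psum sumrB.
have Lj j : L2 setT (fun x => partial l (W j) (x + h) - partial l (W j) x) by apply: L2B => //; [apply: L2_shift|]; exact: HL.
have B j : L2norm setT (fun x => partial l (W j) (x + h) - partial l (W j) x) <=
  (2 * C) `^ (1 - b) * C `^ b * `|h| `^ b * q ^+ j.
 have X : L2norm setT (fun x => partial l (W j) (x + h) - partial l (W j) x) <= 2 * C * 2^-1 ^+ j.
  have Lw := HL j lm'; apply: le_trans (L2normD mT (L2_shift h Lw) (L2N mT Lw)) _.
  rewrite L2norm_shift// L2normN -mulrA mulr2n mulrDl mul1r.
  by apply: lerD; exact: HN.
 apply: le_trans (interpolation_le (L2norm_ge0 _ _) X (HT j h lm) b01) _.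
 have h2 : 0 <= 2^-1 ^+ j :> R by rewrite exprn_ge0// invr_ge0.
 rewrite (powRM _ _ h2) ?mulr_ge0// (powRM b C0)// powR_exp ?invr_ge0//.
 by apply: eqW; rewrite -/q; ring.
apply: le_trans (L2norm_sum N mT Lj B) _.
rewrite -mulr_sumr /K [leRHS]mulrAC; apply: ler_wpM2l; first by rewrite mulr_ge0 ?powR_ge0.
exact: geom_sum_le.
Qed.

(** The identity holds for the partial sums by integration by parts, and both sides pass to the
    limit by Cauchy-Schwarz. *)
Lemma series_weak Om l g f : open Om -> (size l <= m)%N -> L2 setT f -> L2 setT g ->
 (forall k, L2norm setT (fun x => f x - psum [::] k x) <= C2 * 2^-1 ^+ k) ->
 (forall k, L2norm setT (fun x => g x - psum l k x) <= C2 * 2^-1 ^+ k) ->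
 weak_partial Om l f g.
Proof.
move=> oO lm Lf Lg Hf Hg phi tp; have mO := open_meas oO.
have C20 : 0 <= C2 by rewrite divr_ge0// subr_ge0 invf_le1// ler1n.
have sub (u : V -> R) : L2 setT u -> L2 Om u by exact: L2_sub.
have tl := test_partial l tp.
have tL2 psi : tfun Om psi -> L2 Om psi.
 move=> tpsi; have C0psi : Ck 0 Om psi by apply: Ck_sub (tpsi.1 0%N).
 apply: integ_L2 => //; first exact: Ck_meas C0psi.
 by have := Ck_integ oO C0psi tpsi; under eq_fun do rewrite -expr2.
have E k : ip Om (psum [::] k) (partial l phi) = (-1) ^+ size l * ip Om (psum l k) phi.
 rewrite /ip /psum; under eq_Rint => x _ do rewrite mulr_suml.
 under [in RHS]eq_Rint => x _ do rewrite mulr_suml.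
 rewrite !Rint_sum//; last 2 first.
 - by move=> j _; apply: L2_mul => //; [apply: sub; exact: HL|exact: tL2].
 - by move=> j _; apply: L2_mul => //; [apply: sub; exact: (@HL [::] j (leq0n m))|exact: tL2].
 rewrite mulr_sumr; apply: eq_bigr => j _.
 have sO : smooth Om (W j).
  move=> k'; have Ct : Ck k' setT (W j) by exact: sW.
  by apply: Ck_sub Ct.
 exact: (partial_by_parts l oO sO tp).
have A (u w psi : V -> R) : L2 setT u -> L2 setT w -> tfun Om psi ->
  `|ip Om u psi - ip Om w psi| <= L2norm setT (fun x => u x - w x) * L2norm Om psi.
 move=> Lu Lw tpsi; have Lp := tL2 _ tpsi.
 have -> : ip Om u psi - ip Om w psi = ip Om (fun x => u x - w x) psi.
  rewrite /ip -RintegralB//; try by apply: L2_mul => //; exact: sub.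
  by apply: eq_Rint => x _; rewrite mulrBl.
 have Luw := L2B mT Lu Lw.
 apply: le_trans (L2norm_ip mO (sub _ Luw) Lp) _; rewrite ler_wpM2r ?L2norm_ge0//.
 by rewrite ler_wsqrtr// L2n_sub.
pose P := L2norm Om (partial l phi) + L2norm Om phi.
have P0 : 0 <= P by rewrite addr_ge0 ?L2norm_ge0.
apply/eqP; rewrite -subr_eq0 -normr_le0; apply: le_of_small => d d0; rewrite add0r.
have [N HN'] := geom_small (mulr_ge0 C20 P0) (@half01 R) d0.
apply: le_trans (HN' N (leqnn _)).
rewrite -/(ip Om f (partial l phi)) -/(ip Om g phi).
have -> : ip Om f (partial l phi) - (-1) ^+ size l * ip Om g phi =
  (ip Om f (partial l phi) - ip Om (psum [::] N) (partial l phi)) +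
  - ((-1) ^+ size l * (ip Om g phi - ip Om (psum l N) phi)).
 by rewrite E; ring.
apply: le_trans (ler_normD _ _) _; rewrite normrN normrM normrX normrN1 expr1n mul1r.
rewrite mulrAC /P mulrDr; apply: lerD.
 apply: le_trans (A _ _ _ Lf (@psum_L2 [::] N (leq0n m)) tl) _.
 by apply: ler_wpM2r; rewrite ?L2norm_ge0.
apply: le_trans (A _ _ _ Lg (psum_L2 N lm) tp) _.
by apply: ler_wpM2r; rewrite ?L2norm_ge0.
Qed.

Lemma sobolev_series : exists f, [/\ L2 setT f,
 forall k, L2norm setT (fun x => f x - \sum_(j < k) W j x) <= C2 * 2^-1 ^+ k &
 forall Om D (s : R), open Om -> 0 < D -> (forall x y, Om x -> Om y -> `|x - y| <= D) ->
  m%:R <= s < m.+1%:R -> sobolev s Om f].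
Proof.
have [G HG] := choice series_limit.
have [Lf Hf] := HG [::] (leq0n m).
exists (G [::]); split => // Om D s oO D0 OD /andP[ms sm]; have mO := open_meas oO.
split; first exact: L2_sub Lf.
move=> l ls; have lm : (size l <= m)%N.
 by rewrite -ltnS -(ltr_nat R); exact: le_ltT sm.
have [Lg Hg] := HG l lm; exists (G l); split.
- exact: L2_sub Lg.
- exact: series_weak.
(* A proper fractional part occurs only at order [m]. The exponent [b] is put halfway between the
   fractional part and 1. *)
move=> /andP[th0 th1]; have lE : size l = m.
 apply/eqP; rewrite eqn_leq lm/= -ltnS -(ltr_nat R); apply: le_ltT ms _.
 by rewrite -natr1 -ltrBlDl.
pose th := s - (size l)%:R; pose b := (th + 1) / 2.
have [b01 thb] := half_between th0 th1.
have [K K0 HK] := translation_bound lE b01 Lg Hg.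
exact: (gagliardo_shift mO Lg K0 D0 th0 thb HK OD).
Qed.

End partial_parts.

(** * Mollification of the solutions and their sum *)

Section mollified_series.
Context {R : realType}.
Local Notation V := 'rV[R]_4.
Local Notation mu := (lebesgue_rV R 4).
Implicit Types (U N : set V) (u phi : V -> R) (x y h : V) (l : seq 'I_4).

Lemma seq_bound (F : seq 'I_4 -> R) m : exists2 C, 0 <= C & forall l, (size l <= m)%N -> F l <= C.
Proof.
exists (\sum_(j < m.+1) \sum_(t : j.-tuple 'I_4) `|F t|).
 by apply: sumr_ge0 => j _; apply: sumr_ge0 => t _.
move=> l lm; rewrite (bigD1 (Ordinal (lm : (size l < m.+1)%N)))//= (bigD1 (in_tuple l))//=.
rewrite -addrA; apply: le_trans (ler_norm _) _; rewrite lerDl addr_ge0// sumr_ge0// => j _.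
by apply: sumr_ge0.
Qed.

Lemma conv_young u phi (M c : R) : 0 <= c -> 0 <= M -> integ setT u -> L2 setT u ->
 mfun setT phi -> (forall y, `|phi y| <= M) -> bsupp c phi ->
 mfun setT (conv u phi) ->
 L2 setT (conv u phi) /\ L2norm setT (conv u phi) <= M * (c *+ 2) ^+ 4 * L2norm setT u.
Proof.
move=> c0 M0 iu Lu mp HM sp mc.
have c2 : 0 <= (c *+ 2) ^+ 4 by rewrite exprn_ge0// mulrn_wge0.
have b0 : 0 <= M ^+ 2 * (c *+ 2) ^+ 4 by rewrite mulr_ge0// sqr_ge0.
have mF : mfun setT (fun x => (u x ^+ 2)%:E) by apply/EFin_meas/mfunX; exact: Lu.1.
have F0 (x : V) : (0 <= (u x ^+ 2)%:E)%E by rewrite lee_fin sqr_ge0.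
have K : (\int[mu]_z (u z ^+ 2)%:E <= (L2n setT u)%:E)%E by rewrite L2nE.
have H x : setT x -> ((conv u phi x ^+ 2)%:E <= (M ^+ 2 * (c *+ 2) ^+ 4)%:E * \int[mu]_(z in cube x c) (u z ^+ 2)%:E)%E.
 by move=> _; exact: conv_sqr_bound.
have [L H2] := L2_cube_bound measurableT mc mF F0 b0 c0 K H; split => //.
apply: L2norm_le; first by rewrite mulr_ge0 ?L2norm_ge0// mulr_ge0.
apply: le_trans H2 _; rewrite !exprMn L2norm_sqr; apply: eqW; ring.
Qed.

Section mollify.
Context (u : V -> R) (a : R) (a0 : 0 < a) (iu : integ setT u) (Lu : L2 setT u).

Let w := conv u (chi a).

Lemma conv_chi_partialE l : partial l w = conv u (partial l (chi a)).
Proof. exact: conv_partial iu (chi_smooth a) (chi_bsupp a0). Qed.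

Lemma conv_chi_L2 l M : (forall a y, 0 < a -> `|partial l (chi (n := 4) a) y| <= M * a ^+ (4 + size l)) -> 0 <= M ->
 L2 setT (partial l w) /\ L2norm setT (partial l w) <= 16 * M * a ^+ size l * L2norm setT u.
Proof.
move=> HM M0; rewrite conv_chi_partialE.
have a1 : 0 <= a^-1 by rewrite invr_ge0 ltW.
have C1 : Ck 1 setT (partial l (chi a)) by exact: smooth_part (chi_smooth a) _.
have B0 : 0 <= M * a ^+ (4 + size l) by rewrite mulr_ge0// exprn_ge0// ltW.
have sp := partial_bsupp l (chi_bsupp a0).
have mp : mfun setT (partial l (chi a)) by apply: smooth_meas; exact: smooth_part (chi_smooth a).
have mc : mfun setT (conv u (partial l (chi a))) by apply: cont_meas; exact: conv_cont C1 sp.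
have [L H] := conv_young a1 B0 iu Lu mp (fun y => HM a y a0) sp mc; split => //.
have E : M * a ^+ (4 + size l) * (a^-1 *+ 2) ^+ 4 = 16 * M * a ^+ size l by rewrite exprD -[a^-1 *+ 2]mulr_natr; field; rewrite gt_eqF.
by rewrite E in H.
Qed.

(** If [|h| <= 1 / a], the difference is a convolution with a kernel of support radius [2 / a],
    which is small by the Lipschitz bound. For larger [h] the triangle inequality suffices, because
    [a * |h| >= 1]. *)
Lemma mollify_shift l M h :
 (forall l', (size l' <= (size l).+1)%N -> forall a y, 0 < a ->
   `|partial l' (chi (n := 4) a) y| <= M * a ^+ (4 + size l')) -> 0 <= M ->
 L2norm setT (fun x => partial l w (x + h) - partial l w x) <=
  1024 * M * a ^+ (size l).+1 * `|h| * L2norm setT u.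
Proof.
move=> HM M0; have Hl := HM l (leqnSn _).
have [Lw nw] := conv_chi_L2 Hl M0; have n0 := L2norm_ge0 setT u.
have mT : measurable [set: V] by exact: measurableT.
have ap k : 0 <= a ^+ k by rewrite exprn_ge0// ltW.
have [hs|hl] := leP `|h| a^-1; last first.
 apply: le_trans (L2normD mT (L2_shift h Lw) (L2N mT Lw)) _.
 rewrite L2norm_shift// L2normN.
 have ah : 1 <= a * `|h| by rewrite mulrC -ler_pdivrMr// mul1r ltW.
 apply: (@le_trans _ _ (32 * M * a ^+ size l * L2norm setT u * (a * `|h|))).
  apply: (@le_trans _ _ (32 * M * a ^+ size l * L2norm setT u)).
   have := lerD nw nw; rewrite (_ : 16 * M * a ^+ size l * L2norm setT u + 16 * M * a ^+ size l * L2norm setT u = 32 * M * a ^+ size l * L2norm setT u)//.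
   by ring.
  by rewrite ler_peMr// !mulr_ge0.
 rewrite (_ : 32 * M * a ^+ size l * L2norm setT u * (a * `|h|) = 32 * (M * a ^+ (size l).+1 * `|h| * L2norm setT u)); last by rewrite exprS; ring.
 rewrite (_ : 1024 * M * a ^+ (size l).+1 * `|h| * L2norm setT u = 1024 * (M * a ^+ (size l).+1 * `|h| * L2norm setT u)); last by ring.
 by rewrite ler_wpM2r ?ler_nat// !mulr_ge0.
pose psi := partial l (chi (n := 4) a).
have sps : smooth setT psi by exact: smooth_part (chi_smooth a).
have mpsi : mfun setT psi by exact: Ck_meas (@openT_rV R 4) (sps 0%N).
have mph : mfun setT (fun y => psi (y + h)) by exact: mfun_comp mpsi (addrV_meas h).
have E : (fun x => partial l w (x + h) - partial l w x) = conv u (fun y => psi (y + h) - psi y).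
 apply/funext => x; rewrite conv_chi_partialE conv_shift.
 by apply: (convB x iu mph mpsi); [move=> y; exact: Hl a0|move=> y; exact: Hl a0].
have mw : mfun setT (fun x => partial l w (x + h) - partial l w x) by apply: mfunB; [exact: (L2_shift h Lw).1|exact: Lw.1].
pose B := 4 * (M * a ^+ (4 + (size l).+1)) * `|h|.
have B0 : 0 <= B by rewrite /B mulr_ge0// mulr_ge0// mulr_ge0.
have HB y : `|psi (y + h) - psi y| <= B.
 have dp x : pder psi x by exact: (@Ck_pder _ _ 0 setT psi (sps 1%N) x I).
 have Hp i x : `|pd i psi x| <= M * a ^+ (4 + (size l).+1) by exact: (HM (i :: l) (leqnn _) a x a0).
 by have := lipschitz_rV dp Hp (y + h) y; rewrite addrAC subrr add0r.
have sp : bsupp (2 * a^-1) (fun y => psi (y + h) - psi y).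
 have sp1 := partial_bsupp l (chi_bsupp (n := 4) a0).
 have a1 : 0 < a^-1 by rewrite invr_gt0.
 move=> y hy; rewrite /psi (sp1 y); last by apply: le_ltT hy; rewrite ler_peMl ?ler1n// ltW.
 rewrite (sp1 (y + h)) ?subrr//; have := ler_normB (y + h) h; rewrite addrK => h2.
 rewrite -(ltrD2r `|h|); apply: lt_leT h2; apply: le_ltT hy.
 by rewrite mulr2n mulrDl mul1r lerD2l.
rewrite E in mw *.
have md : mfun setT (fun y => psi (y + h) - psi y) by exact: mfunB.
have c0 : 0 <= 2 * a^-1 by rewrite mulr_ge0// invr_ge0 ltW.
apply: le_trans (conv_young c0 B0 iu Lu md HB sp mw).2 _.
rewrite (_ : B * ((2 * a^-1) *+ 2) ^+ 4 = 1024 * M * a ^+ (size l).+1 * `|h|)//.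
by rewrite /B exprD -[(2 * a^-1) *+ 2]mulr_natr; field; rewrite gt_eqF.
Qed.

End mollify.

(** Hides the numerical constant; [16 <= q] lets the same constant serve for the norms of the
    derivatives themselves. *)
Lemma mollify_shift_ex : exists2 q : R, 16 <= q & forall u a l M h, 0 < a -> integ setT u -> L2 setT u ->
 (forall l', (size l' <= (size l).+1)%N -> forall a y, 0 < a ->
   `|partial l' (chi (n := 4) a) y| <= M * a ^+ (4 + size l')) -> 0 <= M ->
 L2norm setT (fun x => partial l (conv u (chi a)) (x + h) - partial l (conv u (chi a)) x) <=
  q * M * a ^+ (size l).+1 * `|h| * L2norm setT u.
Proof.
exists 1024; first by rewrite ler_nat.
by move=> u a l M h a0 iu Lu HM M0; exact: mollify_shift.
Qed.

Lemma L2norm_restrict U u : L2norm setT (u \_ U) = L2norm U u.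
Proof.
congr Num.sqrt; rewrite /L2n [RHS]Rintegral_mkcond; apply: eq_Rint => x _.
by rewrite !patchE; case: ifP => //; rewrite expr0n.
Qed.

Section solutions.
Context (Om N : set V) (sigma : V -> R) (c M B t0 kap eps0 lam : R)
 (ex : exhaustion Om N sigma c M B t0 kap eps0 lam)
 (m : nat) (e : 'I_4 -> V -> R)
 (he : forall i, harm Om (e i))
 (eL2 : forall i l, (size l < m.+2)%N -> L2 Om (partial l (e i)))
 (e_adj : forall j x, Om x -> Dadj e j x = 0)
 (D : R) (D0 : 0 < D) (OD : forall x y, Om x -> Om y -> `|x - y| <= D).

Local Notation dyad := (dyad eps0).
Local Notation Uk k := (sublev N sigma (kap * dyad k)).

(** On [Om] each solution equals its mollification at the scale of its own spare room, and the
    mollified functions live on the whole space. There the derivatives of order [j] of the [k]-th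
    term are of size [dyad k ^ (m + 1 - j)]. *)
Theorem solve_sobolev : exists f : 'I_2 -> V -> R,
 [/\ forall i, L2 Om (f i), forall i s, m%:R <= s < m.+1%:R -> sobolev s Om (f i) &
   forall p, testv Om p -> ipv Om (opAv p) f = - ipv Om e p].
Proof.
have [K K0 [v [Lv hv nv wv]]] := dyadic_solutions ex he eL2 e_adj.
have k0 := ex_kap ex; have l0 := ex_lam ex; have oO := ex_open ex; have mO := open_meas oO.
have /andP[e00 e01] := ex_eps0 ex.
have dy k : 0 < dyad k by have /andP[] := dyad_in ex k.
have dle k : dyad k <= 2^-1 ^+ k by rewrite /dyad ler_piMl// exprn_ge0// invr_ge0.
have d1 k : dyad k <= 1 by have /andP[_ h] := dyad_in ex k; exact: le_trans h e01.
(* The inverse of the room that [ex_dist] guarantees between [Om] and the complement of the [k]-th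
   domain. *)
pose ak k := (lam * (kap * dyad k))^-1.
have ak0 k : 0 < ak k by rewrite invr_gt0 !mulr_gt0.
pose b := (lam * kap)^-1; have b0 : 0 < b by rewrite invr_gt0 mulr_gt0.
have akE k : ak k = b / dyad k by rewrite /ak mulrA invfM.
have mU k : measurable (Uk k) by exact: open_meas (@Uk_open _ _ _ _ _ _ _ _ _ _ _ ex k).
have fU k : (mu (Uk k) < +oo)%E.
 apply: gd_fin (ex_gd ex _); rewrite mulr_gt0//=; exact: (ex_kap_le ex (dyad_in ex k)).
pose u k i := v k i \_ (Uk k).
have iu k i : integ setT (u k i) by apply/(integ_patch _ (mU k)); apply: integ_L2_fin => //; exact: Lv.
have Lu k i : L2 setT (u k i) by apply: L2_restrict => //; exact: Lv.
have nu k i : L2norm setT (u k i) <= K * dyad k ^+ m.+1 by rewrite L2norm_restrict.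
pose W i k := conv (u k i) (chi (ak k)).
have sW i k : smooth setT (W i k) by exact: conv_chi_smooth.
have HF l : exists F, 0 <= F /\ forall a y, 0 < a ->
  `|partial l (chi (n := 4) a) y| <= F * a ^+ (4 + size l).
 by have [X X0 HX] := @chi_partial_bound R 4 l; exists X.
have [Mf HMf] := choice HF.
have [X X0 HX] := seq_bound Mf m.+1.
have HXl l : (size l <= m.+1)%N -> forall a y, 0 < a ->
  `|partial l (chi (n := 4) a) y| <= X * a ^+ (4 + size l).
 move=> lm a y a0; apply: le_trans ((HMf l).2 a y a0) _; rewrite ler_wpM2r ?HX//.
 by rewrite exprn_ge0// ltW.
pose Y := \sum_(j < m.+2) b ^+ j.
have bY j : (j <= m.+1)%N -> b ^+ j <= Y.
 move=> jm; rewrite /Y (bigD1 (Ordinal (jm : (j < m.+2)%N)))//= lerDl sumr_ge0// => i _.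
 by rewrite exprn_ge0// ltW.
have Y0 : 0 <= Y by apply: le_trans (bY 0%N (leq0n _)); rewrite expr0.
have [q q16 Hq] := mollify_shift_ex; have q0 : 0 <= q by apply: le_trans q16.
pose C := q * X * Y * K.
have C0 : 0 <= C by rewrite /C mulr_ge0// mulr_ge0// mulr_ge0.
have ad k j : (j <= m.+1)%N -> ak k ^+ j * dyad k ^+ m.+1 = b ^+ j * dyad k ^+ (m.+1 - j).
 move=> jm; rewrite akE expr_div_n -mulrA; congr (_ * _).
 by rewrite -{1}(subnKC jm) exprD mulrA mulVf ?mul1r// expf_neq0// gt_eqF.
have HL i l k : (size l <= m)%N -> L2 setT (partial l (W i k)).
 by move=> lm; have [] := conv_chi_L2 (ak0 k) (iu k i) (Lu k i) (HXl l (leqW lm)) X0.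
have HN i l k : (size l <= m)%N -> L2norm setT (partial l (W i k)) <= C * 2^-1 ^+ k.
 move=> lm; have [_ h] := conv_chi_L2 (ak0 k) (iu k i) (Lu k i) (HXl l (leqW lm)) X0.
 apply: le_trans h _.
 have p0 : 0 <= 16 * X * ak k ^+ size l by rewrite !mulr_ge0// exprn_ge0// ltW.
 apply: le_trans (ler_wpM2l p0 (nu k i)) _.
 rewrite (_ : 16 * X * ak k ^+ size l * (K * dyad k ^+ m.+1) = 16 * X * K * (ak k ^+ size l * dyad k ^+ m.+1)); last by ring.
 rewrite ad ?leqW// subSn// exprS.
 apply: (@le_trans _ _ (16 * X * K * (Y * (2^-1 ^+ k * 1)))).
  apply: ler_wpM2l; first by rewrite !mulr_ge0.
  apply: ler_pM.
  - by rewrite exprn_ge0// ltW.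
  - by rewrite mulr_ge0 ?exprn_ge0// ltW.
  - by apply: bY; rewrite leqW.
  apply: ler_pM; [exact: ltW|by rewrite exprn_ge0// ltW|exact: dle|].
  by rewrite exprn_ile1// ltW.
 rewrite (_ : 16 * X * K * (Y * (2^-1 ^+ k * 1)) = 16 * (X * K * Y * 2^-1 ^+ k)); last by ring.
 rewrite (_ : C * 2^-1 ^+ k = q * (X * K * Y * 2^-1 ^+ k)); last by rewrite /C; ring.
 by rewrite ler_wpM2r// !mulr_ge0// exprn_ge0// invr_ge0.
have HT i l k h : size l = m -> L2norm setT (fun x => partial l (W i k) (x + h) - partial l (W i k) x) <= C * `|h|.
 move=> lm; have H l' : (size l' <= (size l).+1)%N -> forall a y, 0 < a -> `|partial l' (chi (n := 4) a) y| <= X * a ^+ (4 + size l').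
  by rewrite lm; exact: HXl.
 apply: le_trans (Hq _ _ _ _ h (ak0 k) (iu k i) (Lu k i) H X0) _; rewrite lm.
 have p0 : 0 <= q * X * ak k ^+ m.+1 * `|h| by rewrite !mulr_ge0// exprn_ge0// ltW.
 apply: le_trans (ler_wpM2l p0 (nu k i)) _.
 rewrite (_ : q * X * ak k ^+ m.+1 * `|h| * (K * dyad k ^+ m.+1) = q * X * K * `|h| * (ak k ^+ m.+1 * dyad k ^+ m.+1)); last by ring.
 rewrite ad// subnn expr0 mulr1 (_ : C * `|h| = q * X * K * `|h| * Y); last by rewrite /C; ring.
 by rewrite ler_wpM2l ?bY// !mulr_ge0.
have S i := sobolev_series C0 (sW i) (HL i) (HN i) (HT i).
have [f Hf] := choice S.
have Lf i : L2 Om (f i) by have [L _ _] := Hf i; exact: L2_sub L.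
exists f; split => //.
 by move=> i s ms; have [_ _ H] := Hf i; exact: (H Om D s oO D0 OD ms).
move=> p tp.
(* The cube of mollification around a point of [Om] stays in the [k]-th domain, where the solution
   is weakly harmonic. *)
have vW i k : {ae mu, forall x, Om x -> v k i x = W i k x}.
 have h1 : forall x, Om x -> cube x (ak k)^-1 `<=` Uk k.
  move=> x Ox; rewrite invrK; apply: (ex_dist ex) => //.
  by rewrite mulr_gt0//=; exact: (ex_kap_le ex (dyad_in ex k)).
 have := weyl_mean (@Uk_open _ _ _ _ _ _ _ _ _ _ _ ex k) oO (ex_fin ex) (iu k i) (wharm_restrict (hv k i)) (ak0 k) h1.
 apply: filterS => x Hx Ox; rewrite -[RHS](Hx Ox) /u patchE mem_set//; exact: (Om_sub ex k Ox).
have LWO i k : L2 Om (W i k) by apply: (L2_sub (U' := setT)) => //; exact: (HL i [::] k (leq0n _)).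
have LA i : L2 Om (opAv p i) by apply: (testv_L2v (p := fun _ => opAv p i) oO _ i0) => j; exact: opAv_test.
have vWip k : ipv Om (opAv p) (v k) = ipv Om (opAv p) (fun i => W i k).
 apply: eq_bigr => i _; apply: Rint_ae => //.
 - by apply: mfunM; [exact: (LA i).1|apply: measurable_funS (Lv k i).1 => //; exact: (Om_sub ex)].
 - by apply: mfunM; [exact: (LA i).1|exact: (LWO i k).1].
 - by apply: filterS (vW i k) => x Hx Ox; rewrite Hx.
pose P := \sum_i L2norm Om (opAv p i).
have P0 : 0 <= P by apply: sumr_ge0 => i _; exact: L2norm_ge0.
have C20 : 0 <= C / (1 - 2^-1) by rewrite divr_ge0// subr_ge0 invf_le1// ler1n.
apply/eqP; rewrite -subr_eq0 opprK -normr_le0; apply: le_of_small => d dd0; rewrite add0r.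
have dd2 : 0 < d / 2 by rewrite divr_gt0.
have [N1 HN1] := wv p tp (d / 2) dd2; have [N2 HN2] := geom_small (mulr_ge0 C20 P0) (@half01 R) dd2.
pose k := maxn N1 N2.
have h1 := HN1 k (leq_maxl _ _); have h2 := HN2 k (leq_maxr _ _).
have E : ipv Om (opAv p) f - \sum_(j < k) ipv Om (opAv p) (v j) =
  \sum_i ip Om (opAv p i) (fun x => f i x - \sum_(j < k) W i j x).
 have -> : \sum_(j < k) ipv Om (opAv p) (v j) = \sum_i \sum_(j < k) ip Om (opAv p i) (W i j).
  by rewrite [RHS]exchange_big; apply: eq_bigr => j _; exact: vWip.
 rewrite -sumrB; apply: eq_bigr => i _; rewrite /ip -Rint_sum//; last first.
  by move=> j _; exact: L2_mul.
 rewrite -RintegralB//; last 2 first.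
 - exact: L2_mul.
 - by apply: integ_sum => // j _; exact: L2_mul.
 by apply: eq_Rint => x _; rewrite mulrBr mulr_sumr.
rewrite -(subrK (\sum_(j < k) ipv Om (opAv p) (v j)) (ipv Om (opAv p) f)) -addrA [d]splitr.
apply: le_trans (ler_normD _ _) _; apply: lerD h1; apply: le_trans h2.
rewrite E mulrAC /P mulr_sumr; apply: le_trans (ler_norm_sum _ _ _) _; apply: ler_sum => i _.
have [Lfi Hfi _] := Hf i.
have LT : L2 setT (fun x => f i x - \sum_(j < k) W i j x).
 apply: L2B => //; apply: L2_sum => // j _; exact: (HL i [::] j (leq0n _)).
apply: le_trans (L2norm_ip mO (LA i) (L2_sub mO measurableT (fun _ _ => I) LT)) _.
rewrite mulrC ler_wpM2r ?L2norm_ge0//; apply: le_trans (Hfi k).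
by rewrite ler_wsqrtr// L2n_sub.
Qed.

End solutions.
End mollified_series.

(** * Uniformity on compact sets *)

Section uniformity.
Context {R : realType} {n : nat}.
Local Notation V := 'rV[R]_n.
Implicit Types (K : set V) (x y : V) (f : V -> R).

Lemma compact_uniform K (P : V -> R -> Prop) : compact K ->
 (forall x r r', P x r -> 0 < r' -> r' <= r -> P x r') ->
 (forall x, K x -> exists2 r : R, 0 < r & \forall y \near x, P y r) ->
 exists2 r : R, 0 < r & forall x, K x -> P x r.
Proof.
move=> cK mono loc.
have : \forall r \near (0 : R)^'+, K `<=` (fun x => P x r).
 move: cK; rewrite compact_near_coveringP => /(_ _ (0 : R)^'+ (fun r x => P x r)); apply.
 move=> x Kx; have [r r0 Hr] := loc x Kx.
 exists ([set y | P y r], [set s : R | 0 < s <= r]) => /=.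
  split => //; near=> s; apply/andP; split; near: s; [exact: nbhs_right_gt|exact: nbhs_right_le].
 by move=> [y s]/= [Py /andP[s0 sr]]; exact: mono Py s0 sr.
move=> H; have [r [r0 Hr]] := filter_ex (filterI (nbhs_right_gt (0 : R)) H).
by exists r.
Unshelve. all: by end_near.
Qed.

Lemma near_lt f x (a : R) : {for x, continuous f} -> f x < a -> \forall y \near x, f y < a.
Proof.
move=> /cont_rVP cf fa; have [d d0 Hd] := cf (a - f x) ltac:(by rewrite subr_gt0).
apply/nbhs_rVP; exists d => // y /Hd; rewrite ltr_norml => /andP[_].
by rewrite ltrD2r.
Qed.

Lemma near_gt f x (a : R) : {for x, continuous f} -> a < f x -> \forall y \near x, a < f y.
Proof.
move=> /cont_rVP cf fa; have [d d0 Hd] := cf (f x - a) ltac:(by rewrite subr_gt0).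
apply/nbhs_rVP; exists d => // y /Hd; rewrite ltr_norml => /andP[+ _].
by rewrite opprB ltrD2r.
Qed.

End uniformity.

(** * Lower bounds for the Levi form near the boundary *)

Section levi_bound.
Context {R : realType}.
Local Notation V := 'rV[R]_4.
Implicit Types (U : set V) (rho : V -> R) (x z w : V) (v : 'I_4 -> R).

(** Four times the squared modulus of the [z] derivative of [rho] along [v]; it vanishes exactly on
    the complex tangent vectors. *)
Definition tau rho z v : R := (\sum_i pd i rho z * v i) ^+ 2 + (\sum_i pd i rho z * rotJ v i) ^+ 2.

Lemma tau_ge0 rho z v : 0 <= tau rho z v.
Proof. by rewrite addr_ge0 ?sqr_ge0. Qed.

Lemma rotJ_scale (s : R) v i : rotJ (fun j => s * v j) i = s * rotJ v i.
Proof. by elim/ord4P: i; rewrite /rotJ /= ?mulrN. Qed.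

Lemma tau_scale rho z (s : R) v : tau rho z (fun i => s * v i) = s ^+ 2 * tau rho z v.
Proof.
have E u : \sum_i pd i rho z * (s * u i) = s * \sum_i pd i rho z * u i by rewrite mulr_sumr; apply: eq_bigr => i _; rewrite mulrCA.
rewrite /tau E; under [X in _ + X ^+ 2]eq_bigr => i _ do rewrite rotJ_scale.
by rewrite E !exprMn mulrDr.
Qed.

Lemma levi_scale rho z (s : R) v : levi rho z (fun i => s * v i) = s ^+ 2 * levi rho z v.
Proof.
have E u : hess rho z (fun i => s * u i) (fun i => s * u i) = s ^+ 2 * hess rho z u u.
 rewrite /hess mulr_sumr; apply: eq_bigr => i _; rewrite mulr_sumr; apply: eq_bigr => j _.
 by rewrite -!mulrA; ring.
rewrite /levi E mulrDr; congr (_ + _); rewrite -E /hess.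
by apply: eq_bigr => i _; apply: eq_bigr => j _; rewrite !rotJ_scale.
Qed.

Let F z w := filter_prod (nbhs z) (nbhs w).

Lemma fst_cvg (f : V -> R) z w : {for z, continuous f} ->
 (fun zw : V * V => f zw.1) @ F z w --> f z.
Proof.
move=> cf A /cf Az; exists ([set y | A (f y)], setT); last by move=> [a b] [].
by split => //; exact: filterT.
Qed.

Lemma snd_cvg (f : V -> R) z w : {for w, continuous f} ->
 (fun zw : V * V => f zw.2) @ F z w --> f w.
Proof.
move=> cf A /cf Az; exists (setT, [set y | A (f y)]); last by move=> [a b] [].
by split => //; exact: filterT.
Qed.

Lemma rotJ_cont i w : {for w, continuous (fun w : V => rotJ (w 0) i)}.
Proof.
have c j : {for w, continuous (fun w : V => w 0 j)} by exact: coord_continuous.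
have cN j : {for w, continuous (fun w : V => - w 0 j)} by move: (c j) => h; exact: (@cvgN _ _ _ (nbhs w) (nbhs_filter w) _ _ h).
by elim/ord4P: i; rewrite /rotJ /=.
Qed.

Lemma sum_cvg (G : 'I_4 -> V * V -> R) (l : 'I_4 -> R) z w :
 (forall i, G i @ F z w --> l i) -> (fun zw => \sum_i G i zw) @ F z w --> \sum_i l i.
Proof.
move=> H; rewrite sum4 (_ : (fun zw => _) = fun zw => G i0 zw + G i1 zw + G i2 zw + G i3 zw).
 by apply: cvgD; [apply: cvgD; [apply: cvgD|]|].
by apply/funext => zw; rewrite sum4.
Qed.

Lemma coord_snd_cvg z w i : (fun zw : V * V => zw.2 0 i) @ F z w --> w 0 i.
Proof. by apply: (@snd_cvg (fun w : V => w 0 i)); exact: coord_continuous. Qed.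

Lemma rotJ_snd_cvg z w i : (fun zw : V * V => rotJ (zw.2 0) i) @ F z w --> rotJ (w 0) i.
Proof. by apply: (@snd_cvg (fun w : V => rotJ (w 0) i)); exact: rotJ_cont. Qed.

Lemma levi_cvg U rho z w : open U -> Ck 2 U rho -> U z ->
 (fun zw : V * V => levi rho zw.1 (zw.2 0)) @ F z w --> levi rho z (w 0).
Proof.
move=> oU C2 Uz.
have h i j : (fun zw : V * V => pd i (pd j rho) zw.1) @ F z w --> pd i (pd j rho) z.
 by apply: fst_cvg; apply: (@Ck_cont _ _ 0 U) => //; do 2 apply: Ck_pd.
have c := @coord_snd_cvg z w; have r := @rotJ_snd_cvg z w.
apply: cvgD; apply: sum_cvg => i; apply: sum_cvg => j; apply: cvgM => //; exact: cvgM.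
Qed.

Lemma tau_cvg U rho z w : open U -> Ck 1 U rho -> U z ->
 (fun zw : V * V => tau rho zw.1 (zw.2 0)) @ F z w --> tau rho z (w 0).
Proof.
move=> oU C1 Uz.
have h i : (fun zw : V * V => pd i rho zw.1) @ F z w --> pd i rho z by apply: fst_cvg; apply: (@Ck_cont _ _ 0 U) => //; apply: Ck_pd.
have c := @coord_snd_cvg z w; have r := @rotJ_snd_cvg z w.
have s (G : V * V -> R) (l : R) : G @ F z w --> l -> (fun zw => G zw ^+ 2) @ F z w --> l ^+ 2 by move=> Gl; exact: (cvgM Gl Gl).
by apply: cvgD; apply: s; apply: sum_cvg => i; apply: cvgM.
Qed.

Lemma sphere_compact : compact [set w : V | sqn w = 1].
Proof.
apply: bounded_closed_compact.
 exists 1; split; first exact: num_real.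
 move=> M M1 w /= w1; apply: normrV_le => [|i]; first by rewrite ltW// (lt_trans ltr01).
 apply: le_trans (ltW M1); rewrite -(@ler_sqr _ `|_|) ?nnegrE// expr1n real_normK ?num_real// -w1.
 exact: sqn_coord.
apply: (@closed_comp _ _ (fun w : V => sqn w) [set 1]); last exact: closed_eq.
move=> w _; apply: (@Ck_cont _ _ 0 setT) => //.
exact: (sqn_smooth (@openT_rV R 4)).
Qed.

(* Strict positivity on the complex tangent space gives coercivity up to a
  multiple of the squared normal component. *)
Lemma levi_local U rho p : open U -> smooth U rho -> U p ->
 (forall v, (exists i, v i != 0) -> tau rho p v = 0 -> 0 < levi rho p v) ->
 exists2 r : R, 0 < r & forall z, `|z - p| < r -> forall v,
  r * \sum_i v i ^+ 2 <= levi rho z v + tau rho z v / r.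
Proof.
move=> oU sr Up Hpos.
have C2 : Ck 2 U rho by exact: sr.
have C1 : Ck 1 U rho by exact: sr.
(* One radius for all unit vectors, by compactness of the sphere; homogeneity then extends the bound
   to all [v]. *)
have [] := @compact_uniform R 4 _ (fun w r => forall z, `|z - p| < r ->
  r <= levi rho z (w 0) + tau rho z (w 0) / r) sphere_compact.
- move=> w r r' H r0 rr z zr; apply: (le_trans rr); apply: le_trans (H z (lt_leT zr rr)) _.
 rewrite lerD2l ler_wpM2l ?tau_ge0// lef_pV2 ?posrE//; exact: lt_leT rr.
- move=> w /= w1.
 have w0 : exists i, w 0 i != 0.
  apply: contrapT => /forallNP H; move: w1; rewrite /sqn big1 => [/eqP|i _].
   by rewrite eq_sym oner_eq0.
  by have /negP := H i; rewrite negbK => /eqP ->; rewrite expr0n.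
 have ext (A : set (V * V)) (r1 : R) : F p w A -> 0 < r1 -> exists r, [/\ 0 < r, r <= r1 &
   \forall y \near w, forall z, `|z - p| < r -> A (z, y)].
  move=> [[A1 A2] [/= /nbhs_rVP[d d0 H1] H2] HA] r10.
  exists (Num.min d r1); split; [by rewrite lt_min d0|by rewrite ge_min lexx orbT|].
  apply: filterS H2 => y Ay z; rewrite lt_min => /andP[zd _].
  by apply: HA; split => //; exact: H1.
 have cl := @levi_cvg U rho p w oU C2 Up; have ct := @tau_cvg U rho p w oU C1 Up.
 (* Complex tangent vectors are controlled by strict positivity, all others by the large factor
    [1 / r] in front of [tau]. *)
 have := tau_ge0 rho p (w 0); rewrite le_eqVlt => /orP[/eqP/esym t0|t0].
  have l0 := Hpos _ w0 t0.
  pose b := levi rho p (w 0) / 2; have b0 : 0 < b by rewrite divr_gt0.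
  have bl : b < levi rho p (w 0) by rewrite /b ltr_pdivrMr// ltr_pMr// ltr1n.
  have [r [r0 rb H]] := ext _ b (cvgr_gt _ cl _ bl) b0.
  exists r => //; apply: filterS H => y Hy z zr.
  apply: le_trans rb _; apply: le_trans (ltW (Hy z zr)) _.
  by rewrite lerDl divr_ge0 ?tau_ge0// ltW.
 pose L := levi rho p (w 0); pose T := tau rho p (w 0).
 have T2 : T / 2 < T by rewrite ltr_pdivrMr// ltr_pMr// ltr1n.
 have L1 : L - 1 < L by rewrite ltrBlDr ltrDl.
 pose r1 := Num.min 1 (T / (2 * (`|L| + 2))).
 have L2 : 0 < 2 * (`|L| + 2) by rewrite mulr_gt0// ltr_wpDl.
 have r10 : 0 < r1 by rewrite lt_min ltr01 divr_gt0.
 have [r [r0 rr H]] := ext _ r1 (filterI (cvgr_gt _ cl _ L1) (cvgr_gt _ ct _ T2)) r10.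
 exists r => //; apply: filterS H => y Hy z zr; have [/= h1 h2] := Hy z zr.
 have r_1 : r <= 1 by apply: le_trans rr _; rewrite ge_min lexx.
 have h3 : `|L| + 2 <= tau rho z (y 0) / r.
  rewrite ler_pdivlMr//; apply: le_trans (ltW h2); rewrite ler_pdivlMr//.
  have : r <= T / (2 * (`|L| + 2)) by apply: le_trans rr _; rewrite ge_min lexx orbT.
  rewrite ler_pdivlMr// => h; apply: le_trans h; apply: eqW; ring.
 have := ler_norm (- L); rewrite normrN; move: h1 h3 r_1; clear; move=> h1 h3 r_1 h4; lra.
move=> r r0 H; exists r => // z zr v.
pose s := Num.sqrt (\sum_i v i ^+ 2).
have s2 : s ^+ 2 = \sum_i v i ^+ 2 by rewrite sqr_sqrtr// sumr_ge0// => i _; exact: sqr_ge0.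
have [s0|s0] := eqVneq s 0.
 have v0 : v = fun i => 0 * v i.
  apply/funext => i; rewrite mul0r; apply/eqP; rewrite -sqrf_eq0; apply/eqP.
  have : \sum_i v i ^+ 2 = 0 by rewrite -s2 s0 expr0n.
  move=> /eqP; rewrite psumr_eq0; last by move=> j _; exact: sqr_ge0.
  by move=> /allP /(_ i (mem_index_enum i)) /eqP.
 by rewrite -s2 s0 v0 levi_scale tau_scale expr0n /= !mul0r addr0 mulr0.
pose w : V := \row_i (v i / s).
have vw : v = fun i => s * w 0 i by apply/funext => i; rewrite mxE mulrC divfK.
have w1 : sqn w = 1.
 rewrite /sqn; under eq_bigr do rewrite mxE expr_div_n.
 by rewrite -mulr_suml -s2 mulfV// expf_neq0.
rewrite -s2 {1}vw [X in tau _ _ X]vw levi_scale tau_scale mulrC -mulrA -mulrDr.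
by rewrite ler_wpM2l ?sqr_ge0//; exact: H.
Qed.

Lemma half_complex : (2%:R : R[i])^-1 = (2^-1 : R)%:C%C.
Proof. by rewrite fmorphV rmorph_nat. Qed.

Lemma d_dz_complex (a b : V -> R) j x : d_dz j (fun y => (a y +i* b y)%C) x =
 ((2^-1 * (pd (re_coord j) a x + pd (im_coord j) b x)) +i*
  (2^-1 * (pd (re_coord j) b x - pd (im_coord j) a x)))%C.
Proof.
have E1 i : partial [:: i] (fun y => complex.Re (a y +i* b y)%C) x = pd i a x by [].
have E2 i : partial [:: i] (fun y => complex.Im (a y +i* b y)%C) x = pd i b x by [].
rewrite /d_dz /partialC half_complex !E1 !E2.
move: (pd (re_coord j) a x) (pd (im_coord j) a x) (pd (re_coord j) b x) (pd (im_coord j) b x) => A B C D.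
by apply/eqP; rewrite eq_complex /=; apply/andP; split; apply/eqP; ring.
Qed.

Lemma d_dzbar_real rho k : d_dzbar k (fun x => (rho x)%:C%C) =
 fun x => ((2^-1 * pd (re_coord k) rho x) +i* (2^-1 * pd (im_coord k) rho x))%C.
Proof.
apply/funext => x; rewrite /d_dzbar /partialC half_complex.
have z i : partial [:: i] (fun y : V => complex.Im ((rho y)%:C%C)) x = 0 by rewrite /= derive_cst.
rewrite !z; apply/eqP; rewrite eq_complex /= /pd; move: ('D_ _ _ _) ('D_ _ _ _) => A B.
by apply/andP; split; apply/eqP; ring.
Qed.

Lemma coordsE : [/\ re_coord 0 = i0, im_coord 0 = i1, re_coord (lift ord0 ord0) = i2 &
 im_coord (lift ord0 ord0) = i3].
Proof. by split; apply: val_inj; rewrite /= inordK. Qed.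

Lemma sum2 (M : nmodType) (G : 'I_2 -> M) : \sum_i G i = G 0 + G (lift ord0 ord0).
Proof. by rewrite big_ord_recl big_ord1. Qed.

Lemma sum22 (M : nmodType) (G : 'I_2 -> 'I_2 -> M) : \sum_i \sum_j G i j =
 G 0 0 + G 0 (lift ord0 ord0) + (G (lift ord0 ord0) 0 + G (lift ord0 ord0) (lift ord0 ord0)).
Proof. by rewrite sum2 !sum2. Qed.

Definition cvec v : 'cV[R[i]]_2 :=
 \col_j (if j == 0 then (v i0 +i* v i1)%C else (v i2 +i* v i3)%C).

Lemma hermitian_re (X00 X01 X10 X11 : R[i]) (a00 b00 a01 b01 a10 b10 a11 b11 v0 v1 v2 v3 : R) :
 X00 = (a00 +i* b00)%C -> X01 = (a01 +i* b01)%C -> X10 = (a10 +i* b10)%C -> X11 = (a11 +i* b11)%C ->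
 complex.Re (X00 * (v0 +i* v1)%C * conjc (v0 +i* v1)%C + X01 * (v0 +i* v1)%C * conjc (v2 +i* v3)%C
  + (X10 * (v2 +i* v3)%C * conjc (v0 +i* v1)%C + X11 * (v2 +i* v3)%C * conjc (v2 +i* v3)%C)) =
 a00 * (v0 ^+ 2 + v1 ^+ 2) + a01 * (v0 * v2 + v1 * v3) - b01 * (v1 * v2 - v0 * v3)
 + a10 * (v0 * v2 + v1 * v3) + b10 * (v1 * v2 - v0 * v3) + a11 * (v2 ^+ 2 + v3 ^+ 2).
Proof. by move=> -> -> -> ->; cbn; ring. Qed.

Lemma levi_form_real U rho p v : open U -> smooth U rho -> U p ->
 complex.Re (levi_form rho p (cvec v)) = levi rho p v / 4.
Proof.
move=> oU sr Up; have [r0 m0 r1 m1] := coordsE.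
have C2 : Ck 2 U rho by exact: sr.
have H i j : pd i (fun y => 2^-1 * pd j rho y) p = 2^-1 * pd i (pd j rho) p.
 by apply: pdE; apply: isdZ; apply: isd_pd; exact: (@Ck_pder _ _ 0 U _ (Ck_pd j C2) _ Up).
have C i j : pd i (pd j rho) p = pd j (pd i rho) p by exact: (pdC i j oU C2 Up).
have DD j k : d_dz j (d_dzbar k (fun x => (rho x)%:C%C)) p =
  ((4^-1 * (pd (re_coord j) (pd (re_coord k) rho) p + pd (im_coord j) (pd (im_coord k) rho) p)) +i*
   (4^-1 * (pd (re_coord j) (pd (im_coord k) rho) p - pd (im_coord j) (pd (re_coord k) rho) p)))%C.
 rewrite d_dzbar_real d_dz_complex !H; congr (_ +i* _)%C; gen_pd; intros; by field.
have c0 : cvec v 0 0 = (v i0 +i* v i1)%C by rewrite mxE.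
have c1 : cvec v (lift ord0 ord0) 0 = (v i2 +i* v i3)%C by rewrite mxE.
have d00 := DD 0 0; have d01 := DD 0 (lift ord0 ord0).
have d10 := DD (lift ord0 ord0) 0; have d11 := DD (lift ord0 ord0) (lift ord0 ord0).
rewrite r0 m0 in d00; rewrite r0 m0 r1 m1 in d01; rewrite r0 m0 r1 m1 in d10; rewrite r1 m1 in d11.
rewrite /levi_form (sum22 (fun j k => d_dz j (d_dzbar k (fun x => (rho x)%:C%C)) p * cvec v j 0 * conjc (cvec v k 0))).
rewrite c0 c1.
apply: etrans (hermitian_re _ _ _ _ d00 d01 d10 d11) _; clear d00 d01 d10 d11 DD.
rewrite /levi /hess !sum4 /rotJ /=.
move: (C i1 i0) (C i2 i0) (C i3 i0) (C i2 i1) (C i3 i1) (C i3 i2); clear; gen_pd; intros; subst.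
by field.
Qed.

Lemma tau_tangent rho p v : tau rho p v = 0 -> complex_tangent rho p (cvec v).
Proof.
move=> /eqP; rewrite paddr_eq0 ?sqr_ge0// !sqrf_eq0 => /andP[/eqP h1 /eqP h2].
have [r0 m0 r1 m1] := coordsE.
have z i : pd i (fun=> 0 : R) p = 0 by rewrite pd_cst.
have c0 : cvec v 0 0 = (v i0 +i* v i1)%C by rewrite mxE.
have c1 : cvec v (lift ord0 ord0) 0 = (v i2 +i* v i3)%C by rewrite mxE.
rewrite /complex_tangent sum2.
rewrite !(d_dz_complex rho (fun=> 0)) !z r0 m0 r1 m1 c0 c1.
move: h1 h2; rewrite !sum4 /rotJ /=; gen_pd => h1 h2.
apply/eqP; rewrite eq_complex /=; apply/andP; split; apply/eqP.
 by rewrite -[RHS](mulr0 2^-1) -[in RHS]h1; ring.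
by rewrite -[RHS](mulr0 2^-1) -[in RHS]h2; ring.
Qed.

(** Positivity in [R[i]] includes positivity of the real part, which for the Levi form is a quarter
    of [levi]. *)
Lemma levi_positive U rho p : open U -> smooth U rho -> U p ->
 (forall w : 'cV[R[i]]_2, w != 0 -> complex_tangent rho p w -> 0 < levi_form rho p w) ->
 forall v, (exists i, v i != 0) -> tau rho p v = 0 -> 0 < levi rho p v.
Proof.
move=> oU sr Up H v [i vi] tv.
have w0 : cvec v != 0.
 apply/eqP => /matrixP E; move: vi; apply/negP; rewrite negbK.
 have := E 0 0; have := E (lift ord0 ord0) 0; rewrite !mxE /= => -[e2 e3] [e0 e1].
 by elim/ord4P: i; apply/eqP.
have := H _ w0 (tau_tangent tv); rewrite ltcE /= => /andP[_].
by rewrite (levi_form_real v oU sr Up) pmulr_lgt0// invr_gt0.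
Qed.

End levi_bound.

(** * Taylor estimates on balls *)

Section taylor.
Context {R : realType} {n : nat}.
Local Notation V := 'rV[R]_n.
Implicit Types (U : set V) (f : V -> R) (x h : V).

Lemma ball_mvt U f x h (r : R) : open U -> Ck 1 U f -> (forall z, `|z - x| < r -> U z) -> `|h| < r ->
 exists z, `|z - x| <= `|h| /\ f (x + h) - f x = \sum_i pd i f z * h 0 i.
Proof.
move=> oU C1 HU hr.
pose g (s : R) := f (x + s *: h).
have inb (s : R) : 0 <= s <= 1 -> `|x + s *: h - x| <= `|h| by move=> /andP[s0 s1]; rewrite addrAC subrr add0r normrZ ger0_norm// ler_piMl.
have D (s : R) : 0 <= s <= 1 -> is_derive s (1 : R) g (\sum_i pd i f (x + s *: h) * h 0 i).
 move=> s01; have Us : U (x + s *: h) by apply: HU; exact: le_ltT (inb s s01) hr.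
 have C1z := @Ck_C1at _ _ 0 U _ _ oU C1 Us.
 have H i : is_derive s (1 : R) (fun t : R => (x + t *: h) 0 i) (h 0 i).
  rewrite (_ : (fun t => _) = fun t : R => x 0 i + t * h 0 i); last first.
   by apply/funext => t; rewrite !mxE.
  have := isdD (isd_cst s 1 (x 0 i)) (isdM (@is_derive_id R R s 1) (isd_cst s 1 (h 0 i))).
  by move/isd_eq; apply; rewrite add0r mulr0 addr0 mul1r.
 exact: (isd_comp (G := fun t : R => x + t *: h) (dG := fun i => h 0 i) C1z H).
have cts : {within `[0, 1], continuous g} by apply: derivable_within_continuous => s; rewrite in_itv/= => s01; have [] := D s s01.
have Dz (s : R) : s \in `]0, 1[%R -> is_derive s 1 g (\sum_i pd i f (x + s *: h) * h 0 i).
 by rewrite in_itv/= => /andP[s0 s1]; apply: D; rewrite !ltW.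
have [s] := MVT_segment (@ler01 R) Dz cts.
rewrite in_itv/= => s01; rewrite /g scale1r scale0r addr0 subr0 mulr1 => E.
by exists (x + s *: h); split => //; exact: inb.
Qed.

Lemma sum_le_norm (a : 'I_n -> R) h (M : R) : (forall i, `|a i| <= M) ->
 `|\sum_i a i * h 0 i| <= n%:R * M * `|h|.
Proof.
move=> H; apply: le_trans (ler_norm_sum _ _ _) _.
apply: (@le_trans _ _ (\sum_(i < n) M * `|h|)).
 by apply: ler_sum => i _; rewrite normrM; apply: ler_pM => //; exact: le_normrV.
by rewrite sumr_const card_ord -[_ *+ n]mulr_natl mulrA.
Qed.

Lemma ball_taylor1 U f x h (r M : R) : open U -> Ck 1 U f -> (forall z, `|z - x| < r -> U z) ->
 (forall z i, `|z - x| < r -> `|pd i f z| <= M) -> `|h| < r ->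
 `|f (x + h) - f x| <= n%:R * M * `|h|.
Proof.
move=> oU C1 HU HM hr; have [z [zh ->]] := ball_mvt oU C1 HU hr.
by apply: sum_le_norm => i; apply: HM; exact: le_ltT hr.
Qed.

Lemma ball_taylor2 U f x h (r M : R) : open U -> Ck 2 U f -> (forall z, `|z - x| < r -> U z) ->
 (forall z i j, `|z - x| < r -> `|pd i (pd j f) z| <= M) -> `|h| < r ->
 `|f (x + h) - f x - \sum_i pd i f x * h 0 i| <= n%:R * (n%:R * M * `|h|) * `|h|.
Proof.
move=> oU C2 HU HM hr; have C1 : Ck 1 U f by exact: Ck_le C2.
have [z [zh ->]] := ball_mvt oU C1 HU hr.
rewrite -sumrB; under eq_bigr do rewrite -mulrBl.
apply: sum_le_norm => i; have -> : z = x + (z - x) by rewrite addrC subrK.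
have M0 : 0 <= M by apply: le_trans (HM x i i _); rewrite ?normr_ge0// subrr normr0 (le_ltT _ hr).
apply: (@le_trans _ _ (n%:R * M * `|z - x|)); last by rewrite ler_wpM2l// mulr_ge0.
apply: (ball_taylor1 oU (Ck_pd i C2) HU) => [w j wr|]; first exact: HM.
exact: le_ltT hr.
Qed.

End taylor.

(** * A strictly plurisubharmonic defining function *)

Section defining.
Context {R : realType}.
Local Notation V := 'rV[R]_4.
Local Notation e_ i := (basis_vec R i).
Implicit Types (U : set V) (rho : V -> R) (x z w : V) (v : 'I_4 -> R).

(** Where [rho <= - c] the function is [sqn y - Mg] whatever [rho] is; this allows a defining
    function known only near the boundary to be glued to the interior. With the factor [Mg - sqn y],
    the function is strictly plurisubharmonic there too. *)
Definition sig rho (k c Mg : R) y : R := (k * bfun 0 (rho y + c) - 1) * (Mg - sqn (n := 4) y).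

Lemma isd_sqn x j : is_derive x (e_ j) (sqn (R := R) (n := 4)) (2 * x 0 j).
Proof.
have D i : is_derive x (e_ j) (fun y : V => y 0 i ^+ 2) (2 * x 0 i * (j == i)%:R).
 have := isdM (isd_coord j i x) (isd_coord j i x); move/isd_eq; apply; ring.
have -> : sqn (R := R) (n := 4) = fun y => y 0 i0 ^+ 2 + y 0 i1 ^+ 2 + y 0 i2 ^+ 2 + y 0 i3 ^+ 2.
 by apply/funext => y; rewrite /sqn sum4.
have := isdD (isdD (isdD (D i0) (D i1)) (D i2)) (D i3); move/isd_eq; apply.
by elim/ord4P: j {D}; rewrite /=; ring.
Qed.

Section calculus.
Context (U : set V) (rho : V -> R) (k c Mg : R) (oU : open U) (sr : smooth U rho).
Local Notation S := (sig rho k c Mg).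
Local Notation b j z := (bfun j (rho z + c)).
Local Notation G z := (Mg - sqn z).

Lemma sig_smooth : smooth U S.
Proof.
have s1 : smooth U (fun y => k * bfun 0 (rho y + c) - 1).
 apply: (smoothB oU); last exact: smooth_cst.
 apply: (smoothZ _ oU); apply: (bfun_comp 0 oU); apply: (smoothD oU sr); exact: smooth_cst.
have s2 : smooth U (fun y => Mg - sqn y) by apply: (smoothB oU); [exact: smooth_cst|exact: (sqn_smooth oU)].
exact: (smoothM oU s1 s2).
Qed.

Lemma isd_rho z i : U z -> is_derive z (e_ i) rho (pd i rho z).
Proof.
move=> Uz; have C1 : Ck 1 U rho by exact: sr.
by apply: isd_pd; exact: (@Ck_pder _ _ 0 U _ C1 _ Uz).
Qed.

Lemma isd_bfun m z i : U z -> is_derive z (e_ i) (fun y => b m y) (b m.+1 z * pd i rho z).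
Proof.
move=> Uz; apply: (@isd_comp1 _ V (fun y => rho y + c) (bfun m)); first exact: isd_bfunk.
by have := isdD (isd_rho i Uz) (isd_cst z (e_ i) c); move/isd_eq; apply; rewrite addr0.
Qed.

Lemma isd_G z i : is_derive z (e_ i) (fun y => G y) (- (2 * z 0 i)).
Proof. by have := isdB (isd_cst z (e_ i) Mg) (isd_sqn z i); move/isd_eq; apply; rewrite sub0r. Qed.

Lemma sig_pd z j : U z -> pd j S z = k * (b 1 z * pd j rho z) * G z + (k * b 0 z - 1) * - (2 * z 0 j).
Proof.
move=> Uz; apply: pdE.
have := isdM (isdB (isdZ k (isd_bfun 0 j Uz)) (isd_cst z (e_ j) 1)) (isd_G z j).
by move/isd_eq; apply; move: (b 0 z) (b 1 z) (pd j rho z) => *; ring.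
Qed.

Lemma sig_pd2 z i j : U z -> pd i (pd j S) z =
 k * (b 2 z * pd i rho z * pd j rho z + b 1 z * pd i (pd j rho) z) * G z
 + k * b 1 z * pd j rho z * - (2 * z 0 i) + k * b 1 z * pd i rho z * - (2 * z 0 j)
 + (k * b 0 z - 1) * - (2 * (i == j)%:R).
Proof.
move=> Uz.
have -> : pd i (pd j S) z = pd i (fun z => k * (b 1 z * pd j rho z) * G z + (k * b 0 z - 1) * - (2 * z 0 j)) z.
 apply: pd_near; have := open_nb (conj oU Uz); apply: filterS => y Uy; exact: sig_pd.
have Dr : is_derive z (e_ i) (pd j rho) (pd i (pd j rho) z).
 have C2 : Ck 2 U rho by exact: sr.
 by apply: isd_pd; exact: (@Ck_pder _ _ 0 U _ (Ck_pd j C2) _ Uz).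
have D1 := isdM (isdZ k (isdM (isd_bfun 1 i Uz) Dr)) (isd_G z i).
have D2 := isdM (isdB (isdZ k (isd_bfun 0 i Uz)) (isd_cst z (e_ i) 1)) (isdN (isdZ 2 (isd_coord i j z))).
apply: pdE; have := isdD D1 D2; move/isd_eq; apply.
by move: (b 0 z) (b 1 z) (b 2 z) (pd j rho z) (pd i rho z) (pd i (pd j rho) z) => *; ring.
Qed.

(** The mixed term of the Levi form, in which each factor of [sig] is differentiated once. *)
Definition cross rho z v := (\sum_i pd i rho z * v i) * (\sum_i z 0 i * v i)
 + (\sum_i pd i rho z * rotJ v i) * (\sum_i z 0 i * rotJ v i).

Lemma quad_sum (h q : 'I_4 -> 'I_4 -> R) (r xx w : 'I_4 -> R) (A1 A2 A3 A4 : R) :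
 (forall i j, h i j = A1 * (r i * r j) + A2 * q i j + A3 * (r j * xx i + r i * xx j) + A4 * (i == j)%:R) ->
 \sum_i \sum_j h i j * w i * w j =
 A1 * (\sum_i r i * w i) ^+ 2 + A2 * \sum_i \sum_j q i j * w i * w j
 + 2 * A3 * ((\sum_i r i * w i) * (\sum_i xx i * w i)) + A4 * \sum_i w i ^+ 2.
Proof. by move=> H; rewrite !sum4 !H /=; ring. Qed.

Lemma rotJ_sqr v : \sum_i rotJ v i ^+ 2 = \sum_i v i ^+ 2.
Proof. by rewrite !sum4 /rotJ /=; ring. Qed.

Lemma sig_levi z v : U z -> levi S z v =
 G z * (k * b 2 z) * tau rho z v + G z * (k * b 1 z) * levi rho z v
 - 4 * (k * b 1 z) * cross rho z v - 4 * (k * b 0 z - 1) * \sum_i v i ^+ 2.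
Proof.
move=> Uz; have H i j := sig_pd2 i j Uz.
have Q (w : 'I_4 -> R) := @quad_sum (fun i j => pd i (pd j S) z) (fun i j => pd i (pd j rho) z) (fun i => pd i rho z) (z 0) w
 (G z * (k * b 2 z)) (G z * (k * b 1 z)) (- 2 * (k * b 1 z)) (- 2 * (k * b 0 z - 1)).
have Hq i j : pd i (pd j S) z = G z * (k * b 2 z) * (pd i rho z * pd j rho z) + G z * (k * b 1 z) * pd i (pd j rho) z
  + (- 2 * (k * b 1 z)) * (pd j rho z * z 0 i + pd i rho z * z 0 j) + (- 2 * (k * b 0 z - 1)) * (i == j)%:R.
 by rewrite H; move: (b 0 z) (b 1 z) (b 2 z) (pd j rho z) (pd i rho z) (pd i (pd j rho) z) => *; ring.
apply: etrans (congr2 (fun a b : R => a + b) (Q v Hq) (Q (rotJ v) Hq)) _.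
rewrite rotJ_sqr /levi /hess /tau /cross; clear Q H Hq.
move: (\sum_i pd i rho z * v i) (\sum_i pd i rho z * rotJ v i) (\sum_i z 0 i * v i) (\sum_i z 0 i * rotJ v i) (\sum_i v i ^+ 2) => p1 p2 q1 q2 m.
move: (\sum_i \sum_j pd i (pd j rho) z * v i * v j) (\sum_i \sum_j pd i (pd j rho) z * rotJ v i * rotJ v j) (b 0 z) (b 1 z) (b 2 z) => *.
by ring.
Qed.

End calculus.

Lemma cauchy_sum (a v : 'I_4 -> R) : (\sum_i a i * v i) ^+ 2 <= (\sum_i a i ^+ 2) * \sum_i v i ^+ 2.
Proof.
rewrite !sum4.
move: (a i0) (a i1) (a i2) (a i3) (v i0) (v i1) (v i2) (v i3) => a0 a1 a2 a3 v0 v1 v2 v3.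
rewrite -subr_ge0 (_ : _ - _ = (a0*v1-a1*v0)^+2+(a0*v2-a2*v0)^+2+(a0*v3-a3*v0)^+2
  +(a1*v2-a2*v1)^+2+(a1*v3-a3*v1)^+2+(a2*v3-a3*v2)^+2); last by ring.
by rewrite !addr_ge0 ?sqr_ge0.
Qed.

Lemma cross_le rho z v (a Mg : R) : 0 < a -> 0 < Mg -> sqn z <= Mg ->
 4 * cross rho z v <= 16 * Mg / a * tau rho z v + a / 2 * \sum_i v i ^+ 2.
Proof.
move=> a0 M0 zM; have n0 : 0 <= \sum_i v i ^+ 2 by apply: sumr_ge0 => i _; exact: sqr_ge0.
have q1 := cauchy_sum (z 0) v; have q2 := cauchy_sum (z 0) (rotJ v); rewrite rotJ_sqr in q2.
have zz : (\sum_i z 0 i ^+ 2) * \sum_i v i ^+ 2 <= Mg * \sum_i v i ^+ 2 by rewrite ler_wpM2r.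
have {}q1 := le_trans q1 zz; have {}q2 := le_trans q2 zz.
rewrite /cross /tau; move: q1 q2; clear zz.
move: (\sum_i pd i rho z * v i) (\sum_i pd i rho z * rotJ v i) (\sum_i z 0 i * v i) (\sum_i z 0 i * rotJ v i) (\sum_i v i ^+ 2) n0 => p1 p2 s1 s2 m m0 q1 q2.
have Y (p s : R) : 4 * (p * s) <= 16 * Mg / a * p ^+ 2 + a / (4 * Mg) * s ^+ 2.
 rewrite -subr_ge0 (_ : _ - _ = a / (4 * Mg) * (8 * Mg / a * p - s) ^+ 2); last by field; rewrite !gt_eqF.
 by rewrite mulr_ge0 ?sqr_ge0// divr_ge0 ?mulr_ge0// ltW.
have am : 0 <= a / (4 * Mg) by rewrite divr_ge0 ?mulr_ge0// ltW.
have e1 := ler_wpM2l am q1; have e2 := ler_wpM2l am q2.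
have E : a / (4 * Mg) * (Mg * m) = a / 4 * m by field; rewrite gt_eqF.
rewrite E in e1 e2; have y1 := Y p1 s1; have y2 := Y p2 s2.
move: e1 e2 y1 y2; move: (a / (4 * Mg) * s1 ^+ 2) (a / (4 * Mg) * s2 ^+ 2) => t1 t2.
rewrite [16 * Mg / a * (_ + _)]mulrDr mulrDr; move: (16 * Mg / a * p1 ^+ 2) (16 * Mg / a * p2 ^+ 2) (p1 * s1) (p2 * s2) => *.
have H : a / 2 * m = a / 4 * m + a / 4 * m by field.
by lra.
Qed.

(** [u] stands for [k * exp (- 1 / s)] with [s = rho + c]. Relative to [u] the first and second
    derivatives have size [s ^ - 2] and [s ^ - 4]. For small [s] the second one absorbs all terms in
    [tau], and the first one, through the coercive part of the Levi form, beats the term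
    [4 * u * m]. *)
Lemma levi_real_bound (u s a G Mg m t L E : R) : 0 < a -> 1 <= G -> 0 <= u -> 0 < s -> s ^+ 2 <= a / 8 -> s <= 1 / 4 ->
 s ^+ 2 * (2 * ((1 + 16 * Mg) / a)) <= 1 -> 0 <= m -> 0 <= t -> 0 <= Mg -> a * m - t / a <= L ->
 4 * E <= 16 * Mg / a * t + a / 2 * m ->
 4 * m <= G * (u * (s ^- 4 - 2 * s ^- 3)) * t + G * (u * s ^- 2) * L - 4 * (u * s ^- 2) * E - 4 * (u - 1) * m.
Proof.
move=> a0 G1 u0 s0 sa s4 sQ m0 t0 M0 HL HE.
pose b := u * s ^- 2; have s2 : 0 < s ^- 2 by rewrite invr_gt0 exprn_gt0.
have b0 : 0 <= b by rewrite mulr_ge0// ltW.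
(* Ratio of the second to the first derivative of [exp (- 1 / s)]. *)
pose kp := s ^- 2 - 2 * s^-1.
have Ek : u * (s ^- 4 - 2 * s ^- 3) = b * kp by rewrite /b /kp; field; rewrite gt_eqF.
have kQ : (1 + 16 * Mg) / a <= kp.
 have -> : kp = (1 - 2 * s) / s ^+ 2 by rewrite /kp; field; rewrite gt_eqF.
 rewrite ler_pdivlMr ?exprn_gt0//; move: sQ; rewrite mulrCA [s ^+ 2 * _]mulrC.
 move: ((1 + 16 * Mg) / a * s ^+ 2) => X hX; lra.
have G0 : 0 <= G by apply: le_trans G1.
have h1 : 0 <= G * (kp - (1 + 16 * Mg) / a) * t by rewrite !mulr_ge0// subr_ge0.
have h2 : 0 <= (G - 1) * (16 * Mg / a) * t by rewrite !mulr_ge0// ?subr_ge0// invr_ge0 ltW.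
have h3 : 0 <= (G - 1) * (a * m) by rewrite mulr_ge0 ?subr_ge0// mulr_ge0// ltW.
have h4 : 0 <= G * (L - (a * m - t / a)) by rewrite mulr_ge0// subr_ge0.
have h5 : a / 2 * m <= G * kp * t + G * L - 4 * E.
 have I1 : G * (kp - (1 + 16 * Mg) / a) * t = G * kp * t - G * (t / a) - G * (16 * Mg / a) * t by field; rewrite gt_eqF.
 rewrite I1 in h1; rewrite mulrBl mul1r mulrBl in h2; rewrite mulrBl mul1r in h3.
 rewrite mulrBr mulrBr in h4; have I2 : a * m = a / 2 * m + a / 2 * m by field.
 move: h1 h2 h3 h4 HE I2; move: (G * kp * t) (G * (t / a)) (G * (16 * Mg / a) * t) (16 * Mg / a * t) (G * (a * m)) (a * m) (a / 2 * m) (G * L) => *.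
 lra.
have h6 := ler_wpM2l b0 h5.
have h7 : 4 * u * m <= b * (a / 2 * m).
 rewrite /b (_ : u * s ^- 2 * (a / 2 * m) = (u * m) * (a / 2 * s ^- 2)); last by ring.
 rewrite (_ : 4 * u * m = u * m * 4); last by ring.
 rewrite ler_wpM2l ?mulr_ge0// ler_pdivlMr ?exprn_gt0//.
 move: sa; move: (s ^+ 2) => X hX; lra.
rewrite Ek -/b; have -> : G * (b * kp) * t + G * b * L - 4 * b * E - 4 * (u - 1) * m =
 b * (G * kp * t + G * L - 4 * E) - 4 * u * m + 4 * m by ring.
move: h6 h7; move: (b * _) (b * _) (4 * u * m) (4 * m) => *; lra.
Qed.

Lemma bfun0E (s : R) : 0 < s -> bfun 0 s = expR (- s^-1).
Proof. by move=> s0; rewrite /bfun /bump_p s0 hornerC mul1r. Qed.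

(** Smallness of [c] makes [s = rho + c <= 2 * c] as small as [levi_real_bound] demands. Where
    [s <= 0] only [sqn] is left, whose Levi form is exactly four times the square of the norm: this
    is the origin of the constant 4. *)
Lemma sig_levi_bound U rho (k c Mg a : R) z v : open U -> smooth U rho -> U z ->
 0 < a -> 0 <= k -> 0 < c -> 1 <= Mg - sqn z -> rho z <= c ->
 c <= 1 / 8 -> c <= a / 32 -> 8 * c * ((1 + 16 * Mg) / a) <= 1 ->
 (0 < rho z + c -> a * \sum_i v i ^+ 2 <= levi rho z v + tau rho z v / a) ->
 4 * \sum_i v i ^+ 2 <= levi (sig rho k c Mg) z v.
Proof.
move=> oU sr Uz a0 k0 c0 G1 rc c8 ca cQ HL.
have n0 : 0 <= \sum_i v i ^+ 2 by apply: sumr_ge0 => i _; exact: sqr_ge0.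
rewrite (sig_levi k c Mg oU sr v Uz).
have [s0|s0] := leP (rho z + c) 0.
 rewrite !bfun_le0// !mulr0 !mul0r sub0r addr0 subr0 sub0r mulrN1 mulNr opprK.
 by rewrite ?addr0 ?sub0r ?oppr0 ?add0r.
have M1 : 1 <= Mg by apply: le_trans G1 _; rewrite gerBl sqn_ge0.
have M0 : 0 < Mg by apply: lt_leT M1.
have zM : sqn z <= Mg by rewrite -subr_ge0; apply: le_trans G1.
set s := rho z + c in s0 *.
have s2c : s <= 2 * c by rewrite /s mulr2n mulrDl mul1r lerD2r.
have ss : s ^+ 2 <= 4 * c * c by rewrite (_ : 4 * c * c = (2 * c) ^+ 2) ?lerXn2r ?nnegrE ?(ltW s0) ?mulr_ge0 ?(ltW c0)//; ring.
have ss2 : s ^+ 2 <= 4 * c by apply: le_trans ss _; rewrite ler_piMr ?mulr_ge0 ?(ltW c0)//; move: c8; clear; lra.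
have Q0 : 0 <= (1 + 16 * Mg) / a by rewrite divr_ge0 ?(ltW a0)// addr_ge0// mulr_ge0// ltW.
have := @levi_real_bound (k * expR (- s^-1)) s a (Mg - sqn z) Mg (\sum_i v i ^+ 2) (tau rho z v) (levi rho z v) (cross rho z v).
rewrite bfun0E// bfun1E// bfun2E//.
have -> : k * expR (- s^-1) * (s ^- 4 - 2 * s ^- 3) = k * ((s ^- 4 - 2 * s ^- 3) * expR (- s^-1)) by rewrite mulrAC mulrA.
have -> : k * expR (- s^-1) * s ^- 2 = k * (s ^- 2 * expR (- s^-1)) by rewrite mulrAC mulrA.
apply => //.
- by rewrite mulr_ge0// expR_ge0.
- by apply: le_trans ss2 _; move: ca; clear; lra.
- by move: s2c c8; clear; lra.
- apply: le_trans (ler_wpM2r _ ss2) _; first by rewrite mulr_ge0.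
 by apply: le_trans cQ; apply: eqW; ring.
- exact: tau_ge0.
- exact: ltW.
- by rewrite lerBlDr; exact: HL.
- exact: cross_le.
Qed.

End defining.

(** * Constants of the exhaustion by sublevel sets *)

Section scalars.
Context {R : realType}.
Implicit Types a b c d r s t : R.

Lemma scalar1 a b c d : c / 2 < a + b -> a < d -> d <= c / 4 -> d <= b.
Proof. lra. Qed.

Lemma scalar2 r a b c : 64 * c <= r -> b <= c -> a <= b -> 0 < b -> a < r.
Proof. lra. Qed.

Lemma scalar3 a b c d r s t : a - b <= c -> c <= d -> d <= 4 * s -> 64 * t <= r -> s <= t ->
 0 < s -> b <= - r -> a < 0.
Proof. lra. Qed.

Lemma scalar4 r a : 64 * a <= r -> 16 * a <= r / 4.
Proof. lra. Qed.

Lemma scalar5 a b s c d t r u w : a - b - s <= c -> c <= d -> d <= t -> t <= r / 4 ->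
 u + w = r / 4 -> 0 < r -> s <= - r + w -> b < u -> a < 0.
Proof. lra. Qed.

Lemma scalar6 a b c d t : a - b <= c -> c <= d -> d <= t -> b < 0 -> a < t.
Proof. lra. Qed.

Local Notation V := 'rV[R]_4.
Local Notation mu := (lebesgue_rV R 4).
Implicit Types (x y z : V).

Lemma compact_unif (K : set V) (Q : V -> R -> Prop) : compact K ->
 (forall x r r', Q x r -> 0 < r' -> r' <= r -> Q x r') ->
 (forall x, K x -> exists2 r : R, 0 < r & \forall z \near x, Q z r) ->
 exists2 r : R, 0 < r & forall x z, K x -> `|z - x| < r -> Q z r.
Proof.
move=> cK mono loc.
have [] := @compact_uniform R 4 K (fun x r => forall z, `|z - x| < r -> Q z r) cK.
- by move=> x r r' H r0 rr z zr; apply: (mono z r) => //; apply: H; exact: lt_leT rr.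
- move=> x Kx; have [r r0 /nbhs_rVP[d d0 Hd]] := loc x Kx.
 have m0 : 0 < Num.min r (d / 2) by rewrite lt_min r0 divr_gt0.
 exists (Num.min r (d / 2)) => //; apply/nbhs_rVP; exists (d / 2); first by rewrite divr_gt0.
 move=> y yd z zr; apply: (mono z r) => //; last by rewrite ge_min lexx.
 apply: Hd; rewrite -(subrKA y) [d]splitr; apply: le_ltT (ler_normD _ _) _.
 by apply: ltrD => //; apply: lt_leT zr _; rewrite ge_min lexx orbT.
by move=> r r0 H; exists r => // x z Kx; exact: H.
Qed.

Lemma norm_cvg (f : V -> R) x : {for x, continuous f} -> {for x, continuous (fun y => `|f y|)}.
Proof. by move=> cf; apply: (continuous_comp cf); exact: norm_continuous. Qed.

Lemma sum_cont (G : 'I_4 -> V -> R) x : (forall i, {for x, continuous (G i)}) ->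
 {for x, continuous (fun y => \sum_i G i y)}.
Proof. by move=> H; apply: (@cvg_sum_ord _ _ (nbhs x) (nbhs_filter x) 4 G (fun i => G i x)); exact: H. Qed.

Context (Om N Kc : set V) (sigma : V -> R) (t1 R1 : R)
 (OmE : Om = sublev N sigma 0) (oN : open N) (ss : smooth N sigma)
 (cK : compact Kc) (KN : Kc `<=` N) (t10 : 0 < t1) (sK : sublev N sigma t1 `<=` Kc)
 (lv : forall x v, N x -> 4 * \sum_i v i ^+ 2 <= levi sigma x v)
 (gr : forall x, N x -> sigma x = 0 -> exists i, pd i sigma x != 0)
 (NR : forall x, N x -> `|x| <= R1).

Let C1 : Ck 1 N sigma. Proof. exact: ss. Qed.
Let C2 : Ck 2 N sigma. Proof. exact: ss. Qed.

Definition grad2 z := \sum_i (pd i sigma z) ^+ 2.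
Definition unif z (r : R) := [/\ N z, `|sigma z| <= r^-1, forall i, `|pd i sigma z| <= r^-1,
 forall i j, `|pd i (pd j sigma) z| <= r^-1 & `|sigma z| < r -> r <= grad2 z].

(** [|sigma| + grad2] is positive at every point of [Kc], so near each point [sigma] or its gradient
    stays away from 0. *)
Lemma unif_local x : Kc x -> exists2 r : R, 0 < r & \forall z \near x, unif z r.
Proof.
move=> Kx; have Nx := KN Kx.
have cs : {for x, continuous sigma} by exact: (Ck_cont C1 Nx).
have c1 i : {for x, continuous (pd i sigma)} by exact: (Ck_cont (Ck_pd i C1) Nx).
have c2 i j : {for x, continuous (pd i (pd j sigma))} by exact: (Ck_cont (Ck_pd i (Ck_pd j C2)) Nx).
pose Phi z := (`|sigma z| + \sum_i `|pd i sigma z|) + \sum_i \sum_j `|pd i (pd j sigma) z|.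
pose Psi z := `|sigma z| + grad2 z.
have cPhi : {for x, continuous Phi}.
 apply: (@cvgD _ _ _ (nbhs x) (nbhs_filter x)).
  apply: (@cvgD _ _ _ (nbhs x) (nbhs_filter x)); first exact: norm_cvg cs.
  by apply: (@sum_cont (fun i z => `|pd i sigma z|)) => i; exact: norm_cvg.
 apply: (@sum_cont (fun i z => \sum_j `|pd i (pd j sigma) z|)) => i.
 by apply: (@sum_cont (fun j z => `|pd i (pd j sigma) z|)) => j; exact: norm_cvg.
have cPsi : {for x, continuous Psi}.
 apply: (@cvgD _ _ _ (nbhs x) (nbhs_filter x)); first exact: norm_cvg cs.
 apply: (@sum_cont (fun i z => pd i sigma z ^+ 2)) => i.
 by apply: (@cvgM _ _ (nbhs x) (nbhs_filter x)); exact: c1.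
have g0 z : 0 <= grad2 z by apply: sumr_ge0 => i _; exact: sqr_ge0.
have P0 : 0 < Psi x.
 have [s0|s0] := eqVneq (sigma x) 0; last by rewrite ltr_pwDl// normr_gt0.
 have [i gi] := gr Nx s0; rewrite /Psi s0 normr0 add0r /grad2 (bigD1 i)//=.
 by rewrite ltr_pwDl ?exprn_even_gt0// sumr_ge0// => j _; exact: sqr_ge0.
have Ph0 z : 0 <= Phi z by rewrite /Phi !addr_ge0// sumr_ge0// => i _; rewrite ?sumr_ge0.
have Ph1 : 0 < Phi x + 1 by rewrite ltr_wpDl.
pose r := Num.min (Phi x + 1)^-1 (Psi x / 4).
have r0 : 0 < r by rewrite lt_min invr_gt0 Ph1 divr_gt0.
have rV : Phi x + 1 <= r^-1 by rewrite -[leLHS]invrK lef_pV2 ?posrE ?invr_gt0// /r ge_min lexx.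
have P2 : Psi x / 2 < Psi x by rewrite ltr_pdivrMr// ltr_pMr// ltr1n.
have near1 : \forall z \near x, Phi z < Phi x + 1 by apply: near_lt cPhi _; rewrite ltrDl.
have near2 := near_gt cPsi P2.
have nearN := open_nb (conj oN Nx).
exists r => //; apply: filterS (filterI nearN (filterI near1 near2)) => z [Nz [h1 h2]].
have B (a : R) : a <= Phi z -> a <= r^-1 by move=> h; apply: le_trans rV; apply: le_trans h (ltW h1).
have T (a : 'I_4 -> R) i : (forall k, 0 <= a k) -> a i <= \sum_k a k by move=> a0; rewrite (bigD1 i)//= lerDl sumr_ge0.
have S1 : 0 <= \sum_i `|pd i sigma z| by rewrite sumr_ge0.
have S2 : 0 <= \sum_i \sum_j `|pd i (pd j sigma) z| by rewrite sumr_ge0// => i _; rewrite sumr_ge0.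
split => //.
- by apply: B; rewrite /Phi -addrA lerDl addr_ge0.
- move=> i; apply: B; rewrite /Phi addrAC; apply: ler_wpDl; first by rewrite addr_ge0.
 by rewrite (bigD1 i)//= lerDl sumr_ge0.
- move=> i j; apply: B; rewrite /Phi; apply: ler_wpDl; first by rewrite addr_ge0.
 apply: le_trans (T (fun j => `|pd i (pd j sigma) z|) j _) _ => //.
 by apply: (T (fun i => \sum_j `|pd i (pd j sigma) z|)) => k; rewrite sumr_ge0.
move=> sr; have r4 : r <= Psi x / 4 by rewrite /r ge_min lexx orbT.
exact: (scalar1 h2 sr r4).
Qed.

Lemma unif_ball : exists2 r : R, 0 < r & forall x z, Kc x -> `|z - x| < r -> unif z r.
Proof.
apply: compact_unif cK _ unif_local.
move=> x r r' [Nx h1 h2 h3 h4] r0 rr; have rV : r^-1 <= r'^-1.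
 by rewrite lef_pV2 ?posrE// (lt_leT r0).
split => //; [exact: le_trans rV|by move=> i; apply: le_trans (h2 i) rV|by move=> i j; apply: le_trans (h3 i j) rV|].
by move=> sr; apply: (le_trans rr); apply: h4; exact: lt_leT rr.
Qed.

(** The closure is taken inside [Kc], which lies in [N]; there continuity of [sigma] excludes limit
    points with [t <= sigma x]. *)
Lemma sub_compact t d : 0 < d -> t <= t1 ->
 exists K, [/\ compact K, K `<=` sublev N sigma t & forall x, sublev N sigma t x -> d <= t - sigma x -> K x].
Proof.
move=> d0 tt; exists (Kc `&` closure [set x | sublev N sigma t x /\ d <= t - sigma x]); split.
- by apply: compact_closedI => //; exact: closed_closure.
- move=> x [Kx cx]; have Nx := KN Kx; split => //; rewrite ltNge; apply/negP => ts.
 have cs : {for x, continuous sigma} by exact: (Ck_cont C1 Nx).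
 have td : t - d < sigma x by apply: lt_leT ts; rewrite ltrBlDr ltrDl.
 have [y [[_ h1] h2]] := cx _ (near_gt cs td).
 by move: h1 h2 => /=; rewrite lerBrDl -lerBrDr => h1 h2; have := le_ltT h1 h2; rewrite ltxx.
move=> x Ux dx; split; last by apply: subset_closure.
by apply: sK; exact: sublev_le tt _ Ux.
Qed.

Lemma exhaustion_exists : exists c M B t0 kap eps0 lam, exhaustion Om N sigma c M B t0 kap eps0 lam.
Proof.
have [r r0 Hr] := unif_ball.
have rV0 : 0 < r^-1 by rewrite invr_gt0.
(* The summand 1 absorbs [t <= t0 <= 1] in the bound on the weight [t - sigma]. *)
pose M := r^-1 + 1; have M1 : 1 <= M by rewrite lerDr ltW.
have M0 : 0 < M by apply: lt_leT M1.
have rM : r^-1 <= M by rewrite lerDl.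
pose t0 := Num.min t1 (Num.min (r / 2) 1).
have t00 : 0 < t0 by rewrite !lt_min t10 divr_gt0//=.
have t0t : t0 <= t1 by rewrite ge_min lexx.
have t0r : t0 <= r / 2 by rewrite !ge_min lexx orbT.
have t01 : t0 <= 1 by rewrite !ge_min lexx !orbT.
have D4 : 0 < 4 * (1 + 4 * M) by rewrite mulr_gt0// addr_gt0// mulr_gt0.
(* With [kap * (1 + 4 * M) = r / 4], the enlargement of the domain and the room around the shifted
   point cost only a quarter of the first order decrease [eps * r] along the shift. *)
pose kap := r / (4 * (1 + 4 * M)); have k0 : 0 < kap by rewrite divr_gt0.
have kE : kap * (1 + 4 * M) = r / 4 by rewrite /kap; field; rewrite gt_eqF// addr_gt0// mulr_gt0.
pose Z := M + kap; have Z0 : 0 < Z by rewrite addr_gt0.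
have Z1 : 1 <= Z by apply: le_trans M1 _; rewrite lerDl ltW.
have DD : 0 < 64 * M * Z ^+ 2 by rewrite !mulr_gt0// exprn_gt0.
(* The last bound makes the second order Taylor term at most [r / 4 * eps]. *)
pose eps0 := Num.min 1 (Num.min (t0 / kap) (r / (64 * M * Z ^+ 2))).
have e00 : 0 < eps0 by rewrite !lt_min ltr01 !divr_gt0.
have e01 : eps0 <= 1 by rewrite ge_min lexx.
have ek : kap * eps0 <= t0 by rewrite mulrC -ler_pdivlMr// !ge_min lexx orbT.
have eD : 64 * M * Z ^+ 2 * eps0 <= r by rewrite mulrC -ler_pdivlMr// !ge_min lexx !orbT.
have DM : 0 < 4 * M by rewrite mulr_gt0.
(* [r / 2] keeps the step in the ball where the bounds hold, and [1 / (4 * M)] keeps the increase of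
   [sigma] at most [t]. *)
pose lam := Num.min (r / 2) (4 * M)^-1; have l0 : 0 < lam by rewrite lt_min divr_gt0// invr_gt0.
have lr : lam <= r / 2 by rewrite ge_min lexx.
have lM : 4 * M * lam <= 1 by rewrite mulrC -ler_pdivlMr// mul1r ge_min lexx orbT.
have HK x z : Kc x -> `|z - x| < r -> [/\ N z, `|sigma z| <= M, forall i, `|pd i sigma z| <= M &
  forall i j, `|pd i (pd j sigma) z| <= M].
 move=> Kx zx; have [Nz h1 h2 h3 _] := Hr x z Kx zx.
 by split => //; [exact: le_trans rM|move=> i; exact: le_trans rM|move=> i j; exact: le_trans rM].
have Kself x : Kc x -> `|x - x| < r by rewrite subrr normr0.
have sub t x : t <= t1 -> sublev N sigma t x -> Kc x by move=> tt Ux; apply: sK; exact: sublev_le tt _ Ux.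
have OK : Om `<=` Kc by rewrite OmE => x; apply: sub; exact: ltW.
have fin (A : set V) : measurable A -> A `<=` N -> (mu A < +oo)%E.
 by move=> mA AN; apply: (bounded_leb (c := R1)) => // x /AN; exact: NR.
have oS t : open (sublev N sigma t) by exact: sublev_open.
exists 4, M, R1, t0, kap, eps0, lam; split => //.
- move=> t /andP[tt0 tt]; have tt1 : t <= t1 by exact: le_trans t0t.
 split => //.
 + by apply: fin; [exact: open_meas|move=> x []].
 + by move=> k; apply: (@Ck_sub _ _ k (sublev N sigma t) N); [move=> x []|exact: ss].
 + by move=> x v [Nx _]; exact: lv.
 + move=> x Ux; have [_ sx] := Ux; have Kx := sub _ _ tt1 Ux.
  have [_ h _ _ _] := Hr x x Kx (Kself x Kx).
  rewrite subr_gt0 sx /= /M addrC; apply: lerD; last exact: le_trans tt t01.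
  by apply: le_trans h; rewrite -normrN; exact: ler_norm.
 + by move=> x i Ux; have Kx := sub _ _ tt1 Ux; have [_ _ h _] := HK x x Kx (Kself x Kx).
 + by move=> x i j Ux; have Kx := sub _ _ tt1 Ux; have [_ _ _ h] := HK x x Kx (Kself x Kx).
 + by move=> d d0; exact: sub_compact.
- by move=> x Nx; apply: le_trans (NR Nx); exact: le_normrV.
- apply: fin; first by rewrite OmE; exact: open_meas.
 by rewrite OmE => x [].
- by rewrite e00.
- move=> eps x /andP[ep0 ep] Ux y Hy; have [Nx sx] := Ux.
 have kt : kap * eps <= t1 by apply: le_trans t0t; apply: le_trans ek; rewrite ler_pM2l.
 have Kx := sub _ _ kt Ux; have [_ _ h1 h2] := HK x x Kx (Kself x Kx).
 pose h := y - x; have yE : y = x + h by rewrite addrC subrK.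
 (* Deviation of the step [h] from the exact gradient step. *)
 pose k i := h 0 i + eps * pd i sigma x.
 have kb i : `|k i| <= kap * eps by have := Hy i; rewrite /k /h /shiftv !mxE /dirn mulrN opprD opprK addrA.
 have hb : `|h| <= Z * eps.
  apply: normrV_le => [|i]; first by rewrite mulr_ge0// ltW.
  have -> : h 0 i = k i - eps * pd i sigma x by rewrite /k addrK.
  apply: le_trans (ler_normB _ _) _; rewrite /Z mulrDl addrC; apply: lerD; last exact: kb.
  by rewrite normrM (gtr0_norm ep0) mulrC ler_pM2r.
 have eDe : 64 * M * Z ^+ 2 * eps <= r by apply: le_trans eD; rewrite ler_pM2l.
 have Ze : M * Z * eps <= M * Z ^+ 2 * eps by rewrite ler_pM2r// ler_pM2l// expr2 ler_peMr// ltW.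
 have Ze2 : Z * eps <= M * Z * eps by rewrite ler_pM2r// ler_peMl// ltW.
 have MZe : 0 < M * Z * eps by rewrite !mulr_gt0.
 have X64 : 64 * (M * Z ^+ 2 * eps) <= r by apply: le_trans eDe; apply: eqW; ring.
 have hr : `|h| < r by apply: (le_ltT hb); exact: (scalar2 X64 Ze Ze2 MZe).
 have HU z : `|z - x| < r -> N z by move=> zr; have [] := HK x z Kx zr.
 have HM1 z i : `|z - x| < r -> `|pd i sigma z| <= M by move=> zr; have [_ _ + _] := HK x z Kx zr; apply.
 have HM2 z i j : `|z - x| < r -> `|pd i (pd j sigma) z| <= M by move=> zr; have [_ _ _] := HK x z Kx zr; apply.
 rewrite OmE yE; split; first by apply: HU; rewrite addrAC subrr add0r.
 (* Deep inside, where the gradient may vanish, smallness of the step suffices; elsewhere the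
    gradient is bounded from below and [sigma] decreases. *)
 have [sr|sr] := leP (sigma x) (- r).
  have hM : 4 * M * `|h| <= 4 * (M * Z * eps) by rewrite -!mulrA ler_pM2l// ler_pM2l.
  exact: (scalar3 (ler_norm _) (ball_taylor1 oN C1 HU HM1 hr) hM X64 Ze MZe sr).
 have skap : sigma x < r / 2 by apply: lt_leT sx _; apply: le_trans t0r; apply: le_trans ek; rewrite ler_pM2l.
 have sabs : `|sigma x| < r by rewrite ltr_norml sr/=; apply: lt_leT skap _; rewrite ler_pdivrMr// ler_pMr// ler1n.
 have [_ _ _ _ /(_ sabs) gx] := Hr x x Kx (Kself x Kx).
 have T := ball_taylor2 oN C2 HU HM2 hr.
 have L : \sum_i pd i sigma x * h 0 i <= - (eps * r) + 4 * M * (kap * eps).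
  have -> : \sum_i pd i sigma x * h 0 i = - (eps * grad2 x) + \sum_i pd i sigma x * k i.
   rewrite /grad2 mulr_sumr -sumrN -big_split; apply: eq_bigr => i _ /=.
   by rewrite /k; ring.
  apply: lerD; first by rewrite lerN2 ler_pM2l.
  apply: (@le_trans _ _ (\sum_(i < 4) M * (kap * eps))).
   apply: ler_sum => i _; apply: le_trans (ler_norm _) _; rewrite normrM; exact: ler_pM.
  by rewrite sumr_const card_ord -[_ *+ 4]mulr_natl mulrA.
 have T2 : 4 * (4 * M * `|h|) * `|h| <= 16 * (M * Z ^+ 2 * eps) * eps.
  rewrite (_ : 4 * (4 * M * `|h|) * `|h| = 16 * M * (`|h| * `|h|)); last by ring.
  rewrite (_ : 16 * (M * Z ^+ 2 * eps) * eps = 16 * M * ((Z * eps) * (Z * eps))); last by ring.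
  by rewrite ler_pM2l ?mulr_gt0//; apply: ler_pM.
 have T3 : 16 * (M * Z ^+ 2 * eps) * eps <= r / 4 * eps by rewrite ler_pM2r//; exact: scalar4 X64.
 have kE2 : kap * eps + 4 * M * (kap * eps) = r / 4 * eps by rewrite -kE; ring.
 have re0 : 0 < r * eps by rewrite mulr_gt0.
 have E4 : r / 4 * eps = r * eps / 4 by ring.
 rewrite E4 in T3 kE2; rewrite [eps * r]mulrC in L.
 exact: (scalar5 (ler_norm _) T T2 T3 kE2 re0 L sx).
move=> t x /andP[tt0 tt] Ox y Hy; have Kx := OK x Ox.
pose h := y - x; have yE : y = x + h by rewrite addrC subrK.
have hb : `|h| <= lam * t by apply: normrV_le => [|i]; [rewrite mulr_ge0// ltW|have := Hy i; rewrite !mxE].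
have hr : `|h| < r.
 apply: le_ltT hb _; apply: (@le_ltT _ _ (r / 2)); last by rewrite ltr_pdivrMr// ltr_pMr// ltr1n.
 by apply: le_trans lr; rewrite ler_piMr ?(ltW l0)// (le_trans tt).
have HU z : `|z - x| < r -> N z by move=> zr; have [] := HK x z Kx zr.
have HM1 z i : `|z - x| < r -> `|pd i sigma z| <= M by move=> zr; have [_ _ + _] := HK x z Kx zr; apply.
rewrite yE; split; first by apply: HU; rewrite addrAC subrr add0r.
have sx : sigma x < 0 by move: Ox; rewrite OmE => -[].
have hM : 4 * M * `|h| <= t.
 apply: (@le_trans _ _ (4 * M * (lam * t))); first by rewrite ler_pM2l.
 by rewrite mulrA ler_piMl// ltW.
exact: (scalar6 (ler_norm _) (ball_taylor1 oN C1 HU HM1 hr) hM sx).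
Qed.

End scalars.

(** * From a defining function near the boundary to the exhaustion *)

Section pseudoconvex.
Context {R : realType}.
Local Notation V := 'rV[R]_4.
Implicit Types (x y z p : V).

Lemma closed_diff (A B : set V) : closed A -> open B -> closed (A `\` B).
Proof. by move=> cA oB; rewrite setDE; apply: closedI => //; exact: open_closedC. Qed.

Lemma quarter (a : R) : 0 < a -> 2 * (a / 4) <= a /\ a / 4 <= a.
Proof. by move=> a0; split; lra. Qed.

Lemma eq_levi (f g : V -> R) x v : (forall i j, pd i (pd j f) x = pd i (pd j g) x) ->
 levi f x v = levi g x v.
Proof.
move=> P; have H u w : hess f x u w = hess g x u w.
 by apply: eq_bigr => i _; apply: eq_bigr => j _; exact: (congr1 (fun X => X * u i * w j) (P i j)).
exact: congr2 (H _ _) (H _ _).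
Qed.

Lemma bfun0_ltr (s t : R) : s < t -> 0 < t -> bfun 0 s < bfun 0 t.
Proof.
move=> st t0; have [s0|s0] := leP s 0; first by rewrite (bfun_le0 _ s0) bfun0_gt0.
by rewrite !bfun0E// ltr_expR ltrN2 ltf_pV2.
Qed.

Lemma bfun0_ler (s t : R) : s <= t -> bfun 0 s <= bfun 0 t.
Proof.
rewrite le_eqVlt => /orP[/eqP ->//|st]; have [t0|t0] := leP t 0; last exact/ltW/bfun0_ltr.
by rewrite !bfun_le0// ltW// (lt_leT st).
Qed.

Context (Om U : set V) (rho : V -> R)
 (oO : open Om) (R0 : R) (OR : forall x, Om x -> `|x| <= R0) (R00 : 0 <= R0)
 (oU : open U) (bU : boundary Om `<=` U) (sr : smooth U rho)
 (OU : Om `&` U = [set x | U x /\ rho x < 0])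
 (gr : forall p, boundary Om p -> exists i, pd i rho p != 0)
 (psc : forall p (w : 'cV[R[i]]_2), boundary Om p -> w != 0 -> complex_tangent rho p w -> 0 < levi_form rho p w).

Local Notation bd := (boundary Om).
Definition tube (d : R) : set V := [set x | exists2 p, bd p & `|x - p| < d].

Lemma tube_open d : open (tube d).
Proof.
rewrite openE => x [p bp xp]; apply/nbhs_rVP; exists (d - `|x - p|); first by rewrite subr_gt0.
move=> y yx; exists p => //; rewrite -(subrKA x); apply: le_ltT (ler_normD _ _) _.
by rewrite -ltrBrDr.
Qed.

Lemma tube_sub d d' : d <= d' -> tube d `<=` tube d'.
Proof. by move=> dd x [p bp xp]; exists p => //; exact: lt_leT dd. Qed.

Lemma tube_near d e x y : tube d y -> `|x - y| < e -> tube (d + e) x.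
Proof.
move=> [p bp yp] xy; exists p => //; rewrite -(subrKA y) addrC; apply: le_ltT (ler_normD _ _) _.
exact: ltrD.
Qed.

Lemma closure_ball (A : set V) (c : R) : (forall x, A x -> `|x| <= c) -> forall x, closure A x -> `|x| <= c.
Proof.
move=> H x cx; apply/ler_addgt0Pr => e e0.
have [|y [Ay /= yx]] := cx [set y | `|y - x| < e]; first by apply/nbhs_rVP; exists e.
rewrite -(subrK y x); apply: le_trans (ler_normD _ _) _; rewrite addrC; apply: lerD; first exact: H.
by rewrite distrC ltW.
Qed.

Lemma bounded_compact (A : set V) (c : R) : (forall x, A x -> `|x| <= c) -> closed A -> compact A.
Proof.
move=> H cA; apply: bounded_closed_compact => //; exists c; split; first exact: num_real.
by move=> m cm x Ax /=; apply: le_trans (H x Ax) (ltW cm).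
Qed.

Lemma bd_in p : bd p <-> closure Om p /\ ~ Om p.
Proof.
have E : interior Om = Om by rewrite -interior_id.
by rewrite /boundary E.
Qed.

Lemma bd_compact : compact bd.
Proof.
apply: (@bounded_compact _ R0); first by move=> x [cx _]; exact: closure_ball OR _ cx.
apply: closed_diff; [exact: closed_closure|exact: open_interior].
Qed.

Lemma closure_Om x : closure Om x -> Om x \/ bd x.
Proof. by move=> cx; have [Ox|nO] := pselect (Om x); [left|right; apply/bd_in]. Qed.

Lemma rho_neg x : U x -> Om x -> rho x < 0.
Proof. by move=> Ux Ox; have : (Om `&` U) x by []; rewrite OU => -[]. Qed.

Lemma rho_ge0 x : U x -> ~ Om x -> 0 <= rho x.
Proof.
move=> Ux nO; rewrite leNgt; apply/negP => r0; apply: nO.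
by have : [set x | U x /\ rho x < 0] x by []; rewrite -OU => -[].
Qed.

Let Cr1 : Ck 1 U rho. Proof. exact: sr. Qed.

Lemma rho_cont x : U x -> {for x, continuous rho}.
Proof. by move=> Ux; exact: (Ck_cont Cr1 Ux). Qed.

Lemma rho_bd p : bd p -> rho p <= 0.
Proof.
move=> bp; rewrite leNgt; apply/negP => r0; have Up := bU bp; have [cp _] := bp.
have [y [Oy [Uy ry]]] := cp _ (filterI (open_nb (conj oU Up)) (near_gt (rho_cont Up) r0)).
by have := lt_trans ry (rho_neg Uy Oy); rewrite ltxx.
Qed.

(* A zero of rho outside the domain where the gradient does not vanish is a
  boundary point, since rho takes negative values nearby. *)
Lemma rho_pos x : U x -> (exists i, pd i rho x != 0) -> ~ Om x -> ~ bd x -> 0 < rho x.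
Proof.
move=> Ux [i gi] nO nb; rewrite lt_neqAle rho_ge0// andbT eq_sym; apply/negP => /eqP r0.
apply: nb; apply/bd_in; split => // A /nbhs_rVP[d d0 HA].
have [d' d'0 HU] := open_ballP oU Ux.
pose s := Num.sg (pd i rho x).
have c1 : {for x, continuous (fun y => s * pd i rho y)}.
 by apply: (@cvgM _ _ (nbhs x) (nbhs_filter x)); [exact: cvg_cst|exact: (Ck_cont (Ck_pd i Cr1) Ux)].
have sp : 0 < s * pd i rho x by rewrite -normrEsg normr_gt0.
have /nbhs_rVP[d2 d20 H2] := near_gt c1 sp.
pose m := Num.min d (Num.min d' d2); have m0 : 0 < m by rewrite !lt_min d0 d'0.
pose t := - s * (m / 2).
have s1 : `|s| = 1 by rewrite normr_sg gi.
have m2 : 0 < m / 2 by rewrite divr_gt0.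
have tn : `|t| = m / 2 by rewrite normrM normrN s1 mul1r gtr0_norm.
have en (a : R) : `|a| <= `|t| -> `|x + a *: basis_vec R i - x| < m.
 move=> at_; rewrite addrAC subrr add0r; apply: (@le_ltT _ _ (m / 2)); last by rewrite ltr_pdivrMr// ltr_pMr// ltr1n.
 apply: normrV_le => [|j]; first exact: ltW.
 rewrite !mxE; apply: le_trans (_ : `|a| <= _); last by rewrite -tn.
 by rewrite normrM; case: (_ && _) => /=; rewrite ?normr1 ?normr0 ?mulr1 ?mulr0.
have md : m <= d by rewrite ge_min lexx.
have md' : m <= d' by rewrite !ge_min lexx orbT.
have md2 : m <= d2 by rewrite !ge_min lexx !orbT.
have [|a [at_ E]] := @MVT_line R 4 rho x i t.
 move=> a at_; have Ua : U (x + a *: basis_vec R i) by apply: HU; exact: lt_leT (en a at_) md'.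
 exact: (@Ck_pder _ _ 0 U _ Cr1 _ Ua i).
exists (x + t *: basis_vec R i); split; last by apply: HA; exact: lt_leT (en t (lexx _)) md.
have Ut : U (x + t *: basis_vec R i) by apply: HU; exact: lt_leT (en t (lexx _)) md'.
suff rt : rho (x + t *: basis_vec R i) < 0 by have : [set x | U x /\ rho x < 0] (x + t *: basis_vec R i) by []; rewrite -OU => -[].
have pa := H2 _ (lt_leT (en a at_) md2).
rewrite r0 subr0 in E; rewrite E (_ : t * _ = - (m / 2 * (s * pd i rho (x + a *: basis_vec R i)))).
 by rewrite oppr_lt0 mulr_gt0.
by rewrite /t; move: (pd i rho _) => X; ring.
Qed.

Lemma boundary_uniform : exists2 d : R, 0 < d & forall z, tube d z ->
 [/\ U z, exists i, pd i rho z != 0 & forall v, d * \sum_i v i ^+ 2 <= levi rho z v + tau rho z v / d].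
Proof.
have [] := @compact_unif R bd (fun z r => [/\ U z, exists i, pd i rho z != 0 &
  forall v, r * \sum_i v i ^+ 2 <= levi rho z v + tau rho z v / r]) bd_compact.
- move=> x r r' [Ux g H] r0 rr; split => // v.
 have n0 : 0 <= \sum_i v i ^+ 2 by apply: sumr_ge0 => i _; exact: sqr_ge0.
 apply: le_trans (ler_wpM2r n0 rr) _; apply: le_trans (H v) _.
 by rewrite lerD2l ler_wpM2l ?tau_ge0// lef_pV2 ?posrE// (lt_leT r0).
- move=> p bp; have Up := bU bp; have [i gi] := gr bp.
 have [r r0 Hr] := levi_local oU sr Up (levi_positive oU sr Up (fun w => @psc p w bp)).
 exists r => //; have nr : \forall z \near p, `|z - p| < r by apply/nbhs_rVP; exists r.
 have c1 := norm_cvg (Ck_cont (Ck_pd i Cr1) Up).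
 have n1 : \forall z \near p, 0 < `|pd i rho z| by apply: near_gt c1 _; rewrite normr_gt0.
 apply: filterS (filterI (open_nb (conj oU Up)) (filterI nr n1)) => z [Uz [zr gz]].
 by split => //; [exists i; rewrite -normr_gt0|exact: Hr].
by move=> r r0 H; exists r => // z [p bp zp]; exact: (H p z bp zp).
Qed.

(** By compactness [rho] is bounded away from 0 on the inner part of the tube. There the exponential
    factor of [sig] will already be constant, so that the two definitions of [sigma] match. *)
Lemma Om_gap d : 0 < d -> tube (2 * d) `<=` U -> exists2 eta : R, 0 < eta &
 forall x, Om x -> tube d x -> ~ tube (d / 2) x -> rho x <= - eta.
Proof.
move=> d0 tU.
have cK : compact (closure Om `\` tube (d / 2)).
 apply: (@bounded_compact _ R0); first by move=> x [cx _]; exact: closure_ball OR _ cx.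
 by apply: closed_diff; [exact: closed_closure|exact: tube_open].
have [] := @compact_uniform R 4 _ (fun x r => tube d x -> rho x <= - r) cK.
- by move=> x r r' H r0 rr td; apply: le_trans (H td) _; rewrite lerN2.
- move=> x [cx nt]; have Ox : Om x.
  case: (closure_Om cx) => // bx; exfalso; apply: nt; exists x => //.
  by rewrite subrr normr0 divr_gt0.
 have [Ux|nU] := pselect (U x).
  have r0 := rho_neg Ux Ox; exists (- rho x / 2); first by rewrite divr_gt0// oppr_gt0.
  have h : rho x < rho x / 2 by rewrite ltr_pdivlMr// mulr_natr mulr2n gtrDl.
  apply: filterS (near_lt (rho_cont Ux) h) => y hy _; by rewrite mulNr opprK ltW.
 exists 1 => //; apply/nbhs_rVP; exists d => // y yd ty; exfalso; apply: nU; apply: tU.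
 have xy : `|x - y| < d by rewrite distrC.
 have E : d + d = 2 * d by ring.
 by have := tube_near ty xy; rewrite E.
by move=> r r0 H; exists r => // x Ox td nt; apply: (H x) td; split => //; exact: subset_closure.
Qed.

(** Outside [Om] and off the boundary, [rho] is positive because its gradient does not vanish;
    compactness gives a uniform bound. It keeps small sublevel sets away from the outer edge of the
    tube. *)
Lemma out_gap d d1 R1 : 0 < d -> 2 * d <= d1 -> (forall x, tube d1 x -> U x /\ exists i, pd i rho x != 0) ->
 exists2 eta : R, 0 < eta & forall x, `|x| <= R1 -> tube d x -> ~ tube (d / 2) x -> ~ Om x -> eta <= rho x.
Proof.
move=> d0 dd tU.
have cK : compact ([set x : V | `|x| <= R1] `\` (tube (d / 2) `|` Om)).
 apply: (@bounded_compact _ R1); first by move=> x [].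
 apply: closed_diff; last by apply: openU => //; exact: tube_open.
 apply: (@closed_comp _ _ (fun y : V => `|y|) [set z : R | z <= R1]); last exact: closed_le.
 by move=> y _; exact: norm_continuous.
have [] := @compact_uniform R 4 _ (fun x r => tube d x -> r <= rho x) cK.
- by move=> x r r' H r0 rr td; apply: le_trans rr _; exact: H.
- move=> x [_ nt]; have nO : ~ Om x by move=> ?; apply: nt; right.
 have nb : ~ bd x by move=> bx; apply: nt; left; exists x => //; rewrite subrr normr0 divr_gt0.
 have [tx|nx] := pselect (tube d1 x).
  have [Ux gx] := tU x tx; have r0 := rho_pos Ux gx nO nb.
  exists (rho x / 2); first by rewrite divr_gt0.
  have h : rho x / 2 < rho x by rewrite ltr_pdivrMr// ltr_pMr// ltr1n.
  by apply: filterS (near_gt (rho_cont Ux) h) => y hy _; exact: ltW.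
 exists 1 => //; apply/nbhs_rVP; exists d => // y yd ty; exfalso; apply: nx; apply: (tube_sub dd).
 have xy : `|x - y| < d by rewrite distrC.
 have E : d + d = 2 * d by ring.
 by have := tube_near ty xy; rewrite E.
by move=> r r0 H; exists r => // x xR td nt nO; apply: (H x) td; split => // -[].
Qed.

Theorem psc_exhaustion : exists N sigma c M B t0 kap eps0 lam, exhaustion Om N sigma c M B t0 kap eps0 lam.
Proof.
have [a a0 Ha] := boundary_uniform.
pose d1 := a / 4; have d10 : 0 < d1 by rewrite divr_gt0.
have [d12 d1a] : 2 * d1 <= a /\ d1 <= a by exact: quarter.
have tU1 : tube d1 `<=` U by move=> x /(tube_sub d1a)/Ha[].
have [eta eta0 Heta] := Om_gap d10 (fun x tx => let: And3 u _ _ := Ha x (tube_sub d12 tx) in u).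
pose R1 := R0 + d1; have R10 : 0 <= R1 by rewrite addr_ge0// ltW.
(* On [N] the norm is at most [R1] and [sqn x <= 4 * R1 ^ 2], so that [Mg - sqn x] is at least 1. *)
pose Mg := 1 + 4 * R1 ^+ 2.
have G1 x : `|x| <= R1 -> 1 <= Mg - sqn x.
 move=> xR; rewrite /Mg -addrA lerDl subr_ge0; apply: le_trans (sqn_le x) _.
 by rewrite ler_pM2l// lerXn2r// nnegrE.
have Q0 : 0 < (1 + 16 * Mg) / a by rewrite divr_gt0// ltr_pwDl// mulr_ge0// addr_ge0// mulr_ge0// sqr_ge0.
(* [c <= eta] makes the two formulas for [sigma] agree at the inner edge of the tube; the other
   bounds are those of [sig_levi_bound]. *)
pose c := Num.min (Num.min eta (1 / 8)) (Num.min (a / 32) (1 / (8 * ((1 + 16 * Mg) / a)))).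
have c0 : 0 < c by rewrite !lt_min eta0 !divr_gt0// mulr_gt0.
have ce : c <= eta by rewrite !ge_min lexx.
have c8 : c <= 1 / 8 by rewrite !ge_min lexx orbT.
have ca : c <= a / 32 by rewrite !ge_min lexx !orbT.
have cQ : 8 * c * ((1 + 16 * Mg) / a) <= 1.
 have : c <= 1 / (8 * ((1 + 16 * Mg) / a)) by rewrite !ge_min lexx !orbT.
 have Q8 : 0 < 8 * ((1 + 16 * Mg) / a) by apply: mulr_gt0.
 rewrite (ler_pdivlMr _ _ Q8) => h; apply: le_trans h; apply: eqW; ring.
have [d2 d20 [d21 Hd2]] : exists2 d2 : R, 0 < d2 & d2 <= d1 / 2 /\ forall z, tube d2 z -> rho z <= c.
 have [] := @compact_unif R bd (fun z _ => rho z <= c) bd_compact => //.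
  move=> p bp; exists 1 => //; have Up := bU bp.
  apply: filterS (near_lt (rho_cont Up) (le_ltT (rho_bd bp) c0)) => z; exact: ltW.
 move=> r r0 H; exists (Num.min r (d1 / 2)); first by rewrite lt_min r0 divr_gt0.
 split; first by rewrite ge_min lexx orbT.
 move=> z [p bp zp]; apply: (H p z bp); apply: lt_leT zp _; by rewrite ge_min lexx.
have d2d1 : d2 <= d1 by apply: le_trans d21 _; rewrite ler_pdivrMr// ler_pMr// ler1n.
have [eta2 eta20 Heta2] := @out_gap d2 d1 R1 d20 (ltac:(by rewrite mulrC -ler_pdivlMr)) (fun x tx =>
  let: And3 u g _ := Ha x (tube_sub d1a tx) in conj u g).
pose N := Om `|` tube d2.
have oN : open N by apply: openU => //; exact: tube_open.
(* Normalization that puts the zero level of [sigma] at [rho = 0]. *)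
pose k := (bfun 0 c)^-1; have b0 := bfun0_gt0 c0.
have k0 : 0 < k by rewrite invr_gt0.
(* Outside the tube [rho] is replaced by the constant [- c], at which the exponential factor
   vanishes. *)
pose sigma x := if pselect (tube d1 x) then sig rho k c Mg x else sig (fun=> - c) k c Mg x.
have NR x : N x -> `|x| <= R1.
 move=> [Ox|[p [bp _] xp]]; first by apply: le_trans (OR Ox) _; rewrite lerDl ltW.
 rewrite -(subrK p x) addrC; apply: le_trans (ler_normD _ _) _; apply: lerD; first exact: closure_ball OR _ bp.
 by apply: ltW; apply: lt_leT xp _.
have sE x : tube d1 x -> sigma x = sig rho k c Mg x by rewrite /sigma; case: pselect.
have sN x : ~ tube d1 x -> sigma x = sig (fun=> - c) k c Mg x by rewrite /sigma; case: pselect.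
have loc x : N x -> exists U' rho', [/\ open U' /\ smooth U' rho', U' x, rho' x <= c,
  (0 < rho' x + c -> forall v, a * \sum_i v i ^+ 2 <= levi rho' x v + tau rho' x v / a) &
  \forall y \near x, sigma y = sig rho' k c Mg y].
 move=> Nx; have [tx|nx] := pselect (tube d1 x).
  exists (tube d1), rho; split => //.
  - split; first exact: tube_open.
   by move=> j; apply: (@Ck_sub _ _ j (tube d1) U); [exact: tU1|exact: sr].
  - by case: Nx => [Ox|/Hd2//]; apply: ltW; apply: lt_trans (rho_neg (tU1 x tx) Ox) c0.
  - by move=> _; have [_ _] := Ha x (tube_sub d1a tx).
  - apply: filterS (open_nb (conj (@tube_open d1) tx)) => y; exact: sE.
 have Ox : Om x by case: Nx => // /(tube_sub d2d1).
 exists setT, (fun=> - c); split => //.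
 - by split; [exact: openT_rV|exact: smooth_cst].
 - by apply: (@le_trans _ _ 0); rewrite ?oppr_le0 ltW.
 - by rewrite addNr ltxx.
 have nb : \forall y \near x, `|y - x| < d1 / 2 by apply/nbhs_rVP; exists (d1 / 2); first by rewrite divr_gt0.
 apply: filterS (filterI nb (open_nb (conj oO Ox))) => y [yx Oy].
 have [ty|ny] := pselect (tube d1 y); last exact: sN.
 rewrite (sE y ty) /sig addNr.
 have nt : ~ tube (d1 / 2) y.
  move=> th; apply: nx; have xy : `|x - y| < d1 / 2 by rewrite distrC.
  by have := tube_near th xy; rewrite -splitr.
 have := Heta y Oy ty nt => ry.
 rewrite (@bfun_le0 _ 0 (rho y + c)); first by rewrite bfun_le0.
 by rewrite -lerBrDr sub0r; apply: le_trans ry _; rewrite lerN2.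
have ss : smooth N sigma.
 move=> j l lj x Nx; have [U' [rho' [[oU' sr'] U'x _ _ E]]] := loc x Nx.
 have E' : \forall y \near x, sig rho' k c Mg y = sigma y by apply: filterS E => y ->.
 have [cg dg] := sig_smooth k c Mg oU' sr' lj U'x.
 have E2 := partial_near l E'.
 split; first exact: cont_near E2 cg.
 by move=> lj' i; exact: (pder_near E2 (dg lj')).
have lv x v : N x -> 4 * \sum_i v i ^+ 2 <= levi sigma x v.
 move=> Nx; have [U' [rho' [[oU' sr'] U'x rc Hl E]]] := loc x Nx.
 have -> : levi sigma x v = levi (sig rho' k c Mg) x v.
  have P i j : pd i (pd j sigma) x = pd i (pd j (sig rho' k c Mg)) x by have := partial_near [:: i; j] E => /nbhs_singleton.
  exact: eq_levi P.
 apply: (sig_levi_bound oU' sr' U'x a0 (ltW k0) c0 (G1 x (NR x Nx)) rc c8 ca cQ) => s0.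
 exact: Hl.
have kb (t : R) : (t < 0 -> k * bfun 0 (t + c) - 1 < 0) /\ (0 <= t -> 0 <= k * bfun 0 (t + c) - 1).
 rewrite /k; split => h.
  by rewrite subr_lt0 mulrC ltr_pdivrMr// mul1r bfun0_ltr// gtrDr.
 by rewrite subr_ge0 mulrC ler_pdivlMr// mul1r bfun0_ler// lerDr.
have Gp x : N x -> 0 < Mg - sqn x by move=> Nx; apply: lt_leT (G1 x (NR x Nx)).
have out x : N x -> ~ Om x -> tube d1 x /\ 0 <= rho x.
 move=> [//|tx] nO; have t1x := tube_sub d2d1 tx; split => //.
 exact: rho_ge0 (tU1 x t1x) nO.
have OmE : Om = sublev N sigma 0.
 apply/seteqP; split => x.
  move=> Ox; have Nx : N x by left.
  split => //; have [tx|nx] := pselect (tube d1 x).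
   by rewrite (sE x tx) /sig pmulr_llt0 ?Gp//; apply: (kb _).1; exact: rho_neg (tU1 x tx) Ox.
  by rewrite (sN x nx) /sig addNr bfun_le0// mulr0 sub0r mulN1r oppr_lt0 Gp.
 move=> [Nx sx]; apply: contrapT => nO; have [tx rx] := out x Nx nO.
 move: sx; rewrite (sE x tx) /sig pmulr_llt0 ?Gp// ltNge => /negP; apply; exact: (kb _).2.
have gs x : N x -> sigma x = 0 -> exists i, pd i sigma x != 0.
 move=> Nx sx; have nO : ~ Om x by rewrite OmE => -[_]; rewrite sx ltxx.
 have [tx rx] := out x Nx nO; have Ux := tU1 x tx.
 have [_ [i gi] _] := Ha x (tube_sub d1a tx); exists i.
 have E : \forall y \near x, sigma y = sig rho k c Mg y by apply: filterS (open_nb (conj (@tube_open d1) tx)) => y; exact: sE.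
 have k1 : k * bfun 0 (rho x + c) - 1 = 0.
  move: sx; rewrite (sE x tx) /sig => /eqP; rewrite mulf_eq0 (gt_eqF (Gp x Nx)) orbF.
  by move=> /eqP.
 have s0 : 0 < rho x + c by apply: lt_leT c0 _; rewrite lerDr.
 rewrite (pd_near i E) (sig_pd k c Mg sr i Ux) k1 mul0r addr0.
 have b1 : bfun 1 (rho x + c) != 0 by rewrite gt_eqF// bfun1_gt0.
 have g1 : Mg - sqn x != 0 by rewrite gt_eqF// Gp.
 have k1' : k != 0 by rewrite gt_eqF.
 exact: (mulf_neq0 (mulf_neq0 k1' (mulf_neq0 b1 gi)) g1).
pose Kc := closure (Om `|` tube (d2 / 2)).
have AN : Om `|` tube (d2 / 2) `<=` N.
 move=> x [Ox|tx]; [by left|right; apply: tube_sub tx].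
 by rewrite ler_pdivrMr// ler_pMr// ler1n.
have cK : compact Kc.
 apply: (@bounded_compact _ R1); last exact: closed_closure.
 by apply: closure_ball => x /AN; exact: NR.
have KN : Kc `<=` N.
 move=> x; rewrite /Kc closureU => -[/closure_Om[Ox|bx]|cx]; first by left.
  by right; exists x => //; rewrite subrr normr0.
 have d22 : 0 < d2 / 2 by rewrite divr_gt0.
 have [|y [ty /= yx]] := cx [set y | `|y - x| < d2 / 2]; first by apply/nbhs_rVP; exists (d2 / 2).
 have xy : `|x - y| < d2 / 2 by rewrite distrC.
 by right; have := tube_near ty xy; rewrite -splitr.
(* Value of the first factor of [sig] at [rho = eta2]. As the second factor is at least 1, a point
   outside [Om] below this level lies within [d2 / 2] of the boundary. *)
pose t1 := k * bfun 0 (eta2 + c) - 1.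
have t10 : 0 < t1 by rewrite /t1 /k subr_gt0 mulrC ltr_pdivlMr// mul1r bfun0_ltr// ?ltrDr// addr_gt0.
have sK : sublev N sigma t1 `<=` Kc.
 move=> x [Nx sx]; apply: subset_closure; have [Ox|nO] := pselect (Om x); [by left|right].
 apply: contrapT => nt; have [tx rx] := out x Nx nO.
 have t2 : tube d2 x by case: Nx.
 have re := Heta2 x (NR x Nx) t2 nt nO.
 move: sx; rewrite ltNge => /negP; apply; rewrite (sE x tx) /sig.
 apply: (@le_trans _ _ (k * bfun 0 (rho x + c) - 1)).
  by rewrite lerD2r ler_pM2l// bfun0_ler// lerD2r.
 by rewrite ler_peMr ?G1 ?NR//; exact: (kb _).2.
have [c' [M [B [t0 [kap [eps0 [lam H]]]]]]] := exhaustion_exists OmE oN ss cK KN t10 sK lv gs NR.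
by exists N, sigma, c', M, B, t0, kap, eps0, lam.
Qed.

End pseudoconvex.

(** * Sobolev classes, weak and classical derivatives *)

Section regularity.
Context {R : realType} {n : nat}.
Local Notation V := 'rV[R]_n.
Local Notation mu := (lebesgue_rV R n).
Implicit Types (f g u v : V -> R) (U Om : set V) (x y : V) (l : seq 'I_n).

Lemma partial_lin U f g (k k' : R) l x : open U -> smooth U f -> smooth U g -> U x ->
 partial l (fun y => k * f y + k' * g y) x = k * partial l f x + k' * partial l g x.
Proof.
move=> oU sf sg; elim: l x => [//|i l IH] x Ux.
have -> : partial (i :: l) (fun y => k * f y + k' * g y) x =
  pd i (fun y => k * partial l f y + k' * partial l g y) x.
 apply: pd_near; have := open_nb (conj oU Ux); apply: filterS => y; exact: IH.
have cf : Ck 1 U (partial l f) by exact: smooth_part.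
have cg : Ck 1 U (partial l g) by exact: smooth_part.
apply: pdE; apply: isdD; apply: isdZ; apply: isd_pd.
 exact: (@Ck_pder _ _ 0 U _ cf _ Ux).
exact: (@Ck_pder _ _ 0 U _ cg _ Ux).
Qed.

Lemma harm_lin U f g (k k' : R) : open U -> harm U f -> harm U g -> harm U (fun y => k * f y + k' * g y).
Proof.
move=> oU hf hg; have sf := harm_smooth oU hf; have sg := harm_smooth oU hg.
split; first by apply: (CkD oU); [exact: (CkZ k oU (sf 2%N))|exact: (CkZ k' oU (sg 2%N))].
move=> x Ux; have E i := partial_lin k k' [:: i; i] oU sf sg Ux.
transitivity (\sum_i (k * partial [:: i; i] f x + k' * partial [:: i; i] g x)).
 by apply: eq_bigr => i _; exact: E.
transitivity (k * lap f x + k' * lap g x).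
 by rewrite [k * _]mulr_sumr [k' * _]mulr_sumr -big_split.
by rewrite (hf.2 x Ux) (hg.2 x Ux) !mulr0 addr0.
Qed.

Lemma sobolev_ae (s : R) Om u v : open Om -> mfun Om v ->
 {ae mu, forall x, Om x -> u x = v x} -> sobolev s Om u -> sobolev s Om v.
Proof.
move=> oO mv uv [Lu H]; have mO := open_meas oO; split; first by have [] := L2_ae mO Lu mv uv.
move=> l ls; have [w [Lw Hw gw]] := H l ls; exists w; split => // phi tp.
rewrite -(Hw phi tp); apply: Rint_ae => //.
- apply: mfunM => //; exact: test_meas oO (test_partial l tp).
- apply: mfunM; first exact: Lu.1.
 exact: test_meas oO (test_partial l tp).
- by apply: filterS uv => x Hx Ox; rewrite Hx.
Qed.

End regularity.

Section dimension4.
Context {R : realType}.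
Local Notation V := 'rV[R]_4.
Local Notation mu := (lebesgue_rV R 4).
Implicit Types (u v : V -> R) (Om : set V) (l : seq 'I_4).

(** On each ball of a countable cover both the weak and the classical derivative are integrable, and
    the du Bois-Reymond lemma identifies them. *)
Lemma weak_classical Om u v l : open Om -> (mu Om < +oo)%E -> smooth Om u -> L2 Om v ->
 weak_partial Om l u v -> L2 Om (partial l u).
Proof.
move=> oO fin su Lv H; have mO := open_meas oO.
have sl : smooth Om (partial l u) by exact: smooth_part.
have cl : Ck 0 Om (partial l u) by exact: sl.
have iv : integ Om v by exact: integ_L2_fin.
have [c [r [cU cover]]] := open_cube_cover oO.
have loc k : {ae mu, forall x, 0 < r k -> `|x - c k| < r k -> v x = partial l u x}.
 have [r0|r0] := ltP 0 (r k); last by apply: aeW.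
 pose W := [set x : V | `|x - c k| < r k]; have oW : open W := @ball_open R 4 (c k) (r k).
 have mW := open_meas oW.
 have Wc : W `<=` cube (c k) (2 * r k).
  move=> x Wx; apply: ball_sub_cube; apply: ltW; apply: lt_leT Wx _.
  by rewrite ler_peMl ?ler1n// ltW.
 have WO : W `<=` Om by move=> x /Wc; exact: cU.
 have iW : integ W v by apply: integrableS iv.
 have [M M0 HM] := compact_bdfun (@cube_compact_rV _ _ (c k) (2 * r k)) (fun x cx => Ck_cont cl (cU k r0 x cx)).
 have mWl : mfun W (partial l u) by apply: (Ck_meas (k := 0) oW); apply: Ck_sub cl.
 have iWl : integ W (partial l u).
  exact: (@integ_bd _ _ W (partial l u) M mW mWl (fun x Wx => HM x (Wc x Wx)) (ball_fin _ _)).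
 have := du_bois_reymond oW (integB mW iW iWl).
 have Z phi : tfun W phi -> \int[mu]_(x in W) ((v x - partial l u x) * phi x) = 0.
  move=> tp; have tO := test_sub WO tp.
  have := H phi tO; rewrite (partial_by_parts l oO su tO) => /eqP.
  rewrite (inj_eq (mulfI _)) ?signr_eq0// => /eqP E.
  have sp (f : V -> R) : \int[mu]_(x in W) (f x * phi x) = \int[mu]_(x in Om) (f x * phi x).
   have [_ [K [_ KW HK]]] := tp.
   rewrite (int_supp (K := K) mW KW); last by move=> x nK; rewrite HK// mulr0.
   by rewrite (int_supp (K := K) mO)// => [x /KW /WO//|x nK]; rewrite HK// mulr0.
  have C0W : Ck 0 W (partial l u) by apply: Ck_sub cl.
  have [cs scs] := test_bsupp tp.
  have [Mp Mp0 HMp] := bsupp_bd (smooth_cont tp.1) scs.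
  rewrite (_ : (fun x => _) = fun x => v x * phi x - partial l u x * phi x); last first.
   by apply/funext => x; rewrite mulrBl.
  have i1 : integ W (fun x => v x * phi x).
   apply: (@integ_mul_bd _ _ W v phi Mp) => //.
   exact: test_meas oW tp.
  rewrite RintegralB//; last exact: Ck_integ.
  by rewrite !sp E subrr.
 move=> /(_ Z); apply: filterS => x Hx _ Wx; apply/eqP; rewrite -subr_eq0; apply/eqP; exact: Hx.
have ae : {ae mu, forall x, Om x -> v x = partial l u x}.
 have := ae_foralln loc; apply: filterS => x Hx Ox; have [k Hk] := cover x Ox.
 by apply: (Hx k) => //; apply: le_ltT Hk.
by have [] := L2_ae mO Lv (Ck_meas oO cl) ae.
Qed.

End dimension4.

(** * The equations for [f2] and the conclusion *)

Section conclusion.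
Context {R : realType}.
Local Notation V := 'rV[R]_4.
Local Notation mu := (lebesgue_rV R 4).
Implicit Types (a b : V -> R) (U Om : set V) (x y : V) (p e : 'I_4 -> V -> R).

(* The components of the datum of the problem for [f2], in terms of the real
  and imaginary parts [a] and [b] of [f1]. *)
Definition datum a b (i : 'I_4) : V -> R :=
 fun y => nth 0 [:: -1; 1; 1; -1] i * pd (nth i0 [:: i2; i3; i0; i1] i) a y
     + nth 0 [:: 1; 1; -1; -1] i * pd (nth i0 [:: i3; i2; i1; i0] i) b y.

Lemma datum_harm Om a b i : open Om -> harm Om a -> harm Om b -> harm Om (datum a b i).
Proof. by move=> oO ha hb; exact: (harm_lin _ _ oO (harm_pd _ oO ha) (harm_pd _ oO hb)). Qed.

Lemma pd_datum Om a b i j x : open Om -> harm Om a -> harm Om b -> Om x ->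
 pd j (datum a b i) x =
 nth 0 [:: -1; 1; 1; -1] i * pd j (pd (nth i0 [:: i2; i3; i0; i1] i) a) x
 + nth 0 [:: 1; 1; -1; -1] i * pd j (pd (nth i0 [:: i3; i2; i1; i0] i) b) x.
Proof.
move=> oO ha hb Ox; have sa := harm_smooth oO ha; have sb := harm_smooth oO hb.
exact: (partial_lin _ _ [:: j] oO (smooth_pd _ sa) (smooth_pd _ sb) Ox).
Qed.

(** [A] and [B] stand for the Hessians of the two parts of [f1]: by symmetry everything cancels
    except their traces, the Laplacians. *)
Lemma datum_adj_aux (A B : 'I_4 -> 'I_4 -> R) j :
 (forall i k, A i k = A k i) -> (forall i k, B i k = B k i) ->
 A i0 i0 + A i1 i1 + A i2 i2 + A i3 i3 = 0 -> B i0 i0 + B i1 i1 + B i2 i2 + B i3 i3 = 0 ->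
 \sum_k dsg (R := R) k j * (nth 0 [:: -1; 1; 1; -1] k * A (ddir k j) (nth i0 [:: i2; i3; i0; i1] k)
  + nth 0 [:: 1; 1; -1; -1] k * B (ddir k j) (nth i0 [:: i3; i2; i1; i0] k)) = 0.
Proof.
move=> sA sB LA LB; rewrite sum4.
move: (sA i0 i1) (sA i0 i2) (sA i0 i3) (sA i1 i2) (sA i1 i3) (sA i2 i3).
move: (sB i0 i1) (sB i0 i2) (sB i0 i3) (sB i1 i2) (sB i1 i3) (sB i2 i3).
by elim/ord4P: j; rewrite /dsg /ddir /= => *; lra.
Qed.

Lemma datum_adj Om a b j x : open Om -> harm Om a -> harm Om b -> Om x -> Dadj (datum a b) j x = 0.
Proof.
move=> oO ha hb Ox; have ca : Ck 2 Om a by exact: harm_smooth. have cb : Ck 2 Om b by exact: harm_smooth.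
rewrite /Dadj; transitivity (\sum_k dsg (R := R) k j *
  (nth 0 [:: -1; 1; 1; -1] k * pd (ddir k j) (pd (nth i0 [:: i2; i3; i0; i1] k) a) x
  + nth 0 [:: 1; 1; -1; -1] k * pd (ddir k j) (pd (nth i0 [:: i3; i2; i1; i0] k) b) x)).
 by apply: eq_bigr => k _; congr (_ * _); exact: (pd_datum k (ddir k j) oO ha hb Ox).
apply: (@datum_adj_aux (fun i k => pd i (pd k a) x) (fun i k => pd i (pd k b) x)).
- by move=> i k; exact: (pdC i k oO ca Ox).
- by move=> i k; exact: (pdC i k oO cb Ox).
- by rewrite -(lap4 a x); exact: ha.2.
- by rewrite -(lap4 b x); exact: hb.2.
Qed.

Definition single (i : 'I_4) (phi : V -> R) (k : 'I_4) : V -> R := if k == i then phi else fun=> 0.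

Lemma single_test U i phi : tfun U phi -> testv U (single i phi).
Proof. by move=> tp k; rewrite /single; case: ifP => // _; exact: test0. Qed.

(** [opdir] and [opsg] give, in the [i]-th real equation of the [dbar] system, the direction and the
    sign of the derivative of the imaginary part. *)
Definition opdir (i : 'I_4) : 'I_4 := nth i0 [:: i1; i0; i3; i2] i.
Definition opsg (i : 'I_4) : R := nth 0 [:: -1; 1; -1; 1] i.

Lemma opAv_single i phi x : opAv (single i phi) ord0 x = pd i phi x /\
 opAv (single i phi) (lift ord0 ord0) x = opsg i * pd (opdir i) phi x.
Proof.
rewrite /opAv /opA1 /opA2 /opsg /opdir /=.
elim/ord4P: i; rewrite /single /= !pd_cst; gen_pd; split; ring.
Qed.

(** Test forms with a single nonzero component isolate one real equation; integration by parts and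
    continuity make it pointwise. *)
Lemma classical_equation Om e (w : 'I_2 -> V -> R) i : open Om -> (mu Om < +oo)%E ->
 (forall i, smooth Om (e i)) -> (forall i, smooth Om (w i)) ->
 (forall p, testv Om p -> ipv Om (opAv p) w = - ipv Om e p) ->
 forall x, Om x -> pd i (w ord0) x + opsg i * pd (opdir i) (w (lift ord0 ord0)) x = e i x.
Proof.
move=> oO fin se sw H x Ox; apply/eqP; rewrite -subr_eq0; apply/eqP; move: x Ox.
have mO := open_meas oO.
pose g x := (1 * pd i (w ord0) x + opsg i * pd (opdir i) (w (lift ord0 ord0)) x) - e i x.
have sg : smooth Om g.
 apply: (smoothB oO _ (se i)); apply: (smoothD oO); apply: (smoothZ _ oO); exact: smooth_pd.
suff : forall x, Om x -> g x = 0 by move=> + x Ox => /(_ x Ox); rewrite /g mul1r.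
have C0g : Ck 0 Om g by exact: sg.
apply: (du_bois_cont oO) => [x Ox|phi tp]; first exact: (Ck_cont C0g Ox).
have C k : Ck 1 Om (w k) by exact: sw.
have Ce : Ck 0 Om (e i) by exact: se.
have t1 := test_pd i tp; have t2 := test_pd (opdir i) tp.
have i1 : integ Om (fun x => pd i (w ord0) x * phi x) := Ck_integ oO (Ck_pd i (C ord0)) tp.
have i2 : integ Om (fun x => opsg i * (pd (opdir i) (w (lift ord0 ord0)) x * phi x)).
 by apply: integZ => //; exact: Ck_integ oO (Ck_pd _ (C _)) tp.
have i3 : integ Om (fun x => e i x * phi x) by apply: Ck_integ.
rewrite (_ : (fun x => _) = fun x => (pd i (w ord0) x * phi x + opsg i * (pd (opdir i) (w (lift ord0 ord0)) x * phi x)) - e i x * phi x); last first.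
 by apply/funext => x; rewrite /g; gen_pd; intros; ring.
rewrite (RintegralB mO (integD mO i1 i2) i3) (RintegralD mO i1 i2) RintegralZl//; last exact: Ck_integ oO (Ck_pd _ (C _)) tp.
have := H _ (single_test i tp); rewrite /ipv sum2 /ip.
have [E1 E2] : (forall x, opAv (single i phi) ord0 x = pd i phi x) /\
  (forall x, opAv (single i phi) (lift ord0 ord0) x = opsg i * pd (opdir i) phi x).
 by split => x; have [] := opAv_single i phi x.
rewrite (@eq_Rint _ _ Om _ (fun x => w ord0 x * pd i phi x)); last by move=> x _; rewrite E1 mulrC.
rewrite (@eq_Rint _ _ Om (fun x => opAv (single i phi) (lift ord0 ord0) x * w (lift ord0 ord0) x)
  (fun x => opsg i * (w (lift ord0 ord0) x * pd (opdir i) phi x))); last first.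
 by move=> x _; rewrite E2 mulrAC mulrA.
rewrite RintegralZl//; last by apply: Ck_integ => //; exact: Ck_le (C _).
rewrite (int_by_parts _ oO (C _) tp) (int_by_parts _ oO (C _) tp).
rewrite (bigD1 i)//= big1 ?addr0; last first.
 move=> k ki; rewrite /single (negbTE ki); under eq_Rint => x _ do rewrite mulr0.
 exact: Rint_cst0.
rewrite (@eq_Rint _ _ Om (fun x => e i x * single i phi i x) (fun x => e i x * phi x)); last first.
 by move=> x _; rewrite /single eqxx.
move: (\int[mu]_(x in Om) (pd i (w ord0) x * phi x)) (\int[mu]_(x in Om) (pd (opdir i) (w (lift ord0 ord0)) x * phi x)) (\int[mu]_(x in Om) (e i x * phi x)) (opsg i) => X Y Z s h.
by apply: oppr_inj; rewrite oppr0 -(addrN Z) -[in RHS](opprK Z) -h; ring.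
Qed.

(** The hypothesis is the [dbar] equation for [F2] whose datum consists, up to order and sign, of
    the [z] derivatives of the conjugate of [F1]; conjugating it gives the two components of the
    quaternionic equation. *)
Lemma psi_regular_real (F1 F2 : V -> R[i]) Om : open Om ->
 let a := fun x => complex.Re (F1 x) in let b := fun x => complex.Im (F1 x) in
 let c := fun x => complex.Re (F2 x) in let d := fun x => complex.Im (F2 x) in
 [/\ Ck 1 Om a, Ck 1 Om b, Ck 1 Om c & Ck 1 Om d] ->
 (forall x, Om x -> [/\ pd i0 c x - pd i1 d x = datum a b i0 x, pd i1 c x + pd i0 d x = datum a b i1 x,
   pd i2 c x - pd i3 d x = datum a b i2 x & pd i3 c x + pd i2 d x = datum a b i3 x]) ->
 psi_regular Om (fun z => (F1 z, F2 z)).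
Proof.
move=> oO a b c d [Ca Cb Cc Cd] H.
have [r0 m0 r1 m1] := coordsE.
have D (F : V -> R[i]) k x : d_dzbar k F x =
  ((2^-1 * (pd (re_coord k) (fun x => complex.Re (F x)) x - pd (im_coord k) (fun x => complex.Im (F x)) x)) +i*
  (2^-1 * (pd (re_coord k) (fun x => complex.Im (F x)) x + pd (im_coord k) (fun x => complex.Re (F x)) x)))%C.
 have E1 i : partial [:: i] (fun y => complex.Re (F y)) x = pd i (fun x => complex.Re (F x)) x by [].
 have E2 i : partial [:: i] (fun y => complex.Im (F y)) x = pd i (fun x => complex.Im (F x)) x by [].
 rewrite /d_dzbar /partialC half_complex !E1 !E2.
 move: (pd (re_coord k) (fun x => complex.Re (F x)) x) (pd (im_coord k) (fun x => complex.Re (F x)) x)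
  (pd (re_coord k) (fun x => complex.Im (F x)) x) (pd (im_coord k) (fun x => complex.Im (F x)) x) => A B C E.
 by apply/eqP; rewrite eq_complex /=; apply/andP; split; apply/eqP; ring.
split; [exact: (conj Ca Cb)|exact: (conj Cc Cd)|move=> x Ox].
have d0 := D F1 0 x; have d1 := D F1 (lift ord0 ord0) x.
have d2 := D F2 0 x; have d3 := D F2 (lift ord0 ord0) x.
rewrite r0 m0 in d0 d2; rewrite r1 m1 in d1 d3.
have h1 : (1 : 'I_2) = lift ord0 ord0 by exact: val_inj.
have [q0 q1] : q_dzbar 0 (fun z => (F1 z, F2 z)) x = (d_dzbar 0 F1 x, d_dzbar 0 F2 x) /\
  q_dzbar 1 (fun z => (F1 z, F2 z)) x = (d_dzbar (lift ord0 ord0) F1 x, d_dzbar (lift ord0 ord0) F2 x).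
 by rewrite h1.
rewrite q0 q1 d0 d1 d2 d3; have := H x Ox; rewrite /datum /= -/a -/b -/c -/d.
move: (pd i0 a x) (pd i1 a x) (pd i2 a x) (pd i3 a x) (pd i0 b x) (pd i1 b x) (pd i2 b x) (pd i3 b x)
 (pd i0 c x) (pd i1 c x) (pd i2 c x) (pd i3 c x) (pd i0 d x) (pd i1 d x) (pd i2 d x) (pd i3 d x).
clear => a0 a1 a2 a3 b0 b1 b2 b3 c0 c1 c2 c3 e0 e1 e2 e3 [H0 H1 H2 H3].
apply: (congr2 pair); apply/eqP; rewrite eq_complex /=; apply/andP; split; apply/eqP; lra.
Qed.

End conclusion.

Local Open Scope complex_scope.

Theorem theorem8 (R : realType) (Omega : set 'rV[R]_4) (s : R)
    (f1 F1 : 'rV[R]_4 -> R[i])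
    (hOmega : bounded_domain Omega)
    (hpsc : smooth_strongly_pseudoconvex Omega)
    (hconn : connected (boundary Omega))
    (hs : 3 <= s)
    (hf1 : boundary_sobolev (s - 1 / 2) Omega f1)
    (hF1 : harmonic_extension s Omega f1 F1) :
  exists f2 : 'rV[R]_4 -> R[i],
    harmonic_sobolev (s - 2) Omega f2 /\
    psi_regular Omega (fun z => (F1 z, f2 z)).
Proof.
have [oO _ _ bO] := hOmega.
have [U [rho [[oU bU sr OU gr] psc]]] := hpsc.
have [[[ha hb] [Sa Sb]] _] := hF1.
have mO := open_meas oO.
have [R0 R00 OR] : exists2 R0 : R, 0 <= R0 & forall x, Omega x -> `|x| <= R0.
 have [K [_ HK]] := bO; exists (`|K| + 1); first by rewrite addr_ge0.
 move=> x Ox; apply: (HK (`|K| + 1)) => //.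
 by apply: le_ltT (ler_norm K) _; rewrite ltrDl.
have [N [sigma [c [M [B [t0 [kap [eps0 [lam ex]]]]]]]]] := psc_exhaustion oO OR R00 oU bU sr OU gr psc.
have fin := ex_fin ex.
have D0 : 0 < 2 * R0 + 1 by rewrite ltr_wpDl// mulr_ge0.
have OD x y : Omega x -> Omega y -> `|x - y| <= 2 * R0 + 1.
 move=> Ox Oy; apply: le_trans (ler_normB _ _) _; apply: le_trans (lerD (OR x Ox) (OR y Oy)) _.
 by rewrite mulr_natl mulr2n lerDl.
have s0 : 0 <= s by apply: le_trans hs.
(* [m] is the integer part of [s - 2], at least 1 because [3 <= s]. *)
have [m /andP[m1 m2]] : exists m : nat, m.+2%:R <= s < m.+3%:R.
 have /andP[h1 h2] := truncn_itv s0; have : (2 < Num.truncn s)%N.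
  by rewrite -ltnS -(ltr_nat R); apply: le_ltT h2.
 by case: (Num.truncn s) h1 h2 => [//|[//|m]] h1 h2 _; exists m; rewrite h1.
set a := (fun x => complex.Re (F1 x)) in ha Sa; set b := (fun x => complex.Im (F1 x)) in hb Sb.
have sa := harm_smooth oO ha; have sb := harm_smooth oO hb.
have L2j u : smooth Omega u -> sobolev s Omega u -> forall l, (size l <= m.+2)%N -> L2 Omega (partial l u).
 move=> su [_ Su] l lm; have [|v [Lv wv _]] := Su l; last exact: weak_classical wv.
 by apply: le_trans m1; rewrite ler_nat.
pose e := datum a b.
have he i : harm Omega (e i) by exact: (datum_harm i oO ha hb).
(* The datum contains one derivative of [F1], so [m + 2] square integrable derivatives of [F1] leave
   [m + 1] for [e]. *)
have eL2 i l : (size l < m.+2)%N -> L2 Omega (partial l (e i)).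
 move=> lm; have lr j : (size (rcons l j) <= m.+2)%N by rewrite size_rcons.
 pose da := nth i0 [:: i2; i3; i0; i1] i; pose db := nth i0 [:: i3; i2; i1; i0] i.
 have La : L2 Omega (partial l (pd da a)) by rewrite -partial_rcons; apply: L2j.
 have Lb : L2 Omega (partial l (pd db b)) by rewrite -partial_rcons; apply: L2j.
 apply: eq_L2 (L2D mO (L2Z (nth 0 [:: -1; 1; 1; -1] i) mO La) (L2Z (nth 0 [:: 1; 1; -1; -1] i) mO Lb)).
 by move=> x Ox; apply/esym; exact: (partial_lin _ _ l oO (smooth_pd _ sa) (smooth_pd _ sb) Ox).
have eadj j x : Omega x -> Dadj e j x = 0 by exact: (datum_adj j oO ha hb).
have [f [Lf Sf wf]] := solve_sobolev ex he eL2 eadj D0 OD.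
have se i : smooth Omega (e i) by exact: harm_smooth oO (he i).
(* Coclosedness of [e] makes the limit weakly harmonic as well; its harmonic representative [w]
   inherits the equation and the Sobolev class. *)
have hw : forall i, wharm Omega (f i).
 apply: (solution_wharm oO _ wf) => q tq.
 rewrite (ipv_Dop oO _ tq) => [|k]; last exact: se.
 rewrite /ipv /ip big1 ?oppr0// => k _.
 rewrite (@eq_Rint _ _ Omega _ (fun=> 0)); first exact: Rint_cst0.
 by move=> x Ox; rewrite eadj// mul0r.
have W i := weyl oO (integ_L2_fin mO fin (Lf i)) (hw i).
have [w Hw] := choice W.
have hwi i : harm Omega (w i) by have [] := Hw i.
have fw i : {ae lebesgue_rV R 4, forall x, Omega x -> f i x = w i x} by have [] := Hw i.
have sw i : smooth Omega (w i) by exact: harm_smooth oO (hwi i).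
have mw i : mfun Omega (w i) by exact: Ck_meas oO (sw i 0%N).
have wp p : testv Omega p -> ipv Omega (opAv p) w = - ipv Omega e p.
 move=> tp; rewrite -(wf p tp); apply: eq_bigr => i _; apply: Rint_ae => //.
 - apply: mfunM => //; exact: test_meas oO (opAv_test i tp).
 - apply: mfunM; last exact: (Lf i).1.
  exact: test_meas oO (opAv_test i tp).
 - by apply: filterS (fw i) => x Hx Ox; rewrite Hx.
have ms : m%:R <= s - 2 < m.+1%:R.
 rewrite lerBrDr ltrBlDr -!natrD !addn2; exact/andP.
have Sw i : sobolev (s - 2) Omega (w i) by exact: sobolev_ae oO (mw i) (fw i) (Sf i _ ms).
pose k1 : 'I_2 := lift ord0 ord0.
exists (fun x => (w ord0 x +i* w k1 x)); split.
 by split; split; [exact: hwi|exact: hwi|exact: Sw|exact: Sw].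
apply: (psi_regular_real oO).
 by split; [exact: sa|exact: sb|exact: sw|exact: sw].
move=> x Ox; have E i := classical_equation i oO fin se sw wp Ox.
have := (E i0, E i1, E i2, E i3); rewrite /opsg /opdir /= /e.
case=> [[[h0 h1] h2] h3]; split.
- by rewrite -h0 mulN1r.
- by rewrite -h1 mul1r.
- by rewrite -h2 mulN1r.
- by rewrite -h3 mul1r.
Qed.
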